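(* Let $\mathbb X$ be a complex Banach space that does not contain any subspace isomorphic to $c_0$, let $A$ be a closed linear operator on $\mathbb X$, let $\mathcal B$ be an autonomous bounded linear operator on $BUC(\mathbb R,\mathbb X)$, and let $f:\mathbb R\to\mathbb X$ be almost periodic. Suppose that the equation $\dot u(t)=Au(t)+[\mathcal Bu](t)+f(t)$, $t\in\mathbb R$, has a mild solution $u\in BUC(\mathbb R,\mathbb X)$, that $\overline{e^{i\sigma_i(\mathcal A+\mathcal B)}}\setminus\overline{e^{i\,sp(f)}}$ is closed, and that $\overline{e^{i\,sp(f)}}$ is countable. Then the equation has an almost periodic mild solution $w$ such that $e^{i\,sp(w)}\subset\overline{e^{i\,sp(f)}}$.
   Context: $BUC(\mathbb R,\mathbb X)$ is the Banach space of bounded uniformly continuous functions $\mathbb R\to\mathbb X$ with sup-norm; $(S(t)g)(s)=g(t+s)$ is the translation group on it. A bounded linear operator $\mathcal B$ on $BUC(\mathbb R,\mathbb X)$ is autonomous if $\mathcal BS(t)=S(t)\mathcal B$ for all $t\in\mathbb R$. Almost periodic means almost periodic in the sense of Bohr. $\mathcal A$ is the operator on $BUC(\mathbb R,\mathbb X)$ with domain $D(\mathcal A)=\{g\in BUC(\mathbb R,\mathbb X): g(t)\in D(A)\ \forall t\in\mathbb R,\ Ag(\cdot)\in BUC(\mathbb R,\mathbb X)\}$ and $[\mathcal Ag](t)=Ag(t)$; $\mathcal A+\mathcal B$ is considered on $BUC(\mathbb R,\mathbb X)$ with domain $D(\mathcal A)$. For an operator $T$ in a Banach space, $\sigma_i(T):=\{\xi\in\mathbb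 R: i\xi\in\sigma(T)\}$. For $E\subset\mathbb R$, $e^{iE}=\{e^{i\xi}:\xi\in E\}$. Spectrum of a function: for a bounded continuous $g:\mathbb R\to\mathbb X$, its Carleman–Laplace transform is $\hat g(\lambda)=\int_0^\infty e^{-\lambda\eta}g(\eta)\,d\eta$ for $\mathrm{Re}\,\lambda>0$ and $\hat g(\lambda)=-\int_{-\infty}^0e^{-\lambda\eta}g(\eta)\,d\eta$ for $\mathrm{Re}\,\lambda<0$; $sp(g)$ is the set of all $\xi\in\mathbb R$ such that $\hat g$ has no analytic extension to any neighborhood of $i\xi$. Mild solution: $u\in BUC(\mathbb R,\mathbb X)$ is a mild solution of $\dot u(t)=Au(t)+[\mathcal Bu](t)+f(t)$ if for all $t\in\mathbb R$, $\int_0^tu(\xi)\,d\xi\in D(A)$ and $u(t)-u(0)=A\int_0^tu(\xi)\,d\xi+\int_0^t\big([\mathcal Bu](\xi)+f(\xi)\big)\,d\xi$. *)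

(* Defs.v *)
From Stdlib Require Import Reals Lra Classical FunctionalExtensionality
  ProofIrrelevance.
From Coquelicot Require Import Coquelicot.

Set Implicit Arguments.
Unset Strict Implicit.
Unset Printing Implicit Defensive.

Open Scope R_scope.

(* Coquelicot integrates functions with values in spaces over [R_AbsRing];
   [realify X] is [X] with the same group, balls and norm, and with real
   scalars acting through [RtoC]. *)
Section RestrictScalars.

Variable X : CompleteNormedModule C_AbsRing.

Let rscal (r : R) (x : X) : X := scal (RtoC r : C_AbsRing) x.

Lemma rscal_assoc (r s : R_Ring) (x : X) :
  rscal r (rscal s x) = rscal (mult r s) x.
Proof.
unfold rscal; rewrite scal_assoc; f_equal.
change (Cmult (RtoC r) (RtoC s) = RtoC (r * s)); now rewrite RtoC_mult.
Qed.

Lemma rscal_one (x : X) : rscal one x = x.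
Proof. exact (scal_one (V := X) x). Qed.

Lemma rscal_distr_l (r : R_Ring) (x y : X) :
  rscal r (plus x y) = plus (rscal r x) (rscal r y).
Proof. exact (scal_distr_l (V := X) _ x y). Qed.

Lemma rscal_distr_r (r s : R_Ring) (x : X) :
  rscal (plus r s) x = plus (rscal r x) (rscal s x).
Proof.
unfold rscal; rewrite <- (scal_distr_r (V := X) (RtoC r : C_AbsRing)); f_equal.
change (RtoC (r + s) = Cplus (RtoC r) (RtoC s)); now rewrite RtoC_plus.
Qed.

Definition realify_ModuleSpace : ModuleSpace R_Ring :=
  ModuleSpace.Pack R_Ring X
    (ModuleSpace.Class R_Ring X (AbelianGroup.class X)
       (ModuleSpace.Mixin R_Ring X rscal
          rscal_assoc rscal_one rscal_distr_l rscal_distr_r)) X.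

Definition realify_NormedModuleAux : NormedModuleAux R_AbsRing :=
  NormedModuleAux.Pack R_AbsRing X
    (NormedModuleAux.Class R_AbsRing X
       (ModuleSpace.class R_Ring realify_ModuleSpace)
       (UniformSpace.class X)) X.

Lemma rscal_norm (r : R_AbsRing) (x : X) :
  norm (rscal r x) <= abs r * norm x.
Proof.
apply Rle_trans with (1 := norm_scal (V := X) (RtoC r : C_AbsRing) x).
right; f_equal; exact (Cmod_R r).
Qed.

Definition realify_NormedModule : NormedModule R_AbsRing :=
  NormedModule.Pack R_AbsRing X
    (NormedModule.Class R_AbsRing X
       (NormedModuleAux.class R_AbsRing realify_NormedModuleAux)
       (NormedModule.Mixin R_AbsRing realify_NormedModuleAux
          (@norm C_AbsRing X) (@norm_factor C_AbsRing X)
          (@norm_triangle C_AbsRing X) rscal_norm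
          (@norm_compat1 C_AbsRing X) (@norm_compat2 C_AbsRing X)
          (@norm_eq_zero C_AbsRing X))) X.

Definition realify : CompleteNormedModule R_AbsRing :=
  CompleteNormedModule.Pack R_AbsRing X
    (CompleteNormedModule.Class R_AbsRing X
       (NormedModule.class R_AbsRing realify_NormedModule)
       (CompleteSpace.class X)) X.

Definition integral (g : R -> X) (a b : R) : X := RInt (V := realify) g a b.

Definition integral_gen (g : R -> X) (a b : (R -> Prop) -> Prop) : X :=
  RInt_gen (V := realify) g a b.

End RestrictScalars.

Record bdd_fct_space (I : Type) (K : AbsRing) (V : NormedModule K) :=
  BddFctSpace {
    bfs_pred :> (I -> V) -> Prop;
    bfs_zero : bfs_pred (fun _ => zero);
    bfs_plus : forall g h, bfs_pred g -> bfs_pred h ->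
      bfs_pred (fun i => plus (g i) (h i));
    bfs_scal : forall k g, bfs_pred g -> bfs_pred (fun i => scal k (g i));
    bfs_bounded : forall g, bfs_pred g -> exists M, forall i, norm (g i) <= M
  }.

Record bfun (I : Type) (K : AbsRing) (V : NormedModule K)
    (E : bdd_fct_space I V) :=
  BFun { bfun_fun :> I -> V; bfun_in : E bfun_fun }.

Section SupNorm.

Variables (I : Type) (K : AbsRing) (V : NormedModule K).

Definition sup_norm (g : I -> V) : R :=
  real (Lub_Rbar (fun r => exists i, r = norm (g i))).

Lemma sup_norm_ge0 (g : I -> V) : 0 <= sup_norm g.
Proof.
unfold sup_norm.
destruct (Lub_Rbar_correct (fun r => exists i, r = norm (g i))) as [Hub Hlub].
destruct (Lub_Rbar _) as [r | |]; simpl; try lra.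
destruct (Rle_lt_dec 0 r) as [H | H]; [exact H | exfalso].
assert (Hr : Rbar_le (Finite r) (Finite (r - 1))).
{ apply Hlub; intros x [i ->].
  assert (Hi : Rbar_le (norm (g i)) r) by (apply Hub; now exists i).
  assert (Hn := norm_ge_0 (g i)); simpl in *; lra. }
simpl in Hr; lra.
Qed.

Lemma sup_norm_le (g : I -> V) (M : R) :
  0 <= M -> (forall i, norm (g i) <= M) -> sup_norm g <= M.
Proof.
intros HM Hg; unfold sup_norm.
destruct (Lub_Rbar_correct (fun r => exists i, r = norm (g i))) as [Hub Hlub].
assert (H : Rbar_le (Lub_Rbar (fun r => exists i, r = norm (g i))) M).
{ apply Hlub; intros x [i ->]; exact (Hg i). }
destruct (Lub_Rbar _) as [r | |]; simpl in *; tauto.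
Qed.

Lemma sup_norm_ub (g : I -> V) (M : R) :
  (forall i, norm (g i) <= M) -> forall i, norm (g i) <= sup_norm g.
Proof.
intros Hg i; unfold sup_norm.
destruct (Lub_Rbar_correct (fun r => exists i, r = norm (g i))) as [Hub Hlub].
assert (H : Rbar_le (Lub_Rbar (fun r => exists i, r = norm (g i))) M).
{ apply Hlub; intros x [j ->]; exact (Hg j). }
assert (Hi : Rbar_le (norm (g i))
               (Lub_Rbar (fun r => exists i, r = norm (g i)))).
{ apply Hub; now exists i. }
destruct (Lub_Rbar _) as [r | |]; simpl in *; tauto.
Qed.

Variable E : bdd_fct_space I V.

Lemma bfun_ext (g h : bfun E) : (forall i, g i = h i) -> g = h.
Proof.
destruct g as [g Hg], h as [h Hh]; simpl; intros H.
assert (e : g = h) by now apply functional_extensionality.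
destruct e; f_equal; apply proof_irrelevance.
Qed.

Definition bfun_zero : bfun E := BFun (bfs_zero E).
Definition bfun_plus (g h : bfun E) : bfun E :=
  BFun (bfs_plus (bfun_in g) (bfun_in h)).
Definition bfun_scal (k : K) (g : bfun E) : bfun E :=
  BFun (bfs_scal k (bfun_in g)).
Definition bfun_opp (g : bfun E) : bfun E := bfun_scal (opp one) g.
Definition bfun_norm (g : bfun E) : R := sup_norm g.
Definition bfun_ball (g : bfun E) (e : R) (h : bfun E) : Prop :=
  bfun_norm (bfun_plus h (bfun_opp g)) < e.

Lemma bfun_plus_comm (g h : bfun E) : bfun_plus g h = bfun_plus h g.
Proof. apply bfun_ext; intros i; apply plus_comm. Qed.

Lemma bfun_plus_assoc (g h k : bfun E) :
  bfun_plus g (bfun_plus h k) = bfun_plus (bfun_plus g h) k.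
Proof. apply bfun_ext; intros i; apply plus_assoc. Qed.

Lemma bfun_plus_zero_r (g : bfun E) : bfun_plus g bfun_zero = g.
Proof. apply bfun_ext; intros i; apply plus_zero_r. Qed.

Lemma bfun_plus_opp_r (g : bfun E) : bfun_plus g (bfun_opp g) = bfun_zero.
Proof.
apply bfun_ext; intros i; simpl; rewrite scal_opp_one.
exact (plus_opp_r (G := V) (g i)).
Qed.

Definition bfun_AbelianMonoid_mixin :=
  AbelianMonoid.Mixin (bfun E) bfun_plus bfun_zero
    bfun_plus_comm bfun_plus_assoc bfun_plus_zero_r.
Canonical bfun_AbelianMonoid :=
  AbelianMonoid.Pack (bfun E) bfun_AbelianMonoid_mixin (bfun E).

Definition bfun_AbelianGroup_mixin :=
  AbelianGroup.Mixin bfun_AbelianMonoid bfun_opp bfun_plus_opp_r.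
Canonical bfun_AbelianGroup :=
  AbelianGroup.Pack (bfun E)
    (AbelianGroup.Class (bfun E) bfun_AbelianMonoid_mixin
       bfun_AbelianGroup_mixin) (bfun E).

Lemma bfun_scal_assoc (k l : K) (g : bfun E) :
  bfun_scal k (bfun_scal l g) = bfun_scal (mult k l) g.
Proof. apply bfun_ext; intros i; exact (scal_assoc k l (g i)). Qed.

Lemma bfun_scal_one (g : bfun E) : bfun_scal one g = g.
Proof. apply bfun_ext; intros i; exact (scal_one (g i)). Qed.

Lemma bfun_scal_distr_l (k : K) (g h : bfun E) :
  bfun_scal k (plus g h) = plus (bfun_scal k g) (bfun_scal k h).
Proof. apply bfun_ext; intros i; exact (scal_distr_l k (g i) (h i)). Qed.

Lemma bfun_scal_distr_r (k l : K) (g : bfun E) :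
  bfun_scal (plus k l) g = plus (bfun_scal k g) (bfun_scal l g).
Proof. apply bfun_ext; intros i; exact (scal_distr_r k l (g i)). Qed.

Definition bfun_ModuleSpace_mixin :=
  ModuleSpace.Mixin K bfun_AbelianGroup bfun_scal
    bfun_scal_assoc bfun_scal_one bfun_scal_distr_l bfun_scal_distr_r.
Canonical bfun_ModuleSpace :=
  ModuleSpace.Pack K (bfun E)
    (ModuleSpace.Class K (bfun E) (AbelianGroup.class bfun_AbelianGroup)
       bfun_ModuleSpace_mixin) (bfun E).

Lemma bfun_norm_ub (g : bfun E) (i : I) : norm (g i) <= bfun_norm g.
Proof.
destruct (bfs_bounded (bfun_in g)) as [M HM]; exact (sup_norm_ub HM i).
Qed.

Lemma bfun_norm_le (g : bfun E) (M : R) :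
  0 <= M -> (forall i, norm (g i) <= M) -> bfun_norm g <= M.
Proof. exact (@sup_norm_le g M). Qed.

Lemma bfun_norm_ge0 (g : bfun E) : 0 <= bfun_norm g.
Proof. apply sup_norm_ge0. Qed.

Lemma bfun_norm_triangle (g h : bfun E) :
  bfun_norm (plus g h) <= bfun_norm g + bfun_norm h.
Proof.
assert (Hg := bfun_norm_ge0 g); assert (Hh := bfun_norm_ge0 h).
apply bfun_norm_le; [lra | intros i].
apply Rle_trans with (1 := norm_triangle (g i) (h i)).
apply Rplus_le_compat; apply bfun_norm_ub.
Qed.

Lemma bfun_norm_scal (k : K) (g : bfun E) :
  bfun_norm (scal k g) <= abs k * bfun_norm g.
Proof.
assert (Hk := abs_ge_0 k).
apply bfun_norm_le.
- apply Rmult_le_pos; [exact Hk | apply bfun_norm_ge0].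
- intros i; apply Rle_trans with (1 := norm_scal k (g i)).
  apply Rmult_le_compat_l; [exact Hk | apply bfun_norm_ub].
Qed.

Lemma bfun_norm_eq_zero (g : bfun E) : bfun_norm g = 0 -> g = zero.
Proof.
intros H; apply bfun_ext; intros i; apply norm_eq_zero, Rle_antisym.
- rewrite <- H; apply bfun_norm_ub.
- apply norm_ge_0.
Qed.

Lemma bfun_norm_minus_sym (g h : bfun E) :
  bfun_norm (minus g h) <= bfun_norm (minus h g).
Proof.
apply bfun_norm_le; [apply bfun_norm_ge0 | intros i].
replace (minus g h i) with (opp (minus h g i)).
- rewrite norm_opp; apply bfun_norm_ub.
- change (opp (plus (h i) (scal (opp one) (g i)))
          = plus (g i) (scal (opp one) (h i))).
  rewrite !scal_opp_one; exact (opp_minus (G := V) (h i) (g i)).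
Qed.

Lemma bfun_ball_refl (g : bfun E) (e : posreal) : bfun_ball g e g.
Proof.
unfold bfun_ball; rewrite bfun_plus_opp_r.
apply Rle_lt_trans with 0; [| apply cond_pos].
apply bfun_norm_le; [lra | intros i; simpl; rewrite norm_zero; lra].
Qed.

Lemma bfun_ball_sym (g h : bfun E) (e : R) : bfun_ball g e h -> bfun_ball h e g.
Proof. apply Rle_lt_trans, bfun_norm_minus_sym. Qed.

Lemma bfun_ball_triangle (g h k : bfun E) (e1 e2 : R) :
  bfun_ball g e1 h -> bfun_ball h e2 k -> bfun_ball g (e1 + e2) k.
Proof.
unfold bfun_ball; intros H1 H2.
replace (bfun_plus k (bfun_opp g))
  with (plus (minus k h) (minus h g)).
- apply Rle_lt_trans with (1 := bfun_norm_triangle _ _).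
  unfold minus, plus, opp in *; simpl in *; lra.
- symmetry; exact (minus_trans h k g).
Qed.

Definition bfun_UniformSpace_mixin :=
  UniformSpace.Mixin (bfun E) bfun_zero bfun_ball
    bfun_ball_refl bfun_ball_sym bfun_ball_triangle.
Canonical bfun_UniformSpace :=
  UniformSpace.Pack (bfun E) bfun_UniformSpace_mixin (bfun E).

Canonical bfun_NormedModuleAux :=
  NormedModuleAux.Pack K (bfun E)
    (NormedModuleAux.Class K (bfun E) (ModuleSpace.class K bfun_ModuleSpace)
       bfun_UniformSpace_mixin) (bfun E).

Lemma bfun_norm_compat1 (g h : bfun E) (e : R) :
  bfun_norm (minus h g) < e -> ball g e h.
Proof. exact (fun H => H). Qed.

Lemma bfun_norm_compat2 (g h : bfun E) (e : posreal) :
  ball g e h -> bfun_norm (minus h g) < 1 * e.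
Proof. rewrite Rmult_1_l; exact (fun H => H). Qed.

Definition bfun_NormedModule_mixin :=
  NormedModule.Mixin K bfun_NormedModuleAux bfun_norm 1
    bfun_norm_triangle bfun_norm_scal bfun_norm_compat1 bfun_norm_compat2
    bfun_norm_eq_zero.
Canonical bfun_NormedModule :=
  NormedModule.Pack K (bfun E)
    (NormedModule.Class K (bfun E)
       (NormedModuleAux.class K bfun_NormedModuleAux)
       bfun_NormedModule_mixin) (bfun E).

End SupNorm.

Definition bounded (K : AbsRing) (V : NormedModule K) (I : Type)
    (g : I -> V) : Prop :=
  exists M, forall i, norm (g i) <= M.

Definition unif_continuous (K : AbsRing) (V : NormedModule K)
    (g : R -> V) : Prop :=
  forall eps, 0 < eps -> exists delta, 0 < delta /\
    forall s t, Rabs (s - t) < delta -> norm (minus (g s) (g t)) < eps.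

Definition is_BUC (K : AbsRing) (V : NormedModule K) (g : R -> V) : Prop :=
  bounded g /\ unif_continuous g.

Lemma minus_plus_plus (G : AbelianGroup) (a b c d : G) :
  minus (plus a b) (plus c d) = plus (minus a c) (minus b d).
Proof.
unfold minus; rewrite opp_plus, <- !plus_assoc; f_equal.
rewrite !plus_assoc; f_equal; apply plus_comm.
Qed.

Section BUCSpace.

Variables (K : AbsRing) (V : NormedModule K).

Lemma is_BUC_zero : is_BUC (fun _ : R => (zero : V)).
Proof.
split.
- exists 0; intros _; rewrite norm_zero; lra.
- intros eps He; exists 1; split; [lra | intros s t _].
  rewrite minus_eq_zero; change (norm (zero : V) < eps).
  rewrite norm_zero; exact He.
Qed.

Lemma is_BUC_plus (g h : R -> V) :
  is_BUC g -> is_BUC h -> is_BUC (fun t => plus (g t) (h t)).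
Proof.
intros [[M HM] Hg] [[N HN] Hh]; split.
- exists (M + N); intros t.
  apply Rle_trans with (1 := norm_triangle _ _).
  apply Rplus_le_compat; auto.
- intros eps He.
  destruct (Hg (eps / 2)) as [d1 [Hd1 H1]]; [lra |].
  destruct (Hh (eps / 2)) as [d2 [Hd2 H2]]; [lra |].
  exists (Rmin d1 d2); split; [now apply Rmin_pos | intros s t Hst].
  replace (minus (plus (g s) (h s)) (plus (g t) (h t)))
    with (plus (minus (g s) (g t)) (minus (h s) (h t))).
  + apply Rle_lt_trans with (1 := norm_triangle _ _).
    assert (A1 := H1 s t (Rlt_le_trans _ _ _ Hst (Rmin_l _ _))).
    assert (A2 := H2 s t (Rlt_le_trans _ _ _ Hst (Rmin_r _ _))).
    lra.
  + symmetry; exact (minus_plus_plus (G := V) (g s) (h s) (g t) (h t)).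
Qed.

Lemma is_BUC_scal (k : K) (g : R -> V) :
  is_BUC g -> is_BUC (fun t => scal k (g t)).
Proof.
intros [[M HM] Hg]; assert (Hk := abs_ge_0 k); split.
- exists (abs k * M); intros t.
  apply Rle_trans with (1 := norm_scal _ _).
  now apply Rmult_le_compat_l.
- intros eps He.
  destruct (Hg (eps / (abs k + 1))) as [d [Hd H]].
  { apply Rdiv_lt_0_compat; lra. }
  exists d; split; [exact Hd | intros s t Hst].
  apply Rle_lt_trans with (norm (scal k (minus (g s) (g t)))).
  { right; f_equal.
    exact (eq_sym (scal_minus_distr_l (V := V) k (g s) (g t))). }
  apply Rle_lt_trans with (1 := norm_scal _ _).
  assert (A1 := H s t Hst); assert (A2 := norm_ge_0 (minus (g s) (g t))).
  apply Rle_lt_trans with ((abs k + 1) * norm (minus (g s) (g t))); [nra |].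
  replace eps with ((abs k + 1) * (eps / (abs k + 1))) by (field; lra).
  apply Rmult_lt_compat_l; [lra | exact A1].
Qed.

Lemma is_BUC_bounded (g : R -> V) :
  is_BUC g -> exists M, forall t, norm (g t) <= M.
Proof. now intros [H _]. Qed.

Lemma is_BUC_shift (a : R) (g : R -> V) :
  is_BUC g -> is_BUC (fun s => g (a + s)).
Proof.
intros [[M HM] Hg]; split; [exists M; auto |].
intros eps He; destruct (Hg eps He) as [d [Hd H]].
exists d; split; [exact Hd | intros s t Hst; apply H].
now replace (a + s - (a + t)) with (s - t) by ring.
Qed.

Definition BUC_space : bdd_fct_space R V :=
  BddFctSpace is_BUC_zero is_BUC_plus is_BUC_scal is_BUC_bounded.

End BUCSpace.

Notation BUC V := (bfun (BUC_space V)).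

Definition translation (K : AbsRing) (V : NormedModule K) (t : R)
    (g : BUC V) : BUC V :=
  BFun (E := BUC_space V) (is_BUC_shift t (bfun_in g)).

Definition tends_to_zero (x : nat -> C) : Prop :=
  forall eps, 0 < eps -> exists N, forall n, (N <= n)%nat -> Cmod (x n) < eps.

Lemma tends_to_zero_zero : tends_to_zero (fun _ => zero).
Proof.
intros eps He; exists 0%nat; intros n _.
change (Cmod (RtoC 0) < eps); now rewrite Cmod_0.
Qed.

Lemma tends_to_zero_plus (x y : nat -> C) :
  tends_to_zero x -> tends_to_zero y ->
  tends_to_zero (fun n => plus (x n) (y n)).
Proof.
intros Hx Hy eps He.
destruct (Hx (eps / 2)) as [N1 H1]; [lra |].
destruct (Hy (eps / 2)) as [N2 H2]; [lra |].
exists (N1 + N2)%nat; intros n Hn.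
apply Rle_lt_trans with (1 := Cmod_triangle (x n) (y n)).
assert (A1 := H1 n (Nat.le_trans _ _ _ (Nat.le_add_r _ _) Hn)).
assert (A2 := H2 n (Nat.le_trans _ _ _ (Nat.le_add_l _ _) Hn)).
lra.
Qed.

Lemma tends_to_zero_scal (k : C) (x : nat -> C) :
  tends_to_zero x -> tends_to_zero (fun n => scal k (x n)).
Proof.
intros Hx eps He; assert (Hk := Cmod_ge_0 k).
destruct (Hx (eps / (Cmod k + 1))) as [N H].
{ apply Rdiv_lt_0_compat; lra. }
exists N; intros n Hn.
change (Cmod (k * x n) < eps); rewrite Cmod_mult.
assert (A1 := H n Hn); assert (A2 := Cmod_ge_0 (x n)).
apply Rle_lt_trans with ((Cmod k + 1) * Cmod (x n)); [nra |].
replace eps with ((Cmod k + 1) * (eps / (Cmod k + 1))) by (field; lra).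
apply Rmult_lt_compat_l; [lra | exact A1].
Qed.

Lemma finite_bound (x : nat -> R) (N : nat) :
  exists M, forall n, (n < N)%nat -> x n <= M.
Proof.
induction N as [| N [M HM]].
- exists 0; intros n Hn; inversion Hn.
- exists (Rmax M (x N)); intros n Hn.
  destruct (Nat.eq_dec n N) as [-> | Hne]; [apply Rmax_r |].
  apply Rle_trans with M; [| apply Rmax_l].
  apply HM, Nat.le_neq; split; [now apply Nat.lt_succ_r | exact Hne].
Qed.

Lemma tends_to_zero_bounded (x : nat -> C) :
  tends_to_zero x ->
  exists M, forall n, norm (x n : C_NormedModule) <= M.
Proof.
intros Hx; destruct (Hx 1 Rlt_0_1) as [N H].
destruct (finite_bound (fun n => Cmod (x n)) N) as [M HM].
exists (Rmax M 1); intros n; change (Cmod (x n) <= Rmax M 1).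
destruct (Nat.lt_ge_cases n N) as [Hn | Hn].
- apply Rle_trans with (1 := HM n Hn), Rmax_l.
- apply Rle_trans with (1 := Rlt_le _ _ (H n Hn)), Rmax_r.
Qed.

Definition c0_space : bdd_fct_space nat C_NormedModule :=
  BddFctSpace (V := C_NormedModule) tends_to_zero_zero tends_to_zero_plus
    tends_to_zero_scal tends_to_zero_bounded.

Definition c0 : NormedModule C_AbsRing := bfun_NormedModule c0_space.

(* [T] is an isomorphism of [Y] onto the subspace [T(Y)] of [X]: the lower
   bound says that [T] is injective with bounded inverse on its range. *)
Definition contains_copy (Y X : NormedModule C_AbsRing) : Prop :=
  exists T : Y -> X, is_linear T /\
    exists c, forall y, norm y <= c * norm (T y).

(* An operator is identified with its graph: [T x y] means that [x] is in the
   domain of [T] and [T x = y]. *)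
Record lin_op (Y : NormedModule C_AbsRing) := LinOp {
  graph :> Y -> Y -> Prop;
  graph_fun : forall x y z, graph x y -> graph x z -> y = z;
  graph_zero : graph zero zero;
  graph_plus : forall x y x' y', graph x y -> graph x' y' ->
    graph (plus x x') (plus y y');
  graph_scal : forall k x y, graph x y -> graph (scal k x) (scal k y)
}.

Definition closed_op (Y : NormedModule C_AbsRing) (T : lin_op Y) : Prop :=
  closed (fun p : Y * Y => T (fst p) (snd p)).

Section Operators.

Variable Y : NormedModule C_AbsRing.

Section Perturbation.

Variables (T : lin_op Y) (B : Y -> Y) (HB : is_linear B).

Definition add_graph (x y : Y) : Prop := exists z, T x z /\ y = plus z (B x).

Lemma add_graph_fun x y z : add_graph x y -> add_graph x z -> y = z.
Proof.
intros [a [Ha ->]] [b [Hb ->]]; now rewrite (graph_fun Ha Hb).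
Qed.

Lemma add_graph_zero : add_graph zero zero.
Proof.
exists zero; split; [apply graph_zero |].
now rewrite (linear_zero B HB), plus_zero_l.
Qed.

Lemma add_graph_plus x y x' y' :
  add_graph x y -> add_graph x' y' -> add_graph (plus x x') (plus y y').
Proof.
intros [a [Ha ->]] [b [Hb ->]]; exists (plus a b); split.
- now apply graph_plus.
- rewrite (linear_plus B HB), <- !plus_assoc; f_equal.
  rewrite !plus_assoc; f_equal; apply plus_comm.
Qed.

Lemma add_graph_scal k x y : add_graph x y -> add_graph (scal k x) (scal k y).
Proof.
intros [a [Ha ->]]; exists (scal k a); split.
- now apply graph_scal.
- rewrite (linear_scal B HB); exact (scal_distr_l (V := Y) k a (B x)).
Qed.

Definition add_op : lin_op Y :=
  LinOp add_graph_fun add_graph_zero add_graph_plus add_graph_scal.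

End Perturbation.

(* [lambda - T] is a bijection of the domain of [T] onto [Y] whose inverse [S]
   is bounded. *)
Definition resolvent_set (T : lin_op Y) (lambda : C) : Prop :=
  exists S : Y -> Y, is_linear S /\
    (forall y, T (S y) (minus (scal lambda (S y)) y)) /\
    (forall x z, T x z -> S (minus (scal lambda x) z) = x).

Definition spectrum (T : lin_op Y) (lambda : C) : Prop :=
  ~ resolvent_set T lambda.

Definition sigma_i (T : lin_op Y) (xi : R) : Prop :=
  spectrum T (Ci * RtoC xi)%C.

End Operators.

Section LiftedOperator.

Variables (X : NormedModule C_AbsRing) (A : lin_op X).

Definition lift_graph (g h : BUC X) : Prop := forall t, A (g t) (h t).

Lemma lift_graph_fun g h k : lift_graph g h -> lift_graph g k -> h = k.
Proof.
intros H1 H2; apply bfun_ext; intros t; exact (graph_fun (H1 t) (H2 t)).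
Qed.

Lemma lift_graph_zero : lift_graph zero zero.
Proof. intros t; exact (graph_zero A). Qed.

Lemma lift_graph_plus g h g' h' :
  lift_graph g h -> lift_graph g' h' -> lift_graph (plus g g') (plus h h').
Proof. intros H1 H2 t; exact (graph_plus (H1 t) (H2 t)). Qed.

Lemma lift_graph_scal k g h :
  lift_graph g h -> lift_graph (scal k g) (scal k h).
Proof. intros H t; exact (graph_scal k (H t)). Qed.

Definition lift_op : lin_op (bfun_NormedModule (BUC_space X)) :=
  LinOp lift_graph_fun lift_graph_zero lift_graph_plus lift_graph_scal.

End LiftedOperator.

Definition autonomous (X : NormedModule C_AbsRing) (B : BUC X -> BUC X)
    : Prop :=
  forall t g, B (translation t g) = translation t (B g).

Definition almost_periodic (X : NormedModule C_AbsRing) (g : R -> X) : Prop :=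
  (forall t, continuous g t) /\
  forall eps, 0 < eps -> exists L, 0 < L /\
    forall a, exists tau, a <= tau <= a + L /\
      forall t, norm (minus (g (t + tau)) (g t)) < eps.

Definition Cexp (z : C) : C :=
  (exp (Re z) * cos (Im z), exp (Re z) * sin (Im z)).

(* The value for [Re lambda = 0] is irrelevant. *)
Definition laplace (X : CompleteNormedModule C_AbsRing) (g : R -> X)
    (lambda : C) : X :=
  let k eta := scal (Cexp (- (lambda * RtoC eta)) : C_AbsRing) (g eta) in
  if Rlt_dec 0 (Re lambda)
  then integral_gen k (at_point 0) (Rbar_locally p_infty)
  else opp (integral_gen k (Rbar_locally m_infty) (at_point 0)).

(* Analyticity of [h] near [i xi] is complex differentiability at every point
   of a neighborhood. *)
Definition sp (X : CompleteNormedModule C_AbsRing) (g : R -> X) (xi : R)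
    : Prop :=
  ~ exists h : C -> X,
      locally (Ci * RtoC xi)%C (fun z : C =>
        ex_derive (K := C_AbsRing) h z /\ (Re z <> 0 -> h z = laplace g z)).

Definition exp_i (E : R -> Prop) (z : C) : Prop :=
  exists xi, E xi /\ z = Cexp (Ci * RtoC xi).

Definition closure (T : UniformSpace) (E : T -> Prop) (x : T) : Prop :=
  forall P : T -> Prop, locally x P -> exists y, E y /\ P y.

Definition countable (T : Type) (E : T -> Prop) : Prop :=
  exists e : nat -> T, forall x, E x -> exists n, e n = x.

Definition mild_solution (X : CompleteNormedModule C_AbsRing) (A : lin_op X)
    (B : BUC X -> BUC X) (f : R -> X) (u : BUC X) : Prop :=
  forall t, exists y : X,
    A (integral u 0 t) y /\
    minus (u t) (u 0)
      = plus y (integral (fun xi => plus (B u xi) (f xi)) 0 t).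

(* Main.v *)
(* Let S be the shift by 1 and phi(S) the Wiener functional calculus: phi is
   2 pi periodic and C^2, hence has an absolutely convergent Fourier series.
   A Fejer-kernel argument shows that phi(S) g = 0 as soon as, near each point
   of the line, either phi vanishes or the jump of the Carleman transform of g
   across the imaginary axis tends to 0; the jump does so off sp(f) for f, and
   off sigma_i(A + B) for solutions of the homogeneous equation.
   Take phi = 1 near E2, the closure of e^{i sp(f)}, and phi = 0 near the other
   points of the closure of e^{i sigma_i(A + B)}. Then phi(S) f = f, so that
   w = phi(S)^2 u is a mild solution, and psi(S) w = 0 whenever psi is supported
   off E2. By a Neumann series the Carleman transform of w then extends across
   i xi for e^{i xi} off E2.
   Since E2 is countable, almost periodicity follows as in Loomis' theorem: if
   the set of points near which w is not almost periodic were nonempty, it would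
   have an isolated point by Baire category, and this point is removed by two
   applications of Kadets' theorem, hence by the theorem of Bessaga and
   Pelczynski on spaces without copies of c_0. *)

Require Import Defs.
From Stdlib Require Import Reals Lra Lia ZArith List Permutation Classical
  ClassicalEpsilon FunctionalExtensionality.
From Coquelicot Require Import Coquelicot.
Import ListNotations.
Open Scope R_scope.
Set Bullet Behavior "Strict Subproofs".

(** * Vector arithmetic *)

(** Every hypothesis concerns subsets of the unit circle, while [sigma_i] itself may be unbounded on
    the line. This is why the calculus is built on the shift by 1, whose symbols are functions on
    the circle: compactness then supplies finite covers, and autonomy makes [B] commute with the
    calculus. Almost periodicity is likewise established for the sequences [n |-> w (s + n)] and
    carried to the line by uniform continuity. The link between symbols and spectra is that the jump
    [laplace g (d, x) - laplace g (- d, x)] is the Fourier transform at [x] of [e^{- d |s|} g s].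
    Cutting this transform off by a triangle of width [N] amounts to convolving the damped function
    with a Fejer kernel, so that only a compact frequency interval matters at each stage. A jump
    that tends to 0 locally uniformly is therefore enough, and no holomorphic extension has to be
    built for solutions of the homogeneous equation: Lipschitz dependence on both sides of the axis
    suffices. An analytic extension is constructed only for [sp w], where the vanishing of
    [phi(S) w] for a local bump [phi] is turned into a resolvent equation. *)

Inductive vexp :=
| VVar (n : nat) | VZero | VPlus (a b : vexp) | VOpp (a : vexp)
| VScal (c : C) (a : vexp).

(** Reflection for linear identities. Scalars remain arbitrary terms of [C], so an identity between
    vectors becomes one scalar identity for each atom, which [ring] can close. *)
Fixpoint vcoef (e : vexp) (n : nat) : C :=
  match e with
  | VVar m => if Nat.eqb m n then RtoC 1 else RtoC 0
  | VZero => RtoC 0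
  | VPlus a b => Cplus (vcoef a n) (vcoef b n)
  | VOpp a => Copp (vcoef a n)
  | VScal c a => Cmult c (vcoef a n)
  end.

Fixpoint coef_eq (n : nat) (f g : nat -> C) : Prop :=
  match n with
  | O => True
  | S n => f O = g O /\ coef_eq n (fun i => f (S i)) (fun i => g (S i))
  end.

Section ModuleReflection.
Variable M : ModuleSpace C_Ring.

Fixpoint vdenote (env : list M) (e : vexp) : M :=
  match e with
  | VVar n => nth n env zero
  | VZero => zero
  | VPlus a b => plus (vdenote env a) (vdenote env b)
  | VOpp a => opp (vdenote env a)
  | VScal c a => scal (c : C_Ring) (vdenote env a)
  end.

Fixpoint vcomb (env : list M) (f : nat -> C) : M :=
  match env with
  | nil => zero
  | x :: l => plus (scal (f O : C_Ring) x) (vcomb l (fun i => f (S i)))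
  end.

Lemma vcomb_ext env f g : coef_eq (length env) f g -> vcomb env f = vcomb env g.
Proof.
revert f g; induction env as [|x l IH]; intros f g; simpl; auto.
intros [H1 H2]; rewrite H1; f_equal; now apply IH.
Qed.

Lemma coef_eq_all n f g : (forall i, f i = g i) -> coef_eq n f g.
Proof.
revert f g; induction n as [|n IH]; intros f g H; simpl; auto.
Qed.

Lemma vcomb_zero env : vcomb env (fun _ => RtoC 0) = zero.
Proof.
induction env as [|x l IH]; simpl; auto.
rewrite IH, plus_zero_r; exact (scal_zero_l (V := M) x).
Qed.

Lemma plus_swap (a b c d : M) :
  plus (plus a b) (plus c d) = plus (plus a c) (plus b d).
Proof.
rewrite <- !plus_assoc; f_equal; rewrite !plus_assoc; f_equal; apply plus_comm.
Qed.

Lemma vcomb_plus env f g :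
  vcomb env (fun i => Cplus (f i) (g i)) = plus (vcomb env f) (vcomb env g).
Proof.
revert f g; induction env as [|x l IH]; intros f g; simpl.
- now rewrite plus_zero_l.
- rewrite (IH (fun i => f (S i)) (fun i => g (S i))), plus_swap; f_equal.
  exact (scal_distr_r (V := M) (f O) (g O) x).
Qed.

Lemma vcomb_scal env c f :
  vcomb env (fun i => Cmult c (f i)) = scal (c : C_Ring) (vcomb env f).
Proof.
revert f; induction env as [|x l IH]; intros f; simpl.
- symmetry; exact (scal_zero_r (V := M) c).
- rewrite (IH (fun i => f (S i))).
  rewrite (scal_distr_l (V := M) c); f_equal.
  symmetry; exact (scal_assoc (V := M) c (f O) x).
Qed.

Lemma vdenote_vcomb env e : vdenote env e = vcomb env (vcoef e).
Proof.
induction e as [n| |a IHa b IHb|a IHa|c a IHa]; simpl.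
- revert n; induction env as [|x l IH]; intros n.
  + now destruct n.
  + destruct n as [|n]; simpl.
    * rewrite (vcomb_zero l), plus_zero_r; symmetry; exact (scal_one (V := M) x).
    * rewrite IH; simpl.
      transitivity (plus zero (vcomb l (vcoef (VVar n)))).
      { now rewrite plus_zero_l. }
      f_equal; symmetry; exact (scal_zero_l (V := M) x).
- symmetry; apply vcomb_zero.
- now rewrite IHa, IHb, vcomb_plus.
- rewrite IHa.
  transitivity (scal (opp one : C_Ring) (vcomb env (vcoef a))).
  + symmetry; exact (scal_opp_one (V := M) _).
  + rewrite <- vcomb_scal; apply vcomb_ext, coef_eq_all; intros i.
    change (Cmult (Copp (RtoC 1)) (vcoef a i) = Copp (vcoef a i)); ring.
- now rewrite IHa, vcomb_scal.
Qed.

Lemma vring_correct env e1 e2 :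
  coef_eq (length env) (vcoef e1) (vcoef e2) -> vdenote env e1 = vdenote env e2.
Proof. rewrite !vdenote_vcomb; apply vcomb_ext. Qed.

End ModuleReflection.

Section VectorOps.
Context {X : CompleteNormedModule C_AbsRing}.
(** Operations fixed to one kind of space, so that the reifier can match them syntactically instead
    of looking through canonical structures. *)
Definition v0 : X := zero.
Definition vadd (x y : X) : X := plus x y.
Definition vsub (x y : X) : X := minus x y.
Definition vsc (c : C) (x : X) : X := scal (c : C_AbsRing) x.
Definition nrm (x : X) : R := norm x.
End VectorOps.

Declare Scope vec_scope.
Delimit Scope vec_scope with V.
Infix "+v" := vadd (at level 50, left associativity).
Infix "-v" := vsub (at level 50, left associativity).
Infix "*v" := vsc (at level 40, left associativity).

Ltac v_index x l :=
  lazymatch l with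
  | x :: _ => constr:(O)
  | _ :: ?l' => let n := v_index x l' in constr:(S n)
  end.

Ltac v_mem x l :=
  lazymatch l with
  | nil => constr:(false)
  | x :: _ => constr:(true)
  | _ :: ?l' => v_mem x l'
  end.

Ltac v_atoms M t l :=
  lazymatch t with
  | vadd ?a ?b => let l1 := v_atoms M a l in v_atoms M b l1
  | vsub ?a ?b => let l1 := v_atoms M a l in v_atoms M b l1
  | vsc _ ?a => v_atoms M a l
  | v0 => l
  | _ => let b := v_mem t l in
         lazymatch b with
         | true => l
         | false => constr:(@cons (ModuleSpace.sort C_Ring M) t l)
         end
  end.

Ltac v_reify t l :=
  lazymatch t with
  | vadd ?a ?b =>
    let a' := v_reify a l in let b' := v_reify b l in constr:(VPlus a' b')
  | vsub ?a ?b =>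
    let a' := v_reify a l in let b' := v_reify b l in
    constr:(VPlus a' (VOpp b'))
  | vsc ?c ?a => let a' := v_reify a l in constr:(VScal c a')
  | v0 => constr:(VZero)
  | _ => let n := v_index t l in constr:(VVar n)
  end.

Ltac vnorm :=
  lazymatch goal with
  | |- @eq _ ?a ?b =>
    let X := match goal with
      | |- context [@vadd ?X] => X
      | |- context [@vsub ?X] => X
      | |- context [@vsc ?X] => X
      end in
    let M := constr:(CompleteNormedModule.ModuleSpace C_AbsRing X) in
    let l0 := constr:(@nil (ModuleSpace.sort C_Ring M)) in
    let l1 := v_atoms M a l0 in
    let l := v_atoms M b l1 in
    let ea := v_reify a l in
    let eb := v_reify b l in
    change (vdenote M l ea = vdenote M l eb);
    apply vring_correct; cbn [length coef_eq vcoef Nat.eqb];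
    repeat split
  end.

Ltac vring := vnorm; rewrite ?RtoC_plus, ?RtoC_mult, ?RtoC_minus, ?RtoC_opp; try ring.

Section VectorLemmas.
Context {X : CompleteNormedModule C_AbsRing}.
Implicit Types x y z : X.

Lemma nrm_ge0 x : 0 <= nrm x.
Proof. exact (norm_ge_0 (V := X) x). Qed.

Lemma nrm_add x y : nrm (x +v y) <= nrm x + nrm y.
Proof. exact (norm_triangle (V := X) x y). Qed.

Lemma nrm_sc_le c x : nrm (c *v x) <= Cmod c * nrm x.
Proof. exact (norm_scal (V := X) c x). Qed.

Lemma nrm_0 : nrm (v0 : X) = 0.
Proof. exact (norm_zero (V := X)). Qed.

Lemma nrm_eq0 x : nrm x = 0 -> x = v0.
Proof. exact (norm_eq_zero (V := X) x). Qed.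

Lemma nrm_sc c x : nrm (c *v x) = Cmod c * nrm x.
Proof.
apply Rle_antisym; [apply nrm_sc_le |].
destruct (Ceq_dec c 0) as [-> | Hc].
- rewrite Cmod_0, Rmult_0_l; apply nrm_ge0.
- assert (Hm : 0 < Cmod c) by now apply Cmod_gt_0.
  assert (H := nrm_sc_le (/ c) (c *v x)).
  replace (/ c *v (c *v x)) with x in H by (vring; now field).
  rewrite Cmod_inv in H by exact Hc.
  apply Rmult_le_reg_l with (/ Cmod c); [now apply Rinv_0_lt_compat |].
  apply Rle_trans with (2 := H); right; field; lra.
Qed.

Lemma nrm_sub_sym x y : nrm (x -v y) = nrm (y -v x).
Proof.
replace (y -v x) with ((-(1))%C *v (x -v y)) by vring.
rewrite nrm_sc, Cmod_opp, Cmod_1; ring.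
Qed.

Lemma nrm_sub_tri x y z : nrm (x -v z) <= nrm (x -v y) + nrm (y -v z).
Proof. replace (x -v z) with ((x -v y) +v (y -v z)) by vring; apply nrm_add. Qed.

Lemma nrm_sub x y : nrm (x -v y) <= nrm x + nrm y.
Proof.
replace (x -v y) with (x +v (-(1))%C *v y) by vring.
apply Rle_trans with (1 := nrm_add _ _).
rewrite nrm_sc, Cmod_opp, Cmod_1; lra.
Qed.

Lemma nrm_sub_ge x y : nrm x <= nrm y + nrm (x -v y).
Proof. replace x with (y +v (x -v y)) at 1 by vring; apply nrm_add. Qed.

Lemma nrm_sub0 x y : nrm (x -v y) = 0 -> x = y.
Proof.
intros H; apply nrm_eq0 in H.
transitivity (y +v (x -v y)); [vring | rewrite H; vring].
Qed.

Lemma le_eps_0 (a k : R) : 0 <= a -> (forall eps, 0 < eps -> a <= k * eps) -> a = 0.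
Proof.
intros Ha H; apply Rle_antisym; [| exact Ha].
apply Rnot_lt_le; intros Hlt.
assert (Hk := Rabs_pos k).
assert (H0 : 0 < a / (2 * (Rabs k + 1))) by (apply Rdiv_lt_0_compat; lra).
specialize (H _ H0).
assert (H1 : k * (a / (2 * (Rabs k + 1))) <= (Rabs k + 1) * (a / (2 * (Rabs k + 1)))).
{ apply Rmult_le_compat_r; [lra |]; assert (Hk2 := Rle_abs k); lra. }
replace ((Rabs k + 1) * (a / (2 * (Rabs k + 1)))) with (a / 2) in H1 by (field; lra).
lra.
Qed.

Lemma eq_by_eps x y (k : R) :
  (forall eps, 0 < eps -> nrm (x -v y) <= k * eps) -> x = y.
Proof.
intros H; apply nrm_sub0, (le_eps_0 _ k); [apply nrm_ge0 | exact H].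
Qed.

Lemma ball_of_nrm x y eps : nrm (y -v x) < eps -> ball x eps y.
Proof. exact (norm_compat1 (V := X) x y eps). Qed.

(** Balls and norm are tied only up to the constant [norm_factor], so each passage from a ball to a
    norm estimate costs a fixed factor [k]. *)
Lemma nrm_of_ball :
  exists k, 0 < k /\ forall x y eps, 0 < eps -> ball x eps y -> nrm (y -v x) < k * eps.
Proof.
exists (@norm_factor C_AbsRing X); split; [apply norm_factor_gt_0 |].
intros x y eps He H; exact (norm_compat2 (V := X) x y (mkposreal eps He) H).
Qed.

(** The explicit rate [e] survives the passage to the limit; this is what makes the limit operators
    below approximable with known error. *)
Lemma complete_limit (x : nat -> X) (e : nat -> R) :
  (forall n m, (n <= m)%nat -> nrm (x n -v x m) <= e n) ->
  (forall eps, 0 < eps -> exists n, forall m, (n <= m)%nat -> e m <= eps) ->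
  exists l, forall n, nrm (x n -v l) <= e n.
Proof.
intros H He.
assert (HF : ProperFilter (filtermap x eventually))
  by apply filtermap_proper_filter, eventually_filter.
assert (Hc : cauchy (filtermap x eventually)).
{ intros eps.
  destruct (He (eps / 2) ltac:(assert (h := cond_pos eps); lra)) as [N HN].
  exists (x N); exists N; intros n Hn.
  apply ball_of_nrm; rewrite nrm_sub_sym.
  specialize (HN N (Nat.le_refl _)); specialize (H N n Hn).
  assert (h := cond_pos eps); lra. }
set (l := lim (filtermap x eventually) : X).
assert (Hl := complete_cauchy _ HF Hc); fold l in Hl.
destruct nrm_of_ball as [k [Hk Hb]].
exists l; intros n.
apply Rnot_lt_le; intros Hlt.
assert (Hd' : 0 < (nrm (x n -v l) - e n) / (2 * k)) by (apply Rdiv_lt_0_compat; lra).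
destruct (Hl (mkposreal _ Hd')) as [N HN].
specialize (HN (N + n)%nat (Nat.le_add_r _ _)).
apply Hb in HN; [| exact Hd']; simpl in HN.
assert (H1 := H n (N + n)%nat ltac:(lia)).
assert (H2 := nrm_sub_tri (x n) (x (N + n)%nat) l).
replace (k * ((nrm (x n -v l) - e n) / (2 * k))) with ((nrm (x n -v l) - e n) / 2) in HN
  by (field; lra).
lra.
Qed.

Lemma complete_limit_ex (x : nat -> X) :
  (forall eps, 0 < eps -> exists n, forall m, (n <= m)%nat -> nrm (x m -v x n) <= eps) ->
  exists l, forall eps, 0 < eps -> exists n, forall m, (n <= m)%nat -> nrm (x m -v l) <= eps.
Proof.
intros H.
assert (HF : ProperFilter (filtermap x eventually))
  by apply filtermap_proper_filter, eventually_filter.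
assert (Hc : cauchy (filtermap x eventually)).
{ intros eps; assert (h := cond_pos eps).
  destruct (H (eps / 2) ltac:(lra)) as [N HN].
  exists (x N); exists N; intros n Hn.
  apply ball_of_nrm; specialize (HN n Hn); lra. }
assert (Hl := complete_cauchy _ HF Hc).
set (l := lim (filtermap x eventually) : X) in *.
destruct nrm_of_ball as [k [Hk Hb]].
exists l; intros eps He.
assert (Hd : 0 < eps / k) by (apply Rdiv_lt_0_compat; lra).
destruct (Hl (mkposreal _ Hd)) as [N HN].
exists N; intros m Hm; specialize (HN m Hm).
apply Hb in HN; [| exact Hd]; simpl in HN.
replace (k * (eps / k)) with eps in HN by (field; lra); lra.
Qed.

End VectorLemmas.

(** * Functional calculus of the integer shift *)

Definition cis (x : R) : C := (cos x, sin x).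

Lemma Cmod_cis x : Cmod (cis x) = 1.
Proof.
unfold Cmod, cis; simpl.
replace (cos x * (cos x * 1) + sin x * (sin x * 1)) with 1; [apply sqrt_1 |].
assert (H := sin2_cos2 x); unfold Rsqr in H; lra.
Qed.

Lemma cis_plus x y : cis (x + y) = Cmult (cis x) (cis y).
Proof.
unfold cis, Cmult; simpl; rewrite cos_plus, sin_plus; f_equal; ring.
Qed.

Lemma cis_0 : cis 0 = RtoC 1.
Proof. unfold cis; now rewrite cos_0, sin_0. Qed.

Lemma cis_opp x : Cmult (cis (- x)) (cis x) = RtoC 1.
Proof. rewrite <- cis_plus, Rplus_opp_l; apply cis_0. Qed.

Lemma Cexp_plus a b : Cexp (Cplus a b) = Cmult (Cexp a) (Cexp b).
Proof.
unfold Cexp, Cmult, Cplus, Re, Im; simpl; rewrite exp_plus, cos_plus, sin_plus.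
f_equal; ring.
Qed.

Lemma Cexp_Ci x : Cexp (Cmult Ci (RtoC x)) = cis x.
Proof.
unfold Cexp, cis, Re, Im; simpl.
replace (0 * x - 1 * 0) with 0 by ring; replace (0 * 0 + 1 * x) with x by ring.
rewrite exp_0; f_equal; ring.
Qed.

Lemma Cmod_Cexp z : Cmod (Cexp z) = exp (Re z).
Proof.
replace (Cexp z) with (Cmult (RtoC (exp (Re z))) (cis (Im z))).
- rewrite Cmod_mult, Cmod_cis, Cmod_R, Rabs_pos_eq; [ring | left; apply exp_pos].
- unfold Cexp, cis, Cmult; simpl; f_equal; ring.
Qed.

Lemma cis_Z2PI x (k : Z) : cis (x + 2 * IZR k * PI) = cis x.
Proof.
assert (H : forall x (n : nat), cis (x + 2 * INR n * PI) = cis x).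
{ intros y n; unfold cis; now rewrite cos_period, sin_period. }
destruct (Z.le_ge_cases 0 k) as [Hk | Hk].
- replace (IZR k) with (INR (Z.to_nat k)); [apply H |].
  now rewrite INR_IZR_INZ, Z2Nat.id.
- rewrite <- (H _ (Z.to_nat (- k))), INR_IZR_INZ, Z2Nat.id by lia.
  f_equal; rewrite opp_IZR; ring.
Qed.

(** A list of frequencies with coefficients, repetitions allowed; accordingly [tp_norm] is an upper
    bound for the Wiener norm rather than the norm itself. *)
Definition tpoly := list (Z * C).

Fixpoint tp_eval (p : tpoly) (x : R) : C :=
  match p with
  | nil => RtoC 0
  | (n, c) :: q => Cplus (Cmult c (cis (IZR n * x))) (tp_eval q x)
  end.

Fixpoint tp_norm (p : tpoly) : R :=
  match p with
  | nil => 0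
  | (n, c) :: q => Cmod c + tp_norm q
  end.

Definition tp_mono (n : Z) (c : C) (p : tpoly) : tpoly :=
  map (fun mc => ((n + fst mc)%Z, Cmult c (snd mc))) p.

Fixpoint tp_mul (p q : tpoly) : tpoly :=
  match p with
  | nil => nil
  | (n, c) :: p => tp_mono n c q ++ tp_mul p q
  end.

Lemma tp_norm_ge0 p : 0 <= tp_norm p.
Proof.
induction p as [|[n c] p IH]; simpl; [lra |].
assert (H := Cmod_ge_0 c); lra.
Qed.

Lemma tp_eval_bound p x : Cmod (tp_eval p x) <= tp_norm p.
Proof.
induction p as [|[n c] p IH]; simpl.
- rewrite Cmod_0; lra.
- apply Rle_trans with (1 := Cmod_triangle _ _).
  rewrite Cmod_mult, Cmod_cis; lra.
Qed.

Lemma tp_eval_app p q x : tp_eval (p ++ q) x = Cplus (tp_eval p x) (tp_eval q x).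
Proof. induction p as [|[n c] p IH]; simpl; [ring | rewrite IH; ring]. Qed.

Lemma tp_eval_mono n c p x :
  tp_eval (tp_mono n c p) x = Cmult (Cmult c (cis (IZR n * x))) (tp_eval p x).
Proof.
induction p as [|[m d] p IH]; simpl; [ring |].
rewrite IH, plus_IZR, Rmult_plus_distr_r, cis_plus; ring.
Qed.

Lemma tp_eval_mul p q x : tp_eval (tp_mul p q) x = Cmult (tp_eval p x) (tp_eval q x).
Proof.
induction p as [|[n c] p IH]; simpl; [ring |].
rewrite tp_eval_app, tp_eval_mono, IH; ring.
Qed.

Section Operators.
Context {X : CompleteNormedModule C_AbsRing}.
Implicit Types (g h : R -> X).

Definition bdd g M := forall t, nrm (g t) <= M.

Definition cont_at g t := forall eps, 0 < eps -> exists delta, 0 < delta /\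
  forall s, Rabs (s - t) < delta -> nrm (g s -v g t) <= eps.

Lemma cont_at_continuous g t : cont_at g t <-> continuous g t.
Proof.
split; intros H.
- intros P [eps HP].
  assert (h := cond_pos eps).
  destruct (H (eps / 2)) as [d [Hd Hs]]; [lra |].
  exists (mkposreal d Hd); intros s Hb.
  apply HP, ball_of_nrm.
  apply Rle_lt_trans with (eps / 2); [now apply Hs | lra].
- intros eps He.
  destruct (@nrm_of_ball X) as [k [Hk Hb]].
  assert (Hd : 0 < eps / k) by (apply Rdiv_lt_0_compat; lra).
  destruct (H (ball (g t) (eps / k))) as [d Hd'].
  { exists (mkposreal _ Hd); auto. }
  exists d; split; [apply cond_pos |].
  intros s Hs; specialize (Hd' s Hs); apply Hb in Hd'; [| exact Hd].
  replace (k * (eps / k)) with eps in Hd' by (field; lra); lra.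
Qed.

Lemma cont_at_const (x : X) t : cont_at (fun _ => x) t.
Proof.
intros eps He; exists 1; split; [lra | intros s _].
replace (x -v x) with (v0 : X) by vring; rewrite nrm_0; lra.
Qed.

Lemma cont_at_comb c g h t :
  cont_at g t -> cont_at h t -> cont_at (fun s => c *v g s +v h s) t.
Proof.
intros Hg Hh eps He.
assert (Hc := Cmod_ge_0 c).
destruct (Hg (eps / (2 * (Cmod c + 1)))) as [d1 [Hd1 H1]].
{ apply Rdiv_lt_0_compat; lra. }
destruct (Hh (eps / 2)) as [d2 [Hd2 H2]]; [lra |].
exists (Rmin d1 d2); split; [now apply Rmin_pos | intros s Hs].
specialize (H1 s (Rlt_le_trans _ _ _ Hs (Rmin_l _ _))).
specialize (H2 s (Rlt_le_trans _ _ _ Hs (Rmin_r _ _))).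
replace (c *v g s +v h s -v (c *v g t +v h t))
  with (c *v (g s -v g t) +v (h s -v h t)) by vring.
apply Rle_trans with (1 := nrm_add _ _); rewrite nrm_sc.
assert (Cmod c * nrm (g s -v g t) <= (Cmod c + 1) * (eps / (2 * (Cmod c + 1)))).
{ apply Rmult_le_compat; try lra; apply nrm_ge0. }
replace ((Cmod c + 1) * (eps / (2 * (Cmod c + 1)))) with (eps / 2) in H by (field; lra).
lra.
Qed.

Lemma cont_at_shift g a t : cont_at g (a + t) -> cont_at (fun s => g (a + s)) t.
Proof.
intros H eps He; destruct (H eps He) as [d [Hd Hs]].
exists d; split; [exact Hd | intros s Hst; apply Hs].
now replace (a + s - (a + t)) with (s - t) by ring.
Qed.

Fixpoint tp_act (p : tpoly) g (t : R) : X :=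
  match p with
  | nil => v0
  | (n, c) :: q => c *v g (t + IZR n) +v tp_act q g t
  end.

Lemma tp_act_bound p g M t : bdd g M -> nrm (tp_act p g t) <= tp_norm p * M.
Proof.
intros Hg; induction p as [|[n c] p IH]; simpl.
- rewrite nrm_0; lra.
- apply Rle_trans with (1 := nrm_add _ _); rewrite nrm_sc.
  assert (Cmod c * nrm (g (t + IZR n)) <= Cmod c * M).
  { apply Rmult_le_compat_l; [apply Cmod_ge_0 | apply Hg]. }
  lra.
Qed.

Lemma tp_act_comb p c g h t :
  tp_act p (fun s => c *v g s +v h s) t = c *v tp_act p g t +v tp_act p h t.
Proof.
induction p as [|[n d] p IH]; simpl; [vring |]. rewrite IH; vring.
Qed.

Lemma tp_act_shift p g a t :
  tp_act p (fun s => g (a + s)) t = tp_act p g (a + t).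
Proof.
induction p as [|[n d] p IH]; simpl; [easy |]. now rewrite IH, Rplus_assoc.
Qed.

Lemma tp_act_app p q g t : tp_act (p ++ q) g t = tp_act p g t +v tp_act q g t.
Proof. induction p as [|[n d] p IH]; simpl; [vring | rewrite IH; vring]. Qed.

Lemma tp_act_mono n c q g t :
  tp_act (tp_mono n c q) g t = c *v tp_act q g (t + IZR n).
Proof.
induction q as [|[m d] q IH]; simpl; [vring |].
rewrite IH, plus_IZR, Rplus_assoc; vring.
Qed.

Lemma tp_act_mul p q g t : tp_act (tp_mul p q) g t = tp_act p (tp_act q g) t.
Proof.
induction p as [|[n c] p IH]; simpl; [easy |].
now rewrite tp_act_app, tp_act_mono, IH.
Qed.

Lemma tp_act_cont p g t : (forall s, cont_at g s) -> cont_at (tp_act p g) t.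
Proof.
intros Hg; induction p as [|[n c] p IH]; simpl; [apply cont_at_const |].
apply cont_at_comb; [| exact IH].
assert (H := cont_at_shift g (IZR n) t (Hg _)).
intros eps He; destruct (H eps He) as [d [Hd Hs]]; exists d; split; [exact Hd |].
intros s Hst; specialize (Hs s Hst).
now rewrite (Rplus_comm s), (Rplus_comm t).
Qed.

(* [L] is multiplication by the symbol [phi] in the functional calculus of the
   shift [g |-> g (. + 1)]. *)
Definition Op (L : (R -> X) -> R -> X) (phi : R -> C) :=
  forall eps, 0 < eps -> exists p,
    (forall x, Cmod (Cminus (phi x) (tp_eval p x)) <= eps) /\
    (forall g M t, bdd g M -> nrm (L g t -v tp_act p g t) <= eps * M).

Lemma Op_bound L phi : Op L phi -> exists K, 0 < K /\
  (forall g M t, bdd g M -> nrm (L g t) <= K * M) /\ forall x, Cmod (phi x) <= K.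
Proof.
intros H; destruct (H 1 Rlt_0_1) as [p [H1 H2]].
assert (Hp := tp_norm_ge0 p).
exists (tp_norm p + 1); split; [lra | split].
- intros g M t Hg.
  assert (A1 := nrm_sub_ge (L g t) (tp_act p g t)).
  assert (A2 := H2 g M t Hg); assert (A3 := tp_act_bound p g M t Hg); lra.
- intros x; replace (phi x) with (Cplus (tp_eval p x) (Cminus (phi x) (tp_eval p x))) by ring.
  apply Rle_trans with (1 := Cmod_triangle _ _).
  assert (A1 := tp_eval_bound p x); specialize (H1 x); lra.
Qed.

Lemma Op_ext L phi psi : (forall x, phi x = psi x) -> Op L phi -> Op L psi.
Proof.
intros He H eps Hp; destruct (H eps Hp) as [p [H1 H2]]; exists p; split; auto.
intros x; rewrite <- He; auto.
Qed.

Lemma bdd_ge0 g M : bdd g M -> 0 <= M.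
Proof. intros H; apply Rle_trans with (2 := H 0), nrm_ge0. Qed.

Lemma Op_tp p : Op (tp_act p) (tp_eval p).
Proof.
intros eps He; exists p; split.
- intros x; unfold Cminus; rewrite Cplus_opp_r, Cmod_0; lra.
- intros g M t Hg; replace (tp_act p g t -v tp_act p g t) with (v0 : X) by vring.
  rewrite nrm_0; apply Rmult_le_pos; [lra | now apply bdd_ge0 in Hg].
Qed.

Lemma Op_comb c L1 f1 L2 f2 : Op L1 f1 -> Op L2 f2 ->
  Op (fun g t => c *v L1 g t +v L2 g t) (fun x => Cplus (Cmult c (f1 x)) (f2 x)).
Proof.
intros H1 H2 eps He.
assert (Hc := Cmod_ge_0 c).
set (e1 := eps / (2 * (Cmod c + 1))).
assert (He1 : 0 < e1) by (apply Rdiv_lt_0_compat; lra).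
assert (Hle : Cmod c * e1 <= eps / 2).
{ replace (eps / 2) with ((Cmod c + 1) * e1) by (unfold e1; field; lra).
  apply Rmult_le_compat_r; lra. }
destruct (H1 e1 He1) as [p [P1 P2]].
destruct (H2 (eps / 2)) as [q [Q1 Q2]]; [lra |].
exists (tp_mono 0 c p ++ q); split.
- intros x; rewrite tp_eval_app, tp_eval_mono, Rmult_0_l, cis_0.
  replace (Cminus (Cplus (Cmult c (f1 x)) (f2 x))
     (Cplus (Cmult (Cmult c 1) (tp_eval p x)) (tp_eval q x))) with
     (Cplus (Cmult c (Cminus (f1 x) (tp_eval p x))) (Cminus (f2 x) (tp_eval q x))) by ring.
  apply Rle_trans with (1 := Cmod_triangle _ _); rewrite Cmod_mult.
  specialize (P1 x); specialize (Q1 x).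
  assert (Cmod c * Cmod (Cminus (f1 x) (tp_eval p x)) <= Cmod c * e1)
    by now apply Rmult_le_compat_l.
  lra.
- intros g M t Hg; rewrite tp_act_app, tp_act_mono, Rplus_0_r.
  replace (c *v L1 g t +v L2 g t -v (c *v tp_act p g t +v tp_act q g t))
    with (c *v (L1 g t -v tp_act p g t) +v (L2 g t -v tp_act q g t)) by vring.
  apply Rle_trans with (1 := nrm_add _ _); rewrite nrm_sc.
  specialize (P2 g M t Hg); specialize (Q2 g M t Hg).
  assert (Cmod c * nrm (L1 g t -v tp_act p g t) <= Cmod c * (e1 * M))
    by now apply Rmult_le_compat_l.
  assert (Cmod c * e1 * M <= eps / 2 * M).
  { apply Rmult_le_compat_r; [now apply bdd_ge0 in Hg | exact Hle]. }
  lra.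
Qed.

Lemma Op_comp L1 f1 L2 f2 : Op L1 f1 -> Op L2 f2 ->
  Op (fun g => L1 (L2 g)) (fun x => Cmult (f1 x) (f2 x)).
Proof.
intros H1 H2 eps He.
destruct (Op_bound _ _ H2) as [K [HK [HK1 HK2]]].
set (e1 := eps / (2 * K)).
assert (He1 : 0 < e1) by (apply Rdiv_lt_0_compat; lra).
destruct (H1 e1 He1) as [p [P1 P2]].
assert (Hp := tp_norm_ge0 p).
(* The tolerance for [q] is fixed after [p], since the error of [q] is amplified by the operator
   norm of [p(S)]. *)
set (e2 := eps / (2 * (tp_norm p + 1))).
assert (He2 : 0 < e2) by (apply Rdiv_lt_0_compat; lra).
destruct (H2 e2 He2) as [q [Q1 Q2]].
assert (Hle : tp_norm p * e2 <= eps / 2).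
{ replace (eps / 2) with ((tp_norm p + 1) * e2) by (unfold e2; field; lra).
  apply Rmult_le_compat_r; lra. }
assert (Hle1 : e1 * K = eps / 2) by (unfold e1; field; lra).
exists (tp_mul p q); split.
- intros x; rewrite tp_eval_mul.
  replace (Cminus (Cmult (f1 x) (f2 x)) (Cmult (tp_eval p x) (tp_eval q x))) with
    (Cplus (Cmult (Cminus (f1 x) (tp_eval p x)) (f2 x))
           (Cmult (tp_eval p x) (Cminus (f2 x) (tp_eval q x)))) by ring.
  apply Rle_trans with (1 := Cmod_triangle _ _); rewrite !Cmod_mult.
  specialize (P1 x); specialize (Q1 x); specialize (HK2 x).
  assert (A1 : Cmod (Cminus (f1 x) (tp_eval p x)) * Cmod (f2 x) <= e1 * K)
    by (apply Rmult_le_compat; auto; apply Cmod_ge_0).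
  assert (A2 : Cmod (tp_eval p x) * Cmod (Cminus (f2 x) (tp_eval q x)) <= tp_norm p * e2)
    by (apply Rmult_le_compat; auto; try apply Cmod_ge_0; apply tp_eval_bound).
  lra.
- intros g M t Hg; rewrite tp_act_mul.
  assert (HM := bdd_ge0 _ _ Hg).
  assert (A1 := P2 (L2 g) (K * M) t (fun s => HK1 g M s Hg)).
  assert (A2 : nrm (tp_act p (L2 g) t -v tp_act p (tp_act q g) t) <= tp_norm p * (e2 * M)).
  { replace (tp_act p (L2 g) t -v tp_act p (tp_act q g) t)
      with (tp_act p (fun s => RtoC (-1) *v tp_act q g s +v L2 g s) t)
      by (rewrite tp_act_comb; vring).
    apply tp_act_bound; intros s.
    replace (RtoC (-1) *v tp_act q g s +v L2 g s) with (L2 g s -v tp_act q g s) by vring.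
    now apply Q2. }
  apply Rle_trans with (1 := nrm_sub_tri _ (tp_act p (L2 g) t) _).
  assert (A3 : tp_norm p * e2 * M <= eps / 2 * M) by now apply Rmult_le_compat_r.
  replace (e1 * (K * M)) with (e1 * K * M) in A1 by ring; rewrite Hle1 in A1; lra.
Qed.

(** [Op] does not ask for linearity, and says nothing about unbounded functions; on bounded ones
    linearity is inherited from the approximating polynomials. *)
Lemma Op_lin L phi c g h M N t : Op L phi -> bdd g M -> bdd h N ->
  L (fun s => c *v g s +v h s) t = c *v L g t +v L h t.
Proof.
intros H Hg Hh.
assert (Hc := Cmod_ge_0 c).
apply (eq_by_eps _ _ (2 * (Cmod c * M + N))); intros eps He.
destruct (H eps He) as [p [_ P]].
assert (Hgh : bdd (fun s => c *v g s +v h s) (Cmod c * M + N)).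
{ intros s; apply Rle_trans with (1 := nrm_add _ _); rewrite nrm_sc.
  apply Rplus_le_compat; [| apply Hh].
  apply Rmult_le_compat_l; [exact Hc | apply Hg]. }
assert (A1 := P _ _ t Hgh); assert (A2 := P _ _ t Hg); assert (A3 := P _ _ t Hh).
rewrite tp_act_comb in A1.
set (a := L (fun s => c *v g s +v h s) t) in *.
replace (a -v (c *v L g t +v L h t)) with
  ((a -v (c *v tp_act p g t +v tp_act p h t)) -v
   (c *v (L g t -v tp_act p g t) +v (L h t -v tp_act p h t))) by vring.
apply Rle_trans with (1 := nrm_sub _ _).
assert (A4 := nrm_add (c *v (L g t -v tp_act p g t)) (L h t -v tp_act p h t)).
rewrite nrm_sc in A4.
assert (A5 : Cmod c * nrm (L g t -v tp_act p g t) <= Cmod c * (eps * M))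
  by now apply Rmult_le_compat_l.
lra.
Qed.

Lemma Op_shift L phi g M a t : Op L phi -> bdd g M ->
  L (fun s => g (a + s)) t = L g (a + t).
Proof.
intros H Hg.
apply (eq_by_eps _ _ (2 * M)); intros eps He.
destruct (H eps He) as [p [_ P]].
assert (A1 := P (fun s => g (a + s)) M t (fun s => Hg _)); assert (A2 := P g M (a + t) Hg).
rewrite tp_act_shift in A1.
apply Rle_trans with (1 := nrm_sub_tri _ (tp_act p g (a + t)) _).
rewrite (nrm_sub_sym (tp_act p g (a + t))); lra.
Qed.

(** Bounded pointwise convergence is enough because [tp_act p] looks at finitely many values of its
    argument. *)
Lemma Op_seq L phi (G : nat -> R -> X) g M t : Op L phi ->
  (forall n, bdd (G n) M) -> bdd g M ->
  (forall s eps, 0 < eps -> exists N, forall n, (N <= n)%nat -> nrm (G n s -v g s) <= eps) ->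
  forall eps, 0 < eps -> exists N, forall n, (N <= n)%nat -> nrm (L (G n) t -v L g t) <= eps.
Proof.
intros H HG Hg Hlim eps He.
assert (HM := bdd_ge0 _ _ Hg).
assert (He' : 0 < eps / (4 * (M + 1))) by (apply Rdiv_lt_0_compat; lra).
destruct (H _ He') as [p [_ P]].
assert (Hle : eps / (4 * (M + 1)) * M <= eps / 4).
{ replace (eps / 4) with (eps / (4 * (M + 1)) * (M + 1)) by (field; lra).
  apply Rmult_le_compat_l; lra. }
assert (Hp : forall e, 0 < e -> exists N, forall n, (N <= n)%nat ->
               nrm (tp_act p (G n) t -v tp_act p g t) <= e).
{ clear - Hlim; induction p as [|[k c] p IH]; intros e He; simpl.
  - exists 0%nat; intros n _; replace (v0 -v v0) with (v0 : X) by vring; rewrite nrm_0; lra.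
  - assert (Hc := Cmod_ge_0 c).
    destruct (IH (e / 2)) as [N1 H1]; [lra |].
    destruct (Hlim (t + IZR k) (e / (2 * (Cmod c + 1)))) as [N2 H2].
    { apply Rdiv_lt_0_compat; lra. }
    exists (N1 + N2)%nat; intros n Hn.
    replace (c *v G n (t + IZR k) +v tp_act p (G n) t -v (c *v g (t + IZR k) +v tp_act p g t))
      with (c *v (G n (t + IZR k) -v g (t + IZR k)) +v (tp_act p (G n) t -v tp_act p g t)) by vring.
    apply Rle_trans with (1 := nrm_add _ _); rewrite nrm_sc.
    specialize (H1 n ltac:(lia)); specialize (H2 n ltac:(lia)).
    assert (Cmod c * nrm (G n (t + IZR k) -v g (t + IZR k)) <= (Cmod c + 1) * (e / (2 * (Cmod c +
      1)))).
    { apply Rmult_le_compat; try lra; apply nrm_ge0. }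
    replace ((Cmod c + 1) * (e / (2 * (Cmod c + 1)))) with (e / 2) in H by (field; lra).
    lra. }
destruct (Hp (eps / 2)) as [N HN]; [lra |].
exists N; intros n Hn; specialize (HN n Hn).
assert (A1 := P _ _ t (HG n)); assert (A2 := P _ _ t Hg).
assert (A3 := nrm_sub_tri (L (G n) t) (tp_act p (G n) t) (L g t)).
assert (A4 := nrm_sub_tri (tp_act p (G n) t) (tp_act p g t) (L g t)).
rewrite (nrm_sub_sym (tp_act p g t)) in A4; lra.
Qed.

Lemma Op_cont L phi g M t : Op L phi -> bdd g M -> (forall s, cont_at g s) -> cont_at (L g) t.
Proof.
intros H Hg Hc eps He.
assert (HM := bdd_ge0 _ _ Hg).
assert (He' : 0 < eps / (4 * (M + 1))) by (apply Rdiv_lt_0_compat; lra).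
destruct (H _ He') as [p [_ P]].
assert (Hle : eps / (4 * (M + 1)) * M <= eps / 4).
{ replace (eps / 4) with (eps / (4 * (M + 1)) * (M + 1)) by (field; lra).
  apply Rmult_le_compat_l; lra. }
destruct (tp_act_cont p g t Hc (eps / 2)) as [d [Hd Hs]]; [lra |].
exists d; split; [exact Hd | intros s Hst; specialize (Hs s Hst)].
assert (A1 := P _ _ t Hg); assert (A2 := P _ _ s Hg).
assert (A3 := nrm_sub_tri (L g s) (tp_act p g s) (L g t)).
assert (A4 := nrm_sub_tri (tp_act p g s) (tp_act p g t) (L g t)).
rewrite (nrm_sub_sym (tp_act p g t)) in A4; lra.
Qed.

Definition ucont g := forall eps, 0 < eps -> exists delta, 0 < delta /\
  forall s t, Rabs (s - t) < delta -> nrm (g s -v g t) <= eps.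

Lemma ucont_cont g t : ucont g -> cont_at g t.
Proof.
intros H eps He; destruct (H eps He) as [d [Hd Hs]]; exists d; split; auto.
Qed.

(** [L] commutes with translations, so [L g s - L g t] is [L] of a difference of two translates of
    [g], which is uniformly small. *)
Lemma Op_ucont L phi g M : Op L phi -> bdd g M -> ucont g -> ucont (L g).
Proof.
intros H Hg Hu eps He.
destruct (Op_bound _ _ H) as [K [HK [HK1 _]]].
destruct (Hu (eps / K)) as [d [Hd Hs]]; [now apply Rdiv_lt_0_compat |].
exists d; split; [exact Hd | intros s t Hst].
assert (Hb : bdd (fun r => RtoC (-1) *v g (t + r) +v g (s + r)) (eps / K)).
{ intros r; replace (RtoC (-1) *v g (t + r) +v g (s + r)) with (g (s + r) -v g (t + r)) by vring.
  apply Hs; now replace (s + r - (t + r)) with (s - t) by ring. }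
assert (A := HK1 _ _ 0 Hb).
rewrite (Op_lin L phi (RtoC (-1)) (fun r => g (t + r)) (fun r => g (s + r)) M M 0 H
  (fun r => Hg _) (fun r => Hg _)) in A.
rewrite !(Op_shift L phi g M _ _ H Hg), !Rplus_0_r in A.
replace (L g s -v L g t) with (RtoC (-1) *v L g t +v L g s) by vring.
replace (K * (eps / K)) with eps in A by (field; lra); exact A.
Qed.

End Operators.

(** * Absolutely convergent Fourier series *)

Definition rint (f : R -> R) (a b : R) : R := RInt f a b.

Lemma rint_ext f g a b :
  (forall x, Rmin a b < x < Rmax a b -> f x = g x) -> rint f a b = rint g a b.
Proof. exact (RInt_ext f g a b). Qed.

Lemma rint_const c a b : rint (fun _ => c) a b = (b - a) * c.
Proof. exact (RInt_const (V := R_CompleteNormedModule) a b c). Qed.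

Lemma is_rint_unique f a b (l : R) : is_RInt f a b l -> rint f a b = l.
Proof. exact (is_RInt_unique f a b l). Qed.

Lemma cont_ex_RInt (f : R -> R) a b : (forall x, continuous f x) -> ex_RInt f a b.
Proof. intros H; apply (ex_RInt_continuous (V := R_CompleteNormedModule)); auto. Qed.

Lemma continuous_Rmult (f g : R -> R) x :
  continuous f x -> continuous g x -> continuous (fun y => f y * g y) x.
Proof. intros Hf Hg; exact (continuous_mult f g x Hf Hg). Qed.

Lemma continuous_cos_aff n c x : continuous (fun y => cos (n * (y - c))) x.
Proof. apply (ex_derive_continuous (K := R_AbsRing) (V := R_NormedModule)); auto_derive; auto. Qed.

Lemma continuous_sin_aff n c x : continuous (fun y => sin (n * (y - c))) x.
Proof. apply (ex_derive_continuous (K := R_AbsRing) (V := R_NormedModule)); auto_derive; auto. Qed.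

Lemma cos_nat_period (n : nat) s : cos (s + INR n * (2 * PI)) = cos s.
Proof. rewrite <- (cos_period s n); f_equal; ring. Qed.

Lemma sin_nat_period (n : nat) s : sin (s + INR n * (2 * PI)) = sin s.
Proof. rewrite <- (sin_period s n); f_equal; ring. Qed.

Lemma RInt_cos_period (n : nat) c :
  rint (fun y => cos (INR (S n) * (y - c))) (-PI) PI = 0.
Proof.
assert (Hn : INR (S n) <> 0) by now apply not_0_INR.
assert (E : sin (INR (S n) * (PI - c)) = sin (INR (S n) * (- PI - c))).
{ rewrite <- (sin_nat_period (S n) (INR (S n) * (- PI - c))); f_equal; ring. }
set (m := INR (S n)) in *; clearbody m.
apply is_rint_unique.
replace 0 with (minus (sin (m * (PI - c)) / m) (sin (m * (- PI - c)) / m)).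
- apply (is_RInt_derive (V := R_CompleteNormedModule) (fun y => sin (m * (y - c)) / m)).
  + intros y _; auto_derive; auto; unfold Rminus; field; exact Hn.
  + intros y _; apply continuous_cos_aff.
- rewrite E; unfold minus, plus, opp; simpl; ring.
Qed.

Lemma RInt_sin_period (n : nat) c :
  rint (fun y => sin (INR n * (y - c))) (-PI) PI = 0.
Proof.
destruct n as [|n].
{ rewrite (rint_ext _ (fun _ => 0)).
  - rewrite rint_const; ring.
  - intros y _; simpl; rewrite Rmult_0_l; apply sin_0. }
assert (Hn : INR (S n) <> 0) by now apply not_0_INR.
assert (E : cos (INR (S n) * (PI - c)) = cos (INR (S n) * (- PI - c))).
{ rewrite <- (cos_nat_period (S n) (INR (S n) * (- PI - c))); f_equal; ring. }
set (m := INR (S n)) in *; clearbody m.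
apply is_rint_unique.
replace 0 with (minus (- cos (m * (PI - c)) / m) (- cos (m * (- PI - c)) / m)).
- apply (is_RInt_derive (V := R_CompleteNormedModule) (fun y => - cos (m * (y - c)) / m)).
  + intros y _; auto_derive; auto; unfold Rminus; field; exact Hn.
  + intros y _; apply continuous_sin_aff.
- rewrite E; unfold minus, plus, opp; simpl; ring.
Qed.

Lemma RInt_Rplus (f g : R -> R) a b : ex_RInt f a b -> ex_RInt g a b ->
  rint (fun x => f x + g x) a b = rint f a b + rint g a b.
Proof. exact (RInt_plus f g a b). Qed.

Lemma RInt_Rscal (c : R) (f : R -> R) a b : ex_RInt f a b ->
  rint (fun x => c * f x) a b = c * rint f a b.
Proof. exact (RInt_scal f a b c). Qed.

Lemma rint_lin3 (F f g : R -> R) (c d a b : R) :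
  ex_RInt F a b -> ex_RInt f a b -> ex_RInt g a b ->
  rint (fun x => F x + (c * f x + d * g x)) a b = rint F a b + (c * rint f a b + d * rint g a b).
Proof.
intros HF Hf Hg.
assert (Hf' : ex_RInt (fun x => c * f x) a b) by exact (ex_RInt_scal (V := R_NormedModule) f a b c
  Hf).
assert (Hg' : ex_RInt (fun x => d * g x) a b) by exact (ex_RInt_scal (V := R_NormedModule) g a b d
  Hg).
rewrite <- (RInt_Rscal c f a b Hf), <- (RInt_Rscal d g a b Hg),
  <- (RInt_Rplus (fun x => c * f x) (fun x => d * g x) a b Hf' Hg').
apply (RInt_Rplus F (fun x => c * f x + d * g x) a b HF).
exact (ex_RInt_plus (V := R_NormedModule) _ _ a b Hf' Hg').
Qed.

Lemma RInt_abs_bound (f : R -> R) a b M : a <= b -> ex_RInt f a b ->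
  (forall x, a <= x <= b -> Rabs (f x) <= M) -> Rabs (rint f a b) <= (b - a) * M.
Proof. intros; now apply abs_RInt_le_const. Qed.

(** Half the classical Dirichlet kernel: [1/2 + cos s + ... + cos (k s)], of integral [PI] over a
    period. *)
Fixpoint dirichlet (k : nat) (s : R) : R :=
  match k with
  | O => 1 / 2
  | S k => dirichlet k s + cos (INR (S k) * s)
  end.

Lemma continuous_dirichlet k c x : continuous (fun y => dirichlet k (y - c)) x.
Proof.
induction k as [|k IH]; cbn [dirichlet]; [apply continuous_const |].
apply (continuous_plus (fun y => dirichlet k (y - c))); [exact IH | apply continuous_cos_aff].
Qed.

Lemma RInt_dirichlet k c : rint (fun y => dirichlet k (y - c)) (- PI) PI = PI.
Proof.
induction k as [|k IH]; cbn [dirichlet].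
- rewrite rint_const; field.
- rewrite RInt_Rplus, IH, RInt_cos_period; [ring | |];
    apply cont_ex_RInt; intros y; [apply continuous_dirichlet | apply continuous_cos_aff].
Qed.

(** The kernel is even and [sin] is odd. This allows [cesaro_bound] to subtract the first-order term
    [f1 x * sin (y - x)] free of charge. *)
Lemma RInt_sin_dirichlet k c :
  rint (fun y => sin (y - c) * dirichlet k (y - c)) (- PI) PI = 0.
Proof.
assert (Hs : forall y, continuous (fun y => sin (y - c)) y).
{ intros y; apply (ex_derive_continuous (K := R_AbsRing) (V := R_NormedModule)); auto_derive;
  auto. }
assert (Hd : forall k y, continuous (fun y => sin (y - c) * dirichlet k (y - c)) y).
{ intros j y; apply continuous_Rmult; [apply Hs | apply continuous_dirichlet]. }
assert (Hsa : forall n, ex_RInt (fun y => sin (INR n * (y - c))) (- PI) PI).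
{ intros n; apply cont_ex_RInt; intros y; apply continuous_sin_aff. }
induction k as [|k IH].
- rewrite (rint_ext _ (fun y => 1 / 2 * sin (INR 1 * (y - c)))).
  + rewrite RInt_Rscal by apply Hsa; rewrite RInt_sin_period; ring.
  + intros y _; simpl; rewrite Rmult_1_l; ring.
- pose (F := fun y => sin (y - c) * dirichlet k (y - c)).
  pose (g1 := fun y => sin (INR (S (S k)) * (y - c))).
  pose (g2 := fun y => sin (INR k * (y - c))).
  rewrite (rint_ext _ (fun y => F y + (1 / 2 * g1 y + (- (1 / 2)) * g2 y))).
  + rewrite rint_lin3; [| apply cont_ex_RInt; intros y; apply Hd | apply Hsa | apply Hsa].
    (* The product formula writes [sin s * cos (m s)] as half the difference of the sines of
       [(m + 1) s] and [(m - 1) s]. *)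
    unfold F, g1, g2; rewrite IH, !RInt_sin_period; ring.
  + intros y _; unfold F, g1, g2; cbn [dirichlet].
    replace (INR (S (S k)) * (y - c)) with (INR (S k) * (y - c) + (y - c)) by (rewrite (S_INR (S
      k)); ring).
    replace (INR k * (y - c)) with (INR (S k) * (y - c) - (y - c)) by (rewrite S_INR; ring).
    set (s := y - c); rewrite sin_plus, sin_minus; field.
Qed.

Lemma sum_dirichlet n s :
  sum_f_R0 (fun k => dirichlet k s) n * (1 - cos s) = (1 - cos (INR (S n) * s)) / 2.
Proof.
assert (H : forall k, dirichlet k s * (1 - cos s) = (cos (INR k * s) - cos (INR (S k) * s)) / 2).
{ induction k as [|k IH]; cbn [dirichlet].
  - simpl; rewrite Rmult_0_l, Rmult_1_l, cos_0; field.
  - rewrite Rmult_plus_distr_r, IH.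
    replace (INR k * s) with (INR (S k) * s - s) by (rewrite S_INR; ring).
    replace (INR (S (S k)) * s) with (INR (S k) * s + s) by (rewrite (S_INR (S k)); ring).
    rewrite cos_plus, cos_minus; field. }
induction n as [|n IH].
- cbn [sum_f_R0]; rewrite H; simpl; rewrite Rmult_0_l, cos_0; easy.
- cbn [sum_f_R0]; rewrite Rmult_plus_distr_r, IH, H; field.
Qed.

(** On this range [u^3 / 6 <= 2 u / 3], and the next two terms of the Taylor lower bound add up to a
    nonnegative quantity. *)
Lemma sin_ge_third u : 0 <= u <= 2 -> u / 3 <= sin u.
Proof.
intros Hu.
assert (HPI : u <= PI) by (assert (H := PI2_3_2); unfold PI2 in H; lra).
assert (H := proj1 (SIN u (proj1 Hu) HPI)).
unfold sin_lb, sin_approx, sin_term, sum_f_R0 in H; simpl in H.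
apply Rle_trans with (2 := H).
assert (u * u <= 4) by nra.
assert (0 <= u * (u * u) * (4 - u * u)).
{ apply Rmult_le_pos; [apply Rmult_le_pos; nra | lra]. }
assert (0 <= u * (4 - u * u)) by (apply Rmult_le_pos; lra).
assert (0 <= u * (u * u) * (u * u) * (4 - u * u)).
{ apply Rmult_le_pos; [repeat apply Rmult_le_pos; nra | lra]. }
assert (0 <= u * (u * u) * (u * u)) by (repeat apply Rmult_le_pos; lra).
lra.
Qed.

(** [1 - cos s = 2 sin^2 (|s| / 2) >= 2 (|s| / 6)^2], whence the 18. *)
Lemma sq_le_cos s : Rabs s <= PI -> s * s <= 18 * (1 - cos s).
Proof.
intros Hs.
assert (H4 := PI_4).
assert (A : Rabs s / 2 / 3 <= sin (Rabs s / 2)).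
{ apply sin_ge_third; assert (H := Rabs_pos s); lra. }
replace (cos s) with (cos (Rabs s)).
2:{ unfold Rabs; destruct (Rcase_abs s); [apply cos_neg | easy]. }
replace (s * s) with (Rabs s * Rabs s) by (rewrite <- Rabs_mult; apply Rabs_pos_eq; nra).
replace (cos (Rabs s)) with (1 - 2 * sin (Rabs s / 2) * sin (Rabs s / 2)).
2:{ rewrite <- cos_2a_sin; f_equal; field. }
assert (H := Rabs_pos s); nra.
Qed.

Lemma one_minus_cos_le c : Rabs (1 - cos c) <= Rabs c.
Proof.
destruct (MVT_gen cos 0 c (fun x => - sin x)) as [d [_ Hd]].
- intros x _; auto_derive; auto; ring.
- intros x _; apply continuity_cos.
- rewrite cos_0 in Hd.
  replace (1 - cos c) with (sin d * c) by lra.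
  rewrite Rabs_mult.
  assert (Hs : Rabs (sin d) <= 1) by (apply Rabs_le, SIN_bound).
  assert (H := Rabs_pos c); nra.
Qed.

Lemma sin_taylor s : Rabs (s - sin s) <= s * s.
Proof.
destruct (MVT_gen (fun x => x - sin x) 0 s (fun x => 1 - cos x)) as [d [Hd1 Hd]].
- intros x _; auto_derive; auto; ring.
- intros x _; apply (derivable_continuous_pt), derivable_pt_minus;
    [apply derivable_pt_id | apply derivable_pt_sin].
- rewrite sin_0 in Hd; replace (s - sin s) with ((1 - cos d) * s) by lra.
  rewrite Rabs_mult.
  assert (H := one_minus_cos_le d).
  assert (Hds : Rabs d <= Rabs s).
  { unfold Rmin, Rmax in Hd1; unfold Rabs; destruct (Rle_dec 0 s), (Rcase_abs d), (Rcase_abs s);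
    lra. }
  replace (s * s) with (Rabs s * Rabs s) by (rewrite <- Rabs_mult; apply Rabs_pos_eq; nra).
  apply Rmult_le_compat_r; [apply Rabs_pos | lra].
Qed.

Lemma reduce_2PI s : exists k : Z, Rabs (s + 2 * IZR k * PI) <= PI.
Proof.
assert (HP := PI_RGT_0).
set (q := (s + PI) / (2 * PI)).
exists (- (up q - 1))%Z.
destruct (archimed q) as [H1 H2].
rewrite opp_IZR, minus_IZR.
assert (E : s = q * (2 * PI) - PI) by (unfold q; field; lra).
apply Rabs_le; rewrite E; split; nra.
Qed.

Section Fourier.
Variables (f f1 f2 : R -> R) (a b : R).
Hypothesis Hf1 : forall x, is_derive f x (f1 x).
Hypothesis Hf2 : forall x, is_derive f1 x (f2 x).
Hypothesis Hf2c : forall x, continuous f2 x.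
Hypothesis Hper : forall x, f (x + 2 * PI) = f x.
Hypothesis Ha : forall x, Rabs (f x) <= a.
Hypothesis Hb : forall x, Rabs (f2 x) <= b.

Let fc x : continuous f x.
Proof. apply (ex_derive_continuous (K := R_AbsRing) (V := R_NormedModule)); eexists; apply Hf1. Qed.
Let f1c x : continuous f1 x.
Proof. apply (ex_derive_continuous (K := R_AbsRing) (V := R_NormedModule)); eexists; apply Hf2. Qed.

Lemma f1_per x : f1 (x + 2 * PI) = f1 x.
Proof.
assert (A : is_derive (fun y => f (y + 2 * PI)) x (f1 (x + 2 * PI))).
{ replace (f1 (x + 2 * PI)) with (scal 1 (f1 (x + 2 * PI))) by (unfold scal; simpl; unfold mult;
  simpl; ring).
  apply (is_derive_comp f (fun y => y + 2 * PI)); [apply Hf1 | auto_derive; auto]. }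
assert (B : is_derive (fun y => f (y + 2 * PI)) x (f1 x)).
{ apply (is_derive_ext f); [intros t; now rewrite Hper | apply Hf1]. }
apply is_derive_unique in A; apply is_derive_unique in B; congruence.
Qed.

Lemma f_perZ x (k : Z) : f (x + 2 * IZR k * PI) = f x.
Proof.
assert (H : forall (n : nat) x, f (x + 2 * INR n * PI) = f x).
{ induction n as [|n IH]; intros y.
  - simpl; f_equal; ring.
  - rewrite S_INR; replace (y + 2 * (INR n + 1) * PI) with (y + 2 * INR n * PI + 2 * PI) by ring.
    now rewrite Hper. }
destruct (Z.le_ge_cases 0 k) as [Hk | Hk].
- replace (IZR k) with (INR (Z.to_nat k)); [apply H |].
  now rewrite INR_IZR_INZ, Z2Nat.id.
- rewrite <- (H (Z.to_nat (- k))), INR_IZR_INZ, Z2Nat.id by lia.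
  f_equal; rewrite opp_IZR; ring.
Qed.

Definition Acoef (n : nat) := / PI * rint (fun y => f y * cos (INR n * y)) (- PI) PI.
Definition Bcoef (n : nat) := / PI * rint (fun y => f y * sin (INR n * y)) (- PI) PI.

Let cosc (n : R) x : continuous (fun y => cos (n * y)) x.
Proof. apply (ex_derive_continuous (K := R_AbsRing) (V := R_NormedModule)); auto_derive; auto. Qed.
Let sinc (n : R) x : continuous (fun y => sin (n * y)) x.
Proof. apply (ex_derive_continuous (K := R_AbsRing) (V := R_NormedModule)); auto_derive; auto. Qed.

Lemma coef_bound (h t : R -> R) M : (forall x, continuous h x) -> (forall x, continuous t x) ->
  (forall x, Rabs (h x) <= M) -> (forall x, Rabs (t x) <= 1) ->
  Rabs (/ PI * rint (fun y => h y * t y) (- PI) PI) <= 2 * M.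
Proof.
intros Hh Ht HM H1; assert (HP := PI_RGT_0).
rewrite Rabs_mult, (Rabs_pos_eq (/ PI)) by (left; now apply Rinv_0_lt_compat).
apply Rle_trans with (/ PI * ((PI - - PI) * M)).
- apply Rmult_le_compat_l; [left; now apply Rinv_0_lt_compat |].
  apply RInt_abs_bound; [lra | |].
  + apply cont_ex_RInt; intros; now apply continuous_Rmult.
  + intros x _; rewrite Rabs_mult; specialize (HM x); specialize (H1 x).
    assert (A1 := Rabs_pos (h x)); assert (A2 := Rabs_pos (t x)); nra.
- right; field; lra.
Qed.

Lemma Rabs_cos_le x : Rabs (cos x) <= 1.
Proof. apply Rabs_le, COS_bound. Qed.
Lemma Rabs_sin_le x : Rabs (sin x) <= 1.
Proof. apply Rabs_le, SIN_bound. Qed.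

Lemma coef_decay_gen (t t' : R -> R) (n : R) : n <> 0 ->
  (forall x, is_derive t x (n * t' x)) -> (forall x, is_derive t' x (- n * t x)) ->
  t PI = t (- PI) -> t' PI = t' (- PI) ->
  rint (fun y => f y * t y) (- PI) PI = - / (n * n) * rint (fun y => f2 y * t y) (- PI) PI.
Proof.
intros Hn Ht Ht' E1 E2.
assert (tc : forall x, continuous t x) by (intros x; apply (ex_derive_continuous (K := R_AbsRing)
  (V := R_NormedModule)); eexists; apply Ht).
assert (E : rint (fun y => f y * t y + / (n * n) * (f2 y * t y)) (- PI) PI = 0).
{ apply is_rint_unique.
  (* [G] is the antiderivative of [f t + f2 t / n^2] obtained from two integrations by parts;
     periodicity cancels its boundary terms. *)
  pose (G := fun y => / (n * n) * f1 y * t y - / n * f y * t' y).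
  replace 0 with (minus (G PI) (G (- PI))).
  - apply (is_RInt_derive (V := R_CompleteNormedModule) G).
    + intros y _; unfold G.
      assert (D1 := is_derive_Reals f y (f1 y)).
      auto_derive.
      * repeat split; eexists; [apply Hf2 | apply Ht | apply Hf1 | apply Ht'].
      * replace (Derive (fun x => f1 x) y) with (f2 y) by (symmetry; apply is_derive_unique, Hf2).
        replace (Derive (fun x => t x) y) with (n * t' y) by (symmetry; apply is_derive_unique, Ht).
        replace (Derive (fun x => f x) y) with (f1 y) by (symmetry; apply is_derive_unique, Hf1).
        replace (Derive (fun x => t' x) y) with (- n * t y) by (symmetry;
          apply is_derive_unique, Ht').
        field; auto.
    + intros y _; apply (continuous_plus (fun y => f y * t y)).
      * now apply continuous_Rmult.
      * apply (continuous_Rmult (fun _ => / (n * n))); [apply continuous_const | now apply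
        continuous_Rmult].
  - unfold G; replace PI with (- PI + 2 * PI) at 1 2 by ring.
    replace (f (-PI + 2 * PI)) with (f (- PI)) by now rewrite Hper.
    replace (- PI + 2 * PI) with PI by ring.
    replace (f1 PI) with (f1 (- PI)) by (rewrite <- (f1_per (- PI)); f_equal; ring).
    replace (f PI) with (f (- PI)) by (rewrite <- (Hper (- PI)); f_equal; ring).
    rewrite E1, E2; unfold minus, plus, opp; simpl; ring. }
rewrite RInt_Rplus, RInt_Rscal in E.
- lra.
- apply cont_ex_RInt; intros; now apply continuous_Rmult.
- apply cont_ex_RInt; intros; now apply continuous_Rmult.
- apply (ex_RInt_scal (V := R_NormedModule)).
  apply cont_ex_RInt; intros; now apply continuous_Rmult.
Qed.

Lemma coef_decay n : Rabs (Acoef (S n)) <= 2 * b / (INR (S n) * INR (S n)) /\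
                     Rabs (Bcoef (S n)) <= 2 * b / (INR (S n) * INR (S n)).
Proof.
set (m := INR (S n)).
assert (Hm : 0 < m) by (apply lt_0_INR; lia).
assert (Hm2 : 0 < m * m) by nra.
assert (E1 : cos (m * PI) = cos (m * - PI)).
{ replace (m * - PI) with (- (m * PI)) by ring; now rewrite cos_neg. }
assert (E2 : sin (m * PI) = sin (m * - PI)).
{ rewrite <- (sin_nat_period (S n) (m * - PI)); f_equal; fold m; ring. }
unfold Acoef, Bcoef; fold m; split.
- rewrite (coef_decay_gen (fun y => cos (m * y)) (fun y => - sin (m * y)) m); auto; try lra.
  + replace (/ PI * (- / (m * m) * rint (fun y => f2 y * cos (m * y)) (- PI) PI))
      with (- / (m * m) * (/ PI * rint (fun y => f2 y * cos (m * y)) (- PI) PI)) by ring.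
    rewrite Rabs_mult, Rabs_Ropp, Rabs_pos_eq by (left; now apply Rinv_0_lt_compat).
    replace (2 * b / (m * m)) with (/ (m * m) * (2 * b)) by (field; lra).
    apply Rmult_le_compat_l; [left; now apply Rinv_0_lt_compat |].
    apply coef_bound; auto; intros; apply Rabs_cos_le.
  + intros x; auto_derive; auto; ring.
  + intros x; auto_derive; auto; ring.
- rewrite (coef_decay_gen (fun y => sin (m * y)) (fun y => cos (m * y)) m); auto; try lra.
  + replace (/ PI * (- / (m * m) * rint (fun y => f2 y * sin (m * y)) (- PI) PI))
      with (- / (m * m) * (/ PI * rint (fun y => f2 y * sin (m * y)) (- PI) PI)) by ring.
    rewrite Rabs_mult, Rabs_Ropp, Rabs_pos_eq by (left; now apply Rinv_0_lt_compat).
    replace (2 * b / (m * m)) with (/ (m * m) * (2 * b)) by (field; lra).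
    apply Rmult_le_compat_l; [left; now apply Rinv_0_lt_compat |].
    apply coef_bound; auto; intros; apply Rabs_sin_le.
  + intros x; auto_derive; auto; ring.
  + intros x; auto_derive; auto; ring.
Qed.

Lemma coef_bounded n : Rabs (Acoef n) <= 2 * a /\ Rabs (Bcoef n) <= 2 * a.
Proof.
split; apply coef_bound; auto; intros; [apply Rabs_cos_le | apply Rabs_sin_le].
Qed.

Fixpoint psum (k : nat) (x : R) : R :=
  match k with
  | O => Acoef 0 / 2
  | S k => psum k x + (Acoef (S k) * cos (INR (S k) * x) + Bcoef (S k) * sin (INR (S k) * x))
  end.

Lemma psum_dirichlet k x :
  psum k x = / PI * rint (fun y => f y * dirichlet k (y - x)) (- PI) PI.
Proof.
assert (Hc : forall k, ex_RInt (fun y => f y * dirichlet k (y - x)) (- PI) PI).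
{ intros; apply cont_ex_RInt; intros; apply continuous_Rmult; [apply fc | apply
  continuous_dirichlet]. }
assert (He : forall n, ex_RInt (fun y => f y * cos (n * y)) (- PI) PI).
{ intros; apply cont_ex_RInt; intros; now apply continuous_Rmult. }
assert (He' : forall n, ex_RInt (fun y => f y * sin (n * y)) (- PI) PI).
{ intros; apply cont_ex_RInt; intros; now apply continuous_Rmult. }
induction k as [|k IH]; cbn [psum].
- unfold Acoef.
  rewrite (rint_ext (fun y => f y * dirichlet 0 (y - x)) (fun y => / 2 * (f y * cos (INR 0 * y)))).
  + rewrite RInt_Rscal by apply He; field; apply PI_neq0.
  + intros y _; simpl; rewrite Rmult_0_l, cos_0; field.
- set (m := INR (S k)).
  pose (F := fun y => f y * dirichlet k (y - x)).
  pose (g1 := fun y => f y * cos (m * y)); pose (g2 := fun y => f y * sin (m * y)).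
  rewrite (rint_ext _ (fun y => F y + (cos (m * x) * g1 y + sin (m * x) * g2 y))).
  + rewrite rint_lin3; [| apply Hc | apply He | apply He'].
    rewrite IH; unfold Acoef, Bcoef, F, g1, g2; fold m; ring.
  + intros y _; unfold F, g1, g2; cbn [dirichlet]; fold m.
    replace (m * (y - x)) with (m * y - m * x) by ring; rewrite cos_minus; ring.
Qed.

(** A second-order Taylor estimate in periodic dress: [sin] replaces the linear term and [1 - cos]
    the quadratic one, so that the bound on one period extends to the line. *)
Lemma remainder_bound x : exists K, 0 < K /\ forall y,
  Rabs (f y - f x - f1 x * sin (y - x)) <= K * (1 - cos (y - x)).
Proof.
assert (Hb0 : 0 <= b) by (apply Rle_trans with (2 := Hb 0), Rabs_pos).
assert (H1 := Rabs_pos (f1 x)).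
exists (18 * (b + Rabs (f1 x) + 1)); split; [lra | intros y].
assert (Hloc : forall s, Rabs s <= PI ->
  Rabs (f (x + s) - f x - f1 x * sin s) <= 18 * (b + Rabs (f1 x) + 1) * (1 - cos s)).
{ intros s Hs.
  destruct (MVT_gen f x (x + s) f1) as [c [Hc1 Hc]].
  { intros; apply Hf1. }
  { intros; apply continuity_pt_filterlim, fc. }
  destruct (MVT_gen f1 x c f2) as [d [_ Hd]].
  { intros; apply Hf2. }
  { intros; apply continuity_pt_filterlim, f1c. }
  assert (Hcs : Rabs (c - x) <= Rabs s).
  { unfold Rmin, Rmax in Hc1; unfold Rabs; destruct (Rle_dec x (x + s)), (Rcase_abs (c - x)),
    (Rcase_abs s); lra. }
  replace (f (x + s) - f x - f1 x * sin s) with (f2 d * (c - x) * s + f1 x * (s - sin s)).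
  2:{ replace (f (x + s) - f x) with (f1 c * s) by lra; replace (f2 d * (c - x)) with (f1 c - f1
    x) by lra; ring. }
  apply Rle_trans with (1 := Rabs_triang _ _); rewrite !Rabs_mult.
  assert (A1 := sin_taylor s); assert (A2 := sq_le_cos s Hs).
  assert (A3 : Rabs s * Rabs s = s * s) by (rewrite <- Rabs_mult; apply Rabs_pos_eq; nra).
  assert (A4 : Rabs (f2 d) * Rabs (c - x) * Rabs s <= b * (s * s)).
  { rewrite <- A3, <- Rmult_assoc; apply Rmult_le_compat_r; [apply Rabs_pos |].
    apply Rmult_le_compat; auto; apply Rabs_pos. }
  assert (A5 : Rabs (f1 x) * Rabs (s - sin s) <= Rabs (f1 x) * (s * s)) by now apply
    Rmult_le_compat_l.
  assert (A6 : (b + Rabs (f1 x)) * (s * s) <= (b + Rabs (f1 x)) * (18 * (1 - cos s)))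
    by (apply Rmult_le_compat_l; lra).
  assert (A7 := COS_bound s); nra. }
destruct (reduce_2PI (y - x)) as [k Hk].
specialize (Hloc _ Hk).
assert (E := cis_Z2PI (y - x) k); unfold cis in E; injection E as E1 E2.
rewrite E1, E2 in Hloc.
replace (x + (y - x + 2 * IZR k * PI)) with (y + 2 * IZR k * PI) in Hloc by ring.
rewrite f_perZ in Hloc; exact Hloc.
Qed.

(** The remainder is [O(1 - cos (y - x))], and by [sum_dirichlet] the factor [1 - cos] turns the
    Fejer sum into a bounded function. The integral is thus bounded uniformly in [n], and dividing
    by [n + 1] gives the rate. *)
Lemma cesaro_bound x : exists K, forall n,
  Rabs (sum_f_R0 (fun k => psum k x) n / INR (S n) - f x) <= K / INR (S n).
Proof.
destruct (remainder_bound x) as [K [HK HR]].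
assert (HP := PI_RGT_0).
exists (2 * K); intros n.
pose (F := fun y => f y - f x - f1 x * sin (y - x)).
assert (Fc : forall y, continuous F y).
{ intros y; unfold F; apply (continuous_minus (fun y => f y - f x)).
  - apply (continuous_minus f); [apply fc | apply continuous_const].
  - apply (continuous_Rmult (fun _ => f1 x)); [apply continuous_const |].
    apply (ex_derive_continuous (K := R_AbsRing) (V := R_NormedModule)); auto_derive; auto. }
assert (sc : forall y, continuous (fun y => sin (y - x)) y).
{ intros y; apply (ex_derive_continuous (K := R_AbsRing) (V := R_NormedModule)); auto_derive;
  auto. }
assert (Hk : forall k, psum k x - f x = / PI * rint (fun y => F y * dirichlet k (y - x)) (- PI) PI).
{ intros k; rewrite psum_dirichlet.
  assert (I1 : ex_RInt (fun y => F y * dirichlet k (y - x)) (- PI) PI).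
  { apply cont_ex_RInt; intros; apply continuous_Rmult; [apply Fc | apply continuous_dirichlet]. }
  assert (I2 : ex_RInt (fun y => dirichlet k (y - x)) (- PI) PI).
  { apply cont_ex_RInt; intros; apply continuous_dirichlet. }
  assert (I3 : ex_RInt (fun y => sin (y - x) * dirichlet k (y - x)) (- PI) PI).
  { apply cont_ex_RInt; intros; apply continuous_Rmult; [apply sc | apply continuous_dirichlet]. }
  pose (h := fun y => F y * dirichlet k (y - x)); pose (g1 := fun y => dirichlet k (y - x)).
  pose (g2 := fun y => sin (y - x) * dirichlet k (y - x)).
  rewrite (rint_ext _ (fun y => h y + (f x * g1 y + f1 x * g2 y))).
  2:{ intros y _; unfold h, g1, g2, F; ring. }
  rewrite rint_lin3; [| exact I1 | exact I2 | exact I3].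
  unfold h, g1, g2; rewrite RInt_dirichlet, RInt_sin_dirichlet; field; lra. }
assert (Ec : forall n y, continuous (fun y => sum_f_R0 (fun k => dirichlet k (y - x)) n) y).
{ induction n0 as [|m IH]; intros y; cbn [sum_f_R0].
  - apply (continuous_dirichlet 0).
  - apply (continuous_plus (fun y => sum_f_R0 (fun k => dirichlet k (y - x)) m));
      [apply IH | apply (continuous_dirichlet (S m))]. }
assert (Hs : sum_f_R0 (fun k => psum k x) n - INR (S n) * f x =
   / PI * rint (fun y => F y * sum_f_R0 (fun k => dirichlet k (y - x)) n) (- PI) PI).
{ induction n as [|n IH].
  - cbn [sum_f_R0]; rewrite <- Hk; simpl; ring.
  - cbn [sum_f_R0].
    rewrite (rint_ext _ (fun y => F y * sum_f_R0 (fun k => dirichlet k (y - x)) n +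
         F y * dirichlet (S n) (y - x))) by (intros; simpl; ring).
    rewrite RInt_Rplus, Rmult_plus_distr_l, <- IH, <- Hk, (S_INR (S n)); [simpl; ring | |].
    + apply cont_ex_RInt; intros; apply continuous_Rmult; [apply Fc | apply Ec].
    + apply cont_ex_RInt; intros; apply continuous_Rmult; [apply Fc | apply continuous_dirichlet]. }
assert (Hn : 0 < INR (S n)) by (apply lt_0_INR; lia).
replace (sum_f_R0 (fun k => psum k x) n / INR (S n) - f x) with
  ((sum_f_R0 (fun k => psum k x) n - INR (S n) * f x) * / INR (S n)) by (field; lra).
rewrite Rabs_mult, (Rabs_pos_eq (/ INR (S n))) by (left; now apply Rinv_0_lt_compat).
apply Rmult_le_compat_r; [left; now apply Rinv_0_lt_compat |].
rewrite Hs, Rabs_mult, (Rabs_pos_eq (/ PI)) by (left; now apply Rinv_0_lt_compat).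
apply Rle_trans with (/ PI * ((PI - - PI) * K)); [| right; field; lra].
apply Rmult_le_compat_l; [left; now apply Rinv_0_lt_compat |].
apply RInt_abs_bound; [lra | |].
- apply cont_ex_RInt; intros; apply continuous_Rmult; [apply Fc | apply Ec].
- intros y _; rewrite Rabs_mult.
  apply Rle_trans with (K * (1 - cos (y - x)) * Rabs (sum_f_R0 (fun k => dirichlet k (y - x)) n)).
  + apply Rmult_le_compat_r; [apply Rabs_pos | apply HR].
  + assert (A := COS_bound (y - x)).
    replace (1 - cos (y - x)) with (Rabs (1 - cos (y - x))) by (apply Rabs_pos_eq; lra).
    rewrite Rmult_assoc, <- Rabs_mult, (Rmult_comm (1 - cos (y - x))), sum_dirichlet.
    assert (A2 := COS_bound (INR (S n) * (y - x))).
    rewrite Rabs_pos_eq; nra.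
Qed.

Fixpoint ptp (k : nat) : tpoly :=
  match k with
  | O => [(0%Z, RtoC (Acoef 0 / 2))]
  | S k => (Z.of_nat (S k), (Acoef (S k) / 2, - (Bcoef (S k) / 2)))
        :: ((- Z.of_nat (S k))%Z, (Acoef (S k) / 2, Bcoef (S k) / 2)) :: ptp k
  end.

Lemma ptp_eval k x : tp_eval (ptp k) x = RtoC (psum k x).
Proof.
induction k as [|k IH]; cbn [ptp]; cbn [psum].
- simpl; rewrite Rmult_0_l, cis_0; unfold RtoC, Cplus, Cmult; simpl; f_equal; ring.
- cbn [tp_eval]; rewrite IH, opp_IZR, <- INR_IZR_INZ; unfold cis, RtoC, Cplus, Cmult; cbn [fst snd].
  set (m := INR (S k)).
  replace (- m * x) with (- (m * x)) by ring; rewrite cos_neg, sin_neg; f_equal; field.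
Qed.

Lemma Cmod_half_le u v : Cmod (u / 2, v / 2) <= (Rabs u + Rabs v) / 2.
Proof.
replace ((u / 2, v / 2) : C) with (Cplus (RtoC (u / 2)) (Cmult Ci (RtoC (v / 2)))).
- apply Rle_trans with (1 := Cmod_triangle _ _).
  rewrite Cmod_mult, Cmod_Ci, !Cmod_R; unfold Rdiv; rewrite !Rabs_mult, (Rabs_pos_eq (/2)) by lra;
    lra.
- unfold Cplus, Cmult, Ci, RtoC; simpl; f_equal; ring.
Qed.

Lemma telescope_sq (k : nat) : (0 < k)%nat -> / (INR (S k) * INR (S k)) <= / INR k - / INR (S k).
Proof.
intros Hk; assert (H : 0 < INR k) by now apply lt_0_INR.
rewrite S_INR; replace (/ INR k - / (INR k + 1)) with (/ (INR k * (INR k + 1))) by (field; lra).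
apply Rinv_le_contravar; nra.
Qed.

Lemma ptp_diff (Y : CompleteNormedModule C_AbsRing) (g : R -> Y) M t n m :
  bdd g M -> (0 < n)%nat -> (n <= m)%nat ->
  nrm (tp_act (ptp m) g t -v tp_act (ptp n) g t) <= 4 * b * (/ INR n - / INR m) * M.
Proof.
intros Hg Hn Hm; assert (HM := bdd_ge0 _ _ Hg).
assert (Hb0 : 0 <= b) by (apply Rle_trans with (2 := Hb 0), Rabs_pos).
induction Hm as [|m Hm IH].
- replace (tp_act (ptp n) g t -v tp_act (ptp n) g t) with (v0 : Y) by vring.
  rewrite nrm_0, Rminus_diag; lra.
- cbn [ptp tp_act].
  set (p := tp_act (ptp m) g t) in *.
  set (c1 := (Acoef (S m) / 2, - (Bcoef (S m) / 2)) : C).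
  set (c2 := (Acoef (S m) / 2, Bcoef (S m) / 2) : C).
  set (g1 := g (t + _)); set (g2 := g (t + _)).
  replace (c1 *v g1 +v (c2 *v g2 +v p) -v tp_act (ptp n) g t) with
    (c1 *v g1 +v (c2 *v g2 +v (p -v tp_act (ptp n) g t))) by vring.
  apply Rle_trans with (1 := nrm_add _ _).
  assert (A := nrm_add (c2 *v g2) (p -v tp_act (ptp n) g t)).
  rewrite !nrm_sc in *.
  destruct (coef_decay m) as [D1 D2].
  assert (T := telescope_sq m ltac:(lia)).
  assert (C1 : Cmod c1 <= 2 * b / (INR (S m) * INR (S m))).
  { unfold c1; replace (- (Bcoef (S m) / 2)) with (- Bcoef (S m) / 2) by field.
    apply Rle_trans with (1 := Cmod_half_le _ _); rewrite Rabs_Ropp; lra. }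
  assert (C2 : Cmod c2 <= 2 * b / (INR (S m) * INR (S m))).
  { apply Rle_trans with (1 := Cmod_half_le _ _); lra. }
  assert (E : 2 * b / (INR (S m) * INR (S m)) <= 2 * b * (/ INR m - / INR (S m))).
  { apply Rmult_le_compat_l; lra. }
  assert (G1 : Cmod c1 * nrm g1 <= 2 * b * (/ INR m - / INR (S m)) * M).
  { apply Rmult_le_compat; [apply Cmod_ge_0 | apply nrm_ge0 | lra | apply Hg]. }
  assert (G2 : Cmod c2 * nrm g2 <= 2 * b * (/ INR m - / INR (S m)) * M).
  { apply Rmult_le_compat; [apply Cmod_ge_0 | apply nrm_ge0 | lra | apply Hg]. }
  lra.
Qed.

Lemma ptp_head (Y : CompleteNormedModule C_AbsRing) (g : R -> Y) M t n :
  bdd g M -> nrm (tp_act (ptp n) g t) <= (4 * INR n + 1) * a * M.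
Proof.
intros Hg; assert (HM := bdd_ge0 _ _ Hg).
assert (Ha0 : 0 <= a) by (apply Rle_trans with (2 := Ha 0), Rabs_pos).
induction n as [|n IH].
- cbn [ptp tp_act].
  replace (RtoC (Acoef 0 / 2) *v g (t + 0) +v v0) with (RtoC (Acoef 0 / 2) *v g (t + 0)) by vring.
  rewrite nrm_sc, Cmod_R; destruct (coef_bounded 0) as [A1 _].
  unfold Rdiv; rewrite Rabs_mult, (Rabs_pos_eq (/ 2)) by lra.
  apply Rmult_le_compat; [| apply nrm_ge0 | simpl; lra | apply Hg].
  apply Rmult_le_pos; [apply Rabs_pos | lra].
- cbn [ptp tp_act].
  set (c1 := (Acoef (S n) / 2, - (Bcoef (S n) / 2)) : C).
  set (c2 := (Acoef (S n) / 2, Bcoef (S n) / 2) : C).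
  set (g1 := g (t + _)); set (g2 := g (t + _)).
  apply Rle_trans with (1 := nrm_add _ _).
  assert (A := nrm_add (c2 *v g2) (tp_act (ptp n) g t)).
  rewrite !nrm_sc in *; destruct (coef_bounded (S n)) as [D1 D2].
  assert (C1 : Cmod c1 <= 2 * a).
  { unfold c1; replace (- (Bcoef (S n) / 2)) with (- Bcoef (S n) / 2) by field.
    apply Rle_trans with (1 := Cmod_half_le _ _); rewrite Rabs_Ropp; lra. }
  assert (C2 : Cmod c2 <= 2 * a).
  { apply Rle_trans with (1 := Cmod_half_le _ _); lra. }
  assert (G1 : Cmod c1 * nrm g1 <= 2 * a * M).
  { apply Rmult_le_compat; [apply Cmod_ge_0 | apply nrm_ge0 | lra | apply Hg]. }
  assert (G2 : Cmod c2 * nrm g2 <= 2 * a * M).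
  { apply Rmult_le_compat; [apply Cmod_ge_0 | apply nrm_ge0 | lra | apply Hg]. }
  rewrite S_INR; lra.
Qed.

Lemma psum_diff x n m : (0 < n)%nat -> (n <= m)%nat ->
  Rabs (psum m x - psum n x) <= 4 * b * (/ INR n - / INR m).
Proof.
intros Hn Hm.
induction Hm as [|m Hm IH].
- rewrite !Rminus_diag, Rabs_R0; lra.
- cbn [psum].
  destruct (coef_decay m) as [D1 D2].
  assert (Hb0 : 0 <= b) by (apply Rle_trans with (2 := Hb 0), Rabs_pos).
  assert (T := telescope_sq m ltac:(lia)).
  set (c := cos (INR (S m) * x)); set (s := sin (INR (S m) * x)).
  replace (psum m x + (Acoef (S m) * c + Bcoef (S m) * s) - psum n x) with
    ((psum m x - psum n x) + (Acoef (S m) * c + Bcoef (S m) * s)) by ring.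
  apply Rle_trans with (1 := Rabs_triang _ _).
  assert (A := Rabs_triang (Acoef (S m) * c) (Bcoef (S m) * s)); rewrite !Rabs_mult in A.
  assert (E : 2 * b / (INR (S m) * INR (S m)) <= 2 * b * (/ INR m - / INR (S m))).
  { apply Rmult_le_compat_l; lra. }
  assert (Hc : Rabs c <= 1) by apply Rabs_cos_le.
  assert (Hs : Rabs s <= 1) by apply Rabs_sin_le.
  assert (P1 := Rabs_pos (Acoef (S m))); assert (P2 := Rabs_pos (Bcoef (S m))).
  assert (Rabs (Acoef (S m)) * Rabs c <= Rabs (Acoef (S m)) * 1) by now apply Rmult_le_compat_l.
  assert (Rabs (Bcoef (S m)) * Rabs s <= Rabs (Bcoef (S m)) * 1) by now apply Rmult_le_compat_l.
  lra.
Qed.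

Lemma inv_INR_small eps : 0 < eps -> exists n, (0 < n)%nat /\ / INR n <= eps.
Proof.
intros He; destruct (archimed_cor1 eps He) as [n [H1 H2]]; exists n; split; [exact H2 | lra].
Qed.

(** Coefficient decay makes the partial sums Cauchy; their limit must agree with that of the Cesaro
    means, which is [f x]. *)
Lemma psum_cv x : Un_cv (fun n => psum n x) (f x).
Proof.
assert (Hb0 : 0 <= b) by (apply Rle_trans with (2 := Hb 0), Rabs_pos).
destruct (Rcomplete.R_complete (fun n => psum n x)) as [l Hl].
{ intros eps He.
  destruct (inv_INR_small (eps / (8 * b + 1))) as [N [HN1 HN2]].
  { apply Rdiv_lt_0_compat; lra. }
  assert (HNb : 4 * b * / INR N < eps / 2).
  { apply Rle_lt_trans with (4 * b * (eps / (8 * b + 1))); [apply Rmult_le_compat_l; lra |].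
    replace (eps / 2) with ((4 * b + / 2) * (eps / (8 * b + 1))) by (field; lra).
    apply Rmult_lt_compat_r; [apply Rdiv_lt_0_compat; lra | lra]. }
  assert (Hd : forall n, (n >= N)%nat -> Rabs (psum n x - psum N x) < eps / 2).
  { intros n Hn; apply Rle_lt_trans with (1 := psum_diff x N n HN1 Hn).
    assert (0 < / INR n) by (apply Rinv_0_lt_compat, lt_0_INR; lia).
    assert (0 <= 4 * b * / INR n) by (apply Rmult_le_pos; lra); lra. }
  exists N; intros n m Hn Hm; unfold Rdist.
  replace (psum n x - psum m x) with ((psum n x - psum N x) - (psum m x - psum N x)) by ring.
  apply Rle_lt_trans with (1 := Rabs_triang _ _); rewrite Rabs_Ropp.
  specialize (Hd n Hn) as D1; specialize (Hd m Hm); lra. }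
assert (Hc := Cesaro_1 _ _ Hl).
replace (f x) with l; [exact Hl |].
apply UL_sequence with (1 := Hc).
destruct (cesaro_bound x) as [K HK].
intros eps He.
assert (HK0 := Rabs_pos K).
destruct (inv_INR_small (eps / (2 * (Rabs K + 1)))) as [N [HN1 HN2]].
{ apply Rdiv_lt_0_compat; lra. }
exists N; intros n Hn; unfold Rdist.
destruct n as [|n]; [lia |].
apply Rle_lt_trans with (1 := HK n).
assert (Hi : / INR (S n) <= / INR N).
{ apply Rinv_le_contravar; [apply lt_0_INR; lia | apply le_INR; lia]. }
assert (Hp : 0 < / INR (S n)) by (apply Rinv_0_lt_compat, lt_0_INR; lia).
assert (HKa := Rle_abs K).
apply Rle_lt_trans with ((Rabs K + 1) * (eps / (2 * (Rabs K + 1)))).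
- unfold Rdiv at 1; apply Rle_trans with ((Rabs K + 1) * / INR (S n)).
  + apply Rmult_le_compat_r; lra.
  + apply Rmult_le_compat_l; lra.
- replace ((Rabs K + 1) * (eps / (2 * (Rabs K + 1)))) with (eps / 2) by (field; lra); lra.
Qed.

Lemma psum_tail x n : (0 < n)%nat -> Rabs (f x - psum n x) <= 4 * b * / INR n.
Proof.
intros Hn.
assert (Hb0 : 0 <= b) by (apply Rle_trans with (2 := Hb 0), Rabs_pos).
apply Rnot_lt_le; intros Hlt.
destruct (psum_cv x (Rabs (f x - psum n x) - 4 * b * / INR n)) as [N HN]; [lra |].
specialize (HN (N + n)%nat ltac:(lia)); unfold Rdist in HN.
assert (A := psum_diff x n (N + n) Hn ltac:(lia)).
assert (0 < / INR (N + n)) by (apply Rinv_0_lt_compat, lt_0_INR; lia).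
assert (0 <= 4 * b * / INR (N + n)) by (apply Rmult_le_pos; lra).
assert (T := Rabs_triang (psum (N + n) x - psum n x) (- (psum (N + n) x - f x))).
rewrite Rabs_Ropp in T.
replace (psum (N + n) x - psum n x + - (psum (N + n) x - f x)) with (f x - psum n x) in T by ring.
lra.
Qed.

(** The coefficients are [O(1 / n^2)], so the series of shifts converges in operator norm. The last
    clause cuts it at a free index [m]: the head costs only the sup bound [a], the tail only the
    bound [b] on the second derivative. Hence the norm is small when [a] is small and [b] merely
    bounded, which [small_cutoff] exploits. *)
Lemma Op_fourier (Y : CompleteNormedModule C_AbsRing) :
  exists L : (R -> Y) -> R -> Y, Op L (fun x => RtoC (f x)) /\
    forall m g M t, (0 < m)%nat -> bdd g M ->
      nrm (L g t) <= ((4 * INR m + 1) * a + 4 * b / INR m) * M.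
Proof.
assert (Hb0 : 0 <= b) by (apply Rle_trans with (2 := Hb 0), Rabs_pos).
(* Quantifying over all bounds [M] inside [P] lets one value of the limit serve for each of them;
   for unbounded [g] the condition is vacuous. *)
pose (P := fun (g : R -> Y) t l => forall M n, bdd g M -> (0 < n)%nat ->
   nrm (l -v tp_act (ptp n) g t) <= 4 * b * / INR n * M).
assert (HP : forall g t, exists l, P g t l).
{ intros g t; destruct (classic (exists M, bdd g M)) as [[M HM] | HM].
  2:{ exists v0; intros M n H; exfalso; apply HM; now exists M. }
  destruct (complete_limit (fun n => tp_act (ptp (S n)) g t) (fun n => 4 * b * / INR (S n) * M))
    as [l Hl].
  - intros n m Hnm; rewrite nrm_sub_sym.
    apply Rle_trans with (1 := ptp_diff Y g M t (S n) (S m) HM ltac:(lia) ltac:(lia)).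
    assert (0 < / INR (S m)) by (apply Rinv_0_lt_compat, lt_0_INR; lia).
    apply Rmult_le_compat_r; [now apply bdd_ge0 in HM |].
    apply Rmult_le_compat_l; lra.
  - intros eps He; assert (HM0 := bdd_ge0 _ _ HM).
    assert (HbM : 0 <= b * M) by now apply Rmult_le_pos.
    destruct (inv_INR_small (eps / (4 * b * M + 1))) as [N [HN1 HN2]].
    { apply Rdiv_lt_0_compat; lra. }
    exists N; intros m Hm.
    assert (Hi : / INR (S m) <= / INR N).
    { apply Rinv_le_contravar; [now apply lt_0_INR | apply le_INR; lia]. }
    replace (4 * b * / INR (S m) * M) with (4 * b * M * / INR (S m)) by ring.
    apply Rle_trans with (4 * b * M * (eps / (4 * b * M + 1))).
    + apply Rmult_le_compat_l; lra.
    + apply Rle_trans with ((4 * b * M + 1) * (eps / (4 * b * M + 1))).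
      * apply Rmult_le_compat_r; [left; apply Rdiv_lt_0_compat; lra | lra].
      * right; field; lra.
  - exists l; intros M' n HM' Hn.
    destruct n as [|n]; [lia |].
    apply Rnot_lt_le; intros Hlt.
    set (d := nrm (l -v tp_act (ptp (S n)) g t) - 4 * b * / INR (S n) * M') in *.
    assert (Hd : 0 < d) by (unfold d; lra).
    assert (HM0 := bdd_ge0 _ _ HM); assert (HM'0 := bdd_ge0 _ _ HM').
    assert (HbM : 0 <= b * M) by now apply Rmult_le_pos.
    destruct (inv_INR_small (d / (4 * b * M + 1))) as [N [HN1 HN2]].
    { apply Rdiv_lt_0_compat; lra. }
    specialize (Hl (N + n)%nat); simpl in Hl.
    assert (D := ptp_diff Y g M' t (S n) (S (N + n)) HM' ltac:(lia) ltac:(lia)).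
    assert (T := nrm_sub_tri l (tp_act (ptp (S (N + n))) g t) (tp_act (ptp (S n)) g t)).
    rewrite (nrm_sub_sym l (tp_act (ptp (S (N + n))) g t)) in T.
    assert (Hi : / INR (S (N + n)) <= / INR N).
    { apply Rinv_le_contravar; [now apply lt_0_INR | apply le_INR; lia]. }
    assert (B1 : 4 * b * M * / INR (S (N + n)) < d).
    { apply Rle_lt_trans with (4 * b * M * (d / (4 * b * M + 1))).
      - apply Rmult_le_compat_l; lra.
      - apply Rlt_le_trans with ((4 * b * M + 1) * (d / (4 * b * M + 1))); [| right; field; lra].
        apply Rmult_lt_compat_r; [apply Rdiv_lt_0_compat; lra | lra]. }
    assert (Hp : 0 < / INR (S (N + n))) by (apply Rinv_0_lt_compat, lt_0_INR; lia).
    assert (0 <= 4 * b * / INR (S (N + n)) * M').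
    { repeat apply Rmult_le_pos; lra. }
    change (match (N + n)%nat with 0%nat => 1 | S _ => INR (N + n) + 1 end) with (INR (S (N + n)))
      in Hl.
    change (nrm (tp_act (ptp (S (N + n))) g t -v l) <= 4 * b * / INR (S (N + n)) * M) in Hl.
    unfold d in B1; lra. }
pose (L := fun g t => epsilon (inhabits (v0 : Y)) (P g t)).
assert (HL : forall g t, P g t (L g t)).
{ intros g t; apply epsilon_spec, HP. }
exists L; split.
- intros eps He.
  destruct (inv_INR_small (eps / (4 * b + 1))) as [N [HN1 HN2]].
  { apply Rdiv_lt_0_compat; lra. }
  assert (Hs : 4 * b * / INR N <= eps).
  { apply Rle_trans with ((4 * b + 1) * (eps / (4 * b + 1))); [| right; field; lra].
    assert (0 < / INR N) by now apply Rinv_0_lt_compat, lt_0_INR.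
    apply Rmult_le_compat; lra. }
  exists (ptp N); split.
  + intros x; rewrite ptp_eval, <- RtoC_minus, Cmod_R.
    apply Rle_trans with (2 := Hs), psum_tail; auto.
  + intros g M t Hg; apply Rle_trans with (1 := HL g t M N Hg HN1).
    apply Rmult_le_compat_r; [now apply bdd_ge0 in Hg | exact Hs].
- intros m g M t Hm Hg.
  assert (A1 := HL g t M m Hg Hm); assert (A2 := ptp_head Y g M t m Hg).
  assert (A3 := nrm_sub_ge (L g t) (tp_act (ptp m) g t)).
  unfold Rdiv; lra.
Qed.

End Fourier.

(** * Smooth cutoffs on the circle *)

Definition C2per (f : R -> R) := exists f1 f2 : R -> R,
  (forall x, is_derive f x (f1 x)) /\ (forall x, is_derive f1 x (f2 x)) /\
  (forall x, continuous f2 x) /\ forall x, f (x + 2 * PI) = f x.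

Lemma is_derive_eq (f : R -> R) (x l l' : R) : l = l' -> is_derive f x l -> is_derive f x l'.
Proof. now intros ->. Qed.

Lemma is_derive_continuous (f : R -> R) x l : is_derive f x l -> continuous f x.
Proof.
intros H; apply (ex_derive_continuous (K := R_AbsRing) (V := R_NormedModule)); now exists l.
Qed.

Lemma is_derive_Rmult (f g : R -> R) x f' g' : is_derive f x f' -> is_derive g x g' ->
  is_derive (fun y => f y * g y) x (f' * g x + f x * g').
Proof. intros Hf Hg; exact (is_derive_mult f g x f' g' Hf Hg Rmult_comm). Qed.

Lemma is_derive_Rplus (f g : R -> R) x f' g' : is_derive f x f' -> is_derive g x g' ->
  is_derive (fun y => f y + g y) x (f' + g').
Proof. exact (@is_derive_plus R_AbsRing R_NormedModule f g x f' g'). Qed.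

Lemma is_derive_Rcomp (f g : R -> R) x f' g' : is_derive f (g x) f' -> is_derive g x g' ->
  is_derive (fun y => f (g y)) x (g' * f').
Proof. exact (@is_derive_comp R_AbsRing R_NormedModule f g x f' g'). Qed.

Lemma continuous_Rplus (f g : R -> R) x : continuous f x -> continuous g x ->
  continuous (fun y => f y + g y) x.
Proof. exact (@continuous_plus R_UniformSpace R_AbsRing R_NormedModule f g x). Qed.

Lemma continuous_Rcomp (f g : R -> R) x : continuous g x -> continuous f (g x) ->
  continuous (fun y => f (g y)) x.
Proof. exact (@continuous_comp R_UniformSpace R_UniformSpace R_UniformSpace g f x). Qed.

Lemma C2per_const c : C2per (fun _ => c).
Proof.
exists (fun _ => 0), (fun _ => 0); split; [| split; [| split]]; intros x; try easy.
- apply (is_derive_const (K := R_AbsRing) (V := R_NormedModule)).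
- apply (is_derive_const (K := R_AbsRing) (V := R_NormedModule)).
- apply continuous_const.
Qed.

Lemma C2per_plus f g : C2per f -> C2per g -> C2per (fun x => f x + g x).
Proof.
intros [f1 [f2 [F1 [F2 [F3 F4]]]]] [g1 [g2 [G1 [G2 [G3 G4]]]]].
exists (fun x => f1 x + g1 x), (fun x => f2 x + g2 x); (split; [| split; [| split]]); intros x.
- now apply is_derive_Rplus.
- now apply is_derive_Rplus.
- now apply continuous_Rplus.
- now rewrite F4, G4.
Qed.

Lemma C2per_mult f g : C2per f -> C2per g -> C2per (fun x => f x * g x).
Proof.
intros [f1 [f2 [F1 [F2 [F3 F4]]]]] [g1 [g2 [G1 [G2 [G3 G4]]]]].
assert (fc := fun x => is_derive_continuous _ _ _ (F1 x)).
assert (gc := fun x => is_derive_continuous _ _ _ (G1 x)).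
assert (f1c := fun x => is_derive_continuous _ _ _ (F2 x)).
assert (g1c := fun x => is_derive_continuous _ _ _ (G2 x)).
exists (fun x => f1 x * g x + f x * g1 x),
  (fun x => (f2 x * g x + f1 x * g1 x) + (f1 x * g1 x + f x * g2 x)); (split; [| split;
    [| split]]); intros x.
- now apply is_derive_Rmult.
- apply is_derive_Rplus; now apply is_derive_Rmult.
- apply continuous_Rplus; apply continuous_Rplus; now apply continuous_Rmult.
- now rewrite F4, G4.
Qed.

Lemma C2per_comp (p p1 p2 : R -> R) f :
  C2per f ->
  (forall x, is_derive p (f x) (p1 (f x))) -> (forall x, is_derive p1 (f x) (p2 (f x))) ->
  (forall x, continuous p2 (f x)) ->
  C2per (fun x => p (f x)).
Proof.
intros [f1 [f2 [F1 [F2 [F3 F4]]]]] P1 P2 P3.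
assert (fc := fun x => is_derive_continuous _ _ _ (F1 x)).
assert (f1c := fun x => is_derive_continuous _ _ _ (F2 x)).
assert (p1c := fun x => is_derive_continuous _ _ _ (P2 x)).
exists (fun x => f1 x * p1 (f x)), (fun x => f2 x * p1 (f x) + f1 x * (f1 x * p2 (f x)));
  (split; [| split; [| split]]); intros x.
- now apply (is_derive_Rcomp p f).
- apply (is_derive_Rmult f1 (fun x => p1 (f x))); [easy | now apply (is_derive_Rcomp p1 f)].
- assert (H1 : continuous (fun x => p1 (f x)) x) by now apply (continuous_Rcomp p1 f).
  assert (H2 : continuous (fun x => p2 (f x)) x) by now apply (continuous_Rcomp p2 f).
  apply (continuous_Rplus (fun x => f2 x * p1 (f x))); [now apply (continuous_Rmult f2 (fun x =>
    p1 (f x))) |].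
  apply (continuous_Rmult f1 (fun x => f1 x * p2 (f x))); [easy |].
  now apply (continuous_Rmult f1 (fun x => p2 (f x))).
- now rewrite F4.
Qed.

Lemma C2per_inv f : C2per f -> (forall x, f x <> 0) -> C2per (fun x => / f x).
Proof.
intros Hf H0.
assert (D : forall y, y <> 0 -> is_derive (fun y => / y) y (- / (y * y))).
{ intros y Hy; auto_derive; auto; field; auto. }
assert (D2 : forall y, y <> 0 -> is_derive (fun y => - / (y * y)) y (2 * / (y * y * y))).
{ intros y Hy; auto_derive; [nra | field; auto]. }
apply (C2per_comp (fun y => / y) (fun y => - / (y * y)) (fun y => 2 * / (y * y * y)) f Hf); auto.
intros x; apply (is_derive_continuous _ _ (- 6 / (f x * f x * f x * f x))).
assert (H := H0 x); auto_derive; [| field; auto].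
intros E; apply Rmult_integral in E as [E | E]; [| easy]; nra.
Qed.

Lemma C2per_cos c : C2per (fun x => cos (x - c)).
Proof.
exists (fun x => - sin (x - c)), (fun x => - cos (x - c)); (split; [| split; [| split]]); intros x.
- auto_derive; auto; unfold Rminus; ring.
- auto_derive; auto; unfold Rminus; ring.
- apply (is_derive_continuous _ _ (sin (x - c))); auto_derive; auto; unfold Rminus; ring.
- replace (x + 2 * PI - c) with (x - c + 2 * PI) by ring; apply (f_equal fst (cis_Z2PI (x - c) 1))
  || (rewrite <- (cos_period (x - c) 1); f_equal; simpl; ring).
Qed.

Lemma C2per_sin c : C2per (fun x => sin (x - c)).
Proof.
exists (fun x => cos (x - c)), (fun x => - sin (x - c)); (split; [| split; [| split]]); intros x.
- auto_derive; auto; unfold Rminus; ring.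
- auto_derive; auto; unfold Rminus; ring.
- apply (is_derive_continuous _ _ (- cos (x - c))); auto_derive; auto; unfold Rminus; ring.
- rewrite <- (sin_period (x - c) 1); f_equal; simpl; ring.
Qed.

(** The cube of the positive part: a C^2 function that vanishes exactly on a half-line, from which
    all cutoffs are made. *)
Definition pos3 (y : R) : R := Rmax 0 y * Rmax 0 y * y.

Lemma pos2_derive y : is_derive (fun y => Rmax 0 y * Rmax 0 y) y (2 * Rmax 0 y).
Proof.
apply is_derive_Reals; intros eps He.
exists (mkposreal eps He); intros h Hh Hd; simpl in Hd.
assert (A : Rabs (Rmax 0 (y + h) * Rmax 0 (y + h) - Rmax 0 y * Rmax 0 y - 2 * Rmax 0 y * h) <= h *
  h).
{ apply Rabs_le; unfold Rmax; destruct (Rle_dec 0 (y + h)), (Rle_dec 0 y); split; nra. }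
replace ((Rmax 0 (y + h) * Rmax 0 (y + h) - Rmax 0 y * Rmax 0 y) / h - 2 * Rmax 0 y) with
  ((Rmax 0 (y + h) * Rmax 0 (y + h) - Rmax 0 y * Rmax 0 y - 2 * Rmax 0 y * h) / h) by (field; auto).
unfold Rdiv; rewrite Rabs_mult, Rabs_inv.
assert (Hp : 0 < Rabs h) by now apply Rabs_pos_lt.
apply Rle_lt_trans with (2 := Hd).
replace (h * h) with (Rabs h * Rabs h) in A by (rewrite <- Rabs_mult; apply Rabs_pos_eq; nra).
apply Rmult_le_reg_r with (Rabs h); [exact Hp |].
rewrite Rmult_assoc, Rinv_l, Rmult_1_r by lra; exact A.
Qed.

Definition pos3' (y : R) : R := 3 * (Rmax 0 y * Rmax 0 y).
Definition pos3'' (y : R) : R := 6 * Rmax 0 y.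

Lemma pos3_derive y : is_derive pos3 y (pos3' y).
Proof.
apply is_derive_eq with (2 * Rmax 0 y * y + Rmax 0 y * Rmax 0 y * 1).
- unfold pos3', Rmax; destruct (Rle_dec 0 y); ring.
- apply (is_derive_Rmult (fun y => Rmax 0 y * Rmax 0 y) (fun y => y)); [apply pos2_derive |].
  apply (is_derive_id (K := R_AbsRing)).
Qed.

Lemma pos3'_derive y : is_derive pos3' y (pos3'' y).
Proof.
apply is_derive_eq with (0 * (Rmax 0 y * Rmax 0 y) + 3 * (2 * Rmax 0 y)); [unfold pos3''; ring |].
apply (is_derive_Rmult (fun _ => 3) (fun y => Rmax 0 y * Rmax 0 y)); [| apply pos2_derive].
apply (is_derive_const (K := R_AbsRing) (V := R_NormedModule)).
Qed.

Lemma pos3''_continuous y : continuous pos3'' y.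
Proof.
apply (continuous_Rmult (fun _ => 6) (Rmax 0)); [apply continuous_const |].
apply (filterlim_ext (fun y => (y + Rabs y) / 2)).
{ intros z; unfold Rmax, Rabs; destruct (Rle_dec 0 z), (Rcase_abs z); lra. }
replace (Rmax 0 y) with ((y + Rabs y) / 2)
  by (unfold Rmax, Rabs; destruct (Rle_dec 0 y), (Rcase_abs y); lra).
apply (continuous_Rmult (fun y => y + Rabs y) (fun _ => / 2)); [| apply continuous_const].
apply (continuous_Rplus (fun y => y) Rabs); [apply continuous_id | apply continuous_Rabs].
Qed.

Lemma pos3_ge0 y : 0 <= pos3 y.
Proof. unfold pos3, Rmax; destruct (Rle_dec 0 y); nra. Qed.

Lemma pos3_eq0 y : y <= 0 -> pos3 y = 0.
Proof. unfold pos3, Rmax; destruct (Rle_dec 0 y); intros; [replace y with 0 by lra |]; ring. Qed.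

Lemma pos3_gt0 y : 0 < y -> 0 < pos3 y.
Proof.
intros Hy; unfold pos3, Rmax; destruct (Rle_dec 0 y); [| lra].
apply Rmult_lt_0_compat; nra.
Qed.

Lemma C2per_pos3 f : C2per f -> C2per (fun x => pos3 (f x)).
Proof.
intros Hf; apply (C2per_comp pos3 pos3' pos3'' f Hf); intros x;
  [apply pos3_derive | apply pos3'_derive | apply pos3''_continuous].
Qed.

Lemma per_bounded (f : R -> R) : (forall x, continuous f x) -> (forall x, f (x + 2 * PI) = f x) ->
  exists a, forall x, Rabs (f x) <= a.
Proof.
intros Hc Hp.
assert (HPI := PI_RGT_0).
assert (Hc' : forall c, - PI <= c <= PI -> continuity_pt (fun x => Rabs (f x)) c).
{ intros c _; apply continuity_pt_filterlim, (continuous_Rcomp Rabs f);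
  [apply Hc | apply continuous_Rabs]. }
destruct (continuity_ab_maj (fun x => Rabs (f x)) (- PI) PI ltac:(lra) Hc') as [m [Hm _]].
exists (Rabs (f m)); intros x.
destruct (reduce_2PI x) as [k Hk].
rewrite <- (f_perZ f Hp x k).
apply (Hm (x + 2 * IZR k * PI)); apply Rabs_def2b in Hk || apply Rabs_le_between in Hk; lra.
Qed.

Lemma C2per_Op (Y : CompleteNormedModule C_AbsRing) f : C2per f ->
  exists L : (R -> Y) -> R -> Y, Op L (fun x => RtoC (f x)).
Proof.
intros [f1 [f2 [F1 [F2 [F3 F4]]]]].
assert (P1 := f1_per f f1 F1 F4).
assert (P2 := f1_per f1 f2 F2 P1).
destruct (per_bounded f) as [a Ha]; [intros x; eapply is_derive_continuous; apply F1 | exact F4 |].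
destruct (per_bounded f2) as [b Hb]; [exact F3 | exact P2 |].
destruct (Op_fourier f f1 f2 a b F1 F2 F3 F4 Ha Hb Y) as [L [HL _]]; now exists L.
Qed.

(** The left side is at most [|e^{iy} - e^{iz}|], whose square is [2 (1 - cos (y - z))]; this is
    below [eta^2] for the chosen [c], whatever [x] is. *)
Lemma cos_near eta : 0 < eta -> exists c, c < 1 /\ forall x y z,
  c < cos (y - z) -> Rabs (cos (y - x) - cos (z - x)) < eta.
Proof.
intros He; exists (1 - eta * eta / 2); split; [nra |].
intros x y z H.
set (d := y - z) in *; replace (y - x) with (d + (z - x)) by (unfold d; ring).
set (e := z - x); rewrite cos_plus.
assert (D := sin2_cos2 d); assert (E := sin2_cos2 e); unfold Rsqr in D, E.
set (v := cos d * cos e - sin d * sin e - cos e).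
assert (Hv : v * v <= (cos d - 1) * (cos d - 1) + sin d * sin d).
{ replace ((cos d - 1) * (cos d - 1) + sin d * sin d) with
   (((cos d - 1) * (cos d - 1) + sin d * sin d) * (sin e * sin e + cos e * cos e)) by (rewrite E;
     ring).
  assert (Hs := Rle_0_sqr ((cos d - 1) * sin e + sin d * cos e)); unfold Rsqr in Hs.
  unfold v; nra. }
assert (Hv2 : v * v < eta * eta) by nra.
apply Rabs_def1; nra.
Qed.

Lemma cos_near1 x y : 1 - Rabs (y - x) <= cos (y - x).
Proof.
assert (H := one_minus_cos_le (y - x)); assert (H2 := Rle_abs (1 - cos (y - x))); lra.
Qed.

(** Compactness of one period. [compactness_list] yields its finite list under a double negation,
    hence the classical detour. *)
Lemma circle_cover (c : R -> R) : (forall x, c x < 1) ->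
  exists l : list R, forall y, exists x, In x l /\ c x < cos (y - x).
Proof.
intros Hc.
assert (Hd : forall x, 0 < 1 - c x) by (intros x; specialize (Hc x); lra).
apply NNPP; intros HN.
apply (compactness_list 1 (- PI, tt) (PI, tt) (fun x => mkposreal _ (Hd (fst x)))).
intros [l Hl]; apply HN.
exists (map fst l); intros y.
destruct (reduce_2PI y) as [k Hk].
destruct (Hl (y + 2 * IZR k * PI, tt)) as [[x []] [H1 [_ H2]]].
{ simpl; split; [| easy]; apply Rabs_le_between in Hk; lra. }
exists x; split; [now apply (in_map fst) in H1 |].
simpl in H2; destruct H2 as [H2 _].
assert (A := cos_near1 x (y + 2 * IZR k * PI)).
replace (y + 2 * IZR k * PI - x) with (y - x + 2 * IZR k * PI) in A, H2 by ring.
assert (E := cis_Z2PI (y - x) k); injection E as E1 _; rewrite E1 in A.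
rewrite Rabs_minus_sym in H2 || idtac.
lra.
Qed.

Definition bump (x c y : R) : R := pos3 (cos (y - x) - c).

Lemma C2per_bump x c : C2per (bump x c).
Proof.
unfold bump; apply C2per_pos3, (C2per_plus _ (fun _ => - c)); [apply C2per_cos | apply C2per_const].
Qed.

Fixpoint bumps (c : R -> R) (l : list R) (y : R) : R :=
  match l with
  | nil => 0
  | x :: l => bump x (c x) y + bumps c l y
  end.

Lemma C2per_bumps c l : C2per (bumps c l).
Proof.
induction l as [|x l IH]; [apply C2per_const |].
apply (C2per_plus (bump x (c x))); [apply C2per_bump | exact IH].
Qed.

Lemma bumps_ge0 c l y : 0 <= bumps c l y.
Proof.
induction l as [|x l IH]; simpl; [lra |].
assert (H := pos3_ge0 (cos (y - x) - c x)); unfold bump; lra.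
Qed.

Lemma bumps_gt0 c l y x : In x l -> c x < cos (y - x) -> 0 < bumps c l y.
Proof.
induction l as [|z l IH]; simpl; [easy |]; intros [-> | Hi] Hc.
- assert (H := bumps_ge0 c l y); assert (A := pos3_gt0 (cos (y - x) - c x) ltac:(lra)).
  unfold bump; lra.
- specialize (IH Hi Hc); assert (A := pos3_ge0 (cos (y - z) - c z)); unfold bump; lra.
Qed.

(* Arcs around [x] modulo [2 PI] are described by [c < cos (y - x)], [c < 1]. *)
Definition vanish_near {T : Type} (z : T) (phi : R -> T) (x : R) :=
  exists c, c < 1 /\ forall y, c < cos (y - x) -> phi y = z.

Lemma bumps_vanish_near c c' l z :
  (forall x, c x < c' x) -> (forall x, In x l -> cos (z - x) <= c x) ->
  vanish_near 0 (bumps c' l) z.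
Proof.
intros Hc; induction l as [|x l IH]; simpl; intros H.
- exists 0; split; [lra | easy].
- destruct IH as [d1 [D1 D2]]; [intros y Hy; apply H; now right |].
  destruct (cos_near (c' x - c x)) as [d2 [E1 E2]]; [specialize (Hc x); lra |].
  exists (Rmax d1 d2); split; [now apply Rmax_lub_lt |].
  intros y Hy; rewrite D2 by (apply Rle_lt_trans with (2 := Hy), Rmax_l).
  assert (A := E2 x y z (Rle_lt_trans _ _ _ (Rmax_r _ _) Hy)).
  apply Rabs_def2 in A; specialize (H x (or_introl eq_refl)).
  unfold bump; rewrite pos3_eq0; lra.
Qed.

(** The hypothesis says that each point has an arc missing [P1] or an arc missing [P2]. A finite
    cover by such arcs splits into lists [l1] and [l2], and with [b1], [b2] the sums of bumps over
    them, [phi = b1 / (b1 + b2)]. *)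
Lemma urysohn (P1 P2 : R -> Prop) :
  (forall x, (exists c, c < 1 /\ forall y, c < cos (y - x) -> ~ P1 y) \/
             (exists c, c < 1 /\ forall y, c < cos (y - x) -> ~ P2 y)) ->
  exists phi, C2per phi /\
    (forall x, P1 x -> vanish_near 0 phi x) /\ (forall x, P2 x -> vanish_near 1 phi x).
Proof.
intros H.
assert (Hc : exists c : R -> R, forall x, c x < 1 /\
  ((forall y, c x < cos (y - x) -> ~ P1 y) \/ (forall y, c x < cos (y - x) -> ~ P2 y))).
{ apply (choice (fun x c => c < 1 /\
  ((forall y, c < cos (y - x) -> ~ P1 y) \/ (forall y, c < cos (y - x) -> ~ P2 y)))).
  intros x; destruct (H x) as [[c [C1 C2]] | [c [C1 C2]]]; exists c; auto. }
destruct Hc as [c Hc].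
(* The bumps live strictly inside the arcs given by [c]; the margin makes them vanish near the
   points of [P1] or [P2], not only at them. *)
pose (c' := fun x => (1 + c x) / 2).
destruct (circle_cover c') as [l Hl].
{ intros x; destruct (Hc x) as [A _]; unfold c'; lra. }
assert (Hcc : forall x, c x < c' x).
{ intros x; destruct (Hc x) as [A _]; unfold c'; lra. }
assert (Hs : exists l1 l2, (forall x, In x l -> In x l1 \/ In x l2) /\
  (forall x, In x l1 -> forall y, c x < cos (y - x) -> ~ P1 y) /\
  (forall x, In x l2 -> forall y, c x < cos (y - x) -> ~ P2 y)).
{ clear Hl; induction l as [|x l [l1 [l2 [A1 [A2 A3]]]]].
  - exists nil, nil; simpl; tauto.
  - destruct (Hc x) as [_ [B | B]].
    + exists (x :: l1), l2; simpl; split; [| split]; [| | exact A3].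
      * intros y [-> | Hy]; [auto | destruct (A1 y Hy); auto].
      * intros y [Ey | Hy]; [subst y; exact B | exact (A2 y Hy)].
    + exists l1, (x :: l2); simpl; split; [| split]; [| exact A2 |].
      * intros y [-> | Hy]; [auto | destruct (A1 y Hy); auto].
      * intros y [Ey | Hy]; [subst y; exact B | exact (A3 y Hy)]. }
destruct Hs as [l1 [l2 [A1 [A2 A3]]]].
assert (Hpos : forall y, 0 < bumps c' l1 y + bumps c' l2 y).
{ intros y; destruct (Hl y) as [x [X1 X2]].
  assert (B1 := bumps_ge0 c' l1 y); assert (B2 := bumps_ge0 c' l2 y).
  destruct (A1 x X1) as [E | E]; assert (B := bumps_gt0 c' _ y x E X2); lra. }
exists (fun y => bumps c' l1 y * / (bumps c' l1 y + bumps c' l2 y)); split; [| split].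
- apply (C2per_mult (bumps c' l1)); [apply C2per_bumps |].
  apply (C2per_inv (fun y => bumps c' l1 y + bumps c' l2 y)).
  + apply (C2per_plus (bumps c' l1)); apply C2per_bumps.
  + intros x; specialize (Hpos x); lra.
- intros x Hx.
  destruct (bumps_vanish_near c c' l1 x Hcc) as [d [D1 D2]].
  { intros y Hy; apply Rnot_lt_le; intros Hlt; now apply (A2 y Hy x). }
  exists d; split; [exact D1 |]; intros y Hy; rewrite (D2 y Hy); ring.
- intros x Hx.
  destruct (bumps_vanish_near c c' l2 x Hcc) as [d [D1 D2]].
  { intros y Hy; apply Rnot_lt_le; intros Hlt; now apply (A3 y Hy x). }
  exists d; split; [exact D1 |]; intros y Hy; specialize (Hpos y).
  rewrite (D2 y Hy), Rplus_0_r in *; field; lra.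
Qed.

(** * Local-to-global principle by partitions of unity *)

Section LocalGlobal.
Context {X : CompleteNormedModule C_AbsRing}.

(** The non-regular points form a spectrum of [w] relative to the class [Z]. With [Z] the zero
    function it is the spectrum of [w] itself; with [Z] the almost periodic functions it is the set
    on which Loomis' argument works. *)
Definition regular (Z : (R -> X) -> Prop) (w : R -> X) (x : R) :=
  exists c, c < 1 /\ forall L psi, Op L psi ->
    (forall y, cos (y - x) <= c -> psi y = RtoC 0) -> Z (L w).

(** A partition of unity made of bumps decomposes [phi] into pieces, each with support in an arc
    where [w] is regular or [phi] vanishes. The hypothesis on zero symbols says that operators with
    equal symbols agree at [w], so that the pieces reassemble to [L w]. *)
Lemma local_global (Z : (R -> X) -> Prop) (w : R -> X) L phi :
  Z (fun _ => v0) -> (forall g h, Z g -> Z h -> Z (fun t => g t +v h t)) ->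
  (forall L, Op L (fun _ => RtoC 0) -> forall t, L w t = v0) ->
  Op L phi -> (forall x, regular Z w x \/ vanish_near (RtoC 0) phi x) -> Z (L w).
Proof.
intros Z0 ZP Hnull HL H.
assert (Hc : exists c : R -> R, forall x, c x < 1 /\
  ((forall L psi, Op L psi -> (forall y, cos (y - x) <= c x -> psi y = RtoC 0) -> Z (L w)) \/
   (forall y, c x < cos (y - x) -> phi y = RtoC 0))).
{ apply (choice (fun x c => c < 1 /\
  ((forall L psi, Op L psi -> (forall y, cos (y - x) <= c -> psi y = RtoC 0) -> Z (L w)) \/
   (forall y, c < cos (y - x) -> phi y = RtoC 0)))).
  intros x; destruct (H x) as [[c [C1 C2]] | [c [C1 C2]]]; exists c; auto. }
destruct Hc as [c Hc].
destruct (circle_cover c (fun x => proj1 (Hc x))) as [l Hl].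
assert (Hpos : forall y, 0 < bumps c l y).
{ intros y; destruct (Hl y) as [x [X1 X2]]; now apply bumps_gt0 with x. }
assert (Hsum : forall l', exists L', Op L' (fun y => Cmult (RtoC (bumps c l' y * / bumps c l y))
  (phi y)) /\
   Z (L' w)).
{ induction l' as [|x l' [L' [B1 B2]]].
  - exists (tp_act nil); split; [| exact Z0].
    apply (Op_ext _ (tp_eval nil)); [| apply Op_tp].
    intros y; simpl; rewrite Rmult_0_l; ring.
  - destruct (C2per_Op X (fun y => bump x (c x) y * / bumps c l y)) as [L1 HL1].
    { apply C2per_mult; [apply C2per_bump | apply C2per_inv; [apply C2per_bumps |]].
      intros y; specialize (Hpos y); lra. }
    assert (HLL := Op_comp _ _ _ _ HL1 HL).
    assert (ZL : Z (L1 (L w))).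
    { destruct (Hc x) as [_ [HZ | Hv]].
      - apply (HZ _ _ HLL); intros y Hy; unfold bump.
        rewrite pos3_eq0, Rmult_0_l by lra; ring.
      - replace (L1 (L w)) with (fun _ : R => v0 : X); [exact Z0 |].
        apply functional_extensionality; intros t; symmetry.
        apply (Hnull (fun g => L1 (L g))).
        apply (Op_ext _ _ _ ) with (2 := HLL); intros y.
        destruct (Rlt_le_dec (c x) (cos (y - x))) as [Hlt | Hle].
        + rewrite Hv by exact Hlt; ring.
        + unfold bump; rewrite pos3_eq0, Rmult_0_l by lra; ring. }
    exists (fun g t => RtoC 1 *v L1 (L g) t +v L' g t); split.
    + apply (Op_ext _ _ _) with (2 := Op_comb (RtoC 1) _ _ _ _ HLL B1).
      intros y; simpl; rewrite Rmult_plus_distr_r, RtoC_plus; ring.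
    + replace (fun t => RtoC 1 *v L1 (L w) t +v L' w t) with (fun t => L1 (L w) t +v L' w t);
      [now apply ZP |].
      apply functional_extensionality; intros t; vring. }
destruct (Hsum l) as [L' [B1 B2]].
replace (L w) with (L' w); [exact B2 |].
apply functional_extensionality; intros t.
assert (HD := Op_comb (RtoC (-1)) _ _ _ _ HL B1).
assert (E : RtoC (-1) *v L w t +v L' w t = v0).
{ apply (Hnull (fun g t => RtoC (-1) *v L g t +v L' g t)).
  apply (Op_ext _ _ _) with (2 := HD); intros y.
  rewrite Rinv_r by (specialize (Hpos y); lra); change (RtoC (-1)) with (RtoC (- (1)));
    rewrite RtoC_opp; ring. }
transitivity (L w t +v (RtoC (-1) *v L w t +v L' w t)).
- change (RtoC (-1)) with (RtoC (- (1))); rewrite RtoC_opp; vring.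
- rewrite E; vring.
Qed.

End LocalGlobal.

(** * The theorem of Bessaga and Pelczynski *)

Section BessagaPelczynski.
Context {X : CompleteNormedModule C_AbsRing}.

Fixpoint lsum (v : nat -> X) (l : list nat) : X :=
  match l with
  | nil => v0
  | k :: l => v k +v lsum v l
  end.

Fixpoint wsum (v : nat -> X) (a : nat -> C) (l : list nat) : X :=
  match l with
  | nil => v0
  | k :: l => a k *v v k +v wsum v a l
  end.

Fixpoint psumv (v : nat -> X) (a : nat -> C) (n : nat) : X :=
  match n with
  | O => v0
  | S n => psumv v a n +v a n *v v n
  end.

(** An elementary form of weak unconditional Cauchyness of the series [sum v k]. *)
Definition subset_bounded (v : nat -> X) (K : R) :=
  forall l, NoDup l -> nrm (lsum v l) <= K.

(** The norm is convex in each coefficient, so a coefficient in [[0, 1]] may be replaced by 0 or 1;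
    [l1] collects the indices that were rounded up. *)
Lemma wsum_convex v K (t : nat -> R) : subset_bounded v K -> (forall k, 0 <= t k <= 1) ->
  forall l2 l1, NoDup (l1 ++ l2) ->
    nrm (lsum v l1 +v wsum v (fun k => RtoC (t k)) l2) <= K.
Proof.
intros H Ht; induction l2 as [|k l2 IH]; intros l1 Hl; cbn [wsum].
- rewrite app_nil_r in Hl; replace (lsum v l1 +v v0) with (lsum v l1) by vring; auto.
- destruct (Ht k) as [T0 T1].
  assert (H1 : nrm (lsum v (k :: l1) +v wsum v (fun k => RtoC (t k)) l2) <= K).
  { apply IH; apply (Permutation_NoDup (l := l1 ++ k :: l2)); [| exact Hl].
    symmetry; apply Permutation_middle. }
  assert (H2 : nrm (lsum v l1 +v wsum v (fun k => RtoC (t k)) l2) <= K).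
  { apply IH, (NoDup_remove_1 _ _ _ Hl). }
  cbn [lsum] in H1; set (w := wsum _ _ l2) in *.
  replace (lsum v l1 +v (RtoC (t k) *v v k +v w)) with
    (RtoC (t k) *v (v k +v lsum v l1 +v w) +v RtoC (1 - t k) *v (lsum v l1 +v w)) by vring.
  apply Rle_trans with (1 := nrm_add _ _); rewrite !nrm_sc, !Cmod_R, !Rabs_pos_eq by lra.
  assert (K0 : 0 <= K) by (apply Rle_trans with (2 := H2), nrm_ge0).
  nra.
Qed.

Lemma wsum_real v K (t : nat -> R) l : subset_bounded v K -> (forall k, Rabs (t k) <= 1) ->
  NoDup l -> nrm (wsum v (fun k => RtoC (t k)) l) <= 2 * K.
Proof.
intros H Ht Hl.
assert (P1 := wsum_convex v K (fun k => Rmax 0 (t k)) H).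
assert (P2 := wsum_convex v K (fun k => Rmax 0 (- t k)) H).
assert (E : wsum v (fun k => RtoC (t k)) l =
  (lsum v [] +v wsum v (fun k => RtoC (Rmax 0 (t k))) l) -v
  (lsum v [] +v wsum v (fun k => RtoC (Rmax 0 (- t k))) l)).
{ clear; induction l as [|k l IH]; cbn [wsum lsum] in *; [vring |].
  rewrite IH; replace (t k) with (Rmax 0 (t k) - Rmax 0 (- t k)) at 1;
    [vring | unfold Rmax; destruct (Rle_dec 0 (t k)), (Rle_dec 0 (- t k)); lra]. }
rewrite E; apply Rle_trans with (1 := nrm_sub _ _).
assert (B : forall k, 0 <= Rmax 0 (t k) <= 1 /\ 0 <= Rmax 0 (- t k) <= 1).
{ intros k; specialize (Ht k); apply Rabs_le_between in Ht.
  unfold Rmax; destruct (Rle_dec 0 (t k)), (Rle_dec 0 (- t k)); lra. }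
specialize (P1 (fun k => proj1 (B k)) l [] Hl); specialize (P2 (fun k => proj2 (B k)) l [] Hl).
lra.
Qed.

Lemma Cmod_Re_le (z : C) : Rabs (fst z) <= Cmod z.
Proof. apply Rle_trans with (2 := Rmax_Cmod z), Rmax_l. Qed.
Lemma Cmod_Im_le (z : C) : Rabs (snd z) <= Cmod z.
Proof. apply Rle_trans with (2 := Rmax_Cmod z), Rmax_r. Qed.

Lemma wsum_complex v K (a : nat -> C) r l : subset_bounded v K -> 0 < r ->
  (forall k, In k l -> Cmod (a k) <= r) -> NoDup l -> nrm (wsum v a l) <= 4 * K * r.
Proof.
intros H Hr Ha Hl.
pose (b := fun k => if excluded_middle_informative (In k l) then a k else RtoC 0).
assert (Hb : forall k, Cmod (b k) <= r).
{ intros k; unfold b; destruct excluded_middle_informative; [auto | rewrite Cmod_0; lra]. }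
assert (E0 : wsum v a l = wsum v b l).
{ assert (E : forall l', incl l' l -> wsum v a l' = wsum v b l').
  { induction l' as [|k l' IH]; intros Hi; cbn [wsum]; [easy |].
    rewrite IH by (intros x Hx; apply Hi; now right); f_equal; unfold b.
    destruct excluded_middle_informative as [_ | n]; [easy |]; exfalso; apply n, Hi; now left. }
  apply E, incl_refl. }
clearbody b; pose (t1 := fun k => fst (b k) / r); pose (t2 := fun k => snd (b k) / r).
assert (E : wsum v b l = RtoC r *v wsum v (fun k => RtoC (t1 k)) l +v
  (Cmult Ci (RtoC r)) *v wsum v (fun k => RtoC (t2 k)) l).
{ clear - Hr; induction l as [|k l IH]; cbn [wsum]; [vring |].
  rewrite IH.
  replace (b k) with (Cplus (Cmult (RtoC r) (RtoC (t1 k))) (Cmult (Cmult Ci (RtoC r))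
    (RtoC (t2 k)))); [vring |].
  unfold t1, t2, RtoC, Ci, Cmult, Cplus; destruct (b k); simpl; f_equal; field; lra. }
assert (B : forall k, Rabs (t1 k) <= 1 /\ Rabs (t2 k) <= 1).
{ intros k; unfold t1, t2; specialize (Hb k).
  assert (A1 := Cmod_Re_le (b k)); assert (A2 := Cmod_Im_le (b k)).
  unfold Rdiv; rewrite !Rabs_mult, (Rabs_pos_eq (/ r)) by (left; now apply Rinv_0_lt_compat).
  split; apply Rmult_le_reg_r with r; auto; rewrite Rmult_assoc, Rinv_l; lra. }
assert (W1 := wsum_real v K t1 l H (fun k => proj1 (B k)) Hl).
assert (W2 := wsum_real v K t2 l H (fun k => proj2 (B k)) Hl).
rewrite E0, E; apply Rle_trans with (1 := nrm_add _ _).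
rewrite !nrm_sc, Cmod_mult, Cmod_Ci, Cmod_R, Rabs_pos_eq by lra; nra.
Qed.

Lemma psumv_wsum v a n m : psumv v a (n + m) = psumv v a n +v wsum v a (seq n m).
Proof.
revert n; induction m as [|m IH]; intros n; cbn [seq wsum].
- rewrite Nat.add_0_r; vring.
- replace (n + S m)%nat with (S n + m)%nat by lia; rewrite IH; cbn [psumv]; vring.
Qed.

Lemma infinitely_many (P : nat -> Prop) : (forall N, exists n, (N <= n)%nat /\ P n) ->
  forall m, exists l, NoDup l /\ length l = m /\ List.Forall P l.
Proof.
intros H m.
assert (A : exists l b, NoDup l /\ length l = m /\ List.Forall P l /\ List.Forall (fun k => (k <
  b)%nat) l).
{ induction m as [|m [l [b [H1 [H2 [H3 H4]]]]]].
  - exists nil, 0%nat; repeat split; constructor.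
  - destruct (H b) as [n [Hn Pn]].
    exists (n :: l), (S n); repeat split; simpl.
    + constructor; [| exact H1]; intros Hi; rewrite List.Forall_forall in H4;
      specialize (H4 n Hi); lia.
    + now rewrite H2.
    + now constructor.
    + constructor; [lia |]; eapply List.Forall_impl; [| exact H4]; simpl; intros; lia. }
destruct A as [l [b A]]; exists l; tauto.
Qed.

(* If [|y + c v_n| <= |y| - eta] for [m] indices [n], averaging gives
   [|y| - eta >= |y + (c / m) sum v_n| >= |y| - O(1 / m)]: no functional is needed. *)
Lemma almost_orthogonal_pt v K y (c : C) eta : subset_bounded v K -> 0 < eta ->
  exists N, forall n, (N <= n)%nat -> nrm y - eta <= nrm (y +v c *v v n).
Proof.
intros H He; apply NNPP; intros HN.
assert (Hi : forall N, exists n, (N <= n)%nat /\ nrm (y +v c *v v n) <= nrm y - eta).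
{ intros N; apply NNPP; intros Hn; apply HN; exists N; intros n Hnn.
  apply Rnot_lt_le; intros Hlt; apply Hn; exists n; split; [exact Hnn | lra]. }
assert (K0 : 0 <= K) by (apply Rle_trans with (2 := H nil (NoDup_nil _)), nrm_ge0).
assert (Hc := Cmod_ge_0 c).
destruct (nfloor_ex (Cmod c * K / eta)) as [m Hm].
{ apply Rmult_le_pos; [now apply Rmult_le_pos | left; now apply Rinv_0_lt_compat]. }
destruct (infinitely_many _ Hi (S m)) as [l [L1 [L2 L3]]].
assert (E : RtoC (INR (length l)) *v y +v c *v lsum v l =
  fold_right (fun n z => (y +v c *v v n) +v z) v0 l).
{ clear; induction l as [|k l IH].
  - simpl; vring.
  - cbn [length lsum fold_right]; rewrite <- IH, S_INR; vring. }
assert (B1 : nrm (fold_right (fun n z => (y +v c *v v n) +v z) v0 l) <= INR (length l) * (nrm y -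
  eta)).
{ clear - L3; induction L3 as [|k l Hk _ IH].
  - simpl; rewrite nrm_0; lra.
  - cbn [length fold_right]; rewrite S_INR; apply Rle_trans with (1 := nrm_add _ _); lra. }
rewrite <- E in B1.
assert (B2 := nrm_sub_ge (RtoC (INR (length l)) *v y) (RtoC (INR (length l)) *v y +v c *v lsum v
  l)).
replace (RtoC (INR (length l)) *v y -v (RtoC (INR (length l)) *v y +v c *v lsum v l))
  with ((- c)%C *v lsum v l) in B2 by vring.
rewrite !nrm_sc, Cmod_opp, Cmod_R, Rabs_pos_eq in B2 by apply pos_INR.
specialize (H l L1).
assert (Cmod c * nrm (lsum v l) <= Cmod c * K) by now apply Rmult_le_compat_l.
assert (B3 : INR (length l) * eta <= Cmod c * K) by lra.
rewrite L2, S_INR in B3.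
assert (Cmod c * K / eta * eta < (INR m + 1) * eta) by (apply Rmult_lt_compat_r; lra).
replace (Cmod c * K / eta * eta) with (Cmod c * K) in H1 by (field; lra); lra.
Qed.

Definition totbdd (E : X -> Prop) := forall eta, 0 < eta ->
  exists l, forall y, E y -> exists z, In z l /\ nrm (y -v z) <= eta.

Lemma disk_net eta : 0 < eta -> exists l : list C,
  forall c, Cmod c <= 1 -> exists d, In d l /\ Cmod (Cminus c d) <= eta.
Proof.
intros He.
assert (He2 : 0 < eta / 2) by lra.
apply NNPP; intros HN.
apply (compactness_list 2 (-1, (-1, tt)) (1, (1, tt)) (fun _ => mkposreal _ He2)).
intros [l Hl]; apply HN.
exists (map (fun t => (fst t, fst (snd t)) : C) l); intros c Hc.
assert (A1 := Cmod_Re_le c); assert (A2 := Cmod_Im_le c).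
destruct (Hl (fst c, (snd c, tt))) as [[x [y []]] [H1 [_ H2]]].
{ assert (A1' : Rabs (fst c) <= 1) by lra; assert (A2' : Rabs (snd c) <= 1) by lra.
  apply Rabs_le_between in A1', A2'; simpl; repeat split; lra. }
exists (x, y); split; [now apply (in_map (fun t => (fst t, fst (snd t)) : C)) in H1 |].
simpl in H2; destruct H2 as [B1 [B2 _]].
replace (Cminus c (x, y)) with (Cplus (RtoC (fst c - x)) (Cmult Ci (RtoC (snd c - y)))).
- apply Rle_trans with (1 := Cmod_triangle _ _); rewrite Cmod_mult, Cmod_Ci, !Cmod_R; lra.
- destruct c; unfold Cminus, Cplus, Copp, Cmult, Ci, RtoC; simpl; f_equal; ring.
Qed.

Lemma totbdd_extend E x : totbdd E ->
  totbdd (fun z => exists y c, E y /\ Cmod c <= 1 /\ z = y +v c *v x).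
Proof.
intros HE eta He.
assert (Hx := nrm_ge0 x).
destruct (HE (eta / 2)) as [l Hl]; [lra |].
destruct (disk_net (eta / (2 * (nrm x + 1)))) as [d Hd].
{ apply Rdiv_lt_0_compat; lra. }
exists (flat_map (fun y => map (fun c => y +v c *v x) d) l).
intros z [y [c [Ey [Hc ->]]]].
destruct (Hl y Ey) as [y' [Y1 Y2]]; destruct (Hd c Hc) as [c' [C1 C2]].
exists (y' +v c' *v x); split.
- apply in_flat_map; exists y'; split; [exact Y1 |].
  apply (in_map (fun c => y' +v c *v x)); exact C1.
- replace (y +v c *v x -v (y' +v c' *v x)) with ((y -v y') +v (c - c')%C *v x) by vring.
  apply Rle_trans with (1 := nrm_add _ _); rewrite nrm_sc.
  assert (Cmod (Cminus c c') * nrm x <= eta / (2 * (nrm x + 1)) * (nrm x + 1)).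
  { apply Rmult_le_compat; try lra; apply Cmod_ge_0. }
  replace (eta / (2 * (nrm x + 1)) * (nrm x + 1)) with (eta / 2) in H by (field; lra); lra.
Qed.

(** The pointwise statement holds for finitely many pairs at once; finite nets of [E] and of the
    unit disk, with the uniform bound on [v n], extend it to all pairs. *)
Lemma almost_orthogonal v K E eta : subset_bounded v K -> totbdd E -> 0 < eta ->
  exists N, forall n, (N <= n)%nat -> forall y c, E y -> Cmod c <= 1 ->
    nrm y - eta <= nrm (y +v c *v v n).
Proof.
intros H HE He.
assert (K0 : 0 <= K) by (apply Rle_trans with (2 := H nil (NoDup_nil _)), nrm_ge0).
assert (Hv : forall n, nrm (v n) <= K).
{ intros n; assert (A : NoDup [n]) by (constructor; [easy | constructor]).
  specialize (H _ A); cbn [lsum] in H; replace (v n +v v0) with (v n) in H by vring; exact H. }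
destruct (HE (eta / 6)) as [l Hl]; [lra |].
destruct (disk_net (eta / (6 * (K + 1)))) as [d Hd].
{ apply Rdiv_lt_0_compat; lra. }
assert (HN : forall ps : list (X * C), exists N, forall n, (N <= n)%nat -> forall y c, In (y,
  c) ps ->
   nrm y - eta / 6 <= nrm (y +v c *v v n)).
{ induction ps as [|[y c] ps [N HN]].
  - exists 0%nat; easy.
  - destruct (almost_orthogonal_pt v K y c (eta / 6) H ltac:(lra)) as [N' HN'].
    exists (N + N')%nat; intros n Hn y' c' [Ei | Hi].
    + injection Ei as <- <-; apply HN'; lia.
    + apply HN; [lia | exact Hi]. }
destruct (HN (list_prod l d)) as [N HN'].
exists N; intros n Hn y c Ey Hc.
destruct (Hl y Ey) as [y' [Y1 Y2]]; destruct (Hd c Hc) as [c' [C1 C2]].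
specialize (HN' n Hn y' c' (in_prod _ _ _ _ Y1 C1)).
assert (A1 := nrm_sub_ge y y').
assert (A2 := nrm_sub_ge (y' +v c' *v v n) (y +v c *v v n)).
replace (y' +v c' *v v n -v (y +v c *v v n)) with ((y' -v y) +v (c' - c)%C *v v n) in A2 by vring.
assert (A3 := nrm_add (y' -v y) ((c' - c)%C *v v n)).
rewrite nrm_sc, nrm_sub_sym in A3.
replace (Cmod (c' - c)%C) with (Cmod (c - c')%C) in A3 by (rewrite <- Cmod_opp; f_equal; ring).
assert (Cmod (Cminus c c') * nrm (v n) <= eta / (6 * (K + 1)) * (K + 1)).
{ apply Rmult_le_compat; try apply Cmod_ge_0; try apply nrm_ge0; auto.
  specialize (Hv n); lra. }
replace (eta / (6 * (K + 1)) * (K + 1)) with (eta / 6) in H0 by (field; lra); lra.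
Qed.

(** In the spirit of Mazur's construction of basic sequences: the partial sums with coefficients in
    the disk form a totally bounded set, so the next index can be taken so far out that appending
    its term hardly lowers any of their norms. *)
Lemma basic_subsequence v K eps : subset_bounded v K -> 0 < eps ->
  exists n : nat -> nat, (forall i j, (i < j)%nat -> (n i < n j)%nat) /\
  forall a : nat -> C, (forall j, Cmod (a j) <= 1) -> forall k,
    nrm (psumv (fun j => v (n j)) a k) - eps / 2 ^ k <=
    nrm (psumv (fun j => v (n j)) a (S k)).
Proof.
intros H He.
assert (HF : exists F : (X -> Prop) * nat -> nat -> nat, forall s k, totbdd (fst s) ->
  (snd s <= F s k)%nat /\ forall y c, fst s y -> Cmod c <= 1 ->
    nrm y - eps / 2 ^ k <= nrm (y +v c *v v (F s k))).
{ destruct (choice (fun (sk : ((X -> Prop) * nat) * nat) (n : nat) => totbdd (fst (fst sk)) ->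
    (snd (fst sk) <= n)%nat /\ forall y c, fst (fst sk) y -> Cmod c <= 1 ->
    nrm y - eps / 2 ^ (snd sk) <= nrm (y +v c *v v n))) as [F HF].
  - intros [[E m] k]; simpl.
    destruct (classic (totbdd E)) as [HE | HE]; [| now exists 0%nat].
    destruct (almost_orthogonal v K E (eps / 2 ^ k) H HE) as [N HN].
    { apply Rdiv_lt_0_compat; [lra | apply pow_lt; lra]. }
    exists (N + m)%nat; intros _; split; [lia |]; intros y c; apply HN; lia.
  - exists (fun s k => F (s, k)); intros s k Hs; exact (HF (s, k) Hs). }
destruct HF as [F HF].
(* The state holds the set of all partial sums so far and a lower bound for the next index. *)
pose (st := nat_rect (fun _ => ((X -> Prop) * nat)%type) ((fun y => y = v0), 0%nat)
  (fun k s => ((fun z => exists y c, fst s y /\ Cmod c <= 1 /\ z = y +v c *v v (F s k)),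
    S (F s k)))).
assert (Hst : forall k, totbdd (fst (st k))).
{ induction k as [|k IH].
  - intros eta Heta; exists [v0 : X]; intros y Hy; exists v0; split; [now left |].
    simpl in Hy; rewrite Hy; replace (v0 -v v0) with (v0 : X) by vring; rewrite nrm_0; lra.
  - exact (totbdd_extend _ (v (F (st k) k)) IH). }
pose (n := fun k => F (st k) k).
exists n; split.
- assert (Hs : forall i, (n i < n (S i))%nat).
  { intros i; destruct (HF (st (S i)) (S i) (Hst (S i))) as [A _]; exact A. }
  intros i j Hij; induction Hij as [|j Hij IH]; [apply Hs |].
  apply Nat.lt_trans with (1 := IH), Hs.
- intros a Ha k.
  assert (Hin : forall k, fst (st k) (psumv (fun j => v (n j)) a k)).
  { induction k0 as [|k0 IH]; [reflexivity |].
    exists (psumv (fun j => v (n j)) a k0), (a k0); repeat split; auto. }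
  destruct (HF (st k) k (Hst k)) as [_ A]; cbn [psumv]; apply A; auto.
Qed.

Lemma sub_subset_bounded v K n : (forall i j, (i < j)%nat -> (n i < n j)%nat) ->
  subset_bounded v K -> subset_bounded (fun j => v (n j)) K.
Proof.
intros Hn H l Hl.
replace (lsum (fun j => v (n j)) l) with (lsum v (map n l))
  by (clear; induction l as [|k l IH]; cbn [map lsum]; congruence).
apply H, FinFun.Injective_map_NoDup; [| exact Hl].
intros i j Hij; destruct (Nat.lt_trichotomy i j) as [A | [A | A]]; auto;
  apply Hn in A; lia.
Qed.

Lemma pow_half_sum k m : (k <= m)%nat -> forall (s : nat -> R) e, 0 <= e ->
  (forall j, s j - e / 2 ^ j <= s (S j)) -> s k - 2 * e <= s m.
Proof.
intros Hkm s e He Hs.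
assert (A : s k - 2 * e / 2 ^ k + 2 * e / 2 ^ m <= s m).
{ induction Hkm as [|m Hkm IH]; [lra |].
  specialize (Hs m).
  assert (0 < 2 ^ m) by (apply pow_lt; lra).
  replace (2 * e / 2 ^ S m) with (e / 2 ^ m) by (simpl; field; lra).
  replace (2 * e / 2 ^ m) with (e / 2 ^ m + e / 2 ^ m) in IH by (field; lra); lra. }
assert (H1 : 1 <= 2 ^ k) by (apply pow_R1_Rle; lra).
assert (H2 : 0 < 2 ^ m) by (apply pow_lt; lra).
assert (0 <= 2 * e / 2 ^ m) by (apply Rmult_le_pos; [lra | left; now apply Rinv_0_lt_compat]).
assert (2 * e / 2 ^ k <= 2 * e * 1).
{ apply Rmult_le_compat_l; [lra |]; rewrite <- Rinv_1; apply Rinv_le_contravar; lra. }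
lra.
Qed.

(** The embedding sends [y] in [c0] to the sum of [y j * v (n j)] along a nearly basic subsequence.
    Bounded subset sums give convergence and the upper bound, the subsequence gives the lower
    one. *)
Lemma bessaga_pelczynski v K eps : subset_bounded v K -> 0 < eps ->
  (forall k, eps <= nrm (v k)) -> contains_copy c0 X.
Proof.
intros H He Hv.
destruct (basic_subsequence v K (eps / 16) H ltac:(lra)) as [n [Hn Hb]].
pose (u := fun j => v (n j)).
assert (Hu := sub_subset_bounded v K n Hn H); fold u in Hu, Hb.
assert (K0 : 0 <= K) by (apply Rle_trans with (2 := H nil (NoDup_nil _)), nrm_ge0).
pose (co := fun (y : c0) (j : nat) => bfun_fun y j : C).
assert (Hco : forall (y : c0) j, Cmod (co y j) <= bfun_norm y).
{ intros y j; exact (bfun_norm_ub y j). }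
assert (Htail : forall (y : c0) e, 0 < e -> exists N, forall k m, (N <= k)%nat ->
   nrm (psumv u (co y) (k + m) -v psumv u (co y) k) <= 4 * K * e).
{ intros y e Hep; destruct (bfun_in y e Hep) as [N HN]; exists N; intros k m Hk.
  rewrite psumv_wsum.
  replace (psumv u (co y) k +v wsum u (co y) (seq k m) -v psumv u (co y) k)
    with (wsum u (co y) (seq k m)) by vring.
  apply wsum_complex; [exact Hu | exact Hep | | apply seq_NoDup].
  intros j Hj; apply in_seq in Hj; left; apply HN; lia. }
assert (Hlim : forall y : c0, exists l, forall e, 0 < e -> exists N, forall m, (N <= m)%nat ->
   nrm (psumv u (co y) m -v l) <= e).
{ intros y; apply complete_limit_ex; intros e Hep.
  destruct (Htail y (e / (4 * (K + 1)))) as [N HN].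
  { apply Rdiv_lt_0_compat; lra. }
  exists N; intros m Hm.
  replace m with (N + (m - N))%nat by lia.
  apply Rle_trans with (1 := HN N (m - N)%nat (Nat.le_refl _)).
  apply Rle_trans with (4 * (K + 1) * (e / (4 * (K + 1)))); [| right; field; lra].
  apply Rmult_le_compat_r; [left; apply Rdiv_lt_0_compat; lra | lra]. }
destruct (choice _ Hlim) as [T HT].
assert (Hbd : forall y : c0, nrm (T y) <= 4 * (K + 1) * bfun_norm y).
{ intros y.
  assert (N0 := bfun_norm_ge0 y).
  assert (A : forall e, 0 < e -> nrm (T y) <= 4 * K * (bfun_norm y + e) + e).
  { intros e Hep; destruct (HT y e Hep) as [N HN]; specialize (HN N (Nat.le_refl _)).
    assert (A := nrm_sub_ge (T y) (psumv u (co y) N)); rewrite nrm_sub_sym in A.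
    assert (B := psumv_wsum u (co y) 0 N); simpl in B.
    replace (v0 +v wsum u (co y) (seq 0 N)) with (wsum u (co y) (seq 0 N)) in B by vring.
    assert (D : nrm (wsum u (co y) (seq 0 N)) <= 4 * K * (bfun_norm y + e)).
    { apply wsum_complex; [exact Hu | lra | | apply seq_NoDup].
      intros k _; specialize (Hco y k); lra. }
    rewrite <- B in D; lra. }
  apply Rnot_lt_le; intros Hlt.
  assert (Hd : 0 < nrm (T y) - 4 * (K + 1) * bfun_norm y) by lra.
  set (d := nrm (T y) - 4 * (K + 1) * bfun_norm y) in *.
  assert (Hd2 : 0 < d / (2 * (4 * K + 1))) by (apply Rdiv_lt_0_compat; lra).
  specialize (A _ Hd2).
  replace (4 * K * (bfun_norm y + d / (2 * (4 * K + 1))) + d / (2 * (4 * K + 1)))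
    with (4 * K * bfun_norm y + d / 2) in A by (field; lra).
  unfold d in *; lra. }
assert (Hlow : forall y : c0, bfun_norm y <= 8 / eps * nrm (T y)).
{ intros y.
  set (s := bfun_norm y).
  destruct (Rle_lt_dec s 0) as [Hs | Hs].
  { apply Rle_trans with (1 := Hs), Rmult_le_pos; [| apply nrm_ge0].
    left; apply Rdiv_lt_0_compat; lra. }
  assert (Hi : exists i, s / 2 < Cmod (co y i)).
  { apply NNPP; intros Hi.
    assert (A : bfun_norm y <= s / 2).
    { apply bfun_norm_le; [lra |]; intros i; apply Rnot_lt_le; intros Hlt; apply Hi; now exists i. }
    fold s in A; lra. }
  destruct Hi as [i Hi].
  pose (a := fun j => (co y j * RtoC (/ s))%C).
  assert (Ha : forall j, Cmod (a j) <= 1).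
  { intros j; unfold a; rewrite Cmod_mult, Cmod_R, Rabs_pos_eq by (left;
    now apply Rinv_0_lt_compat).
    apply Rmult_le_reg_r with s; [exact Hs |]; rewrite Rmult_assoc, Rinv_l by lra.
    specialize (Hco y j); fold s in Hco; lra. }
  assert (Hps : forall m, psumv u a m = RtoC (/ s) *v psumv u (co y) m).
  { induction m as [|m IH]; cbn [psumv]; [vring | rewrite IH; unfold a; vring]. }
  (* One of two consecutive partial sums has norm at least [eps / 4]. Later sums lose at most
     [2 * (eps / 16)], which leaves [eps / 8] and explains the constant [8 / eps]. *)
  assert (Hai : eps / 2 <= nrm (psumv u a (S i)) + nrm (psumv u a i)).
  { apply Rle_trans with (nrm (a i *v u i)).
    - rewrite nrm_sc; unfold a; rewrite Cmod_mult, Cmod_R, Rabs_pos_eq by (left;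
      now apply Rinv_0_lt_compat).
      assert (/ 2 <= Cmod (co y i) * / s).
      { apply Rmult_le_reg_r with s; [exact Hs |]; rewrite Rmult_assoc, Rinv_l by lra; lra. }
      assert (B := Hv (n i)); fold (u i) in B; assert (B2 := nrm_ge0 (u i)); nra.
    - replace (a i *v u i) with (psumv u a (S i) -v psumv u a i) by (cbn [psumv]; vring).
      apply nrm_sub. }
  assert (Hm : forall m, (S i <= m)%nat -> eps / 8 <= nrm (psumv u a m)).
  { intros m Hm.
    assert (P1 := pow_half_sum (S i) m Hm (fun j => nrm (psumv u a j)) (eps / 16) ltac:(lra)
      (Hb a Ha)).
    assert (P2 := pow_half_sum i m ltac:(lia) (fun j => nrm (psumv u a j)) (eps / 16) ltac:(lra)
      (Hb a Ha)).
    cbv beta in P1, P2; lra. }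
  apply Rnot_lt_le; intros Hlt.
  assert (Hlt' : nrm (T y) < s * (eps / 8)).
  { apply Rmult_lt_reg_l with (8 / eps); [apply Rdiv_lt_0_compat; lra |].
    replace (8 / eps * (s * (eps / 8))) with s by (field; lra); exact Hlt. }
  destruct (HT y ((s * (eps / 8) - nrm (T y)) / 2)) as [N HN]; [lra |].
  specialize (HN (N + S i)%nat ltac:(lia)).
  specialize (Hm (N + S i)%nat ltac:(lia)).
  rewrite Hps, nrm_sc, Cmod_R, Rabs_pos_eq in Hm by (left; now apply Rinv_0_lt_compat).
  assert (A := nrm_sub_ge (psumv u (co y) (N + S i)) (T y)).
  assert (B : s * (eps / 8) <= nrm (psumv u (co y) (N + S i))).
  { apply Rmult_le_reg_l with (/ s); [now apply Rinv_0_lt_compat |].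
    rewrite <- Rmult_assoc, Rinv_l by lra; lra. }
  lra. }
exists T; split; [split |].
- intros x y.
  apply (eq_by_eps _ _ 3); intros e Hep.
  destruct (HT x e Hep) as [N1 H1]; destruct (HT y e Hep) as [N2 H2].
  destruct (HT (plus x y) e Hep) as [N3 H3].
  set (m := (N1 + N2 + N3)%nat).
  specialize (H1 m ltac:(lia)); specialize (H2 m ltac:(lia)); specialize (H3 m ltac:(lia)).
  change (nrm (T (plus x y) -v (T x +v T y)) <= 3 * e).
  assert (E : psumv u (co (plus x y)) m = psumv u (co x) m +v psumv u (co y) m).
  { clear; induction m as [|m IH]; cbn [psumv]; [vring |]; rewrite IH.
    change (co (plus x y) m) with (Cplus (co x m) (co y m)); vring. }
  rewrite E in H3; set (z := T (plus x y)) in *.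
  replace (z -v (T x +v T y)) with ((z -v (psumv u (co x) m +v psumv u (co y) m)) +v
     ((psumv u (co x) m -v T x) +v (psumv u (co y) m -v T y))) by vring.
  apply Rle_trans with (1 := nrm_add _ _).
  assert (A := nrm_add (psumv u (co x) m -v T x) (psumv u (co y) m -v T y)).
  rewrite nrm_sub_sym in H3; lra.
- intros c x.
  assert (Hc := Cmod_ge_0 c).
  apply (eq_by_eps _ _ (1 + Cmod c)); intros e Hep.
  destruct (HT x e Hep) as [N1 H1]; destruct (HT (scal c x) e Hep) as [N3 H3].
  set (m := (N1 + N3)%nat).
  specialize (H1 m ltac:(lia)); specialize (H3 m ltac:(lia)).
  change (nrm (T (scal c x) -v c *v T x) <= (1 + Cmod c) * e).
  assert (E : psumv u (co (scal c x)) m = c *v psumv u (co x) m).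
  { clear; induction m as [|m IH]; cbn [psumv]; [vring |]; rewrite IH.
    change (co (scal c x) m) with (Cmult c (co x m)); vring. }
  rewrite E in H3; set (z := T (scal c x)) in *.
  replace (z -v c *v T x) with ((z -v c *v psumv u (co x) m) +v c *v (psumv u (co x) m -v T x)) by
    vring.
  apply Rle_trans with (1 := nrm_add _ _); rewrite nrm_sc.
  rewrite nrm_sub_sym in H3.
  assert (Cmod c * nrm (psumv u (co x) m -v T x) <= Cmod c * e) by now apply Rmult_le_compat_l.
  lra.
- exists (4 * (K + 1)); split; [lra | exact Hbd].
- exists (8 / eps); exact Hlow.
Qed.

End BessagaPelczynski.

(** * Kadets' theorem for sequences *)

Section Kadets.
Context {X : CompleteNormedModule C_AbsRing}.
Implicit Types x y : Z -> X.

(** A colouring of the translations by [N] colours such that equally coloured translates of [x] are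
    uniformly [eps]-close, that is, a finite cover of the orbit by sets of small diameter. *)
Definition splits x eps (c : Z -> nat) (N : nat) :=
  (forall m, (c m < N)%nat) /\
  forall m m', c m = c m' -> forall n, nrm (x (n + m)%Z -v x (n + m')%Z) <= eps.

(* Total boundedness of the set of translates, i.e. Bochner's form of almost
   periodicity. *)
Definition apseq x := forall eps, 0 < eps -> exists c N, splits x eps c N.

(** Common refinement of two colourings, coded in base [N]. *)
Definition pair_class (N : nat) (c1 c2 : Z -> nat) (m : Z) : nat := (c1 m + N * c2 m)%nat.

Lemma pair_class_lt N1 N2 c1 c2 m : (c1 m < N1)%nat -> (c2 m < N2)%nat ->
  (pair_class N1 c1 c2 m < N1 * N2)%nat.
Proof.
unfold pair_class; intros H1 H2.
assert (N1 * S (c2 m) <= N1 * N2)%nat by (apply Nat.mul_le_mono_l; lia); lia.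
Qed.

Lemma pair_class_eq N c1 c2 m m' : (c1 m < N)%nat -> (c1 m' < N)%nat ->
  pair_class N c1 c2 m = pair_class N c1 c2 m' -> c1 m = c1 m' /\ c2 m = c2 m'.
Proof.
unfold pair_class; intros H1 H2 E.
destruct (Nat.div_mod_unique N (c2 m) (c2 m') (c1 m) (c1 m') H1 H2); lia.
Qed.

Lemma apseq_common (l : list (Z -> X)) eps : 0 < eps -> (forall x, In x l -> apseq x) ->
  exists c N, (forall m, (c m < N)%nat) /\ forall x, In x l -> splits x eps c N.
Proof.
intros He; induction l as [|x l IH]; intros H.
- exists (fun _ => 0%nat), 1%nat; split; [intros; lia | easy].
- destruct IH as [c1 [N1 [A1 A2]]]; [intros y Hy; apply H; now right |].
  destruct (H x (or_introl eq_refl) eps He) as [c2 [N2 [B1 B2]]].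
  assert (L : forall m, (pair_class N1 c1 c2 m < N1 * N2)%nat).
  { intros m; now apply pair_class_lt. }
  exists (pair_class N1 c1 c2), (N1 * N2)%nat; split; [exact L |].
  intros y [<- | Hy]; (split; [exact L |]); intros m m' Hm;
    apply pair_class_eq in Hm as [E1 E2]; auto.
  apply (proj2 (A2 y Hy)); auto.
Qed.

Lemma apseq_comb (k : C) x y : apseq x -> apseq y -> apseq (fun n => k *v x n +v y n).
Proof.
intros Hx Hy eps He.
assert (Hk := Cmod_ge_0 k).
assert (He' : 0 < eps / (Cmod k + 1)) by (apply Rdiv_lt_0_compat; lra).
destruct (apseq_common [x; y] _ He') as [c [N [A1 A2]]].
{ intros z [<- | [<- | []]]; auto. }
exists c, N; split; [exact A1 |]; intros m m' Hm n.
assert (B1 := proj2 (A2 x (or_introl eq_refl)) m m' Hm n).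
assert (B2 := proj2 (A2 y (or_intror (or_introl eq_refl))) m m' Hm n).
set (a := x (n + m)%Z) in *; set (b := x (n + m')%Z) in *.
set (a' := y (n + m)%Z) in *; set (b' := y (n + m')%Z) in *.
replace (k *v a +v a' -v (k *v b +v b')) with (k *v (a -v b) +v (a' -v b')) by vring.
apply Rle_trans with (1 := nrm_add _ _); rewrite nrm_sc.
assert (Cmod k * nrm (a -v b) <= Cmod k * (eps / (Cmod k + 1))) by now apply Rmult_le_compat_l.
replace eps with (Cmod k * (eps / (Cmod k + 1)) + eps / (Cmod k + 1)) by (field; lra); lra.
Qed.

Lemma apseq_const (v : X) : apseq (fun _ => v).
Proof.
intros eps He; exists (fun _ => 0%nat), 1%nat; split; [intros; lia |].
intros m m' _ n; replace (v -v v) with (v0 : X) by vring; rewrite nrm_0; lra.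
Qed.

Lemma apseq_shift x a : apseq x -> apseq (fun n => x (n + a)%Z).
Proof.
intros H eps He; destruct (H eps He) as [c [N [A1 A2]]]; exists c, N; split; [exact A1 |].
intros m m' Hm n; specialize (A2 m m' Hm (n + a)%Z).
replace (n + m + a)%Z with (n + a + m)%Z by ring.
now replace (n + m' + a)%Z with (n + a + m')%Z by ring.
Qed.

Lemma apseq_limit x : (forall eps, 0 < eps -> exists y, apseq y /\ forall n,
  nrm (x n -v y n) <= eps) ->
  apseq x.
Proof.
intros H eps He; destruct (H (eps / 3)) as [y [Hy Hxy]]; [lra |].
destruct (Hy (eps / 3)) as [c [N [A1 A2]]]; [lra |].
exists c, N; split; [exact A1 |]; intros m m' Hm n; specialize (A2 m m' Hm n).
assert (B1 := Hxy (n + m)%Z); assert (B2 := Hxy (n + m')%Z).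
assert (T1 := nrm_sub_tri (x (n + m)%Z) (y (n + m)%Z) (x (n + m')%Z)).
assert (T2 := nrm_sub_tri (y (n + m)%Z) (y (n + m')%Z) (x (n + m')%Z)).
rewrite (nrm_sub_sym (y (n + m')%Z)) in T2; lra.
Qed.

Definition diff (a : Z) x (n : Z) : X := x (n + a)%Z -v x n.

Lemma apseq_ext x y : (forall n, x n = y n) -> apseq x -> apseq y.
Proof. intros H; now replace y with x by now apply functional_extensionality. Qed.

Lemma apseq_diff x a : apseq (diff 1 x) -> apseq (diff a x).
Proof.
intros H1.
assert (Hn : forall n : nat, apseq (diff (Z.of_nat n) x)).
{ induction n as [|n IH].
  - apply (apseq_ext (fun _ => v0)); [| apply apseq_const].
    intros n; unfold diff; simpl; rewrite Z.add_0_r; vring.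
  - apply (apseq_ext (fun k => RtoC 1 *v diff 1 x (k + Z.of_nat n)%Z +v diff (Z.of_nat n) x k)).
    + intros k; unfold diff; replace (k + Z.of_nat (S n))%Z with (k + Z.of_nat n + 1)%Z by lia;
      vring.
    + apply apseq_comb; [now apply apseq_shift | exact IH]. }
destruct (Z.le_ge_cases 0 a) as [Ha | Ha].
- rewrite <- (Z2Nat.id a Ha); apply Hn.
- specialize (Hn (Z.to_nat (- a))); rewrite Z2Nat.id in Hn by lia.
  apply (apseq_ext (fun k => RtoC (-1) *v diff (- a) x (k + a)%Z +v v0)).
  + intros k; unfold diff; replace (k + a + - a)%Z with k by lia; vring.
  + apply apseq_comb; [now apply apseq_shift | apply apseq_const].
Qed.

Lemma representatives (c : Z -> nat) (N : nat) : (forall m, (c m < N)%nat) ->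
  exists q : list Z, forall m, exists a, In a q /\ c a = c m.
Proof.
intros Hc.
assert (A : forall n, exists q : list Z, forall m, (c m < n)%nat -> exists a, In a q /\ c a = c m).
{ induction n as [|n [q Hq]].
  - exists nil; intros m Hm; lia.
  - destruct (classic (exists a, c a = n)) as [[a Ha] | Hn].
    + exists (a :: q); intros m Hm; destruct (Nat.eq_dec (c m) n) as [E | E].
      * exists a; split; [now left | congruence].
      * destruct (Hq m ltac:(lia)) as [b [B1 B2]]; exists b; split; [now right | exact B2].
    + exists q; intros m Hm; apply Hq.
      assert (c m <> n) by (intros E; apply Hn; now exists m); lia. }
destruct (A N) as [q Hq]; exists q; intros m; apply Hq, Hc.
Qed.

Definition almost_period x eps p := forall n, nrm (x (n + p)%Z -v x n) <= eps.

Lemma split_period x eps c N m m' : splits x eps c N -> c m = c m' -> almost_period x eps (m - m').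
Proof.
intros [_ H] Hm n; specialize (H m m' Hm (n - m')%Z).
now replace (n - m' + m)%Z with (n + (m - m'))%Z in H by lia;
  replace (n - m' + m')%Z with n in H by lia.
Qed.

(** Suppose every common [delta]-period [a] of [ds] moved [x] by at most [eps] at each [t + tau].
    Any [s] is [t + tau + b] with [b] in a finite set [q] of representatives, and the finitely many
    [diff b x] are almost periodic. So a common [eps]-period of those moves [x] by at most [2 eps]
    everywhere, and colouring by both conditions contradicts the failure of [splits]. *)
Lemma kadets_step x eps (ds : list (Z -> X)) delta t :
  apseq (diff 1 x) -> 0 < eps -> 0 < delta ->
  ~ (exists c N, splits x (2 * eps) c N) -> (forall d, In d ds -> apseq d) ->
  exists a tau, (forall d, In d ds -> almost_period d delta a /\ almost_period d delta tau) /\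
    eps < nrm (diff a x (t + tau)%Z).
Proof.
intros H1 He Hd Hx Hds; apply NNPP; intros HN; apply Hx.
destruct (apseq_common ds delta Hd Hds) as [c1 [N1 [A1 A2]]].
destruct (representatives c1 N1 A1) as [q Hq].
destruct (apseq_common (map (fun b => diff b x) q) eps He) as [c2 [N2 [B1 B2]]].
{ intros y Hy; apply in_map_iff in Hy as [b [<- _]]; now apply apseq_diff. }
exists (pair_class N1 c1 c2), (N1 * N2)%nat; split.
{ intros m; now apply pair_class_lt. }
intros m m' Hm; apply pair_class_eq in Hm as [E1 E2]; auto.
assert (Hp : almost_period x (2 * eps) (m - m')).
{ intros s.
  destruct (Hq (s - t)%Z) as [b [Q1 Q2]].
  set (tau := (s - t - b)%Z); set (p := (m - m')%Z).
  assert (L1 : nrm (diff p x (t + tau)%Z) <= eps).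
  { apply Rnot_lt_le; intros Hlt; apply HN; exists p, tau; split; [| exact Hlt].
    intros d Hi; split; apply (split_period _ _ c1 N1); auto. }
  assert (L2 : almost_period (diff b x) eps p).
  { apply (split_period _ _ c2 N2); [| exact E2].
    apply B2; apply (in_map (fun b => diff b x)); exact Q1. }
  specialize (L2 (t + tau)%Z); unfold diff in *.
  replace (t + tau + p + b)%Z with (s + p)%Z in L2 by (unfold tau; lia).
  replace (t + tau + b)%Z with s in L2 by (unfold tau; lia).
  set (y := x (t + tau + p)%Z) in *; set (z := x (t + tau)%Z) in *.
  replace (x (s + p)%Z -v x s) with ((y -v z) +v (x (s + p)%Z -v y -v (x s -v z))) by vring.
  apply Rle_trans with (1 := nrm_add _ _); lra. }
intros n; specialize (Hp (n + m')%Z).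
now replace (n + m' + (m - m'))%Z with (n + m)%Z in Hp by lia.
Qed.

Fixpoint bsum (v : nat -> X) (b : nat -> bool) (n : nat) : X :=
  match n with
  | O => v0
  | S n => bsum v b n +v (if b n then v n else v0)
  end.

Lemma lsum_permutation (v : nat -> X) l l' : Permutation l l' -> lsum v l = lsum v l'.
Proof.
induction 1; cbn [lsum]; [easy | now rewrite IHPermutation | vring | congruence].
Qed.

Lemma lsum_app (v : nat -> X) l l' : lsum v (l ++ l') = lsum v l +v lsum v l'.
Proof. induction l as [|k l IH]; cbn [app lsum]; [vring | rewrite IH; vring]. Qed.

Lemma bsum_filter (v : nat -> X) b n : bsum v b n = lsum v (filter b (seq 0 n)).
Proof.
induction n as [|n IH]; [easy |].
cbn [bsum]; rewrite seq_S, filter_app, lsum_app, <- IH; simpl.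
destruct (b n); cbn [lsum]; vring.
Qed.

Lemma subset_bounded_bsum (v : nat -> X) K : (forall b n, nrm (bsum v b n) <= K) -> subset_bounded
  v K.
Proof.
intros H l Hl.
pose (b := fun k => if in_dec Nat.eq_dec k l then true else false).
rewrite (lsum_permutation v l (filter b (seq 0 (S (list_max l))))).
- rewrite <- bsum_filter; apply H.
- apply NoDup_Permutation; [exact Hl | apply NoDup_filter, seq_NoDup |].
  intros k; rewrite filter_In, in_seq; unfold b.
  destruct (in_dec Nat.eq_dec k l) as [Hk | Hk]; split; try tauto; try easy.
  intros _; repeat split; try lia.
  assert (A := proj1 (list_max_le l (list_max l)) (Nat.le_refl _)).
  rewrite List.Forall_forall in A; specialize (A k Hk); lia.
Qed.

(** If [x] is not almost periodic, [kadets_step] yields [a n] and base points [t n] at which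
    [diff (a n) x] exceeds [eps]. Each [a n] almost preserves the differences by all subset sums of
    the earlier ones, so differences nearly add up and every finite subset sum stays below [2 M]
    plus a small error. The moves [tau n] also almost preserve the earlier differences, so these
    converge along [t] to vectors [v k], with bounded subset sums and norms bounded below. *)
Lemma kadets x M : (forall n, nrm (x n) <= M) -> ~ contains_copy c0 X ->
  apseq (diff 1 x) -> apseq x.
Proof.
intros HM HX H1 eps0 He0; apply NNPP; intros HN.
pose (eps := eps0 / 2).
assert (He : 0 < eps) by (unfold eps; lra).
assert (HN' : ~ exists c N, splits x (2 * eps) c N) by (unfold eps;
  now replace (2 * (eps0 / 2)) with eps0 by field).
assert (M0 : 0 <= M) by (apply Rle_trans with (2 := HM 0%Z), nrm_ge0).
pose (delta := fun n : nat => eps / 8 / 2 ^ n).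
assert (Hd : forall n, 0 < delta n).
{ intros n; apply Rdiv_lt_0_compat; [lra | apply pow_lt; lra]. }
destruct (choice (fun (s : (list Z * Z) * nat) (at_ : Z * Z) =>
   (forall r, In r (fst (fst s)) -> almost_period (diff r x) (delta (snd s)) (fst at_) /\
                                    almost_period (diff r x) (delta (snd s)) (snd at_)) /\
   eps < nrm (diff (fst at_) x (snd (fst s) + snd at_)%Z))) as [F HF].
{ intros [[sums t] n]; simpl.
  destruct (kadets_step x eps (map (fun r => diff r x) sums) (delta n) t H1 He (Hd n) HN')
    as [a [tau [K1 K2]]].
  - intros d Hi; apply in_map_iff in Hi as [r [<- _]]; now apply apseq_diff.
  - exists (a, tau); simpl; split; [| exact K2].
    intros r Hr; apply K1, (in_map (fun r => diff r x)), Hr. }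
(* The first component lists all subset sums of the [a k] found so far, starting with the empty one;
   the second is the current base point. *)
pose (st := nat_rect (fun _ => (list Z * Z)%type) ([0%Z], 0%Z)
  (fun n s => (fst s ++ map (fun r => (r + fst (F (s, n)))%Z) (fst s), (snd s + snd (F (s,
    n)))%Z))).
pose (a := fun n => fst (F (st n, n))).
pose (tau := fun n => snd (F (st n, n))).
pose (t := fun n => snd (st n)).
assert (HtS : forall n, t (S n) = (t n + tau n)%Z) by reflexivity.
assert (HsS : forall n, fst (st (S n)) = fst (st n) ++ map (fun r => (r + a n)%Z)
  (fst (st n))) by reflexivity.
assert (Hstep : forall n, (forall r, In r (fst (st n)) -> almost_period (diff r x) (delta n)
  (a n) /\
   almost_period (diff r x) (delta n) (tau n)) /\ eps < nrm (diff (a n) x (t (S n)))).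
{ intros n; exact (HF (st n, n)). }
clearbody a tau.
assert (Hmono : forall n m r, (n <= m)%nat -> In r (fst (st n)) -> In r (fst (st m))).
{ intros n m r Hnm Hr; induction Hnm as [|m Hnm IH]; [exact Hr |].
  rewrite HsS; apply in_or_app; now left. }
assert (H0 : forall n, In 0%Z (fst (st n))).
{ intros n; apply (Hmono 0%nat); [lia | now left]. }
assert (Ha : forall k n, (k < n)%nat -> In (a k) (fst (st n))).
{ intros k n Hkn; apply (Hmono (S k)); [exact Hkn |].
  rewrite HsS; apply in_or_app; right; apply in_map_iff; exists 0%Z; split; [lia | apply H0]. }
assert (Hdrift : forall k n, (k < n)%nat -> nrm (diff (a k) x (t (S n)) -v diff (a k) x (t n)) <=
  delta n).
{ intros k n Hkn; rewrite HtS; apply Hstep, Ha, Hkn. }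
assert (Hdel : forall n, delta n = 2 * delta (S n)).
{ intros n; unfold delta; simpl; field; apply pow_nonzero; lra. }
assert (Hdrift2 : forall k n m, (k < n)%nat -> (n <= m)%nat ->
   nrm (diff (a k) x (t m) -v diff (a k) x (t n)) <= 2 * delta n - 2 * delta m).
{ intros k n m Hkn Hnm; induction Hnm as [|m Hnm IH].
  - replace (diff (a k) x (t n) -v diff (a k) x (t n)) with (v0 : X) by vring; rewrite nrm_0; lra.
  - assert (T := nrm_sub_tri (diff (a k) x (t (S m))) (diff (a k) x (t m)) (diff (a k) x (t n))).
    specialize (Hdrift k m ltac:(lia)); specialize (Hdel m); lra. }
assert (Hdsmall : forall e, 0 < e -> exists n, forall m, (n <= m)%nat -> 2 * delta m <= e).
{ intros e Hep.
  destruct (pow_lt_1_zero (1 / 2)) with (y := e / (eps / 4)) as [n Hn].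
  - rewrite Rabs_pos_eq; lra.
  - apply Rdiv_lt_0_compat; lra.
  - exists n; intros m Hm; specialize (Hn m Hm).
    rewrite Rabs_pos_eq in Hn by (apply pow_le; lra).
    unfold delta; replace (2 * (eps / 8 / 2 ^ m)) with ((1 / 2) ^ m * (eps / 4)).
    + left; apply Rmult_lt_reg_r with (/ (eps / 4)); [apply Rinv_0_lt_compat; lra |].
      rewrite Rmult_assoc, Rinv_r, Rmult_1_r by lra; exact Hn.
    + unfold Rdiv; rewrite Rmult_1_l, pow_inv; field; apply pow_nonzero; lra. }
assert (Hlim : forall k, exists v, forall n, nrm (diff (a k) x (t (S k + n)%nat) -v v) <= 2 *
  delta (S k + n)%nat).
{ intros k; apply (complete_limit (fun n => diff (a k) x (t (S k + n)%nat))
    (fun n => 2 * delta (S k + n)%nat)).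
  - intros n m Hnm; rewrite nrm_sub_sym.
    assert (A := Hdrift2 k (S k + n)%nat (S k + m)%nat ltac:(lia) ltac:(lia)).
    specialize (Hd (S k + m)%nat); lra.
  - intros e Hep; destruct (Hdsmall e Hep) as [n Hn]; exists n; intros m Hm; apply Hn; lia. }
destruct (choice _ Hlim) as [v Hv].
(* [s] is the sum of the selected [a k]; each new term costs [delta n], because [a n] is an almost
   period of [diff s x]. *)
assert (Hsum : forall b n, exists s, In s (fst (st n)) /\ forall r,
   nrm (bsum (fun k => diff (a k) x r) b n -v diff s x r) <= 2 * delta 0%nat - 2 * delta n).
{ intros b; induction n as [|n [s [S1 S2]]].
  - exists 0%Z; split; [apply H0 |]; intros r; cbn [bsum]; unfold diff; rewrite Z.add_0_r.
    replace (v0 -v (x r -v x r)) with (v0 : X) by vring; rewrite nrm_0; lra.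
  - assert (D := Hdel n); assert (D' := Hd n); destruct (b n) eqn:Eb.
    + exists (s + a n)%Z; split.
      * rewrite HsS; apply in_or_app; right; apply (in_map (fun r => (r + a n)%Z)), S1.
      * intros r; cbn [bsum]; rewrite Eb; specialize (S2 r).
        assert (P := proj1 (proj1 (Hstep n) s S1) r); unfold diff in P.
        replace (r + a n + s)%Z with (r + (s + a n))%Z in P by lia.
        set (B := bsum _ b n) in *; unfold diff in *.
        replace (B +v (x (r + a n)%Z -v x r) -v (x (r + (s + a n))%Z -v x r)) with
          ((B -v (x (r + s)%Z -v x r)) -v (x (r + (s + a n))%Z -v x (r + a n)%Z -v (x (r + s)%Z -v
            x r))) by vring.
        apply Rle_trans with (1 := nrm_sub _ _); lra.
    + exists s; split; [apply (Hmono n); [lia | exact S1] |].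
      intros r; cbn [bsum]; rewrite Eb; specialize (S2 r).
      set (B := bsum _ b n) in *; replace (B +v v0 -v diff s x r) with (B -v diff s x r) by vring;
        lra. }
assert (Hbs : forall b n, nrm (bsum v b n) <= 2 * M + 3 * eps).
{ intros b n.
  destruct (Hdsmall (eps / (INR n + 1))) as [m Hm].
  { apply Rdiv_lt_0_compat; [lra |]; assert (H := pos_INR n); lra. }
  set (r := t (n + m)%nat).
  assert (A : nrm (bsum v b n -v bsum (fun k => diff (a k) x r) b n) <= INR n * (eps / (INR n +
    1))).
  { assert (Hp : forall j, (j <= n)%nat -> nrm (bsum v b j -v bsum (fun k => diff (a k) x r) b j)
       <= INR j * (eps / (INR n + 1))).
    { induction j as [|j IH]; intros Hj.
      - cbn [bsum]; replace (v0 -v v0) with (v0 : X) by vring; rewrite nrm_0; simpl; lra.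
      - cbn [bsum]; rewrite S_INR; specialize (IH ltac:(lia)).
        assert (E : nrm (diff (a j) x r -v v j) <= eps / (INR n + 1)).
        { specialize (Hv j (n + m - S j)%nat); replace (S j + (n + m - S j))%nat with (n + m)%nat
          in Hv by lia.
          apply Rle_trans with (1 := Hv), Hm; lia. }
        set (B := bsum v b j) in *; set (B' := bsum (fun k => diff (a k) x r) b j) in *.
        destruct (b j).
        + replace (B +v v j -v (B' +v diff (a j) x r)) with ((B -v B') -v (diff (a j) x r -v v j))
          by vring.
          apply Rle_trans with (1 := nrm_sub _ _); lra.
        + replace (B +v v0 -v (B' +v v0)) with (B -v B') by vring.
          assert (0 <= eps / (INR n + 1)).
          { apply Rle_trans with (2 := E), nrm_ge0. }
          lra. }
    apply Hp; lia. }
  assert (A2 : INR n * (eps / (INR n + 1)) <= eps).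
  { assert (H := pos_INR n); apply Rle_trans with ((INR n + 1) * (eps / (INR n + 1))).
    - apply Rmult_le_compat_r; [left; apply Rdiv_lt_0_compat; lra | lra].
    - right; field; lra. }
  destruct (Hsum b n) as [s [_ Hs]]; specialize (Hs r).
  assert (B1 := nrm_sub (x (r + s)%Z) (x r)).
  assert (B2 := HM (r + s)%Z); assert (B3 := HM r).
  assert (B4 := nrm_sub_ge (bsum (fun k => diff (a k) x r) b n) (diff s x r)).
  assert (B5 := nrm_sub_ge (bsum v b n) (bsum (fun k => diff (a k) x r) b n)).
  specialize (Hd n); assert (D0 : delta 0%nat = eps / 8) by (unfold delta; simpl; field).
  unfold diff in B4 at 2; lra. }
apply HX, (bessaga_pelczynski v (2 * M + 3 * eps) (eps / 2)); [now apply subset_bounded_bsum | lra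
  |].
intros k.
specialize (Hv k 0%nat); rewrite Nat.add_0_r in Hv.
destruct (Hstep k) as [_ Hk].
assert (A := nrm_sub_ge (diff (a k) x (t (S k))) (v k)).
assert (D : delta (S k) <= eps / 8).
{ unfold delta; unfold Rdiv at 1; rewrite <- (Rmult_1_r (eps / 8)) at 2; apply Rmult_le_compat_l;
  [lra |].
  rewrite <- Rinv_1; apply Rinv_le_contravar; [lra | apply pow_R1_Rle; lra]. }
lra.
Qed.

End Kadets.

(** * Integrals and the Carleman transform *)

Lemma is_RInt_linear (U V : NormedModule R_AbsRing) (phi : U -> V) (f : R -> U) a b l :
  (forall x y, phi (plus x y) = plus (phi x) (phi y)) ->
  (forall (k : R) x, phi (scal k x) = scal k (phi x)) ->
  filterlim phi (locally l) (locally (phi l)) ->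
  is_RInt f a b l -> is_RInt (fun t => phi (f t)) a b (phi l).
Proof.
intros Hp Hs Hc H.
assert (Hz : phi zero = zero).
{ transitivity (phi (scal (zero : R_AbsRing) zero)).
  - f_equal; symmetry; exact (scal_zero_l (K := R_AbsRing) (V := U) zero).
  - rewrite Hs; exact (scal_zero_l (K := R_AbsRing) (V := V) _). }
assert (HR : forall ptd, Riemann_sum (fun t => phi (f t)) ptd = phi (Riemann_sum f ptd)).
{ intros ptd; induction ptd as [x0 | [x0 y0] s IH] using SF_cons_ind.
  - exact (eq_sym Hz).
  - rewrite !Riemann_sum_cons.
    rewrite Hp, IH; f_equal; symmetry; apply Hs. }
apply (filterlim_ext (fun ptd => phi (scal (sign (b - a)) (Riemann_sum f ptd)))).
- intros ptd; rewrite HR; apply Hs.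
- exact (filterlim_comp _ _ _ _ _ _ _ _ H Hc).
Qed.

Section Calculus.
Context {X : CompleteNormedModule C_AbsRing}.
Implicit Types (g h F : R -> X).

Lemma ex_int g a b : (forall t, cont_at g t) -> ex_RInt (V := realify X) g a b.
Proof.
intros H; apply (ex_RInt_continuous (V := realify X)); intros z _.
apply cont_at_continuous, H.
Qed.

Lemma is_int g a b : (forall t, cont_at g t) -> is_RInt (V := realify X) g a b (integral g a b).
Proof. intros H; apply (RInt_correct (V := realify X)), ex_int, H. Qed.

Lemma integral_unique g a b (l : X) : is_RInt (V := realify X) g a b l -> integral g a b = l.
Proof. exact (is_RInt_unique (V := realify X) g a b l). Qed.

Lemma integral_ext g h a b : (forall t, g t = h t) -> integral g a b = integral h a b.
Proof. intros H; replace h with g by now apply functional_extensionality. reflexivity. Qed.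

Lemma integral_comb c g h a b : (forall t, cont_at g t) -> (forall t, cont_at h t) ->
  integral (fun t => c *v g t +v h t) a b = c *v integral g a b +v integral h a b.
Proof.
intros Hg Hh; apply integral_unique.
apply (is_RInt_plus (V := realify X) (fun t => c *v g t)); [| now apply is_int].
apply (is_RInt_linear (realify X) (realify X) (fun x : X => c *v x : X)); [| | | now apply is_int].
- intros x y; change (c *v (x +v y) = c *v x +v c *v y); vring.
- intros k x; change (c *v (RtoC k *v x) = RtoC k *v (c *v x)); vring.
- exact (filterlim_scal_r (K := C_AbsRing) (V := X) c (integral g a b)).
Qed.

Lemma integral_shift g c a b : (forall t, cont_at g t) ->
  integral (fun t => g (c + t)) a b = integral g (c + a) (c + b).
Proof.
intros Hg; apply integral_unique.
assert (H := is_RInt_comp_lin (V := realify X) g 1 c a b).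
apply (is_RInt_ext (V := realify X) (fun y => scal (1 : R_AbsRing) (g (1 * y + c) : realify X))).
- intros x _; change (RtoC 1 *v g (1 * x + c) = g (c + x)).
  replace (1 * x + c) with (c + x) by ring; vring.
- apply H; replace (1 * a + c) with (c + a) by ring; replace (1 * b + c) with (c + b) by ring.
  now apply is_int.
Qed.

Lemma integral_chasles g a b c : (forall t, cont_at g t) ->
  integral g a b +v integral g b c = integral g a c.
Proof.
intros Hg; symmetry; apply integral_unique.
exact (is_RInt_Chasles (V := realify X) g a b c _ _ (is_int g a b Hg) (is_int g b c Hg)).
Qed.

Lemma integral_point g a : integral g a a = v0.
Proof. apply integral_unique, (is_RInt_point (V := realify X)). Qed.

Lemma integral_bound_fun g (m : R -> R) a b I : (forall t, cont_at g t) -> a <= b ->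
  (forall t, a <= t <= b -> nrm (g t) <= m t) -> is_RInt m a b I -> nrm (integral g a b) <= I.
Proof.
intros Hg Hab Hm HI.
exact (norm_RInt_le (V := realify X) g m a b _ _ Hab Hm (is_int g a b Hg) HI).
Qed.

Lemma integral_bound g a b M : (forall t, cont_at g t) ->
  (forall t, Rmin a b <= t <= Rmax a b -> nrm (g t) <= M) -> nrm (integral g a b) <= M * Rabs (b -
    a).
Proof.
intros Hg HM.
assert (A : forall a b, a <= b -> (forall t, a <= t <= b -> nrm (g t) <= M) -> nrm (integral g a
  b) <= M * (b - a)).
{ intros a' b' Hab Hm; apply (integral_bound_fun g (fun _ => M) a' b'); auto.
  replace (M * (b' - a')) with (scal (b' - a') M) by (unfold scal; simpl; unfold mult; simpl; ring).
  apply (is_RInt_const (V := R_NormedModule)). }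
destruct (Rle_lt_dec a b) as [H | H].
- rewrite Rabs_pos_eq by lra; apply A; [exact H |].
  intros t Ht; apply HM; rewrite Rmin_left, Rmax_right by lra; exact Ht.
- rewrite Rabs_left by lra; replace (- (b - a)) with (a - b) by ring.
  replace (integral g a b) with (RtoC (-1) *v integral g b a).
  + rewrite nrm_sc, Cmod_R, Rabs_left by lra; replace (- (-1)) with 1 by ring; rewrite Rmult_1_l;
    apply A; [lra |].
    intros t Ht; apply HM; rewrite Rmin_right, Rmax_left by lra; exact Ht.
  + assert (E := integral_chasles g a b a Hg); rewrite integral_point in E.
    transitivity ((RtoC (-1) *v integral g b a) +v (integral g a b +v integral g b a)).
    * rewrite E; vring.
    * vring.
Qed.

Definition has_deriv F t (d : X) := forall eps, 0 < eps -> exists delta, 0 < delta /\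
  forall s, Rabs (s - t) < delta -> nrm (F s -v F t -v RtoC (s - t) *v d) <= eps * Rabs (s - t).

Lemma has_deriv_is_derive F t d : has_deriv F t d <-> is_derive (V := realify X) F t d.
Proof.
split.
- intros H; split.
  + apply (is_linear_scal_l (K := R_AbsRing) (V := realify X)).
  + intros x Hx.
    apply (is_filter_lim_locally_unique (V := AbsRing_NormedModule R_AbsRing)) in Hx; subst x.
    intros eps; destruct (H eps (cond_pos eps)) as [d' [Hd Hs]].
    exists (mkposreal d' Hd); intros s Hb; exact (Hs s Hb).
- intros [_ H] eps He.
  destruct (H t (fun P HP => HP) (mkposreal eps He)) as [d' Hd].
  exists d'; split; [apply cond_pos | intros s Hs; exact (Hd s Hs)].
Qed.

Lemma has_deriv_cont F t d : has_deriv F t d -> cont_at F t.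
Proof.
intros H; apply cont_at_continuous.
apply (ex_derive_continuous (K := R_AbsRing) (V := realify X)).
exists d; now apply has_deriv_is_derive.
Qed.

Lemma ftc F g a b : (forall t, has_deriv F t (g t)) -> (forall t, cont_at g t) ->
  integral g a b = F b -v F a.
Proof.
intros HF Hg; apply integral_unique.
apply (is_RInt_derive (V := realify X) F g).
- intros x _; apply has_deriv_is_derive, HF.
- intros x _; apply cont_at_continuous, Hg.
Qed.

Lemma integral_deriv g a t : (forall s, cont_at g s) -> has_deriv (fun t => integral g a t) t (g t).
Proof.
intros Hg eps He.
destruct (Hg t eps He) as [d [Hd Hs]]; exists d; split; [exact Hd |]; intros s Hst.
replace (integral g a s -v integral g a t) with (integral g t s)
  by (rewrite <- (integral_chasles g a t s Hg); vring).
assert (Hc : forall s, cont_at (fun _ : R => RtoC (-1) *v g t) s) by (intros; apply cont_at_const).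
assert (E : integral g t s -v RtoC (s - t) *v g t = integral (fun r => RtoC (-1) *v g t +v g r) t
  s).
{ rewrite (integral_ext (fun r => RtoC (-1) *v g t +v g r) (fun r => RtoC 1 *v (RtoC (-1) *v g t)
  +v g r)) by (intros; vring).
  rewrite (integral_comb (RtoC 1) (fun _ => RtoC (-1) *v g t) g t s Hc Hg).
  assert (Ec : integral (fun _ : R => RtoC (-1) *v g t) t s = RtoC (s - t) *v (RtoC (-1) *v g t)).
  { apply integral_unique, (is_RInt_const (V := realify X)). }
  rewrite Ec; vring. }
rewrite E; apply integral_bound.
- intros r; apply cont_at_comb; [apply cont_at_const | apply Hg].
- intros r Hr; replace (RtoC (-1) *v g t +v g r) with (g r -v g t)
    by (vring).
  apply Hs; apply Rle_lt_trans with (2 := Hst).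
  unfold Rmin, Rmax in Hr; unfold Rabs; destruct (Rle_dec t s), (Rcase_abs (r - t)),
    (Rcase_abs (s - t)); lra.
Qed.

Definition cderiv (c : R -> C) t (d : C) := forall eps, 0 < eps -> exists delta, 0 < delta /\
  forall s, Rabs (s - t) < delta -> Cmod (Cminus (Cminus (c s) (c t))
    (Cmult (RtoC (s - t)) d)) <= eps * Rabs (s - t).

(** The product rule with one scalar factor; [K] below collects the coefficients of all error terms
    once [|s - t| <= e <= 1]. *)
Lemma has_deriv_scal (c : R -> C) (c' : C) F t d :
  cderiv c t c' -> has_deriv F t d ->
  has_deriv (fun s => c s *v F s) t (c' *v F t +v c t *v d).
Proof.
intros Hc HF eps He.
set (K := nrm (F t) + Cmod (c t) + Cmod c' * nrm d + Cmod c' + nrm d + 2).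
assert (P1 := nrm_ge0 (F t)); assert (P2 := Cmod_ge_0 (c t)).
assert (P3 := nrm_ge0 d); assert (P4 := Cmod_ge_0 c').
assert (P5 : 0 <= Cmod c' * nrm d) by now apply Rmult_le_pos.
assert (HK : 0 < K) by (unfold K; lra).
set (e := Rmin 1 (eps / K)).
assert (He1 : 0 < e) by (apply Rmin_pos; [lra | now apply Rdiv_lt_0_compat]).
assert (He2 : e <= 1) by apply Rmin_l.
assert (He3 : e * K <= eps).
{ apply Rle_trans with (eps / K * K); [apply Rmult_le_compat_r; [lra | apply Rmin_r] | right;
  field; lra]. }
destruct (Hc e He1) as [d1 [D1 H1]]; destruct (HF e He1) as [d2 [D2 H2]].
exists (Rmin (Rmin d1 d2) e); split; [apply Rmin_pos; [apply Rmin_pos|]; assumption |].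
intros s Hs.
assert (Hs1 : Rabs (s - t) < d1).
{ apply Rlt_le_trans with (1 := Hs), Rle_trans with (1 := Rmin_l _ _), Rmin_l. }
assert (Hs2 : Rabs (s - t) < d2).
{ apply Rlt_le_trans with (1 := Hs), Rle_trans with (1 := Rmin_l _ _), Rmin_r. }
assert (Hs3 : Rabs (s - t) <= e).
{ left; apply Rlt_le_trans with (1 := Hs), Rmin_r. }
specialize (H1 s Hs1); specialize (H2 s Hs2).
set (hh := Rabs (s - t)) in *; assert (Hh : 0 <= hh) by apply Rabs_pos.
set (r1 := Cminus (Cminus (c s) (c t)) (Cmult (RtoC (s - t)) c')) in *.
set (r2 := F s -v F t -v RtoC (s - t) *v d) in *.
assert (Ec : Cminus (c s) (c t) = Cplus r1 (Cmult (RtoC (s - t)) c')) by (unfold r1; ring).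
assert (E : c s *v F s -v c t *v F t -v RtoC (s - t) *v (c' *v F t +v c t *v d) =
  r1 *v F t +v (c t *v r2 +v (Cminus (c s) (c t)) *v (r2 +v RtoC (s - t) *v d))).
{ unfold r1, r2; vring. }
rewrite E; clear E.
assert (Hcs : Cmod (Cminus (c s) (c t)) <= hh * (1 + Cmod c')).
{ rewrite Ec; apply Rle_trans with (1 := Cmod_triangle _ _).
  rewrite Cmod_mult, Cmod_R; fold hh; nra. }
assert (Hrs : nrm (r2 +v RtoC (s - t) *v d) <= hh * (1 + nrm d)).
{ apply Rle_trans with (1 := nrm_add _ _); rewrite nrm_sc, Cmod_R; fold hh; nra. }
apply Rle_trans with (1 := nrm_add _ _).
assert (A := nrm_add (c t *v r2) ((Cminus (c s) (c t)) *v (r2 +v RtoC (s - t) *v d))).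
rewrite !nrm_sc in *.
assert (A1 : Cmod r1 * nrm (F t) <= e * hh * nrm (F t)) by (apply Rmult_le_compat_r; auto).
assert (A2 : Cmod (c t) * nrm r2 <= Cmod (c t) * (e * hh)) by (apply Rmult_le_compat_l; auto).
assert (A3 : Cmod (Cminus (c s) (c t)) * nrm (r2 +v RtoC (s - t) *v d) <= (hh * (1 + Cmod c')) *
  (hh * (1 + nrm d))).
{ apply Rmult_le_compat; auto; [apply Cmod_ge_0 | apply nrm_ge0]. }
assert (A4 : (hh * (1 + Cmod c')) * (hh * (1 + nrm d)) <= e * hh * ((1 + Cmod c') * (1 + nrm d))).
{ replace ((hh * (1 + Cmod c')) * (hh * (1 + nrm d))) with (hh * hh * ((1 + Cmod c') * (1 + nrm
  d))) by ring.
  apply Rmult_le_compat_r; [apply Rmult_le_pos; lra |]; apply Rmult_le_compat_r; lra. }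
assert (A5 : e * hh * K <= eps * hh).
{ replace (e * hh * K) with (e * K * hh) by ring; now apply Rmult_le_compat_r. }
apply Rle_trans with (2 := A5); unfold K.
assert (0 <= e * hh) by (apply Rmult_le_pos; lra).
nra.
Qed.

Lemma has_deriv_comb c F G t d d' : has_deriv F t d -> has_deriv G t d' ->
  has_deriv (fun s => c *v F s +v G s) t (c *v d +v d').
Proof.
intros HF HG eps He.
assert (Hc := Cmod_ge_0 c).
assert (He' : 0 < eps / (Cmod c + 1)) by (apply Rdiv_lt_0_compat; lra).
destruct (HF _ He') as [d1 [D1 H1]]; destruct (HG _ He') as [d2 [D2 H2]].
exists (Rmin d1 d2); split; [now apply Rmin_pos |]; intros s Hs.
specialize (H1 s (Rlt_le_trans _ _ _ Hs (Rmin_l _ _))).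
specialize (H2 s (Rlt_le_trans _ _ _ Hs (Rmin_r _ _))).
set (r1 := F s -v F t -v RtoC (s - t) *v d) in *.
set (r2 := G s -v G t -v RtoC (s - t) *v d') in *.
replace (c *v F s +v G s -v (c *v F t +v G t) -v RtoC (s - t) *v (c *v d +v d'))
  with (c *v r1 +v r2) by (unfold r1, r2; vring).
apply Rle_trans with (1 := nrm_add _ _); rewrite nrm_sc.
set (hh := Rabs (s - t)) in *.
assert (Cmod c * nrm r1 <= Cmod c * (eps / (Cmod c + 1) * hh)) by now apply Rmult_le_compat_l.
replace (eps * hh) with (Cmod c * (eps / (Cmod c + 1) * hh) + eps / (Cmod c + 1) * hh) by (field;
  lra).
lra.
Qed.

Lemma has_deriv_shift F a t d : has_deriv F (a + t) d -> has_deriv (fun s => F (a + s)) t d.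
Proof.
intros H eps He; destruct (H eps He) as [d1 [D1 H1]]; exists d1; split; [exact D1 |].
intros s Hs; specialize (H1 (a + s)).
replace (a + s - (a + t)) with (s - t) in H1 by ring; auto.
Qed.

Lemma cderiv_pair (c1 c2 d1 d2 : R -> R) t :
  is_derive c1 t (d1 t) -> is_derive c2 t (d2 t) ->
  cderiv (fun s => (c1 s, c2 s)) t (d1 t, d2 t).
Proof.
intros H1 H2 eps He.
apply is_derive_Reals in H1; apply is_derive_Reals in H2.
destruct (H1 (eps / 2)) as [e1 E1]; [lra |].
destruct (H2 (eps / 2)) as [e2 E2]; [lra |].
exists (Rmin e1 e2); split; [apply Rmin_pos; apply cond_pos |].
intros s Hs.
assert (B : forall (c : R -> R) (d : R) (e : posreal), (forall z : R,
  z <> 0 -> Rabs z < pos e -> Rabs ((c (t + z) - c t) / z - d) < eps / 2) ->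
   Rabs (s - t) < e -> Rabs (c s - c t - (s - t) * d) <= eps / 2 * Rabs (s - t)).
{ intros c d e H Hse; destruct (Req_dec s t) as [-> | Hne].
  - rewrite !Rminus_diag, Rmult_0_l, Rminus_0_r, Rabs_R0; lra.
  - assert (Hn0 : s - t <> 0) by lra.
    specialize (H (s - t) Hn0 Hse); replace (t + (s - t)) with s in H by ring.
    replace (c s - c t - (s - t) * d) with (((c s - c t) / (s - t) - d) * (s - t)) by (field; lra).
    rewrite Rabs_mult; apply Rmult_le_compat_r; [apply Rabs_pos | lra]. }
assert (B1 := B c1 (d1 t) e1 E1 (Rlt_le_trans _ _ _ Hs (Rmin_l _ _))).
assert (B2 := B c2 (d2 t) e2 E2 (Rlt_le_trans _ _ _ Hs (Rmin_r _ _))).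
replace (Cminus (Cminus (c1 s, c2 s) (c1 t, c2 t)) (Cmult (RtoC (s - t)) (d1 t, d2 t))) with
  (Cplus (RtoC (c1 s - c1 t - (s - t) * d1 t)) (Cmult Ci (RtoC (c2 s - c2 t - (s - t) * d2 t)))).
- apply Rle_trans with (1 := Cmod_triangle _ _); rewrite Cmod_mult, Cmod_Ci, !Cmod_R; lra.
- unfold Cminus, Cplus, Copp, Cmult, Ci, RtoC; simpl; f_equal; ring.
Qed.

Lemma cderiv_Cexp (l : C) t : cderiv (fun s => Cexp (Cmult l (RtoC s))) t (Cmult l (Cexp (Cmult l
  (RtoC t)))).
Proof.
destruct l as [p q].
assert (H := cderiv_pair (fun s => exp (p * s) * cos (q * s)) (fun s => exp (p * s) * sin (q * s))
  (fun s => p * (exp (p * s) * cos (q * s)) - q * (exp (p * s) * sin (q * s)))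
  (fun s => p * (exp (p * s) * sin (q * s)) + q * (exp (p * s) * cos (q * s))) t).
assert (Ef : forall s, Cexp (Cmult (p, q) (RtoC s)) = (exp (p * s) * cos (q * s),
  exp (p * s) * sin (q * s))).
{ intros s; unfold Cexp, Re, Im, Cmult, RtoC; simpl.
  now replace (p * s - q * 0) with (p * s) by ring; replace (p * 0 + q * s) with (q * s) by ring. }
replace (fun s => Cexp (Cmult (p, q) (RtoC s))) with (fun s => (exp (p * s) * cos (q * s),
  exp (p * s) * sin (q * s)) : C)
  by (apply functional_extensionality; intros; now rewrite Ef).
rewrite Ef; unfold Cmult at 1; simpl.
apply H; auto_derive; auto; ring.
Qed.

Definition kern (l : C) g (s : R) : X := Cexp (- (l * RtoC s))%C *v g s.

Lemma kern_alt l g s : kern l g s = Cexp ((- l) * RtoC s)%C *v g s.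
Proof. unfold kern; f_equal; f_equal; ring. Qed.

Definition ccont (c : R -> C) t := forall eps, 0 < eps -> exists delta, 0 < delta /\
  forall s, Rabs (s - t) < delta -> Cmod (Cminus (c s) (c t)) <= eps.

Lemma cderiv_ccont c t d : cderiv c t d -> ccont c t.
Proof.
intros H eps He; assert (P := Cmod_ge_0 d).
destruct (H 1 Rlt_0_1) as [d1 [D1 H1]].
assert (He4 : 0 < eps / (Cmod d + 1)) by (apply Rdiv_lt_0_compat; lra).
exists (Rmin d1 (eps / (Cmod d + 1))); split; [now apply Rmin_pos |].
intros s Hs; specialize (H1 s (Rlt_le_trans _ _ _ Hs (Rmin_l _ _))).
assert (Hs3 := Rlt_le_trans _ _ _ Hs (Rmin_r _ _)).
replace (Cminus (c s) (c t)) with (Cplus (Cminus (Cminus (c s) (c t)) (Cmult (RtoC (s - t)) d))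
  (Cmult (RtoC (s - t)) d)) by ring.
apply Rle_trans with (1 := Cmod_triangle _ _); rewrite Cmod_mult, Cmod_R.
apply Rle_trans with ((Cmod d + 1) * (eps / (Cmod d + 1))); [| right; field; lra].
apply Rle_trans with ((Cmod d + 1) * Rabs (s - t)); [lra |].
apply Rmult_le_compat_l; lra.
Qed.

Lemma cont_at_scal (c : R -> C) g t : ccont c t -> cont_at g t -> cont_at (fun s => c s *v g s) t.
Proof.
intros Hc Hg eps He.
set (K := 1 + Cmod (c t) + nrm (g t) + 1).
assert (P1 := nrm_ge0 (g t)); assert (P2 := Cmod_ge_0 (c t)).
assert (HK : 0 < K) by (unfold K; lra).
set (e := Rmin 1 (eps / K)).
assert (He1 : 0 < e) by (apply Rmin_pos; [lra | now apply Rdiv_lt_0_compat]).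
assert (He2 : e <= 1) by apply Rmin_l.
assert (He3 : e * K <= eps).
{ apply Rle_trans with (eps / K * K); [apply Rmult_le_compat_r; [lra | apply Rmin_r] | right;
  field; lra]. }
destruct (Hc e He1) as [d1 [D1 H1]]; destruct (Hg e He1) as [d2 [D2 H2]].
exists (Rmin d1 d2); split; [now apply Rmin_pos |].
intros s Hs.
specialize (H1 s (Rlt_le_trans _ _ _ Hs (Rmin_l _ _))).
specialize (H2 s (Rlt_le_trans _ _ _ Hs (Rmin_r _ _))).
replace (c s *v g s -v c t *v g t) with (c t *v (g s -v g t) +v (Cminus (c s)
  (c t)) *v ((g s -v g t) +v g t)) by vring.
apply Rle_trans with (1 := nrm_add _ _); rewrite !nrm_sc.
assert (A := nrm_add (g s -v g t) (g t)).
assert (Cmod (c t) * nrm (g s -v g t) <= Cmod (c t) * e) by (apply Rmult_le_compat_l; auto).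
assert (Cmod (Cminus (c s) (c t)) * nrm (g s -v g t +v g t) <= e * (1 + nrm (g t))).
{ apply Rmult_le_compat; [apply Cmod_ge_0 | apply nrm_ge0 | exact H1 | lra]. }
apply Rle_trans with (e * K); [unfold K; nra | lra].
Qed.

Lemma kern_cont l g : (forall t, cont_at g t) -> forall t, cont_at (kern l g) t.
Proof.
intros Hg t.
replace (kern l g) with (fun s => Cexp ((- l) * RtoC s)%C *v g s)
  by (apply functional_extensionality; intros; now rewrite kern_alt).
apply cont_at_scal; [| apply Hg]; eapply cderiv_ccont, cderiv_Cexp.
Qed.

Lemma nrm_kern l g s : nrm (kern l g s) = exp (- (Re l * s)) * nrm (g s).
Proof.
unfold kern; rewrite nrm_sc, Cmod_Cexp; f_equal; f_equal.
unfold Re; destruct l; simpl; ring.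
Qed.

(** An oriented integral: with [T] of the sign of [Re l] it tends to the Carleman transform in both
    half-planes, since minus the integral over the negative half-line is the integral from 0 to
    minus infinity. Hence the condition [0 <= Re l * T] throughout. *)
Definition ltr l T g : X := integral (kern l g) 0 T.

Lemma kern_int_bound l g M T1 T2 : (forall t, cont_at g t) -> bdd g M -> Re l <> 0 -> T1 <= T2 ->
  nrm (integral (kern l g) T1 T2) <= M * (exp (- (Re l * T1)) - exp (- (Re l * T2))) / Re l.
Proof.
intros Hg HM Hl HT.
apply (integral_bound_fun _ (fun s => M * exp (- (Re l * s))));
  [now apply kern_cont | exact HT | |].
- intros t _; rewrite nrm_kern, Rmult_comm; apply Rmult_le_compat_r; [left;
  apply exp_pos | apply HM].
- replace (M * (exp (- (Re l * T1)) - exp (- (Re l * T2))) / Re l)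
    with (minus (- M * exp (- (Re l * T2)) / Re l) (- M * exp (- (Re l * T1)) / Re l))
    by (unfold minus, plus, opp; simpl; field; auto).
  apply (is_RInt_derive (V := R_CompleteNormedModule) (fun s => - M * exp (- (Re l * s)) / Re l)).
  + intros s _; auto_derive; auto; field; auto.
  + intros s _; apply (ex_derive_continuous (K := R_AbsRing) (V := R_NormedModule)); auto_derive;
    auto.
Qed.

Lemma ltr_diff l g M T T' : (forall t, cont_at g t) -> bdd g M -> Re l <> 0 ->
  0 <= Re l * T -> Re l * T <= Re l * T' ->
  nrm (ltr l T g -v ltr l T' g) <= M * exp (- (Re l * T)) / Rabs (Re l).
Proof.
intros Hg HM Hl HT HT'.
assert (HM0 := bdd_ge0 _ _ HM).
assert (He := exp_pos (- (Re l * T'))).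
assert (E : ltr l T' g -v ltr l T g = integral (kern l g) T T').
{ unfold ltr; rewrite <- (integral_chasles (kern l g) 0 T T' (kern_cont l g Hg)); vring. }
destruct (Rlt_le_dec (Re l) 0) as [Hn | Hp].
- assert (H1 : T' <= T) by nra.
  assert (E2 : ltr l T g -v ltr l T' g = integral (kern l g) T' T).
  { unfold ltr; rewrite <- (integral_chasles (kern l g) 0 T' T (kern_cont l g Hg)); vring. }
  rewrite E2; apply Rle_trans with (1 := kern_int_bound l g M T' T Hg HM Hl H1).
  rewrite Rabs_left by exact Hn.
  replace (M * (exp (- (Re l * T')) - exp (- (Re l * T))) / Re l)
    with (M * (exp (- (Re l * T)) - exp (- (Re l * T'))) / - Re l) by (field; lra).
  apply Rmult_le_compat_r; [left; apply Rinv_0_lt_compat; lra |].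
  apply Rmult_le_compat_l; lra.
- assert (H1 : T <= T') by nra.
  rewrite nrm_sub_sym, E; apply Rle_trans with (1 := kern_int_bound l g M T T' Hg HM Hl H1).
  rewrite Rabs_pos_eq by exact Hp.
  apply Rmult_le_compat_r; [left; apply Rinv_0_lt_compat; lra |].
  apply Rmult_le_compat_l; lra.
Qed.

Lemma exp_decay_small a K eps : 0 < a -> 0 < eps -> exists n : nat, forall x,
  INR n <= x -> K * exp (- (a * x)) <= eps.
Proof.
intros Ha He.
assert (HK := Rabs_pos K).
destruct (nfloor_ex (Rabs K / (a * eps))) as [n Hn].
{ apply Rmult_le_pos; [exact HK | left; apply Rinv_0_lt_compat; nra]. }
exists (S n); intros x Hx; rewrite S_INR in Hx.
assert (Hx0 : 0 < x) by (assert (H := pos_INR n); lra).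
assert (Hax : 0 < a * x) by nra.
assert (Hexp : 1 + a * x < exp (a * x)) by (apply exp_ineq1; lra).
rewrite exp_Ropp.
apply Rle_trans with (Rabs K * / exp (a * x)).
{ apply Rmult_le_compat_r; [left; apply Rinv_0_lt_compat, exp_pos | apply Rle_abs]. }
apply Rmult_le_reg_r with (exp (a * x)); [apply exp_pos |].
rewrite Rmult_assoc, Rinv_l, Rmult_1_r by (apply Rgt_not_eq, exp_pos).
assert (Rabs K <= a * eps * x).
{ replace (Rabs K) with (a * eps * (Rabs K / (a * eps))) by (field; split; lra).
  apply Rmult_le_compat_l; [nra | lra]. }
nra.
Qed.

(** Identifies the limit of the truncations with the improper integral and records the exponential
    rate, through which all later facts on the transform are obtained. *)
Lemma lap_spec l g M : (forall t, cont_at g t) -> bdd g M -> Re l <> 0 ->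
  forall T, 0 <= Re l * T -> nrm (laplace g l -v ltr l T g) <= M * exp (- (Re l * T)) / Rabs (Re l).
Proof.
intros Hg HM Hl.
assert (HM0 := bdd_ge0 _ _ HM).
set (a := Rabs (Re l)).
assert (Ha : 0 < a) by now apply Rabs_pos_lt.
(* [sg] is the sign of [Re l]; truncating at [sg * n] lets one sequence serve both half-planes. *)
pose (sg := Re l / a).
assert (Hsg : Re l * sg = a).
{ unfold sg, a, Rabs; destruct (Rcase_abs (Re l)); field; lra. }
destruct (complete_limit (fun n => ltr l (sg * INR n) g) (fun n => M * exp (- (a * INR n)) / a))
  as [v Hv].
- intros n m Hnm; rewrite <- Hsg, Rmult_assoc at 1.
  replace (M * exp (- (Re l * (sg * INR n))) / a) with (M * exp (- (Re l * (sg * INR n))) / Rabs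
    (Re l)) by easy.
  apply (ltr_diff l g M); auto.
  + rewrite <- Rmult_assoc, Hsg; apply Rmult_le_pos; [lra | apply pos_INR].
  + rewrite <- !Rmult_assoc, Hsg; apply Rmult_le_compat_l; [lra | now apply le_INR].
- intros eps He; destruct (exp_decay_small a (M / a) eps Ha He) as [n Hn].
  exists n; intros m Hm; replace (M * exp (- (a * INR m)) / a) with (M / a * exp (- (a * INR m)))
    by (field; lra).
  now apply Hn, le_INR.
- assert (Hall : forall T, 0 <= Re l * T -> nrm (v -v ltr l T g) <= M * exp (- (Re l * T)) / a).
  { intros T HT; apply Rnot_lt_le; intros Hlt.
    set (d := nrm (v -v ltr l T g) - M * exp (- (Re l * T)) / a) in *.
    assert (Hd : 0 < d / 2) by (unfold d; lra).
    destruct (exp_decay_small a (M / a) (d / 2) Ha Hd) as [n Hn].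
    destruct (nfloor_ex (Re l * T / a)) as [k Hk].
    { apply Rmult_le_pos; [exact HT | left; now apply Rinv_0_lt_compat]. }
    set (m := (n + S k)%nat).
    assert (Hm : INR n <= INR m) by (apply le_INR; lia).
    assert (Hk2 : INR (S k) <= INR m) by (apply le_INR; lia); rewrite S_INR in Hk2.
    assert (B1 := Hv m); cbv beta in B1.
    replace (M * exp (- (a * INR m)) / a) with (M / a * exp (- (a * INR m))) in B1 by (field; lra).
    specialize (Hn _ Hm).
    assert (B2 : nrm (ltr l T g -v ltr l (sg * INR m) g) <= M * exp (- (Re l * T)) / Rabs (Re l)).
    { apply ltr_diff; auto.
      rewrite <- Rmult_assoc, Hsg.
      apply Rle_trans with (a * (Re l * T / a)); [right; field; lra | apply Rmult_le_compat_l;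
        lra]. }
    fold a in B2.
    assert (B3 := nrm_sub_tri v (ltr l (sg * INR m) g) (ltr l T g)).
    rewrite (nrm_sub_sym v (ltr l (sg * INR m) g)), (nrm_sub_sym (ltr l (sg * INR m) g)
      (ltr l T g)) in B3.
    unfold d in *; lra. }
  assert (Hlap : laplace g l = v).
  { unfold laplace; fold (kern l g).
    assert (Hfil : forall P : X -> Prop, locally v P -> exists K, 0 <= K /\ forall T,
      0 <= Re l * T -> K <= a * Rabs T -> P (ltr l T g)).
    { intros P [eps HP].
      assert (He := cond_pos eps).
      destruct (exp_decay_small a (M / a) (eps / 2) Ha ltac:(lra)) as [n Hn].
      exists (a * INR n); split; [apply Rmult_le_pos; [lra | apply pos_INR] |].
      intros T HT HaT; apply HP, ball_of_nrm; rewrite nrm_sub_sym.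
      assert (B := Hall T HT).
      assert (Hab : Re l * T = a * Rabs T).
      { unfold a; rewrite <- Rabs_mult; symmetry; now apply Rabs_pos_eq. }
      rewrite Hab in B.
      replace (M * exp (- (a * Rabs T)) / a) with (M / a * exp (- (a * Rabs T))) in B by (field;
        lra).
      assert (HT2 : INR n <= Rabs T) by (apply Rmult_le_reg_l with a; auto).
      specialize (Hn _ HT2); lra. }
    destruct (Rlt_dec 0 (Re l)) as [Hp | Hn].
    - unfold integral_gen; apply (is_RInt_gen_unique (V := realify X)).
      intros P HP; destruct (Hfil P HP) as [K [K0 HK]].
      exists (fun x => x = 0) (fun x => K / a < x).
      + reflexivity.
      + now exists (K / a).
      + intros x y -> Hy; simpl; exists (ltr l y g); split; [apply is_int; now apply kern_cont |].
        assert (Hy0 : 0 < y) by (apply Rle_lt_trans with (2 := Hy), Rmult_le_pos;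
          [exact K0 | left; now apply Rinv_0_lt_compat]).
        apply HK; [nra |]; rewrite Rabs_pos_eq by lra.
        apply Rle_trans with (a * (K / a)); [right; field; lra | apply Rmult_le_compat_l; lra].
    - assert (Hneg : Re l < 0) by lra.
      assert (E : integral_gen (kern l g) (Rbar_locally m_infty) (at_point 0) = RtoC (-1) *v v).
      { unfold integral_gen; apply (is_RInt_gen_unique (V := realify X)).
        intros P HP.
        assert (HP' : locally v (fun z => P (RtoC (-1) *v z))).
        { exact (filterlim_scal_r (K := C_AbsRing) (V := X) (RtoC (-1)) v P HP). }
        destruct (Hfil _ HP') as [K [K0 HK]].
        exists (fun x => x < - (K / a)) (fun x => x = 0).
        + now exists (- (K / a)).
        + reflexivity.
        + intros x y Hx ->; simpl; exists (RtoC (-1) *v ltr l x g); split.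
          * replace (RtoC (-1) *v ltr l x g) with (integral (kern l g) x 0); [apply is_int;
            now apply kern_cont |].
            assert (Ech := integral_chasles (kern l g) x 0 x (kern_cont l g Hg)).
            rewrite integral_point in Ech; unfold ltr.
            transitivity (integral (kern l g) x 0 +v RtoC (-1) *v (integral (kern l g) x 0 +v
              integral (kern l g) 0 x)).
            -- rewrite Ech; vring.
            -- vring.
          * assert (Hx0 : x < 0).
            { apply Rlt_le_trans with (1 := Hx).
              assert (0 <= K / a) by (apply Rmult_le_pos; [exact K0 | left;
                now apply Rinv_0_lt_compat]); lra. }
            apply HK; [nra |]; rewrite Rabs_left by exact Hx0.
            apply Rle_trans with (a * (K / a)); [right; field; lra | apply Rmult_le_compat_l;
              lra]. }
      transitivity (RtoC (-1) *v (integral_gen (kern l g) (Rbar_locally m_infty) (at_point 0))).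
      + change (opp (integral_gen (kern l g) (Rbar_locally m_infty) (at_point 0)) =
          scal (opp one : C_AbsRing) (integral_gen (kern l g) (Rbar_locally m_infty)
            (at_point 0))) || idtac.
        assert (Ev := scal_opp_one (V := X) (integral_gen (kern l g) (Rbar_locally m_infty)
          (at_point 0))).
        change (RtoC (-1)) with (RtoC (- (1))); rewrite RtoC_opp; symmetry; exact Ev.
      + rewrite E; vring. }
  rewrite Hlap; exact Hall.
Qed.

End Calculus.

(** * Riemann sums of Lipschitz functions and an exchange of integrals *)

Section RiemannSums.
Context {X : CompleteNormedModule C_AbsRing}.
Implicit Types (g h G : R -> X).

Definition lips G K := forall s t, nrm (G s -v G t) <= K * Rabs (s - t).

Lemma lips_cont G K t : lips G K -> cont_at G t.
Proof.
intros H eps He; assert (HK := Rabs_pos K).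
exists (eps / (Rabs K + 1)); split; [apply Rdiv_lt_0_compat; lra |]; intros s Hs.
apply Rle_trans with (1 := H s t).
apply Rle_trans with ((Rabs K + 1) * (eps / (Rabs K + 1))); [| right; field; lra].
assert (H1 := Rle_abs K); assert (H2 := Rabs_pos (s - t)).
apply Rle_trans with ((Rabs K + 1) * Rabs (s - t)); [apply Rmult_le_compat_r; lra |].
apply Rmult_le_compat_l; lra.
Qed.

Lemma integral_const (x : X) a b : integral (fun _ => x) a b = RtoC (b - a) *v x.
Proof. apply integral_unique, (is_RInt_const (V := realify X)). Qed.

Lemma integral_approx g x a b e : (forall s, cont_at g s) ->
  (forall s, Rmin a b <= s <= Rmax a b -> nrm (g s -v x) <= e) ->
  nrm (integral g a b -v RtoC (b - a) *v x) <= e * Rabs (b - a).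
Proof.
intros Hg He.
assert (E : integral g a b -v RtoC (b - a) *v x = integral (fun r => RtoC (-1) *v x +v g r) a b).
{ rewrite (integral_comb (RtoC (-1)) (fun _ => x) g a b (fun s => cont_at_const x s) Hg),
  integral_const; vring. }
rewrite E; apply integral_bound.
- intros r; apply cont_at_comb; [apply cont_at_const | apply Hg].
- intros r Hr; replace (RtoC (-1) *v x +v g r) with (g r -v x) by vring; auto.
Qed.

Fixpoint rsum G a d (n : nat) : X :=
  match n with
  | O => v0
  | S n => rsum G a d n +v RtoC d *v G (a + INR n * d)
  end.

Lemma rsum_error G K a d n : lips G K -> 0 <= K -> 0 <= d ->
  nrm (integral G a (a + INR n * d) -v rsum G a d n) <= INR n * (K * d * d).
Proof.
intros HG HK Hd; assert (Gc := fun t => lips_cont G K t HG).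
induction n as [|n IH].
- simpl INR; rewrite Rmult_0_l, Rplus_0_r, integral_point; cbn [rsum].
  replace (v0 -v v0) with (v0 : X) by vring; rewrite nrm_0; lra.
- set (x := a + INR n * d) in *.
  replace (a + INR (S n) * d) with (x + d) by (rewrite S_INR; unfold x; ring).
  rewrite <- (integral_chasles G a x (x + d) Gc); cbn [rsum]; fold x.
  replace (integral G a x +v integral G x (x + d) -v (rsum G a d n +v RtoC d *v G x)) with
    ((integral G a x -v rsum G a d n) +v (integral G x (x + d) -v RtoC (x + d - x) *v G x))
    by (replace (x + d - x) with d by ring; vring).
  apply Rle_trans with (1 := nrm_add _ _).
  assert (A : nrm (integral G x (x + d) -v RtoC (x + d - x) *v G x) <= K * d * Rabs (x + d - x)).
  { apply integral_approx; [exact Gc |]; intros s Hs.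
    rewrite Rmin_left, Rmax_right in Hs by lra.
    apply Rle_trans with (1 := HG s x); apply Rmult_le_compat_l; [exact HK |].
    rewrite Rabs_pos_eq; lra. }
  replace (x + d - x) with d in A at 2 by ring; rewrite (Rabs_pos_eq d) in A by exact Hd.
  rewrite S_INR; lra.
Qed.

End RiemannSums.

Lemma integral_RtoC (f : R -> R) a b I : is_RInt f a b I ->
  integral (X := C_CompleteNormedModule) (fun t => RtoC (f t)) a b = RtoC I.
Proof.
intros H; apply (integral_unique (X := C_CompleteNormedModule)).
apply (is_RInt_linear R_NormedModule (realify C_CompleteNormedModule) (fun x : R => RtoC x));
  [| | | exact H].
- intros x y; exact (RtoC_plus x y).
- intros k x; exact (RtoC_mult k x).
- intros P [eps HP]; exists eps; intros y Hy; apply HP.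
  split; [exact Hy | apply ball_center].
Qed.

Section Fubini.
Context {X : CompleteNormedModule C_AbsRing}.
Variables (c : R -> R -> R) (h : R -> X) (ci : R -> R).
Variables (a b p q K M : R).
Hypothesis Hab : a <= b.
Hypothesis Hpq : p <= q.
Hypothesis HK : 0 <= K.
Hypothesis Hh : forall t, cont_at h t.
Hypothesis HM : bdd h M.
Hypothesis Hc1 : forall x y e, p <= e <= q -> Rabs (c x e - c y e) <= K * Rabs (x - y).
Hypothesis Hc2 : forall x, exists k, forall e e', Rabs (c x e - c x e') <= k * Rabs (e - e').
Hypothesis Hci : forall e, is_RInt (fun x => c x e) a b (ci e).
Hypothesis Hci2 : exists k, forall e e', Rabs (ci e - ci e') <= k * Rabs (e - e').

Lemma ccont_lips (u : R -> R) k t : (forall e e', Rabs (u e - u e') <= k * Rabs (e - e')) ->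
  ccont (fun e => RtoC (u e)) t.
Proof.
intros H.
assert (L : lips (X := C_CompleteNormedModule) (fun e => RtoC (u e)) k).
{ intros s r; change (Cmod (Cminus (RtoC (u s)) (RtoC (u r))) <= k * Rabs (s - r)).
  rewrite <- RtoC_minus, Cmod_R; apply H. }
exact (lips_cont _ k t L).
Qed.

Let Fc x t : cont_at (fun e => RtoC (c x e) *v h e) t.
Proof.
destruct (Hc2 x) as [k Hk]; apply cont_at_scal; [| apply Hh].
exact (ccont_lips (c x) k t Hk).
Qed.

Let G (x : R) : X := integral (fun e => RtoC (c x e) *v h e) p q.

Lemma fubini_lips : lips G (K * M * (q - p)).
Proof.
intros x y; unfold G.
assert (HM0 := bdd_ge0 _ _ HM).
assert (E : integral (fun e => RtoC (c x e) *v h e) p q -v integral (fun e => RtoC (c y e) *v h e)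
  p q =
   integral (fun e => RtoC (-1) *v (RtoC (c y e) *v h e) +v RtoC (c x e) *v h e) p q).
{ rewrite (integral_comb (RtoC (-1)) (fun e => RtoC (c y e) *v h e)
  (fun e => RtoC (c x e) *v h e) p q (Fc y) (Fc x)).
  vring. }
rewrite E; clear E.
apply Rle_trans with ((K * Rabs (x - y) * M) * Rabs (q - p)).
- apply integral_bound; [intros t; now apply cont_at_comb |].
  intros e He; rewrite Rmin_left, Rmax_right in He by lra.
  replace (RtoC (-1) *v (RtoC (c y e) *v h e) +v RtoC (c x e) *v h e) with (RtoC (c x e - c y e)
    *v h e) by vring.
  rewrite nrm_sc, Cmod_R; apply Rmult_le_compat; auto using Rabs_pos, nrm_ge0.
- rewrite (Rabs_pos_eq (q - p)) by lra; right; ring.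
Qed.

(** A Riemann sum in [x] of the iterated integral is exactly the integral in [e] of the Riemann sums
    of [c]. Lipschitz bounds in [x] make both errors [O(1 / n)], uniformly in [e]. *)
Lemma fubini : integral G a b = integral (fun e => RtoC (ci e) *v h e) p q.
Proof.
assert (HM0 := bdd_ge0 _ _ HM).
destruct Hci2 as [kk Hkk].
assert (Cic : forall t, cont_at (fun e => RtoC (ci e) *v h e) t).
{ intros t; apply cont_at_scal; [exact (ccont_lips ci kk t Hkk) | apply Hh]. }
assert (Hs : forall d n, exists s : R -> R, (forall t, cont_at (fun e => RtoC (s e) *v h e) t) /\
   rsum G a d n = integral (fun e => RtoC (s e) *v h e) p q /\
   forall e, rsum (X := C_CompleteNormedModule) (fun x => RtoC (c x e)) a d n = RtoC (s e)).
{ intros d; induction n as [|n [s [S1 [S2 S3]]]].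
  - exists (fun _ => 0); repeat split.
    + intros t; apply (cont_at_scal (fun _ => RtoC 0)); [| apply Hh].
      apply (ccont_lips (fun _ => 0) 0); intros; rewrite Rminus_diag, Rabs_R0; lra.
    + cbn [rsum]; rewrite (integral_ext _ (fun _ => v0)) by (intros; vring).
      rewrite integral_const; vring.
  - exists (fun e => s e + d * c (a + INR n * d) e).
    assert (E : (fun e => RtoC (s e + d * c (a + INR n * d) e) *v h e) =
      (fun e => RtoC d *v (RtoC (c (a + INR n * d) e) *v h e) +v RtoC (s e) *v h e)).
    { apply functional_extensionality; intros e; vring. }
    rewrite E; repeat split.
    + intros t; apply cont_at_comb; [apply Fc | apply S1].
    + rewrite (integral_comb (RtoC d) _ _ p q (Fc _) S1), <- S2; cbn [rsum]; unfold G; vring.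
    + intros e; cbn [rsum]; rewrite S3.
      change (Cplus (RtoC (s e)) (Cmult (RtoC d) (RtoC (c (a + INR n * d) e))) = RtoC (s e + d * c
        (a + INR n * d) e)).
      now rewrite RtoC_plus, RtoC_mult. }
apply (eq_by_eps _ _ (K * M * (q - p) * (b - a) * (b - a) + K * (b - a) * (b - a) * M * (q - p))).
intros eps He.
destruct (inv_INR_small eps He) as [n [Hn1 Hn2]].
assert (Hn : 0 < INR n) by now apply lt_0_INR.
set (d := (b - a) / INR n).
assert (Hd : 0 <= d) by (apply Rmult_le_pos; [lra | left; now apply Rinv_0_lt_compat]).
assert (Hb : a + INR n * d = b) by (unfold d; field; lra).
destruct (Hs d n) as [s [S1 [S2 S3]]].
assert (A1 : nrm (integral G a b -v rsum G a d n) <= INR n * (K * M * (q - p) * d * d)).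
{ rewrite <- Hb at 1; apply rsum_error; [apply fubini_lips | | exact Hd].
  repeat apply Rmult_le_pos; lra. }
assert (A2 : nrm (integral (fun e => RtoC (s e) *v h e) p q -v integral (fun e => RtoC (ci e) *v h
  e) p q)
   <= INR n * (K * d * d) * M * Rabs (q - p)).
{ assert (E : integral (fun e => RtoC (s e) *v h e) p q -v integral (fun e => RtoC (ci e) *v h e)
  p q =
    integral (fun e => RtoC (-1) *v (RtoC (ci e) *v h e) +v RtoC (s e) *v h e) p q).
  { rewrite (integral_comb (RtoC (-1)) (fun e => RtoC (ci e) *v h e)
    (fun e => RtoC (s e) *v h e) p q Cic S1); vring. }
  rewrite E; apply integral_bound; [intros t; now apply cont_at_comb |].
  intros e Hepq; rewrite Rmin_left, Rmax_right in Hepq by lra.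
  replace (RtoC (-1) *v (RtoC (ci e) *v h e) +v RtoC (s e) *v h e) with (RtoC (s e - ci e) *v h e)
    by vring.
  rewrite nrm_sc, Cmod_R; apply Rmult_le_compat; auto using Rabs_pos, nrm_ge0.
  assert (L : lips (X := C_CompleteNormedModule) (fun x => RtoC (c x e)) K).
  { intros x y; change (Cmod (Cminus (RtoC (c x e)) (RtoC (c y e))) <= K * Rabs (x - y)).
    rewrite <- RtoC_minus, Cmod_R; now apply Hc1. }
  assert (B := rsum_error _ K a d n L HK Hd).
  rewrite Hb, (integral_RtoC _ a b (ci e) (Hci e)), S3 in B.
  change (Cmod (Cminus (RtoC (ci e)) (RtoC (s e))) <= INR n * (K * d * d)) in B.
  rewrite <- RtoC_minus, Cmod_R, Rabs_minus_sym in B; exact B. }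
rewrite <- S2 in A2.
assert (B := nrm_sub_tri (integral G a b) (rsum G a d n) (integral (fun e => RtoC (ci e) *v h e) p
  q)).
assert (Hdd : INR n * (d * d) <= (b - a) * (b - a) * eps).
{ replace (INR n * (d * d)) with ((b - a) * (b - a) * / INR n) by (unfold d; field; lra).
  apply Rmult_le_compat_l; [apply Rmult_le_pos; lra | exact Hn2]. }
rewrite (Rabs_pos_eq (q - p)) in A2 by lra.
replace (INR n * (K * M * (q - p) * d * d)) with (K * M * (q - p) * (INR n * (d * d))) in A1 by
  ring.
replace (INR n * (K * d * d) * M * (q - p)) with (K * M * (q - p) * (INR n * (d * d))) in A2 by
  ring.
assert (K * M * (q - p) * (INR n * (d * d)) <= K * M * (q - p) * ((b - a) * (b - a) * eps)).
{ apply Rmult_le_compat_l; [repeat apply Rmult_le_pos; lra | exact Hdd]. }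
lra.
Qed.

End Fubini.

(** * The Fejer kernel on the line *)

Lemma cos_lip x y : Rabs (cos x - cos y) <= Rabs (x - y).
Proof.
destruct (MVT_gen cos y x (fun x => - sin x)) as [d [_ Hd]].
- intros z _; auto_derive; auto; ring.
- intros z _; apply continuity_cos.
- rewrite Hd, Rabs_mult, Rabs_Ropp.
  assert (Hs : Rabs (sin d) <= 1) by (apply Rabs_le, SIN_bound).
  assert (H := Rabs_pos (x - y)); nra.
Qed.

Lemma sin_lip x y : Rabs (sin x - sin y) <= Rabs (x - y).
Proof.
destruct (MVT_gen sin y x cos) as [d [_ Hd]].
- intros z _; auto_derive; auto; ring.
- intros z _; apply continuity_sin.
- rewrite Hd, Rabs_mult.
  assert (Hs : Rabs (cos d) <= 1) by (apply Rabs_le, COS_bound).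
  assert (H := Rabs_pos (x - y)); nra.
Qed.

Lemma cis_lip x y : Cmod (Cminus (cis x) (cis y)) <= 2 * Rabs (x - y).
Proof.
replace (Cminus (cis x) (cis y)) with (Cplus (RtoC (cos x - cos y))
  (Cmult Ci (RtoC (sin x - sin y)))).
- apply Rle_trans with (1 := Cmod_triangle _ _); rewrite Cmod_mult, Cmod_Ci, !Cmod_R.
  assert (A := cos_lip x y); assert (B := sin_lip x y); lra.
- unfold cis, Cminus, Cplus, Copp, Cmult, Ci, RtoC; simpl; f_equal; ring.
Qed.

Lemma rint_ge0 f a b : a <= b -> (forall x, continuous f x) -> (forall x,
  0 <= f x) -> 0 <= rint f a b.
Proof.
intros H Hc Hf; apply RInt_ge_0; [exact H | now apply cont_ex_RInt | auto].
Qed.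

Lemma rint_le f g a b : a <= b -> (forall x, continuous f x) -> ex_RInt g a b ->
  (forall x, a < x < b -> f x <= g x) -> rint f a b <= rint g a b.
Proof.
intros H Hc Hg Hf; apply RInt_le; [exact H | now apply cont_ex_RInt | exact Hg | auto].
Qed.

Lemma rint_chasles f a b c : (forall x, continuous f x) -> rint f a b + rint f b c = rint f a c.
Proof. intros Hc; apply (RInt_Chasles f a b c); now apply cont_ex_RInt. Qed.

Lemma rint_correct f a b : (forall x, continuous f x) -> is_RInt f a b (rint f a b).
Proof. intros Hc; apply (RInt_correct (V := R_CompleteNormedModule)); now apply cont_ex_RInt. Qed.

Lemma rlip_continuous (f : R -> R) k x : (forall s t, Rabs (f s - f t) <= k * Rabs (s - t)) ->
  continuous f x.
Proof.
intros H P [eps HP].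
assert (Hk := Rabs_pos k); assert (He := cond_pos eps).
assert (Hd : 0 < eps / (Rabs k + 1)) by (apply Rdiv_lt_0_compat; lra).
exists (mkposreal _ Hd); intros y Hy; apply HP.
change (Rabs (y - x) < eps / (Rabs k + 1)) in Hy; change (Rabs (f y - f x) < eps).
apply Rle_lt_trans with (1 := H y x).
apply Rle_lt_trans with (Rabs k * Rabs (y - x)).
- apply Rmult_le_compat_r; [apply Rabs_pos | apply Rle_abs].
- apply Rle_lt_trans with (Rabs k * (eps / (Rabs k + 1))); [apply Rmult_le_compat_l; lra |].
  apply Rlt_le_trans with ((Rabs k + 1) * (eps / (Rabs k + 1))); [apply Rmult_lt_compat_r;
    lra | right; field; lra].
Qed.

Section FejerKernel.
Variable N : R.
Hypothesis HN : 1 <= N.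

Definition tri (x : R) := Rmax 0 (1 - Rabs x / N).

Lemma tri_bound x : 0 <= tri x <= 1.
Proof.
unfold tri; split; [apply Rmax_l |].
assert (0 <= Rabs x / N) by (apply Rmult_le_pos; [apply Rabs_pos | left; apply Rinv_0_lt_compat;
  lra]).
apply Rmax_lub; lra.
Qed.

Lemma tri_lip x y : Rabs (tri x - tri y) <= / N * Rabs (x - y).
Proof.
assert (H := Rabs_triang_inv2 x y).
assert (HN' : 0 < / N) by (apply Rinv_0_lt_compat; lra).
assert (A : Rabs (Rabs x / N - Rabs y / N) <= / N * Rabs (x - y)).
{ replace (Rabs x / N - Rabs y / N) with (/ N * (Rabs x - Rabs y)) by (unfold Rdiv; ring).
  rewrite Rabs_mult, (Rabs_pos_eq (/ N)) by lra; apply Rmult_le_compat_l; lra. }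
apply Rle_trans with (2 := A); unfold tri, Rmax.
set (u := Rabs x / N); set (v := Rabs y / N).
unfold Rabs; destruct (Rle_dec 0 (1 - u)), (Rle_dec 0 (1 - v)), (Rcase_abs _), (Rcase_abs _); lra.
Qed.

Lemma tri_arg x : tri x * Rabs x <= N.
Proof.
unfold tri, Rmax; destruct (Rle_dec 0 (1 - Rabs x / N)) as [H | H]; [| rewrite Rmult_0_l; lra].
assert (E : Rabs x = N * (Rabs x / N)) by (field; lra).
assert (P := Rabs_pos x).
assert (0 <= Rabs x / N) by (apply Rmult_le_pos; [apply Rabs_pos | left; apply Rinv_0_lt_compat;
  lra]).
set (u := Rabs x / N) in *; rewrite E; nra.
Qed.

(** The Fourier integral of the triangle over [[- N, N]], folded to [[0, N]] by evenness. *)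
Definition fker (s : R) := rint (fun x => 2 * tri x * cos (x * s)) 0 N.

Lemma fker_integrand_cont s x : continuous (fun x => 2 * tri x * cos (x * s)) x.
Proof.
apply (continuous_Rmult (fun x => 2 * tri x) (fun x => cos (x * s))).
- apply (continuous_Rmult (fun _ => 2) tri); [apply continuous_const | apply (rlip_continuous _ (/
  N)), tri_lip].
- apply (ex_derive_continuous (K := R_AbsRing) (V := R_NormedModule)); auto_derive; auto.
Qed.

Lemma fker_integrand_lip2 x s t :
  Rabs (2 * tri x * cos (x * s) - 2 * tri x * cos (x * t)) <= 2 * N * Rabs (s - t).
Proof.
replace (2 * tri x * cos (x * s) - 2 * tri x * cos (x * t)) with (2 * tri x * (cos (x * s) - cos
  (x * t))) by ring.
assert (T := tri_bound x); assert (A := tri_arg x); assert (L := cos_lip (x * s) (x * t)).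
replace (x * s - x * t) with (x * (s - t)) in L by ring; rewrite Rabs_mult in L.
rewrite Rabs_mult, Rabs_pos_eq by lra.
apply Rle_trans with (2 * tri x * (Rabs x * Rabs (s - t))).
- apply Rmult_le_compat_l; lra.
- replace (2 * tri x * (Rabs x * Rabs (s - t))) with (2 * (tri x * Rabs x) * Rabs (s - t)) by ring.
  apply Rmult_le_compat_r; [apply Rabs_pos | lra].
Qed.

Lemma fker_lip s t : Rabs (fker s - fker t) <= N * (2 * N) * Rabs (s - t).
Proof.
unfold fker.
assert (E : rint (fun x => 2 * tri x * cos (x * s)) 0 N - rint (fun x => 2 * tri x * cos (x * t))
  0 N =
  rint (fun x => 2 * tri x * cos (x * s) - 2 * tri x * cos (x * t)) 0 N).
{ symmetry; apply (RInt_minus (V := R_CompleteNormedModule)); apply cont_ex_RInt;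
  apply fker_integrand_cont. }
rewrite E.
replace (N * (2 * N) * Rabs (s - t)) with ((N - 0) * (2 * N * Rabs (s - t))) by ring.
apply RInt_abs_bound; [lra | |].
- apply cont_ex_RInt; intros x.
  apply (continuous_minus (fun x => 2 * tri x * cos (x * s)) (fun x => 2 * tri x * cos (x * t)));
    apply fker_integrand_cont.
- intros x _; apply fker_integrand_lip2.
Qed.

Lemma fker_cont s : continuous fker s.
Proof. apply (rlip_continuous _ (N * (2 * N))), fker_lip. Qed.

Lemma fker_even s : fker (- s) = fker s.
Proof.
apply rint_ext; intros x _; replace (x * - s) with (- (x * s)) by ring; now rewrite cos_neg.
Qed.

Lemma tri_in x : 0 <= x <= N -> tri x = 1 - x / N.
Proof.
intros H; unfold tri; rewrite Rabs_pos_eq by lra; apply Rmax_right.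
assert (x / N <= 1); [| lra].
apply Rmult_le_reg_r with N; [lra |]; unfold Rdiv; rewrite Rmult_assoc, Rinv_l; lra.
Qed.

Lemma fker_0 : fker 0 = N.
Proof.
unfold fker; rewrite (rint_ext _ (fun x => 2 * (1 - x / N))).
- apply is_rint_unique.
  replace N with (minus (2 * (N - N * N / (2 * N))) (2 * (0 - 0 * 0 / (2 * N)))) at 2
    by (unfold minus, plus, opp; simpl; field; lra).
  apply (is_RInt_derive (V := R_CompleteNormedModule) (fun x => 2 * (x - x * x / (2 * N)))).
  + intros x _; auto_derive; auto; field; lra.
  + intros x _; apply (ex_derive_continuous (K := R_AbsRing) (V := R_NormedModule)); auto_derive;
    auto.
- intros x Hx; rewrite Rmin_left, Rmax_right in Hx by lra.
  rewrite tri_in, Rmult_0_r, cos_0 by lra; ring.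
Qed.

Lemma fker_closed s : s <> 0 -> fker s = 2 * (1 - cos (N * s)) / (N * (s * s)).
Proof.
intros Hs.
unfold fker; rewrite (rint_ext _ (fun x => 2 * (1 - x / N) * cos (x * s))).
- apply is_rint_unique.
  pose (F := fun x => 2 * ((1 - x / N) * sin (x * s) / s - cos (x * s) / (N * (s * s)))).
  replace (2 * (1 - cos (N * s)) / (N * (s * s))) with (minus (F N) (F 0)).
  + apply (is_RInt_derive (V := R_CompleteNormedModule) F).
    * intros x _; unfold F; auto_derive; auto; field; split; lra.
    * intros x _; apply (ex_derive_continuous (K := R_AbsRing) (V := R_NormedModule));
      auto_derive; auto.
  + unfold F, minus, plus, opp; simpl; rewrite Rmult_0_l, sin_0, cos_0; field; split; lra.
- intros x Hx; rewrite Rmin_left, Rmax_right in Hx by lra; rewrite tri_in by lra; ring.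
Qed.

Lemma fker_ge0 s : 0 <= fker s.
Proof.
destruct (Req_dec s 0) as [-> | Hs]; [rewrite fker_0; lra |].
rewrite fker_closed by exact Hs; assert (C := COS_bound (N * s)).
apply Rmult_le_pos; [lra |]; left; apply Rinv_0_lt_compat.
assert (0 < s * s) by nra; apply Rmult_lt_0_compat; lra.
Qed.

Lemma fker_le s : s <> 0 -> fker s <= 4 / N * / (s * s).
Proof.
intros Hs; rewrite fker_closed by exact Hs; assert (C := COS_bound (N * s)).
assert (0 < s * s) by nra.
replace (4 / N * / (s * s)) with (4 / (N * (s * s))) by (field; split; lra).
apply Rmult_le_compat_r; [left; apply Rinv_0_lt_compat, Rmult_lt_0_compat; lra | lra].
Qed.

Lemma fker_ge s : Rabs s <= / N -> N / 9 <= fker s.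
Proof.
intros H; destruct (Req_dec s 0) as [-> | Hs]; [rewrite fker_0; lra |].
rewrite fker_closed by exact Hs.
assert (0 < s * s) by nra.
assert (A : Rabs (N * s) <= PI).
{ rewrite Rabs_mult, Rabs_pos_eq by lra.
  apply Rle_trans with (N * / N); [apply Rmult_le_compat_l; lra |].
  rewrite Rinv_r by lra; assert (P := PI2_3_2); unfold PI2 in P; lra. }
apply sq_le_cos in A.
assert (0 < N * (s * s)) by (apply Rmult_lt_0_compat; lra).
apply Rmult_le_reg_r with (N * (s * s)); [easy |].
unfold Rdiv; rewrite (Rmult_assoc (2 * _)), Rinv_l by lra.
replace (N * / 9 * (N * (s * s))) with (/ 9 * (N * s * (N * s))) by ring; lra.
Qed.

Lemma fker_tail a b r : 0 < r -> a <= b -> r <= a \/ b <= - r ->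
  rint fker a b <= 4 / (N * r).
Proof.
intros Hr Hab Hs.
assert (H0 : forall x, a <= x <= b -> x <> 0) by (intros; lra).
assert (HI : is_RInt (fun s => 4 / N * / (s * s)) a b (minus (- (4 / N * / b)) (- (4 / N * / a)))).
{ apply (is_RInt_derive (V := R_CompleteNormedModule) (fun s => - (4 / N * / s))).
  - intros x Hx; rewrite Rmin_left, Rmax_right in Hx by lra; specialize (H0 x Hx).
    auto_derive; [easy | field; split; lra].
  - intros x Hx; rewrite Rmin_left, Rmax_right in Hx by lra; specialize (H0 x Hx).
    apply (ex_derive_continuous (K := R_AbsRing) (V := R_NormedModule)); auto_derive; nra. }
apply Rle_trans with (rint (fun s => 4 / N * / (s * s)) a b).
- apply rint_le; [exact Hab | apply fker_cont | eexists; exact HI |].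
  intros x Hx; apply fker_le, H0; lra.
- rewrite (is_rint_unique _ _ _ _ HI); unfold minus, plus, opp; simpl.
  assert (Hn : 0 < 4 / N) by (apply Rdiv_lt_0_compat; lra).
  replace (4 / (N * r)) with (4 / N * / r) by (field; split; lra).
  replace (- (4 / N * / b) + - - (4 / N * / a)) with (4 / N * (/ a - / b)) by ring.
  apply Rmult_le_compat_l; [lra |].
  destruct Hs as [Hs | Hs].
  + assert (/ a <= / r) by (apply Rinv_le_contravar; lra).
    assert (0 < / b) by (apply Rinv_0_lt_compat; lra); lra.
  + assert (/ - b <= / r) by (apply Rinv_le_contravar; lra).
    assert (0 < / - a) by (apply Rinv_0_lt_compat; lra).
    rewrite Rinv_opp in *; lra.
Qed.

(** The normalising constant, in place of the total mass [2 PI]: it suffices that it stays above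
    [2 / 9] while the tails are [O(1 / N)]. *)
Definition fmass := rint fker (-1) 1.

Lemma rint_mono f a b c d : (forall x, continuous f x) -> (forall x, 0 <= f x) ->
  c <= a -> a <= b -> b <= d -> rint f a b <= rint f c d.
Proof.
intros Hc Hf H1 H2 H3.
rewrite <- (rint_chasles f c a d Hc), <- (rint_chasles f a b d Hc).
assert (A := rint_ge0 f c a H1 Hc Hf); assert (B := rint_ge0 f b d H3 Hc Hf); lra.
Qed.

(** The kernel is at least [N / 9] on an interval of length [2 / N]. *)
Lemma fmass_ge : 2 / 9 <= fmass.
Proof.
assert (HN' : 0 < / N <= 1).
{ split; [apply Rinv_0_lt_compat; lra |]; rewrite <- Rinv_1; apply Rinv_le_contravar; lra. }
apply Rle_trans with (rint fker (- / N) (/ N)).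
- apply Rle_trans with (rint (fun _ => N / 9) (- / N) (/ N)).
  + rewrite rint_const; right; field; lra.
  + apply rint_le; [lra | intros; apply continuous_const | apply cont_ex_RInt, fker_cont |].
    intros x Hx; apply fker_ge, Rabs_le; lra.
- apply rint_mono; [apply fker_cont | apply fker_ge0 | | |]; lra.
Qed.

Lemma fker_total a b : a <= b -> rint fker a b <= fmass + 8 / N.
Proof.
intros H.
apply Rle_trans with (rint fker (Rmin a (-1)) (Rmax b 1)).
- apply rint_mono; [apply fker_cont | apply fker_ge0 | apply Rmin_l | exact H | apply Rmax_l].
- rewrite <- (rint_chasles fker _ (-1) _ fker_cont), <- (rint_chasles fker (-1) 1 _ fker_cont).
  fold fmass.
  assert (A := fker_tail (Rmin a (-1)) (-1) 1 Rlt_0_1 (Rmin_r _ _) (or_intror (Rle_refl _))).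
  assert (B := fker_tail 1 (Rmax b 1) 1 Rlt_0_1 (Rmax_r _ _) (or_introl (Rle_refl _))).
  rewrite Rmult_1_r in *; replace (8 / N) with (4 / N + 4 / N) by (field; lra); lra.
Qed.

End FejerKernel.

(** * Spectral vanishing *)

Section Null.
Context {X : CompleteNormedModule C_AbsRing}.
Implicit Types g : R -> X.

Lemma integral_ext_in g h a b : (forall t, Rmin a b < t < Rmax a b -> g t = h t) ->
  integral g a b = integral h a b.
Proof. exact (RInt_ext (V := realify X) g h a b). Qed.

Lemma integral_scal_const (f : R -> R) (x : X) a b : (forall t, continuous f t) ->
  integral (fun t => RtoC (f t) *v x) a b = RtoC (rint f a b) *v x.
Proof.
intros Hf; apply integral_unique.
apply (is_RInt_linear R_NormedModule (realify X) (fun k : R => RtoC k *v x : X));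
  [| | | now apply rint_correct].
- intros k l; change (RtoC (k + l) *v x = RtoC k *v x +v RtoC l *v x); vring.
- intros k l; change (RtoC (k * l) *v x = RtoC k *v (RtoC l *v x)); vring.
- exact (filterlim_scal_l (K := R_AbsRing) (V := realify X) (rint f a b) x).
Qed.

Lemma ccont_continuous (f : R -> R) t : continuous f t -> ccont (fun s => RtoC (f s)) t.
Proof.
intros H eps He; destruct (H (ball (f t) (mkposreal eps He)) (locally_ball _ _)) as [d Hd].
exists d; split; [apply cond_pos |]; intros s Hs; rewrite <- RtoC_minus, Cmod_R.
left; exact (Hd s Hs).
Qed.

Lemma ccont_clips (c : R -> C) k t : (forall s r, Cmod (Cminus (c s)
  (c r)) <= k * Rabs (s - r)) -> ccont c t.
Proof. intros H; exact (lips_cont (X := C_CompleteNormedModule) c k t H). Qed.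

Lemma ccont_cis a t : ccont (fun s => cis (a * s)) t.
Proof.
apply (ccont_clips _ (2 * Rabs a)); intros s r.
apply Rle_trans with (1 := cis_lip _ _).
replace (a * s - a * r) with (a * (s - r)) by ring; rewrite Rabs_mult; lra.
Qed.

Variables (g : R -> X) (M : R).
Hypothesis Hg : forall t, cont_at g t.
Hypothesis HM : bdd g M.

Section Params.
Variables (N d T : R).
Hypothesis HN : 1 <= N.
Hypothesis Hd : 0 < d.
Hypothesis HT : 0 <= T.

Definition gdamp (e : R) : X := RtoC (exp (- (d * Rabs e))) *v g e.

Lemma gdamp_cont t : cont_at gdamp t.
Proof.
apply cont_at_scal; [| apply Hg]; apply ccont_continuous.
apply (continuous_Rcomp exp (fun e => - (d * Rabs e))).
- apply (continuous_opp (fun e => d * Rabs e)).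
  apply (continuous_Rmult (fun _ => d) Rabs); [apply continuous_const | apply continuous_Rabs].
- apply continuous_exp.
Qed.

Lemma exp_damp_le e : 0 < exp (- (d * Rabs e)) <= 1.
Proof.
split; [apply exp_pos |]; rewrite <- exp_0.
assert (H := Rabs_pos e); assert (0 <= d * Rabs e) by (apply Rmult_le_pos; lra).
destruct (Req_dec (d * Rabs e) 0) as [-> | Hne]; [rewrite Ropp_0; lra |].
left; apply exp_increasing; lra.
Qed.

Lemma gdamp_bdd : bdd gdamp M.
Proof.
intros e; unfold gdamp; assert (H := exp_damp_le e).
rewrite nrm_sc, Cmod_R, Rabs_pos_eq by lra.
specialize (HM e); assert (P := nrm_ge0 (g e)); nra.
Qed.

(** Damping by [d] makes the Fourier transform of a merely bounded [g] meaningful; truncation at [T]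
    keeps every integral on a compact interval, as [fubini] requires. *)
Definition damped_ft (x : R) : X := integral (fun e => cis (- (x * e)) *v gdamp e) (- T) T.

Lemma cisg_cont x t : cont_at (fun e => cis (- (x * e)) *v gdamp e) t.
Proof.
apply cont_at_scal; [| apply gdamp_cont].
replace (fun e => cis (- (x * e))) with (fun e => cis (- x * e)); [apply ccont_cis |].
apply functional_extensionality; intros e; f_equal; ring.
Qed.

Lemma damped_ft_lips : lips damped_ft (2 * T * M * (2 * T)).
Proof.
intros x y; unfold damped_ft.
assert (HM0 := bdd_ge0 _ _ HM).
assert (E : integral (fun e => cis (- (x * e)) *v gdamp e) (- T) T -v integral (fun e => cis (- (y
  * e)) *v gdamp e) (- T) T =
  integral (fun e => RtoC (-1) *v (cis (- (y * e)) *v gdamp e) +v cis (- (x * e)) *v gdamp e)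
    (- T) T).
{ rewrite (integral_comb (RtoC (-1)) _ _ (- T) T (cisg_cont y) (cisg_cont x)); vring. }
rewrite E; clear E.
apply Rle_trans with ((2 * T * Rabs (x - y) * M) * Rabs (T - - T)).
- apply integral_bound; [intros t; apply cont_at_comb; apply cisg_cont |].
  intros e He; rewrite Rmin_left, Rmax_right in He by lra.
  replace (RtoC (-1) *v (cis (- (y * e)) *v gdamp e) +v cis (- (x * e)) *v gdamp e) with
    (Cminus (cis (- (x * e))) (cis (- (y * e))) *v gdamp e) by vring.
  rewrite nrm_sc; apply Rmult_le_compat; [apply Cmod_ge_0 | apply nrm_ge0 | | apply gdamp_bdd].
  apply Rle_trans with (1 := cis_lip _ _).
  replace (- (x * e) - - (y * e)) with (- e * (x - y)) by ring; rewrite Rabs_mult, Rabs_Ropp.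
  assert (Rabs e <= T) by (apply Rabs_le; lra).
  rewrite Rmult_assoc; apply Rmult_le_compat_l; [lra |].
  apply Rmult_le_compat_r; [apply Rabs_pos | easy].
- rewrite (Rabs_pos_eq (T - - T)) by lra; right; ring.
Qed.

Definition fejer (t : R) : X := integral (fun e => RtoC (fker N (t - e)) *v gdamp e) (- T) T.

(** Joint contribution of the frequencies [x] and [- x], with factors [u] and [v], because the
    triangle is integrated over [[0, N]] only. *)
Definition fint (u v : C) (x : R) : X :=
  RtoC (tri N x) *v (u *v damped_ft x +v v *v damped_ft (- x)).

Lemma fejer_fourier t :
  fejer t = integral (fun x => fint (cis (x * t)) (cis (- (x * t))) x) 0 N.
Proof.
unfold fejer.
rewrite <- (fubini (fun x e => 2 * tri N x * cos (x * (t - e))) gdamp (fun e => fker N (t - e)) 0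
  N (- T) T
  (2 * (/ N + (Rabs t + T))) M).
- apply integral_ext; intros x; unfold fint, damped_ft.
  transitivity (integral (fun e => RtoC (tri N x) *v (cis (x * t) *v (cis (- (x * e)) *v gdamp e) +v
     cis (- (x * t)) *v (cis (- (- x * e)) *v gdamp e))) (- T) T).
  + apply integral_ext; intros e.
    replace (RtoC (2 * tri N x * cos (x * (t - e)))) with
      (Cmult (RtoC (tri N x)) (Cplus (Cmult (cis (x * t)) (cis (- (x * e))))
        (Cmult (cis (- (x * t))) (cis (- (- x * e))))));
      [vring |].
    rewrite <- !cis_plus.
    replace (x * t + - (x * e)) with (x * (t - e)) by ring.
    replace (- (x * t) + - (- x * e)) with (- (x * (t - e))) by ring.
    unfold cis; rewrite cos_neg, sin_neg; unfold Cplus, Cmult, RtoC; simpl; f_equal; ring.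
  + assert (C1 := fun s => cisg_cont x s); assert (C2 := fun s => cisg_cont (- x) s).
    assert (C0 : forall s, cont_at (fun _ : R => v0 : X) s) by (intros; apply cont_at_const).
    assert (C3 : forall s, cont_at (fun e => cis (- (x * t)) *v (cis (- (- x * e)) *v gdamp e) +v
      v0) s)
      by (intros; now apply cont_at_comb).
    assert (C4 : forall s, cont_at (fun e => cis (x * t) *v (cis (- (x * e)) *v gdamp e) +v
      (cis (- (x * t)) *v (cis (- (- x * e)) *v gdamp e) +v v0)) s)
      by (intros; now apply (cont_at_comb _ _ (fun e => cis (- (x * t)) *v (cis (- (- x * e)) *v
        gdamp e) +v v0))).
    rewrite (integral_ext _ (fun e => RtoC (tri N x) *v (cis (x * t) *v (cis (- (x * e)) *v gdamp
      e) +v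
      (cis (- (x * t)) *v (cis (- (- x * e)) *v gdamp e) +v v0)) +v v0)) by (intros; vring).
    rewrite (integral_comb _ (fun e => cis (x * t) *v (cis (- (x * e)) *v gdamp e) +v
      (cis (- (x * t)) *v (cis (- (- x * e)) *v gdamp e) +v v0)) _ _ _ C4 C0).
    rewrite (integral_comb _ (fun e => cis (- (x * e)) *v gdamp e)
      (fun e => cis (- (x * t)) *v (cis (- (- x * e)) *v gdamp e) +v v0) _ _ C1 C3).
    rewrite (integral_comb _ (fun e => cis (- (- x * e)) *v gdamp e) _ _ _ C2 C0).
    rewrite integral_const; vring.
- lra.
- lra.
- assert (0 < / N) by (apply Rinv_0_lt_compat; lra); assert (P0 := Rabs_pos t); lra.
- exact gdamp_cont.
- exact gdamp_bdd.
- intros x y e He.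
  replace (2 * tri N x * cos (x * (t - e)) - 2 * tri N y * cos (y * (t - e))) with
    (2 * (tri N x - tri N y) * cos (x * (t - e)) + 2 * tri N y * (cos (x * (t - e)) - cos (y * (t
      - e)))) by ring.
  apply Rle_trans with (1 := Rabs_triang _ _); rewrite !Rabs_mult.
  assert (A1 := tri_lip N HN x y); assert (A2 := Rabs_cos_le (x * (t - e))).
  assert (A3 := cos_lip (x * (t - e)) (y * (t - e))).
  replace (x * (t - e) - y * (t - e)) with ((t - e) * (x - y)) in A3 by ring;
    rewrite Rabs_mult in A3.
  assert (A4 := tri_bound N HN y).
  assert (A5 : Rabs (t - e) <= Rabs t + T).
  { apply Rle_trans with (1 := Rabs_triang _ _); rewrite Rabs_Ropp.
    assert (Rabs e <= T) by (apply Rabs_le; lra); lra. }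
  rewrite (Rabs_pos_eq 2), (Rabs_pos_eq (tri N y)) by lra.
  assert (P := Rabs_pos (x - y)); assert (P2 := Rabs_pos (tri N x - tri N y)).
  assert (B1 : 2 * Rabs (tri N x - tri N y) * Rabs (cos (x * (t - e))) <= 2 * (/ N * Rabs (x - y))
    * 1).
  { apply Rmult_le_compat; try lra; apply Rabs_pos. }
  assert (B2 : 2 * tri N y * Rabs (cos (x * (t - e)) - cos (y * (t - e))) <= 2 * 1 * ((Rabs t + T)
    * Rabs (x - y))).
  { apply Rmult_le_compat; try lra; [apply Rabs_pos |].
    apply Rle_trans with (1 := A3), Rmult_le_compat_r; lra. }
  lra.
- intros x; exists (2 * N); intros e e'.
  replace (e - e') with (- ((t - e) - (t - e'))) by ring; rewrite Rabs_Ropp.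
  apply fker_integrand_lip2; exact HN.
- intros e; apply rint_correct; intros x; now apply fker_integrand_cont.
- exists (N * (2 * N)); intros e e'.
  replace (e - e') with (- ((t - e) - (t - e'))) by ring; rewrite Rabs_Ropp.
  now apply fker_lip.
Qed.

Lemma fint_cont (p : tpoly) t x :
  cont_at (fun x => fint (Cmult (tp_eval p x) (cis (x * t))) (Cmult (tp_eval p (- x))
    (cis (- (x * t)))) x) x.
Proof.
assert (Hb : forall t x, cont_at (fun x => fint (cis (x * t)) (cis (- (x * t))) x) x).
{ intros r y; unfold fint; apply cont_at_scal.
  - apply ccont_continuous, (rlip_continuous _ (/ N)), (tri_lip N HN).
  - assert (A : cont_at (fun x => cis (- r * x) *v damped_ft (- x)) y).
    { apply cont_at_scal; [apply ccont_cis |].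
      apply (lips_cont _ (2 * T * M * (2 * T))); intros a b.
      replace (a - b) with (- (- a - - b)) by ring; rewrite Rabs_Ropp; apply damped_ft_lips. }
    assert (B : cont_at (fun x => cis (r * x) *v damped_ft x) y).
    { apply cont_at_scal; [apply ccont_cis |]. eapply lips_cont, damped_ft_lips. }
    assert (C := cont_at_comb (RtoC 1) _ _ y B A); cbv beta in C.
    intros eps He; destruct (C eps He) as [dd [D1 D2]]; exists dd; split; [exact D1 |].
    intros s Hs; specialize (D2 s Hs).
    replace (s * r) with (r * s) by ring; replace (y * r) with (r * y) by ring.
    replace (- (r * s)) with (- r * s) by ring; replace (- (r * y)) with (- r * y) by ring.
    replace (cis (r * s) *v damped_ft s) with (RtoC 1 *v (cis (r * s) *v damped_ft s)) by vring.
    replace (cis (r * y) *v damped_ft y) with (RtoC 1 *v (cis (r * y) *v damped_ft y)) by vring.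
    exact D2. }
induction p as [|[n c] p IH].
- replace (fun x0 => fint (Cmult (tp_eval [] x0) (cis (x0 * t))) (Cmult (tp_eval [] (- x0))
  (cis (- (x0 * t)))) x0)
    with (fun _ : R => v0 : X); [apply cont_at_const |].
  apply functional_extensionality; intros y; unfold fint; simpl; vring.
- replace (fun x0 => fint (Cmult (tp_eval ((n, c) :: p) x0) (cis (x0 * t))) (Cmult (tp_eval ((n,
  c) :: p) (- x0)) (cis (- (x0 * t)))) x0)
    with (fun x => c *v fint (cis (x * (t + IZR n))) (cis (- (x * (t + IZR n)))) x +v
      fint (Cmult (tp_eval p x) (cis (x * t))) (Cmult (tp_eval p (- x)) (cis (- (x * t)))) x).
  + apply cont_at_comb; [apply Hb | apply IH].
  + apply functional_extensionality; intros y; cbn [tp_eval].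
    replace (y * (t + IZR n)) with (IZR n * y + y * t) by ring.
    replace (- (IZR n * y + y * t)) with (IZR n * - y + - (y * t)) by ring.
    rewrite !cis_plus; unfold fint; vring.
Qed.

(** On the frequency side, a polynomial in the shift multiplies the integrand by its symbol. *)
Lemma fejer_tp (p : tpoly) t : tp_act p fejer t =
  integral (fun x => fint (Cmult (tp_eval p x) (cis (x * t))) (Cmult (tp_eval p (- x))
    (cis (- (x * t)))) x) 0 N.
Proof.
induction p as [|[n c] p IH].
- rewrite (integral_ext _ (fun _ => v0)); [rewrite integral_const; cbn [tp_act]; vring |].
  intros x; unfold fint; simpl; vring.
- cbn [tp_act]; rewrite IH, fejer_fourier.
  assert (C1 : forall x, cont_at (fun x => fint (cis (x * (t + IZR n)))
    (cis (- (x * (t + IZR n)))) x) x).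
  { intros x; assert (A := fint_cont [(0%Z, RtoC 1)] (t + IZR n) x).
    replace (fun x => fint (cis (x * (t + IZR n))) (cis (- (x * (t + IZR n)))) x) with
      (fun x => fint (Cmult (tp_eval [(0%Z, RtoC 1)] x) (cis (x * (t + IZR n))))
         (Cmult (tp_eval [(0%Z, RtoC 1)] (- x)) (cis (- (x * (t + IZR n))))) x); [exact A |].
    apply functional_extensionality; intros y; cbn [tp_eval]; rewrite !Rmult_0_l, cis_0; f_equal;
      ring. }
  rewrite <- (integral_comb c _ _ 0 N C1 (fint_cont p t)).
  apply integral_ext; intros y; cbn [tp_eval].
  replace (y * (t + IZR n)) with (IZR n * y + y * t) by ring.
  replace (- (IZR n * y + y * t)) with (IZR n * - y + - (y * t)) by ring.
  rewrite !cis_plus; unfold fint; vring.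
Qed.

Lemma fejer_tp_bound p t K : (forall x, Rabs x <= N -> Cmod (tp_eval p x) * nrm (damped_ft x) <=
  K) ->
  nrm (tp_act p fejer t) <= 2 * N * K.
Proof.
intros H; rewrite fejer_tp.
replace (2 * N * K) with (2 * K * Rabs (N - 0)) by (rewrite Rminus_0_r, Rabs_pos_eq by lra; ring).
apply integral_bound; [apply fint_cont |].
intros x Hx; rewrite Rmin_left, Rmax_right in Hx by lra; unfold fint.
assert (A := tri_bound N HN x).
rewrite nrm_sc, Cmod_R, Rabs_pos_eq by lra.
assert (B := nrm_add (Cmult (tp_eval p x) (cis (x * t)) *v damped_ft x) (Cmult (tp_eval p (- x))
  (cis (- (x * t))) *v damped_ft (- x))).
rewrite !nrm_sc, !Cmod_mult, !Cmod_cis, !Rmult_1_r in B.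
assert (H1 := H x ltac:(apply Rabs_le; lra)); assert (H2 := H (- x) ltac:(apply Rabs_le; lra)).
set (u := nrm (_ +v _)) in *; assert (P : 0 <= u) by apply nrm_ge0; nra.
Qed.

Lemma fejer_bdd : bdd fejer (M * (fmass N + 8 / N)).
Proof.
intros t; unfold fejer.
assert (HM0 := bdd_ge0 _ _ HM).
assert (Cf : forall e, continuous (fun e => fker N (t - e)) e).
{ intros e; apply (continuous_Rcomp (fker N) (fun e => t - e)); [| now apply fker_cont].
  apply (ex_derive_continuous (K := R_AbsRing) (V := R_NormedModule)); auto_derive; auto. }
apply Rle_trans with (M * rint (fun e => fker N (t - e)) (- T) T).
- apply (integral_bound_fun _ (fun e => M * fker N (t - e))).
  + intros e; apply cont_at_scal; [| apply gdamp_cont].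
    now apply ccont_continuous.
  + lra.
  + intros e _; rewrite nrm_sc, Cmod_R, Rabs_pos_eq by now apply fker_ge0.
    rewrite Rmult_comm; apply Rmult_le_compat_r; [now apply fker_ge0 | apply gdamp_bdd].
  + apply (is_RInt_scal (V := R_NormedModule)), rint_correct, Cf.
- apply Rmult_le_compat_l; [exact HM0 |].
  replace (rint (fun e => fker N (t - e)) (- T) T) with (rint (fker N) (- T - t) (T - t)).
  + apply fker_total; lra.
  + symmetry; apply is_rint_unique.
    apply (is_RInt_ext (fun y => scal 1 (fker N (1 * y + - t)))).
    * intros x _; unfold scal; simpl; unfold mult; simpl; rewrite Rmult_1_l,
      <- (fker_even N (t - x)); f_equal; ring.
    * apply (is_RInt_comp_lin (V := R_NormedModule) (fker N) 1 (- t) (- T) T).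
      replace (1 * - T + - t) with (- T - t) by ring; replace (1 * T + - t) with (T - t) by ring.
      apply rint_correct; intros; now apply fker_cont.
Qed.

(** An approximate identity argument in which [fmass * g t] is written as an integral over
    [[t - 1, t + 1]]. Outside radius [r] there are four tails, each at most [M * (4 / (N * r))],
    whence the 16. *)
Lemma fejer_concentrates t r eps : 0 < r <= 1 -> Rabs t + 1 <= T ->
  (forall s, Rabs s <= r -> nrm (gdamp (t + s) -v g t) <= eps) ->
  nrm (fejer t -v RtoC (fmass N) *v g t) <= eps * fmass N + 16 * M / (N * r).
Proof.
intros Hr HtT Heps.
assert (HM0 := bdd_ge0 _ _ HM).
assert (Ht := Rabs_le_between t (T - 1)); assert (Ht' : - (T - 1) <= t <= T - 1) by (apply Ht; lra).
set (k := fun e => fker N (t - e)).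
assert (kc : forall e, continuous k e).
{ intros e; apply (continuous_Rcomp (fker N) (fun e => t - e)); [| now apply fker_cont].
  apply (ex_derive_continuous (K := R_AbsRing) (V := R_NormedModule)); auto_derive; auto. }
assert (k0 : forall e, 0 <= k e) by (intros e; exact (fker_ge0 N HN (t - e))).
assert (Hk : forall a b, rint k (t + a) (t + b) = rint (fker N) a b).
{ intros a b; symmetry; apply is_rint_unique.
  apply (is_RInt_ext (fun y => scal 1 (k (1 * y + t)))).
  - intros x _; unfold scal, k; simpl; unfold mult; simpl; rewrite Rmult_1_l, <- (fker_even N x);
    f_equal; ring.
  - apply (is_RInt_comp_lin (V := R_NormedModule) k 1 t a b).
    replace (1 * a + t) with (t + a) by ring; replace (1 * b + t) with (t + b) by ring.
    apply rint_correct, kc. }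
set (G := fun e => RtoC (k e) *v gdamp e).
set (H := fun e => RtoC (k e) *v g t).
assert (Gc : forall e, cont_at G e).
{ intros e; apply cont_at_scal; [now apply ccont_continuous | apply gdamp_cont]. }
assert (Hc : forall e, cont_at H e).
{ intros e; apply cont_at_scal; [now apply ccont_continuous | apply cont_at_const]. }
assert (E1 : fejer t = integral G (- T) (t - r) +v (integral G (t - r)
  (t + r) +v integral G (t + r) T)).
{ rewrite !integral_chasles by exact Gc; reflexivity. }
assert (E2 : RtoC (fmass N) *v g t = integral H (t - 1) (t - r) +v (integral H (t - r)
  (t + r) +v integral H (t + r) (t + 1))).
{ rewrite !integral_chasles by exact Hc; unfold H; rewrite integral_scal_const by exact kc.
  f_equal; f_equal; unfold fmass; rewrite <- Hk; f_equal; ring. }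
assert (Htail : forall (F : R -> X) a b, (forall e, cont_at F e) -> (forall e,
  nrm (F e) <= M * k e) -> a <= b ->
   (r <= a \/ b <= - r) -> nrm (integral F (t + a) (t + b)) <= M * (4 / (N * r))).
{ intros F a b Fc HF Hab Hr'.
  apply Rle_trans with (M * rint k (t + a) (t + b)).
  - apply (integral_bound_fun F (fun e => M * k e)); [exact Fc | lra | intros; apply HF |].
    apply (is_RInt_scal (V := R_NormedModule)), rint_correct, kc.
  - apply Rmult_le_compat_l; [exact HM0 |]; rewrite Hk; apply fker_tail; auto; lra. }
assert (GM : forall e, nrm (G e) <= M * k e).
{ intros e; unfold G; rewrite nrm_sc, Cmod_R, Rabs_pos_eq by apply k0.
  rewrite Rmult_comm; apply Rmult_le_compat_r; [apply k0 | apply gdamp_bdd]. }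
assert (HMk : forall e, nrm (H e) <= M * k e).
{ intros e; unfold H; rewrite nrm_sc, Cmod_R, Rabs_pos_eq by apply k0.
  rewrite Rmult_comm; apply Rmult_le_compat_r; [apply k0 | apply HM]. }
assert (T1 : nrm (integral G (- T) (t - r)) <= M * (4 / (N * r))).
{ assert (A := Htail G (- T - t) (- r) Gc GM ltac:(lra) ltac:(lra)).
  replace (t + (- T - t)) with (- T) in A by ring; exact A. }
assert (T2 : nrm (integral G (t + r) T) <= M * (4 / (N * r))).
{ assert (A := Htail G r (T - t) Gc GM ltac:(lra) ltac:(lra)).
  replace (t + (T - t)) with T in A by ring; exact A. }
assert (T3 : nrm (integral H (t - 1) (t - r)) <= M * (4 / (N * r))).
{ exact (Htail H (- (1)) (- r) Hc HMk ltac:(lra) ltac:(lra)). }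
assert (T4 : nrm (integral H (t + r) (t + 1)) <= M * (4 / (N * r))).
{ exact (Htail H r 1 Hc HMk ltac:(lra) ltac:(lra)). }
assert (T5 : nrm (integral G (t - r) (t + r) -v integral H (t - r) (t + r)) <= eps * fmass N).
{ assert (E : integral G (t - r) (t + r) -v integral H (t - r) (t + r) =
    integral (fun e => RtoC (-1) *v H e +v G e) (t - r) (t + r)).
  { rewrite (integral_comb (RtoC (-1)) H G _ _ Hc Gc); vring. }
  assert (He0 : 0 <= eps).
  { apply Rle_trans with (2 := Heps 0 ltac:(rewrite Rabs_R0; lra)), nrm_ge0. }
  rewrite E; apply Rle_trans with (eps * rint k (t - r) (t + r)).
  - apply (integral_bound_fun _ (fun e => eps * k e)).
    + intros; now apply cont_at_comb.
    + lra.
    + intros e He; unfold G, H.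
      replace (RtoC (-1) *v (RtoC (k e) *v g t) +v RtoC (k e) *v gdamp e) with (RtoC (k e) *v
        (gdamp e -v g t)) by vring.
      rewrite nrm_sc, Cmod_R, Rabs_pos_eq, Rmult_comm by apply k0.
      apply Rmult_le_compat_r; [apply k0 |].
      replace e with (t + (e - t)) by ring; apply Heps, Rabs_le; lra.
    + apply (is_RInt_scal (V := R_NormedModule)), rint_correct, kc.
  - apply Rmult_le_compat_l; [exact He0 |].
    replace (t - r) with (t + - r) by ring; rewrite Hk.
    apply rint_mono; [intros; now apply fker_cont | intros; now apply fker_ge0 | | |]; lra. }
rewrite E1, E2.
set (a1 := integral G (- T) (t - r)) in *; set (a2 := integral G (t - r) (t + r)) in *;
  set (a3 := integral G (t + r) T) in *.
set (b1 := integral H (t - 1) (t - r)) in *; set (b2 := integral H (t - r) (t + r)) in *;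
  set (b3 := integral H (t + r) (t + 1)) in *.
replace (a1 +v (a2 +v a3) -v (b1 +v (b2 +v b3))) with ((a2 -v b2) +v ((a1 -v b1) +v (a3 -v b3)))
  by vring.
apply Rle_trans with (1 := nrm_add _ _).
assert (A1 := nrm_add (a1 -v b1) (a3 -v b3)).
assert (A2 := nrm_sub a1 b1); assert (A3 := nrm_sub a3 b3).
replace (16 * M / (N * r)) with (4 * (M * (4 / (N * r)))) by (field; split; lra).
lra.
Qed.

(** On the positive half-line the damped exponential is the Laplace kernel at [d + i x], on the
    negative one that at [- d + i x]; only the truncation at [T] leaves an error. *)
Lemma damped_ft_laplace x :
  nrm (damped_ft x -v (laplace g (d, x) -v laplace g (- d, x))) <= 2 * M * exp (- (d * T)) / d.
Proof.
assert (R1 : Re (d, x) <> 0) by (simpl; lra); assert (R2 : Re (- d, x) <> 0) by (simpl; lra).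
assert (A1 := lap_spec (d, x) g M Hg HM R1 T ltac:(simpl; apply Rmult_le_pos; lra)).
assert (A2 := lap_spec (- d, x) g M Hg HM R2 (- T) ltac:(simpl; nra)).
simpl Re in A1, A2.
replace (- (- d * - T)) with (- (d * T)) in A2 by ring.
rewrite (Rabs_left (- d)), Ropp_involutive in A2 by lra; rewrite (Rabs_pos_eq d) in A1 by lra.
assert (E : damped_ft x = ltr (d, x) T g -v ltr (- d, x) (- T) g).
{ unfold damped_ft, ltr.
  rewrite <- (integral_chasles _ (- T) 0 T (cisg_cont x)).
  assert (B1 : integral (fun e => cis (- (x * e)) *v gdamp e) 0 T = integral (kern (d, x) g) 0 T).
  { apply integral_ext_in; intros e He; rewrite Rmin_left, Rmax_right in He by lra.
    unfold gdamp, kern; rewrite Rabs_pos_eq by lra.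
    replace (Cexp (- ((d, x) * e))%C) with (Cmult (cis (- (x * e))) (RtoC (exp (- (d * e)))));
      [vring |].
    unfold Cexp, cis, Re, Im, Cmult, Copp, RtoC; simpl.
    replace (- (d * e - x * 0)) with (- (d * e)) by ring; replace (- (d * 0 + x * e)) with (- (x *
      e)) by ring.
    f_equal; ring. }
  assert (B2 : integral (fun e => cis (- (x * e)) *v gdamp e) (- T) 0 = integral (kern (- d,
    x) g) (- T) 0).
  { apply integral_ext_in; intros e He; rewrite Rmin_left, Rmax_right in He by lra.
    unfold gdamp, kern; rewrite Rabs_left by lra.
    replace (Cexp (- ((Ropp d, x) * e))%C) with (Cmult (cis (- (x * e)))
      (RtoC (exp (- (d * - e))))); [vring |].
    unfold Cexp, cis, Re, Im, Cmult, Copp, RtoC; simpl.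
    replace (- (- d * e - x * 0)) with (- (d * - e)) by ring; replace (- (- d * 0 + x * e)) with
      (- (x * e)) by ring.
    f_equal; ring. }
  rewrite B1, B2.
  assert (B3 := integral_chasles (kern (- d, x) g) (- T) 0 (- T) (kern_cont (- d, x) g Hg)).
  rewrite integral_point in B3.
  transitivity (integral (kern (- d, x) g) (- T) 0 +v integral (kern (d, x) g) 0 T -v
    (integral (kern (- d, x) g) (- T) 0 +v integral (kern (- d, x) g) 0 (- T))); [rewrite B3 | ];
      vring. }
rewrite E.
set (u := ltr (d, x) T g) in *; set (v := ltr (- d, x) (- T) g) in *.
set (u' := laplace g (d, x)) in *; set (v' := laplace g (- d, x)) in *.
replace (u -v v -v (u' -v v')) with ((v' -v v) -v (u' -v u)) by vring.
apply Rle_trans with (1 := nrm_sub _ _).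
replace (2 * M * exp (- (d * T)) / d) with (M * exp (- (d * T)) / d + M * exp (- (d * T)) / d) by
  (field; lra).
lra.
Qed.

End Params.

(* The jump of the Carleman transform across the imaginary axis tends to [0]
   uniformly near [i x]. *)
Definition jump_null (x : R) := exists r, 0 < r /\ forall eps, 0 < eps ->
  exists d0, 0 < d0 /\ forall d y, 0 < d < d0 -> Rabs (y - x) < r ->
    nrm (laplace g (d, y) -v laplace g (- d, y)) <= eps.

(** The integral representation is available for polynomials. Replacing [L] by [p] with tolerance
    [e] costs [e * M'] for the operator and [2 N S e] for the symbol, where [S] is a crude bound of
    the transform; both vanish with [e]. *)
Lemma op_bound_symbol L phi N d T K t : Op L phi -> 1 <= N -> 0 < d -> 0 <= T ->
  (forall x, Rabs x <= N -> Cmod (phi x) * nrm (damped_ft d T x) <= K) ->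
  nrm (L (fejer N d T) t) <= 2 * N * K.
Proof.
intros HL HN Hd HT HK.
assert (HM0 := bdd_ge0 _ _ HM).
set (S := 2 * T * M).
assert (HS : forall x, nrm (damped_ft d T x) <= S).
{ intros x; unfold S; replace (2 * T * M) with (M * Rabs (T - - T)) by (rewrite Rabs_pos_eq by
  lra; ring).
  apply integral_bound; [now apply cisg_cont |]; intros e _.
  rewrite nrm_sc, Cmod_cis, Rmult_1_l; now apply gdamp_bdd. }
assert (HS0 : 0 <= S) by (apply Rle_trans with (2 := HS 0), nrm_ge0).
set (M' := M * (fmass N + 8 / N)).
assert (HB : bdd (fejer N d T) M') by now apply fejer_bdd.
assert (HM'0 := bdd_ge0 _ _ HB).
apply Rnot_lt_le; intros Hlt.
set (gap := nrm (L (fejer N d T) t) - 2 * N * K) in *.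
assert (Hgap : 0 < gap) by (unfold gap; lra).
assert (HNS : 0 <= N * S) by (apply Rmult_le_pos; lra).
set (e := gap / (2 * (M' + 2 * (N * S) + 1))).
assert (He : 0 < e) by (apply Rdiv_lt_0_compat; lra).
destruct (HL e He) as [p [P1 P2]].
assert (A : nrm (tp_act p (fejer N d T) t) <= 2 * N * (K + e * S)).
{ apply fejer_tp_bound; auto; intros x Hx.
  specialize (P1 x); specialize (HK x Hx).
  assert (B : Cmod (tp_eval p x) <= Cmod (phi x) + e).
  { replace (tp_eval p x) with (Cplus (phi x) (- (phi x - tp_eval p x))%C) by ring.
    apply Rle_trans with (1 := Cmod_triangle _ _); rewrite Cmod_opp; lra. }
  specialize (HS x); assert (Q := nrm_ge0 (damped_ft d T x)).
  apply Rle_trans with ((Cmod (phi x) + e) * nrm (damped_ft d T x));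
    [now apply Rmult_le_compat_r |].
  rewrite Rmult_plus_distr_r; apply Rplus_le_compat; [exact HK |].
  apply Rmult_le_compat_l; lra. }
specialize (P2 _ M' t HB).
assert (B := nrm_sub_ge (L (fejer N d T) t) (tp_act p (fejer N d T) t)).
assert (E : e * (M' + 2 * (N * S) + 1) = gap / 2) by (unfold e; field; lra).
unfold gap in *; nra.
Qed.

Lemma uniform_jump (phi : R -> C) Kphi N eps : 0 < eps -> (forall x, Cmod (phi x) <= Kphi) ->
  (forall x, (exists r, 0 < r /\ forall y, Rabs (y - x) < r -> phi y = RtoC 0) \/ jump_null x) ->
  exists d0, 0 < d0 /\ forall d x, 0 < d < d0 -> Rabs x <= N ->
    Cmod (phi x) * nrm (laplace g (d, x) -v laplace g (- d, x)) <= eps.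
Proof.
intros He HK H.
assert (HK0 : 0 <= Kphi) by (apply Rle_trans with (2 := HK 0), Cmod_ge_0).
assert (Hloc : forall x, exists r, 0 < r /\ exists d0, 0 < d0 /\ forall d y,
  0 < d < d0 -> Rabs (y - x) < r ->
    Cmod (phi y) * nrm (laplace g (d, y) -v laplace g (- d, y)) <= eps).
{ intros x; destruct (H x) as [[r [R1 R2]] | [r [R1 R2]]]; exists r; (split; [exact R1 |]).
  - exists 1; split; [lra |]; intros d y _ Hy; rewrite R2, Cmod_0 by exact Hy; lra.
  - destruct (R2 (eps / (Kphi + 1))) as [d0 [D1 D2]]; [apply Rdiv_lt_0_compat; lra |].
    exists d0; split; [exact D1 |]; intros d y Hd Hy; specialize (D2 d y Hd Hy).
    apply Rle_trans with ((Kphi + 1) * (eps / (Kphi + 1))); [| right; field; lra].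
    apply Rmult_le_compat; auto using Cmod_ge_0, nrm_ge0; specialize (HK y); lra. }
destruct (choice _ Hloc) as [r Hr].
apply NNPP; intros HN.
apply (compactness_list 1 (- N, tt) (N, tt) (fun x => mkposreal _ (proj1 (Hr (fst x))))).
intros [l Hl]; apply HN.
assert (Hd : exists d0, 0 < d0 /\ forall x, In x l -> forall d y,
  0 < d < d0 -> Rabs (y - fst x) < r (fst x) ->
    Cmod (phi y) * nrm (laplace g (d, y) -v laplace g (- d, y)) <= eps).
{ clear Hl; induction l as [|x l [d1 [D1 D2]]].
  - exists 1; split; [lra | easy].
  - destruct (proj2 (Hr (fst x))) as [d2 [E1 E2]].
    exists (Rmin d1 d2); split; [now apply Rmin_pos |].
    intros z [<- | Hz] d y Hdd Hy.
    + apply E2; [| exact Hy]; assert (A := Rmin_r d1 d2); lra.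
    + apply (D2 z Hz); [| exact Hy]; assert (A := Rmin_l d1 d2); lra. }
destruct Hd as [d0 [D1 D2]]; exists d0; split; [exact D1 |]; intros d x Hdd Hx.
apply Rabs_le_between in Hx.
destruct (Hl (x, tt)) as [[z []] [Z1 [_ Z2]]].
{ simpl; split; [lra | easy]. }
apply (D2 _ Z1); [exact Hdd |]; simpl in Z2; exact (proj1 Z2).
Qed.

(** The Fejer means of the damped truncated [g], divided by [fmass], are bounded and tend to [g]
    pointwise, so [L] of them tends to [L g] by [Op_seq]. The same images are bounded through the
    symbol by [O(1 / N)], hence [L g = 0]. *)
Theorem op_null L phi : Op L phi ->
  (forall x, (exists r, 0 < r /\ forall y, Rabs (y - x) < r -> phi y = RtoC 0) \/ jump_null x) ->
  forall t, L g t = v0.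
Proof.
intros HL H t.
assert (HM0 := bdd_ge0 _ _ HM).
destruct (Op_bound L phi HL) as [Kp [Kp0 [_ HKp]]].
pose (Nn := fun n : nat => INR (S n)).
assert (HNn : forall n, 1 <= Nn n).
{ intros n; unfold Nn; rewrite S_INR; assert (P := pos_INR n); lra. }
(* For each width [N], first the damping [d] is chosen to make the jump small, then the truncation
   [T], since its error [e^{- d T} / d] depends on [d]. The target [1 / N^2] leaves [O(1 / N)] after
   integration over frequencies up to [N]. *)
assert (Hpar : forall n, exists dT : R * R, 0 < fst dT <= / Nn n /\ Nn n <= snd dT /\
   forall x, Rabs x <= Nn n -> Cmod (phi x) * nrm (damped_ft (fst dT)
     (snd dT) x) <= / (Nn n * Nn n)).
{ intros n; assert (H1 := HNn n).
  set (e := / (Nn n * Nn n)).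
  assert (He : 0 < e) by (apply Rinv_0_lt_compat; nra).
  destruct (uniform_jump phi Kp (Nn n) (e / 2) ltac:(lra) HKp H) as [d0 [D1 D2]].
  assert (Hn0 : 0 < / Nn n) by (apply Rinv_0_lt_compat; lra).
  set (d := Rmin (d0 / 2) (/ Nn n)).
  assert (Hd : 0 < d) by (apply Rmin_pos; lra).
  assert (Hdd : d < d0) by (apply Rle_lt_trans with (1 := Rmin_l _ _); lra).
  assert (Hdn : d <= / Nn n) by apply Rmin_r.
  destruct (exp_decay_small d (Kp * (2 * M / d)) (e / 2) Hd ltac:(lra)) as [m Hm].
  exists (d, INR m + Nn n); simpl; split; [lra | split].
  - assert (P := pos_INR m); lra.
  - intros x Hx.
    assert (P := pos_INR m).
    assert (A1 := damped_ft_laplace d (INR m + Nn n) Hd ltac:(lra) x).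
    assert (A2 := D2 d x ltac:(lra) Hx).
    assert (A3 := Hm (INR m + Nn n) ltac:(lra)).
    assert (A4 := nrm_sub_ge (damped_ft d (INR m + Nn n) x) (laplace g (d, x) -v laplace g (- d,
      x))).
    set (D := nrm (damped_ft d (INR m + Nn n) x)) in *.
    set (E := exp (- (d * (INR m + Nn n)))) in *.
    assert (Hph := Cmod_ge_0 (phi x)); specialize (HKp x).
    apply Rle_trans with (Cmod (phi x) * (nrm (laplace g (d, x) -v laplace g (- d,
      x)) + 2 * M * E / d)).
    { apply Rmult_le_compat_l; lra. }
    rewrite Rmult_plus_distr_l.
    assert (A5 : Cmod (phi x) * (2 * M * E / d) <= Kp * (2 * M / d) * E).
    { replace (Kp * (2 * M / d) * E) with (Kp * (2 * M * E / d)) by (field; lra).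
      apply Rmult_le_compat_r; [| exact HKp].
      apply Rmult_le_pos; [| left; now apply Rinv_0_lt_compat].
      apply Rmult_le_pos; [lra | left; apply exp_pos]. }
    lra. }
destruct (choice _ Hpar) as [dT HdT].
pose (c := fun n => fmass (Nn n)).
assert (Hc : forall n, 2 / 9 <= c n) by (intros; now apply fmass_ge).
pose (F := fun n => fejer (Nn n) (fst (dT n)) (snd (dT n))).
assert (FB : forall n, bdd (F n) (M * (c n + 8 / Nn n))).
{ intros n; destruct (HdT n) as [A1 [A2 _]]; specialize (HNn n).
  exact (fejer_bdd (Nn n) (fst (dT n)) (snd (dT n)) HNn (proj1 A1) ltac:(lra)). }
pose (G := fun n s => RtoC (/ c n) *v F n s +v v0).
(* [(c + 8) / c <= 37] because [c >= 2 / 9]. *)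
assert (GB : forall n, bdd (G n) (37 * M)).
{ intros n s; unfold G; replace (RtoC (/ c n) *v F n s +v v0) with (RtoC (/ c n) *v F n s) by vring.
  specialize (Hc n); assert (0 < / c n) by (apply Rinv_0_lt_compat; lra).
  rewrite nrm_sc, Cmod_R, Rabs_pos_eq by lra.
  apply Rle_trans with (/ c n * (M * (c n + 8 / Nn n))); [apply Rmult_le_compat_l;
    [lra | apply FB] |].
  assert (8 / Nn n <= 8).
  { specialize (HNn n); apply Rmult_le_reg_r with (Nn n); [lra |]; unfold Rdiv;
    rewrite Rmult_assoc, Rinv_l; lra. }
  apply Rle_trans with (/ c n * (37 * M * c n)).
  - apply Rmult_le_compat_l; [lra |].
    assert (0 <= M * (c n - 2 / 9)) by (apply Rmult_le_pos; lra).
    assert (M * (8 / Nn n) <= M * 8) by (apply Rmult_le_compat_l; lra). lra.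
  - right; field; lra. }
assert (Hinv : forall e, 0 < e -> exists m, forall n, (m <= n)%nat -> / Nn n <= e).
{ intros e He; destruct (inv_INR_small e He) as [m [M1 M2]]; exists m; intros n Hn.
  apply Rle_trans with (2 := M2), Rinv_le_contravar; [now apply lt_0_INR | apply le_INR; lia]. }
assert (Gcv : forall s eps, 0 < eps -> exists m, forall n, (m <= n)%nat -> nrm (G n s -v g s) <=
  eps).
{ intros s eps He.
  destruct (Hg s (eps / 4)) as [r0 [R1 R2]]; [lra |].
  set (r := Rmin 1 (r0 / 2)).
  assert (Hr : 0 < r <= 1) by (split; [apply Rmin_pos; lra | apply Rmin_l]).
  assert (Hrr : r < r0) by (apply Rle_lt_trans with (1 := Rmin_r _ _); lra).
  set (Ks := M * (Rabs s + 2)).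
  assert (HKs : 0 <= Ks) by (apply Rmult_le_pos; [lra | assert (P := Rabs_pos s); lra]).
  destruct (Hinv (eps / 4 / (Ks + 1))) as [m1 Hm1]; [apply Rdiv_lt_0_compat; lra |].
  destruct (Hinv (eps / 2 / (72 * M / r + 1))) as [m2 Hm2].
  { apply Rdiv_lt_0_compat; [lra |].
    assert (0 <= 72 * M / r) by (apply Rmult_le_pos; [lra | left; apply Rinv_0_lt_compat; lra]);
      lra. }
  destruct (nfloor_ex (Rabs s + 1)) as [m3 Hm3]; [assert (P := Rabs_pos s); lra |].
  exists (m1 + m2 + m3)%nat; intros n Hn.
  specialize (Hm1 n ltac:(lia)); specialize (Hm2 n ltac:(lia)).
  destruct (HdT n) as [[A1 A1'] [A2 _]]; assert (HN1 := HNn n); specialize (Hc n).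
  assert (HsT : Rabs s + 1 <= snd (dT n)).
  { apply Rle_trans with (2 := A2); unfold Nn; rewrite S_INR.
    assert (INR m3 <= INR n) by (apply le_INR; lia); lra. }
  assert (Hdamp : forall e, Rabs e <= r -> nrm (gdamp (fst (dT n)) (s + e) -v g s) <= eps / 2).
  { intros e Hee; set (dd := fst (dT n)) in *.
    assert (B1 := R2 (s + e)); replace (s + e - s) with e in B1 by ring; specialize (B1 ltac:(lra)).
    assert (B2 := nrm_sub_tri (gdamp dd (s + e)) (g (s + e)) (g s)).
    assert (B3 : nrm (gdamp dd (s + e) -v g (s + e)) <= eps / 4).
    { unfold gdamp.
      replace (RtoC (exp (- (dd * Rabs (s + e)))) *v g (s + e) -v g (s + e)) with
        (RtoC (exp (- (dd * Rabs (s + e))) - 1) *v g (s + e)) by vring.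
      rewrite nrm_sc, Cmod_R.
      assert (C1 := exp_damp_le dd A1 (s + e)).
      rewrite Rabs_left1 by lra.
      assert (C2 : 1 - dd * Rabs (s + e) <= exp (- (dd * Rabs (s + e)))).
      { assert (C := exp_ineq1_le (- (dd * Rabs (s + e)))); lra. }
      assert (C3 : Rabs (s + e) <= Rabs s + 2).
      { apply Rle_trans with (1 := Rabs_triang _ _); lra. }
      apply Rle_trans with (dd * (Rabs s + 2) * M).
      - apply Rmult_le_compat; [lra | apply nrm_ge0 | | apply HM].
        assert (dd * Rabs (s + e) <= dd * (Rabs s + 2)) by (apply Rmult_le_compat_l; lra); lra.
      - replace (dd * (Rabs s + 2) * M) with (dd * Ks) by (unfold Ks; ring).
        apply Rle_trans with (eps / 4 / (Ks + 1) * (Ks + 1)); [| right; field; lra].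
        apply Rmult_le_compat; lra. }
    lra. }
  assert (B := fejer_concentrates (Nn n) (fst (dT n)) (snd (dT n)) HN1 A1 s r (eps / 2) Hr HsT
    Hdamp).
  fold (F n) in B; fold (c n) in B.
  assert (Hci : 0 < / c n) by (apply Rinv_0_lt_compat; lra).
  unfold G; replace (RtoC (/ c n) *v F n s +v v0 -v g s) with (RtoC (/ c n) *v (F n s -v RtoC (c
    n) *v g s)).
  2:{ replace (RtoC (/ c n) *v (F n s -v RtoC (c n) *v g s)) with (RtoC (/ c n) *v F n s -v RtoC
    (/ c n * c n) *v g s) by vring.
      rewrite Rinv_l by lra; vring. }
  rewrite nrm_sc, Cmod_R, Rabs_pos_eq by lra.
  apply Rle_trans with (/ c n * (eps / 2 * c n + 16 * M / (Nn n * r))); [apply Rmult_le_compat_l;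
    lra |].
  rewrite Rmult_plus_distr_l.
  replace (/ c n * (eps / 2 * c n)) with (eps / 2) by (field; lra).
  assert (C : / c n * (16 * M / (Nn n * r)) <= eps / 2); [| lra].
  apply Rle_trans with (9 / 2 * (16 * M / (Nn n * r))).
  - apply Rmult_le_compat_r.
    + apply Rmult_le_pos; [lra | left; apply Rinv_0_lt_compat, Rmult_lt_0_compat; lra].
    + replace (9 / 2) with (/ (2 / 9)) by field; apply Rinv_le_contravar; lra.
  - replace (9 / 2 * (16 * M / (Nn n * r))) with (72 * M / r * / Nn n) by (field; split; lra).
    assert (0 <= 72 * M / r) by (apply Rmult_le_pos; [lra | left; apply Rinv_0_lt_compat; lra]).
    apply Rle_trans with ((72 * M / r + 1) * (eps / 2 / (72 * M / r + 1))); [| right; field;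
      split; lra].
    apply Rmult_le_compat; try lra; left; apply Rinv_0_lt_compat; lra. }
assert (HM37 : bdd g (37 * M)) by (intros s; specialize (HM s); lra).
assert (HLG := Op_seq L phi G g (37 * M) t HL GB HM37 Gcv).
apply nrm_eq0, (le_eps_0 _ 2); [apply nrm_ge0 |]; intros eps He.
destruct (HLG eps He) as [m1 Hm1].
destruct (Hinv (eps / 9)) as [m2 Hm2]; [lra |].
set (n := (m1 + m2)%nat).
specialize (Hm1 n ltac:(lia)); specialize (Hm2 n ltac:(lia)).
destruct (HdT n) as [A1 [A2 A3]]; assert (HN1 := HNn n); specialize (Hc n).
assert (Hz : bdd (fun _ : R => v0 : X) 0) by (intros s; rewrite nrm_0; lra).
assert (E : L (G n) t = RtoC (/ c n) *v L (F n) t +v L (fun _ => v0) t).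
{ exact (Op_lin L phi (RtoC (/ c n)) (F n) (fun _ => v0) _ 0 t HL (FB n) Hz). }
assert (E0 : L (fun _ => v0) t = v0).
{ destruct (Op_bound L phi HL) as [K [K0 [K1 _]]]; apply nrm_eq0, Rle_antisym; [| apply nrm_ge0].
  apply Rle_trans with (1 := K1 _ 0 t Hz); lra. }
assert (B := op_bound_symbol L phi (Nn n) (fst (dT n)) (snd (dT n))
  (/ (Nn n * Nn n)) t HL HN1 ltac:(lra) ltac:(lra) A3).
fold (F n) in B.
assert (HB : nrm (L (G n) t) <= eps).
{ rewrite E, E0; replace (RtoC (/ c n) *v L (F n) t +v v0) with (RtoC (/ c n) *v L (F n) t) by
  vring.
  assert (Hci : 0 < / c n) by (apply Rinv_0_lt_compat; lra).
  rewrite nrm_sc, Cmod_R, Rabs_pos_eq by lra.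
  apply Rle_trans with (9 / 2 * (2 * Nn n * / (Nn n * Nn n))).
  - apply Rmult_le_compat; [lra | apply nrm_ge0 | | exact B].
    replace (9 / 2) with (/ (2 / 9)) by field; apply Rinv_le_contravar; lra.
  - replace (9 / 2 * (2 * Nn n * / (Nn n * Nn n))) with (9 * / Nn n) by (field; lra); lra. }
assert (A := nrm_sub_ge (L g t) (L (G n) t)); rewrite nrm_sub_sym in A; lra.
Qed.

End Null.

(** * Mild solutions *)

Section ClosedOperator.
Context {X : CompleteNormedModule C_AbsRing}.
Variable A : lin_op X.
Hypothesis hA : closed_op A.

Lemma graph_limit (x y : X) :
  (forall eps, 0 < eps -> exists x' y', A x' y' /\ nrm (x' -v x) <= eps /\ nrm (y' -v y) <= eps) ->
  A x y.
Proof.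
intros H; apply (hA (x, y)); intros [eps Heps].
assert (He := cond_pos eps).
destruct (H (eps / 2)) as [x' [y' [H1 [H2 H3]]]]; [lra |].
apply (Heps (x', y')); [| exact H1].
split; apply ball_of_nrm; simpl; lra.
Qed.

Lemma graph_comb c (x y x' y' : X) : A x y -> A x' y' -> A (c *v x +v x') (c *v y +v y').
Proof. intros H H'; exact (graph_plus (graph_scal c H) H'). Qed.

(** A closed operator commutes with integrals: the Riemann sums of [a] and [h] over one common
    tagged partition form a point of the graph, and the graph is closed. *)
Lemma graph_integral (a h : R -> X) p q : (forall t, cont_at a t) -> (forall t, cont_at h t) ->
  (forall t, A (a t) (h t)) -> A (integral a p q) (integral h p q).
Proof.
intros Ha Hh H.
assert (HR : forall s, A (Riemann_sum (V := realify X) a s) (Riemann_sum (V := realify X) h s)).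
{ intros s; induction s as [x0 | [x0 y0] s IH] using SF_cons_ind.
  - exact (graph_zero A).
  - rewrite !Riemann_sum_cons.
    exact (graph_plus (graph_scal (RtoC (SF_h s - x0)) (H y0)) IH). }
assert (Ia := is_int a p q Ha); assert (Ih := is_int h p q Hh).
apply graph_limit; intros eps He.
assert (HB : forall (F : R -> X), is_RInt (V := realify X) F p q (integral F p q) ->
  Riemann_fine p q (fun s => nrm ((RtoC (sign (q - p)) *v Riemann_sum (V := realify X) F s) -v
    integral F p q) <= eps)).
{ intros F HF.
  destruct (@nrm_of_ball X) as [k [Hk Hb]].
  assert (Hek : 0 < eps / k) by (apply Rdiv_lt_0_compat; lra).
  apply (HF (fun z => nrm (z -v integral F p q) <= eps)).
  exists (mkposreal _ Hek); intros z Hz.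
  apply Hb in Hz; [| exact Hek]; simpl in Hz.
  replace (k * (eps / k)) with eps in Hz by (field; lra); lra. }
destruct (filter_ex _ (filter_and _ _ (HB a Ia) (HB h Ih))) as [s [S1 S2]].
exists (RtoC (sign (q - p)) *v Riemann_sum (V := realify X) a s),
  (RtoC (sign (q - p)) *v Riemann_sum (V := realify X) h s).
split; [| auto]; exact (graph_scal (RtoC (sign (q - p))) (HR s)).
Qed.

(** The mild form of [u' = A u + v] on every interval instead of from 0 only, which makes
    translation invariance visible. *)
Definition mildp (u v : R -> X) := forall a b, A (integral u a b) (u b -v u a -v integral v a b).

Lemma mildp_comb c u v u' v' : (forall t, cont_at u t) -> (forall t, cont_at v t) ->
  (forall t, cont_at u' t) -> (forall t, cont_at v' t) ->
  mildp u v -> mildp u' v' -> mildp (fun t => c *v u t +v u' t) (fun t => c *v v t +v v' t).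
Proof.
intros Cu Cv Cu' Cv' H H' a b.
rewrite (integral_comb c u u' a b Cu Cu'), (integral_comb c v v' a b Cv Cv').
replace (c *v u b +v u' b -v (c *v u a +v u' a) -v (c *v integral v a b +v integral v' a b)) with
  (c *v (u b -v u a -v integral v a b) +v (u' b -v u' a -v integral v' a b)) by vring.
apply graph_comb; auto.
Qed.

Lemma mildp_tp p u v : (forall t, cont_at u t) -> (forall t, cont_at v t) ->
  mildp u v -> mildp (tp_act p u) (tp_act p v).
Proof.
intros Cu Cv H; induction p as [|[n c] p IH].
- intros a b; cbn [tp_act]; rewrite integral_const.
  replace (RtoC (b - a) *v v0) with (v0 : X) by vring.
  replace (v0 -v v0 -v v0) with (v0 : X) by vring; exact (graph_zero A).
- apply (mildp_comb c (fun t => u (t + IZR n)) (fun t => v (t + IZR n)) (tp_act p u)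
  (tp_act p v)); auto;
    try (intros t; apply tp_act_cont; auto).
  + intros t; assert (K := cont_at_shift u (IZR n) t (Cu _)).
    replace (fun t => u (t + IZR n)) with (fun t => u (IZR n + t)); [exact K |].
    apply functional_extensionality; intros; f_equal; ring.
  + intros t; assert (K := cont_at_shift v (IZR n) t (Cv _)).
    replace (fun t => v (t + IZR n)) with (fun t => v (IZR n + t)); [exact K |].
    apply functional_extensionality; intros; f_equal; ring.
  + intros a b.
    rewrite (integral_ext (fun t => u (t + IZR n)) (fun t => u (IZR n + t))) by (intros; f_equal;
      ring).
    rewrite (integral_ext (fun t => v (t + IZR n)) (fun t => v (IZR n + t))) by (intros; f_equal;
      ring).
    rewrite !integral_shift by auto.
    rewrite (Rplus_comm a), (Rplus_comm b); apply H.
Qed.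

Lemma mildp_limit u v : (forall t, cont_at u t) -> (forall t, cont_at v t) ->
  (forall eps, 0 < eps -> exists u' v', (forall t, cont_at u' t) /\ (forall t, cont_at v' t) /\
     mildp u' v' /\ (forall t, nrm (u' t -v u t) <= eps) /\ (forall t, nrm (v' t -v v t) <= eps)) ->
  mildp u v.
Proof.
intros Cu Cv H a b; apply graph_limit; intros eps He.
assert (Hab := Rabs_pos (b - a)).
set (e := eps / (Rabs (b - a) + 2)).
assert (He0 : 0 < e) by (apply Rdiv_lt_0_compat; lra).
assert (Ee : e * Rabs (b - a) + 2 * e = eps) by (unfold e; field; lra).
destruct (H e He0) as [u' [v' [Cu' [Cv' [Hm [Hu Hv]]]]]].
assert (HI : forall w w' : R -> X, (forall t, cont_at w t) -> (forall t, cont_at w' t) ->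
  (forall t, nrm (w' t -v w t) <= e) -> nrm (integral w' a b -v integral w a b) <= e * Rabs (b -
    a)).
{ intros w w' Cw Cw' Hw.
  assert (E : integral w' a b -v integral w a b = integral (fun t => RtoC (-1) *v w t +v w' t) a b).
  { rewrite (integral_comb (RtoC (-1)) w w' a b Cw Cw'); vring. }
  rewrite E; apply integral_bound; [intros; now apply cont_at_comb |].
  intros t _; replace (RtoC (-1) *v w t +v w' t) with (w' t -v w t) by vring; auto. }
exists (integral u' a b), (u' b -v u' a -v integral v' a b); split; [apply Hm | split].
- apply Rle_trans with (1 := HI u u' Cu Cu' Hu); lra.
- assert (I := HI v v' Cv Cv' Hv).
  replace (u' b -v u' a -v integral v' a b -v (u b -v u a -v integral v a b)) with
    ((u' b -v u b) -v ((u' a -v u a) +v (integral v' a b -v integral v a b))) by vring.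
  apply Rle_trans with (1 := nrm_sub _ _).
  assert (T := nrm_add (u' a -v u a) (integral v' a b -v integral v a b)).
  assert (U1 := Hu a); assert (U2 := Hu b); lra.
Qed.

Lemma mildp_op L phi u v M N : Op L phi -> bdd u M -> bdd v N ->
  (forall t, cont_at u t) -> (forall t, cont_at v t) -> mildp u v -> mildp (L u) (L v).
Proof.
intros HL Hu Hv Cu Cv H.
assert (HM := bdd_ge0 _ _ Hu); assert (HN := bdd_ge0 _ _ Hv).
apply mildp_limit; [intros; eapply Op_cont; eauto | intros; eapply Op_cont; eauto |].
intros eps He.
assert (He' : 0 < eps / (M + N + 1)) by (apply Rdiv_lt_0_compat; lra).
destruct (HL _ He') as [p [_ P]].
assert (Ee : eps / (M + N + 1) * (M + N + 1) = eps) by (field; lra).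
exists (tp_act p u), (tp_act p v); repeat split.
- intros; now apply tp_act_cont.
- intros; now apply tp_act_cont.
- now apply mildp_tp.
- intros t; rewrite nrm_sub_sym; specialize (P u M t Hu); nra.
- intros t; rewrite nrm_sub_sym; specialize (P v N t Hv); nra.
Qed.

End ClosedOperator.

(** * The Carleman transform of translates as a resolvent of differentiation *)

Section Laplace.
Context {X : CompleteNormedModule C_AbsRing}.

Lemma lap_lim l (g : R -> X) M (x : X) K : (forall t, cont_at g t) -> bdd g M -> Re l <> 0 ->
  (forall T, 0 <= Re l * T -> nrm (x -v ltr l T g) <= K * exp (- (Re l * T))) -> x = laplace g l.
Proof.
intros Hg HM Hl H.
apply (eq_by_eps _ _ 2); intros eps He.
set (a := Rabs (Re l)); assert (Ha : 0 < a) by now apply Rabs_pos_lt.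
destruct (exp_decay_small a K eps Ha He) as [n1 H1].
destruct (exp_decay_small a (M / a) eps Ha He) as [n2 H2].
set (m := INR (n1 + n2)).
set (T := (Re l / a) * m).
assert (HT : Re l * T = a * m).
{ unfold T, a, Rabs; destruct (Rcase_abs (Re l)); field; lra. }
assert (Hm : 0 <= m) by apply pos_INR.
assert (HT0 : 0 <= Re l * T) by (rewrite HT; apply Rmult_le_pos; lra).
assert (B1 := H T HT0); assert (B2 := lap_spec l g M Hg HM Hl T HT0).
rewrite HT in B1, B2; fold a in B2.
assert (N1 : INR n1 <= m) by (apply le_INR; lia).
assert (N2 : INR n2 <= m) by (apply le_INR; lia).
specialize (H1 m N1); specialize (H2 m N2).
replace (M * exp (- (a * m)) / a) with (M / a * exp (- (a * m))) in B2 by (field; lra).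
assert (B := nrm_sub_tri x (ltr l T g) (laplace g l)).
rewrite (nrm_sub_sym (ltr l T g)) in B; lra.
Qed.

Lemma kern_comb l c (g h : R -> X) s : kern l (fun t => c *v g t +v h t) s = c *v kern l g s +v
  kern l h s.
Proof. unfold kern; vring. Qed.

Lemma ltr_comb l T c (g h : R -> X) : (forall t, cont_at g t) -> (forall t, cont_at h t) ->
  ltr l T (fun t => c *v g t +v h t) = c *v ltr l T g +v ltr l T h.
Proof.
intros Hg Hh; unfold ltr.
rewrite (integral_ext _ _ 0 T (kern_comb l c g h)).
apply integral_comb; now apply kern_cont.
Qed.

Lemma bdd_comb c (g h : R -> X) M N : bdd g M -> bdd h N -> bdd (fun t => c *v g t +v h t)
  (Cmod c * M + N).
Proof.
intros Hg Hh t; apply Rle_trans with (1 := nrm_add _ _); rewrite nrm_sc.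
apply Rplus_le_compat; [apply Rmult_le_compat_l; [apply Cmod_ge_0 | apply Hg] | apply Hh].
Qed.

Lemma lap_comb l c (g h : R -> X) M N : (forall t, cont_at g t) -> (forall t, cont_at h t) ->
  bdd g M -> bdd h N -> Re l <> 0 ->
  laplace (fun t => c *v g t +v h t) l = c *v laplace g l +v laplace h l.
Proof.
intros Cg Ch Hg Hh Hl; symmetry.
apply (lap_lim l _ (Cmod c * M + N) _ ((Cmod c * M + N) / Rabs (Re l))); auto.
- intros; now apply cont_at_comb.
- now apply bdd_comb.
- intros T HT; rewrite ltr_comb by auto.
  assert (B1 := lap_spec l g M Cg Hg Hl T HT); assert (B2 := lap_spec l h N Ch Hh Hl T HT).
  replace (c *v laplace g l +v laplace h l -v (c *v ltr l T g +v ltr l T h)) with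
    (c *v (laplace g l -v ltr l T g) +v (laplace h l -v ltr l T h)) by vring.
  apply Rle_trans with (1 := nrm_add _ _); rewrite nrm_sc.
  assert (Ha : 0 < Rabs (Re l)) by now apply Rabs_pos_lt.
  replace ((Cmod c * M + N) / Rabs (Re l) * exp (- (Re l * T))) with
    (Cmod c * (M * exp (- (Re l * T)) / Rabs (Re l)) + N * exp (- (Re l * T)) / Rabs (Re l)) by
      (field; lra).
  apply Rplus_le_compat; [apply Rmult_le_compat_l; [apply Cmod_ge_0 |] |]; auto.
Qed.

Lemma lap_bound l (g : R -> X) M : (forall t, cont_at g t) -> bdd g M -> Re l <> 0 ->
  nrm (laplace g l) <= M / Rabs (Re l).
Proof.
intros Hg HM Hl; assert (B := lap_spec l g M Hg HM Hl 0 ltac:(rewrite Rmult_0_r; lra)).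
unfold ltr in B; rewrite integral_point, Rmult_0_r, Ropp_0, exp_0, Rmult_1_r in B.
now replace (laplace g l -v v0) with (laplace g l) in B by vring.
Qed.

(** The resolvent at [l] of the generator of translations, applied to [g]: the only bounded solution
    of [z' = l z - g] when [Re l] is not 0. Its value at 0 is the transform of [g]. *)
Definition Lp (l : C) (g : R -> X) (t : R) : X := laplace (fun s => g (t + s)) l.

Section Fixed.
Variables (l : C) (g : R -> X) (M : R).
Hypothesis Hl : Re l <> 0.
Hypothesis Hg : bdd g M.
Hypothesis Ug : ucont g.

Let Cg t : cont_at g t.
Proof. now apply ucont_cont. Qed.

Let Cs t s : cont_at (fun r => g (t + r)) s.
Proof. apply cont_at_shift, Cg. Qed.

Let Bs t : bdd (fun r => g (t + r)) M.
Proof. intros s; apply Hg. Qed.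

Lemma Lp_bdd : bdd (Lp l g) (M / Rabs (Re l)).
Proof. intros t; now apply lap_bound. Qed.

Lemma Lp_ucont : ucont (Lp l g).
Proof.
assert (Ha : 0 < Rabs (Re l)) by now apply Rabs_pos_lt.
intros eps He; destruct (Ug (eps * Rabs (Re l))) as [d [Hd Hs]]; [nra |].
exists d; split; [exact Hd | intros s t Hst].
replace (Lp l g s -v Lp l g t) with (RtoC (-1) *v Lp l g t +v Lp l g s) by vring.
unfold Lp; rewrite <- (lap_comb l (RtoC (-1)) _ _ M M (Cs t) (Cs s) (Bs t) (Bs s) Hl).
replace eps with (eps * Rabs (Re l) / Rabs (Re l)) by (field; lra).
apply lap_bound; auto.
- intros r; apply cont_at_comb; apply Cs.
- intros r; replace (RtoC (-1) *v g (t + r) +v g (s + r)) with (g (s + r) -v g (t + r)) by vring.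
  apply Hs; now replace (s + r - (t + r)) with (s - t) by ring.
Qed.

Lemma by_parts (F f : R -> X) T : (forall s, has_deriv F s (f s)) -> (forall s, cont_at f s) ->
  integral (kern l f) 0 T = Cexp (- (l * RtoC T))%C *v F T -v F 0 +v l *v integral (kern l F) 0 T.
Proof.
intros HF Hf.
assert (CF : forall s, cont_at F s) by (intros s; eapply has_deriv_cont, HF).
assert (HD : forall s, has_deriv (fun s => Cexp ((- l) * RtoC s)%C *v F s) s
   ((- l)%C *v kern l F s +v kern l f s)).
{ intros s; assert (D := has_deriv_scal _ _ F s _ (cderiv_Cexp (- l)%C s) (HF s)).
  rewrite !kern_alt.
  replace ((- l)%C *v (Cexp (- l * RtoC s)%C *v F s) +v Cexp (- l * RtoC s)%C *v f s) with
   (((- l) * Cexp (- l * RtoC s))%C *v F s +v Cexp (- l * RtoC s)%C *v f s) by vring; exact D. }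
assert (E := ftc _ (fun s => (- l)%C *v kern l F s +v kern l f s) 0 T HD
  (fun s => cont_at_comb _ _ _ s (kern_cont l F CF s) (kern_cont l f Hf s))).
rewrite (integral_comb _ _ _ 0 T (kern_cont l F CF) (kern_cont l f Hf)) in E.
replace (- l * RtoC T)%C with (- (l * RtoC T))%C in E by ring.
replace (- l * RtoC 0)%C with (RtoC 0) in E by ring.
replace (Cexp (RtoC 0)) with (RtoC 1) in E
  by (unfold Cexp, RtoC; simpl; rewrite exp_0, cos_0, sin_0; f_equal; ring).
replace (Cexp (- (l * RtoC T))%C *v F T -v F 0) with (Cexp (- (l * RtoC T))%C *v F T -v RtoC 1 *v
  F 0) by vring.
rewrite <- E; vring.
Qed.

(** Integration by parts leaves the single boundary term [e^{- l T} z (t + T)], which tends to 0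
    because [z] is bounded. *)
Lemma Lp_unique (z : R -> X) K : bdd z K -> (forall s, has_deriv z s (l *v z s -v g s)) -> forall
  t, z t = Lp l g t.
Proof.
intros Hz HD t; unfold Lp.
assert (Cz : forall s, cont_at z s) by (intros s; eapply has_deriv_cont, HD).
assert (HK0 := bdd_ge0 _ _ Hz).
apply (lap_lim l _ M _ K); auto.
intros T HT.
assert (Cd : forall s, cont_at (fun s => (- (1))%C *v g (t + s) +v l *v z (t + s)) s).
{ intros s; apply (cont_at_comb _ (fun s => g (t + s)) (fun s => l *v z (t + s))); [apply Cs |].
  assert (D := cont_at_comb l (fun s => z (t + s)) (fun _ => v0) s (cont_at_shift z t s (Cz _))
    (cont_at_const _ s)).
  replace (fun s => l *v z (t + s)) with (fun s => l *v z (t + s) +v v0); [exact D |].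
  apply functional_extensionality; intros; vring. }
assert (E := by_parts (fun s => z (t + s)) (fun s => (- (1))%C *v g (t + s) +v l *v z (t + s)) T).
assert (E' : integral (kern l (fun s => (- (1))%C *v g (t + s) +v l *v z (t + s))) 0 T =
  (- (1))%C *v ltr l T (fun s => g (t + s)) +v l *v integral (kern l (fun s => z (t + s))) 0 T).
{ assert (C1 : forall s, cont_at (fun s => z (t + s)) s) by (intros; apply cont_at_shift, Cz).
  assert (C0 : forall s, cont_at (fun _ : R => v0 : X) s) by (intros; apply cont_at_const).
  replace (fun s => (- (1))%C *v g (t + s) +v l *v z (t + s)) with
    (fun s => (- (1))%C *v g (t + s) +v (l *v z (t + s) +v v0)) by (apply
      functional_extensionality; intros; vring).
  assert (C2 : forall s, cont_at (fun s => l *v z (t + s) +v v0) s) by (intros;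
    now apply cont_at_comb).
  rewrite (integral_ext _ _ 0 T (kern_comb l _ _ _)).
  rewrite (integral_comb _ _ _ 0 T (kern_cont l _ (Cs t)) (kern_cont l _ C2)).
  rewrite (integral_ext _ _ 0 T (kern_comb l _ _ _)).
  rewrite (integral_comb _ _ _ 0 T (kern_cont l _ C1) (kern_cont l _ C0)).
  rewrite (integral_ext (kern l (fun _ => v0)) (fun _ => v0)) by (intros; unfold kern; vring).
  rewrite integral_const; unfold ltr; vring. }
rewrite E' in E; clear E'.
assert (Hz' : z t -v ltr l T (fun s => g (t + s)) = Cexp (- (l * RtoC T))%C *v z (t + T)).
{ transitivity (z t +v ((- (1))%C *v ltr l T (fun s => g (t + s)) +v l *v integral (kern l (fun s
  => z (t + s))) 0 T) -v
    l *v integral (kern l (fun s => z (t + s))) 0 T); [vring |].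
  rewrite E; [rewrite Rplus_0_r; vring | | exact Cd].
  intros s; apply has_deriv_shift.
  replace ((- (1))%C *v g (t + s) +v l *v z (t + s)) with (l *v z (t + s) -v g (t + s)) by vring;
    apply HD. }
rewrite Hz', nrm_sc, Cmod_Cexp.
replace (Re (- (l * RtoC T))%C) with (- (Re l * T)) by (destruct l; unfold Re, RtoC, Cmult, Copp;
  simpl; ring).
rewrite Rmult_comm; apply Rmult_le_compat_r; [left; apply exp_pos | apply Hz].
Qed.

Lemma Lp_deriv t : has_deriv (Lp l g) t (l *v Lp l g t -v g t).
Proof.
(* Variation of constants; this form can be differentiated by the product rule. *)
assert (E : forall t, Lp l g t = Cexp (l * RtoC t)%C *v (RtoC (-1) *v integral (kern l g) 0 t +v
  Lp l g 0)).
{ intros r; symmetry; unfold Lp at 2.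
  apply (lap_lim l _ M _ (M / Rabs (Re l))); auto.
  assert (HM0 := bdd_ge0 _ _ Hg).
  assert (Ha : 0 < Rabs (Re l)) by now apply Rabs_pos_lt.
  intros T HT.
  assert (E1 : ltr l T (fun s => g (r + s)) = Cexp (l * RtoC r)%C *v integral (kern l g) r (r + T)).
  { unfold ltr.
    rewrite (integral_ext (kern l (fun s => g (r + s))) (fun s => Cexp (l * RtoC r)%C *v kern l g
      (r + s) +v v0)).
    - rewrite (integral_comb _ (fun s => kern l g (r + s)) (fun _ => v0) 0 T).
      + rewrite integral_const, (integral_shift (kern l g) r 0 T (kern_cont l g Cg)), Rplus_0_r;
        vring.
      + intros s; apply cont_at_shift, kern_cont, Cg.
      + intros; apply cont_at_const.
    - intros s; unfold kern.
      replace (Cexp (- (l * RtoC s))%C) with (Cexp (l * RtoC r)%C * Cexp (- (l * RtoC (r +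
        s)))%C)%C; [vring |].
      rewrite <- Cexp_plus; f_equal; rewrite RtoC_plus; ring. }
  assert (E2 : integral (kern l g) r (r + T) = ltr l (r + T) g -v integral (kern l g) 0 r).
  { unfold ltr; rewrite <- (integral_chasles (kern l g) 0 r (r + T) (kern_cont l g Cg)); vring. }
  assert (E3 : Lp l g 0 = laplace g l).
  { unfold Lp; f_equal; apply functional_extensionality; intros; f_equal; ring. }
  rewrite E1, E2, E3.
  replace (Cexp (l * RtoC r)%C *v (RtoC (-1) *v integral (kern l g) 0 r +v laplace g l) -v
    Cexp (l * RtoC r)%C *v (ltr l (r + T) g -v integral (kern l g) 0 r)) with
    (Cexp (l * RtoC r)%C *v (laplace g l -v ltr l (r + T) g)) by vring.
  rewrite nrm_sc, Cmod_Cexp.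
  replace (Re (l * RtoC r)%C) with (Re l * r) by (destruct l; unfold Re, RtoC, Cmult; simpl; ring).
  (* After the shift by [r], the truncation point may lie on the wrong side of 0, which [lap_spec]
     does not cover; there the integral over the missing piece is estimated directly. *)
  assert (HB : nrm (laplace g l -v ltr l (r + T) g) <= M / Rabs (Re l) * exp (- (Re l * (r + T)))).
  { destruct (Rle_lt_dec 0 (Re l * (r + T))) as [Hp | Hn].
    - apply Rle_trans with (1 := lap_spec l g M Cg Hg Hl _ Hp); right; field; lra.
    - assert (B1 := lap_bound l g M Cg Hg Hl).
      assert (B2 : nrm (ltr l (r + T) g) <= M / Rabs (Re l) * (exp (- (Re l * (r + T))) - 1)).
      { assert (D : forall p q, p <= q -> nrm (integral (kern l g) p q) <= M * (exp (- (Re l * p))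
        - exp (- (Re l * q))) / Re l).
        { intros p q; now apply kern_int_bound. }
        unfold ltr; destruct (Rle_lt_dec 0 (r + T)) as [H0 | H0].
        - apply Rle_trans with (1 := D _ _ H0); rewrite Rmult_0_r, Ropp_0, exp_0.
          assert (Hneg : Re l < 0) by nra; rewrite Rabs_left by exact Hneg; right; field; lra.
        - replace (integral (kern l g) 0 (r + T)) with (RtoC (-1) *v integral (kern l g) (r + T) 0).
          + rewrite nrm_sc, Cmod_R, Rabs_left by lra; replace (- (-1)) with 1 by ring;
            rewrite Rmult_1_l.
            apply Rle_trans with (1 := D _ _ (Rlt_le _ _ H0)); rewrite Rmult_0_r, Ropp_0, exp_0.
            assert (Hpos : 0 < Re l) by nra; rewrite Rabs_pos_eq by lra; right; field; lra.
          + assert (Ch := integral_chasles (kern l g) 0 (r + T) 0 (kern_cont l g Cg));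
            rewrite integral_point in Ch.
            transitivity (RtoC (-1) *v integral (kern l g) (r + T) 0 +v (integral (kern l g) 0 (r
              + T) +v integral (kern l g) (r + T) 0));
              [rewrite Ch |]; vring. }
      assert (B := nrm_sub (laplace g l) (ltr l (r + T) g)); lra. }
  apply Rle_trans with (exp (Re l * r) * (M / Rabs (Re l) * exp (- (Re l * (r + T))))).
  - apply Rmult_le_compat_l; [left; apply exp_pos | exact HB].
  - replace (exp (- (Re l * T))) with (exp (Re l * r) * exp (- (Re l * (r + T)))); [right; ring |].
    rewrite <- exp_plus; f_equal; ring. }
assert (D1 : has_deriv (fun t => RtoC (-1) *v integral (kern l g) 0 t +v Lp l g 0) t (RtoC (-1) *v
  kern l g t +v v0)).
{ apply has_deriv_comb; [apply integral_deriv, kern_cont, Cg |].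
  intros eps He; exists 1; split; [lra |]; intros s _.
  replace (Lp l g 0 -v Lp l g 0 -v RtoC (s - t) *v v0) with (v0 : X) by vring; rewrite nrm_0.
  apply Rmult_le_pos; [lra | apply Rabs_pos]. }
assert (D2 := has_deriv_scal _ _ _ t _ (cderiv_Cexp l t) D1).
replace (Lp l g) with (fun s => Cexp (l * RtoC s)%C *v (RtoC (-1) *v integral (kern l g) 0 s +v Lp
  l g 0))
  by (apply functional_extensionality; intros; symmetry; apply E); cbv beta.
replace (l *v (Cexp (l * RtoC t)%C *v (RtoC (-1) *v integral (kern l g) 0 t +v Lp l g 0)) -v g t)
  with
  ((l * Cexp (l * RtoC t))%C *v (RtoC (-1) *v integral (kern l g) 0 t +v Lp l g 0) +v Cexp (l *
    RtoC t)%C *v (RtoC (-1) *v kern l g t +v v0));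
  [exact D2 |].
replace (Cexp (l * RtoC t)%C *v (RtoC (-1) *v kern l g t +v v0)) with ((RtoC (-1) * (Cexp (l *
  RtoC t) * Cexp (- (l * RtoC t))))%C *v g t)
  by (unfold kern; vring).
rewrite <- Cexp_plus; replace (l * RtoC t + - (l * RtoC t))%C with (RtoC 0) by ring.
replace (Cexp (RtoC 0)) with (RtoC 1)
  by (unfold Cexp, RtoC; simpl; rewrite exp_0, cos_0, sin_0; f_equal; ring).
vring.
Qed.

End Fixed.
End Laplace.

(** * Autonomous operators and jumps of the Carleman transform *)

Section BUC.
Context {X : CompleteNormedModule C_AbsRing}.

Lemma is_BUC_of (g : R -> X) M : bdd g M -> ucont g -> is_BUC g.
Proof.
intros HM Hu; split; [now exists M |].
intros eps He; destruct (Hu (eps / 2)) as [d [Hd Hs]]; [lra |].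
exists d; split; [exact Hd |]; intros s t Hst; specialize (Hs s t Hst).
change (nrm (g s -v g t) < eps); lra.
Qed.

Definition toBUC (g : R -> X) M (HM : bdd g M) (Hu : ucont g) : BUC X :=
  BFun (E := BUC_space X) (is_BUC_of g M HM Hu).

Lemma BUC_bdd (g : BUC X) : bdd g (bfun_norm g).
Proof. intros t; exact (bfun_norm_ub g t). Qed.

Lemma BUC_ucont (g : BUC X) : ucont g.
Proof.
intros eps He; destruct (proj2 (bfun_in g) eps He) as [d [Hd Hs]].
exists d; split; [exact Hd |]; intros s t Hst; left; exact (Hs s t Hst).
Qed.

Lemma BUC_cont (g : BUC X) t : cont_at g t.
Proof. apply ucont_cont, BUC_ucont. Qed.

Definition bcomb (c : C) (g h : BUC X) : BUC X := plus (scal (c : C_AbsRing) g) h.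

Lemma bcomb_eval c (g h : BUC X) t : bcomb c g h t = c *v g t +v h t.
Proof. reflexivity. Qed.

Lemma bminus_eval (g h : BUC X) t : minus g h t = g t -v h t.
Proof.
change (g t +v (opp one : C_AbsRing) *v h t = g t -v h t).
change (g t +v (- (1))%C *v h t = g t -v h t); vring.
Qed.

Variables (B : BUC X -> BUC X).
Hypothesis hB : is_linear B.
Hypothesis hBaut : autonomous B.

Lemma B_comb c (g h : BUC X) t : B (bcomb c g h) t = c *v B g t +v B h t.
Proof.
unfold bcomb; rewrite (linear_plus B hB), (linear_scal B hB); reflexivity.
Qed.

Lemma B_bound : exists K, 0 < K /\ forall (g : BUC X) e, 0 <= e -> bdd g e -> bdd (B g) (K * e).
Proof.
destruct (linear_norm B hB) as [K [HK H]]; exists K; split; [exact HK |].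
intros g e He Hg t.
apply Rle_trans with (bfun_norm (B g)); [exact (bfun_norm_ub (B g) t) |].
apply Rle_trans with (1 := H g), Rmult_le_compat_l; [lra |].
now apply bfun_norm_le.
Qed.

Lemma B_zero t : B (zero : BUC X) t = v0.
Proof.
destruct B_bound as [K [HK H]].
assert (Hz : bdd (zero : BUC X) 0) by (intros s; change (nrm (v0 : X) <= 0); rewrite nrm_0; lra).
apply nrm_eq0, Rle_antisym; [| apply nrm_ge0].
apply Rle_trans with (1 := H zero 0 (Rle_refl 0) Hz t); lra.
Qed.

Lemma B_tp (p : tpoly) (g : BUC X) : exists q : BUC X, (forall t, q t = tp_act p g t) /\
  forall t, B q t = tp_act p (B g) t.
Proof.
induction p as [|[n c] p [q [Q1 Q2]]].
- exists zero; split; [reflexivity |]; intros t; apply B_zero.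
- exists (bcomb c (translation (IZR n) g) q); split; intros t.
  + rewrite bcomb_eval, Q1; cbn [tp_act]; f_equal; f_equal.
    change (g (IZR n + t) = g (t + IZR n)); f_equal; ring.
  + rewrite B_comb, Q2, hBaut; cbn [tp_act]; f_equal; f_equal.
    change (B g (IZR n + t) = B g (t + IZR n)); f_equal; ring.
Qed.

(** Autonomy lets [B] commute with shift polynomials, and boundedness carries this to their uniform
    limits. *)
Lemma B_op L phi (g gL : BUC X) : Op L phi -> (forall t, gL t = L g t) -> forall t,
  B gL t = L (B g) t.
Proof.
intros HL HgL t.
destruct B_bound as [K [HK HB]].
assert (N1 := bfun_norm_ge0 g); assert (N2 := bfun_norm_ge0 (B g)).
apply (eq_by_eps _ _ (K * bfun_norm g + bfun_norm (B g))); intros eps He.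
destruct (HL eps He) as [p [_ P]]; destruct (B_tp p g) as [q [Q1 Q2]].
assert (D : nrm (B gL t -v B q t) <= K * (eps * bfun_norm g)).
{ assert (E : B (bcomb (RtoC (-1)) q gL) t = B gL t -v B q t) by (rewrite B_comb; vring).
  rewrite <- E; apply HB; [apply Rmult_le_pos; lra |].
  intros s; rewrite bcomb_eval, HgL, Q1.
  replace (RtoC (-1) *v tp_act p g s +v L g s) with (L g s -v tp_act p g s) by vring.
  apply P, BUC_bdd. }
assert (D2 := P (B g) _ t (BUC_bdd (B g))).
rewrite <- Q2, nrm_sub_sym in D2.
assert (T := nrm_sub_tri (B gL t) (B q t) (L (B g) t)); lra.
Qed.

Section Resolvent.
Variables (l : C) (y : BUC X).
Hypothesis Hl : Re l <> 0.

Definition LpB : BUC X :=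
  toBUC (Lp l y) _ (Lp_bdd l y _ Hl (BUC_bdd y) (BUC_ucont y)) (Lp_ucont l y _ Hl (BUC_bdd y)
    (BUC_ucont y)).

(** [LpB] has a uniformly continuous derivative, so its difference quotients converge in sup norm
    and [B] may be applied to them. Thus [B LpB] is a bounded solution of [z' = l z - B y], and
    [Lp_unique] identifies it. *)
Lemma B_Lp t : B LpB t = Lp l (B y) t.
Proof.
destruct B_bound as [K [HK HB]].
apply (Lp_unique l (B y) (bfun_norm (B y)) Hl (BUC_bdd _) (BUC_ucont _) (B LpB)
  (bfun_norm (B LpB))); [apply BUC_bdd |].
clear t; intros t eps He.
pose (D := bcomb l LpB (bcomb (RtoC (-1)) y zero)).
assert (De : forall r, D r = l *v Lp l y r -v y r).
{ intros r; unfold D; rewrite !bcomb_eval; change (LpB r) with (Lp l y r);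
  change (bfun_fun (zero : BUC X) r) with (v0 : X); vring. }
assert (HK' : 0 < eps / K) by now apply Rdiv_lt_0_compat.
destruct (BUC_ucont D _ HK') as [d [Hd Hs]]; exists d; split; [exact Hd |]; intros s Hst.
set (h := s - t) in *.
(* The first-order Taylor remainder of [LpB] for the increment [h], as an element of the space, so
   that [B] can act on it. *)
pose (E := bcomb (RtoC (-1)) LpB (bcomb (- RtoC h)%C D (translation h LpB))).
assert (EB : bdd E (eps / K * Rabs h)).
{ intros r; unfold E; rewrite !bcomb_eval.
  change (translation h LpB r) with (Lp l y (h + r)); change (LpB r) with (Lp l y r).
  assert (F := ftc (Lp l y) D r (r + h) (fun q => eq_ind_r _ (Lp_deriv l y _ Hl (BUC_bdd y)
    (BUC_ucont y) q) (De q)) (BUC_cont D)).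
  replace (h + r) with (r + h) by ring.
  replace (RtoC (-1) *v Lp l y r +v ((- RtoC h)%C *v D r +v Lp l y (r + h))) with
    (integral D r (r + h) -v RtoC h *v D r) by (rewrite F; vring).
  replace (RtoC h) with (RtoC (r + h - r)) by (f_equal; ring).
  replace (Rabs h) with (Rabs (r + h - r)) by (f_equal; ring).
  apply integral_approx; [apply BUC_cont |].
  intros q Hq; apply Hs, Rle_lt_trans with (2 := Hst).
  unfold Rmin, Rmax in Hq; unfold Rabs; destruct (Rle_dec r (r + h)), (Rcase_abs (q - r)),
    (Rcase_abs h); lra. }
assert (EP : 0 <= eps / K * Rabs h) by (apply Rmult_le_pos; [lra | apply Rabs_pos]).
assert (BE := HB E _ EP EB t).
replace (K * (eps / K * Rabs h)) with (eps * Rabs h) in BE by (field; lra).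
replace (B LpB s -v B LpB t -v RtoC h *v (l *v B LpB t -v B y t)) with (B E t); [exact BE |].
unfold E, D; rewrite !B_comb, hBaut, B_zero.
change (translation h (B LpB) t) with (B LpB (h + t)).
change (bfun_fun (zero : BUC X) t) with (v0 : X).
replace (h + t) with s by (unfold h; ring); vring.
Qed.

End Resolvent.

Section GraphLaplace.
Variable A : lin_op X.
Hypothesis hA : closed_op A.

(** The mild equation puts only the primitives of [y] in the domain of [A]. Integration by parts
    expresses the truncated transform through the primitive [I], to which [graph_integral]
    applies. *)
Lemma A_trunc l T (y v : R -> X) t : (forall s, cont_at y s) -> (forall s,
  cont_at v s) -> mildp A y v ->
  A (ltr l T (fun s => y (t + s)))
    (l *v ltr l T (fun s => y (t + s)) -v y t +v Cexp (- (l * RtoC T))%C *v y (t + T) -v ltr l T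
      (fun s => v (t + s))).
Proof.
intros Cy Cv H.
set (yt := fun s => y (t + s)); set (vt := fun s => v (t + s)).
assert (Cyt : forall s, cont_at yt s) by (intros; apply cont_at_shift, Cy).
assert (Cvt : forall s, cont_at vt s) by (intros; apply cont_at_shift, Cv).
set (I := fun s => integral yt 0 s); set (K := fun s => integral vt 0 s).
assert (DI : forall s, has_deriv I s (yt s)) by (intros; now apply integral_deriv).
assert (DK : forall s, has_deriv K s (vt s)) by (intros; now apply integral_deriv).
assert (CI : forall s, cont_at I s) by (intros s; eapply has_deriv_cont, DI).
assert (CK : forall s, cont_at K s) by (intros s; eapply has_deriv_cont, DK).
assert (D0 : forall s, has_deriv (fun _ : R => y t) s v0).
{ intros s eps He; exists 1; split; [lra |]; intros r _.
  replace (y t -v y t -v RtoC (r - s) *v v0) with (v0 : X) by vring; rewrite nrm_0.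
  apply Rmult_le_pos; [lra | apply Rabs_pos]. }
set (J := fun s => RtoC (-1) *v y t +v (RtoC (-1) *v K s +v yt s)).
assert (CKy : forall s, cont_at (fun s => RtoC (-1) *v K s +v yt s) s) by (intros;
  now apply cont_at_comb).
assert (Cc : forall s, cont_at (fun _ : R => y t) s) by (intros; apply cont_at_const).
assert (CJ : forall s, cont_at J s) by (intros; now apply cont_at_comb).
assert (HIJ : forall s, A (I s) (J s)).
{ intros s; specialize (H t (t + s)); unfold I, J, K, yt, vt.
  rewrite !integral_shift by auto; rewrite Rplus_0_r.
  replace (RtoC (-1) *v y t +v (RtoC (-1) *v integral v t (t + s) +v y (t + s))) with
    (y (t + s) -v y t -v integral v t (t + s)) by vring; exact H. }
assert (P1 := by_parts l I yt T DI Cyt); assert (P2 := by_parts l K vt T DK Cvt).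
assert (P3 := by_parts l (fun _ => y t) (fun _ => v0) T D0 (fun s => cont_at_const _ s)).
assert (I0 : I 0 = v0) by apply integral_point; assert (K0 : K 0 = v0) by apply integral_point.
rewrite I0 in P1; rewrite K0 in P2.
rewrite (integral_ext (kern l (fun _ => v0)) (fun _ => v0)), integral_const in P3 by (intros;
  unfold kern; vring).
assert (PJ : integral (kern l J) 0 T = RtoC (-1) *v integral (kern l (fun _ => y t)) 0 T +v
  (RtoC (-1) *v integral (kern l K) 0 T +v integral (kern l yt) 0 T)).
{ unfold J; rewrite (integral_ext _ _ 0 T (kern_comb l _ (fun _ => y t)
  (fun s => RtoC (-1) *v K s +v yt s))).
  rewrite (integral_comb _ _ _ 0 T (kern_cont l _ Cc) (kern_cont l _ CKy)).
  rewrite (integral_ext _ _ 0 T (kern_comb l _ K yt)).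
  now rewrite (integral_comb _ _ _ 0 T (kern_cont l _ CK) (kern_cont l _ Cyt)). }
assert (GA : A (integral (kern l I) 0 T) (integral (kern l J) 0 T)).
{ apply (graph_integral A hA); [now apply kern_cont | now apply kern_cont |].
  intros s; exact (graph_scal _ (HIJ s)). }
assert (G := graph_comb A l _ _ _ _ GA (graph_scal (Cexp (- (l * RtoC T))%C) (HIJ T))).
change (scal (Cexp (- (l * RtoC T))%C) (I T)) with (Cexp (- (l * RtoC T))%C *v I T) in G.
change (scal (Cexp (- (l * RtoC T))%C) (J T)) with (Cexp (- (l * RtoC T))%C *v J T) in G.
replace (ltr l T yt) with (l *v integral (kern l I) 0 T +v Cexp (- (l * RtoC T))%C *v I T) at 1
  by (unfold ltr; rewrite P1; vring).
replace (l *v ltr l T yt -v y t +v Cexp (- (l * RtoC T))%C *v y (t + T) -v ltr l T vt) with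
  (l *v integral (kern l J) 0 T +v Cexp (- (l * RtoC T))%C *v J T); [exact G |].
rewrite PJ; unfold ltr, J; fold (yt T); rewrite P2.
set (ic := integral (kern l (fun _ => y t)) 0 T) in *.
set (e := Cexp (- (l * RtoC T))%C) in *.
assert (P4 : l *v ic = y t -v e *v y t).
{ transitivity (e *v y t -v y t +v l *v ic +v (y t -v e *v y t)); [vring | rewrite <- P3; vring]. }
change (y (t + T)) with (yt T).
transitivity (RtoC (-1) *v (l *v ic) +v l *v (RtoC (-1) *v integral (kern l K) 0 T +v integral
  (kern l yt) 0 T) +v
  e *v (RtoC (-1) *v y t +v (RtoC (-1) *v K T +v yt T))); [vring | rewrite P4; vring].
Qed.

(** The truncated identity tends to this one as [T] grows, and [A] is closed. So [Lp l y] is in the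
    domain of [A] although [y] need not be. *)
Lemma A_Lp l (y v : R -> X) M N t : bdd y M -> bdd v N -> (forall s, cont_at y s) -> (forall s,
  cont_at v s) ->
  Re l <> 0 -> mildp A y v -> A (Lp l y t) (l *v Lp l y t -v y t -v Lp l v t).
Proof.
intros Hy Hv Cy Cv Hl H; apply (graph_limit A hA); intros eps He.
assert (Cyt : forall s, cont_at (fun s => y (t + s)) s) by (intros; apply cont_at_shift, Cy).
assert (Cvt : forall s, cont_at (fun s => v (t + s)) s) by (intros; apply cont_at_shift, Cv).
assert (Byt : bdd (fun s => y (t + s)) M) by (intros s; apply Hy).
assert (Bvt : bdd (fun s => v (t + s)) N) by (intros s; apply Hv).
assert (M0 := bdd_ge0 _ _ Hy); assert (N0 := bdd_ge0 _ _ Hv).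
set (a := Rabs (Re l)); assert (Ha : 0 < a) by now apply Rabs_pos_lt.
assert (Hc := Cmod_ge_0 l).
set (e := eps / (Cmod l + 3)).
assert (He0 : 0 < e) by (apply Rdiv_lt_0_compat; lra).
assert (Ee : e * (Cmod l + 3) = eps) by (unfold e; field; lra).
destruct (exp_decay_small a (M / a) e Ha He0) as [n1 H1].
destruct (exp_decay_small a (N / a) e Ha He0) as [n2 H2].
destruct (exp_decay_small a M e Ha He0) as [n3 H3].
set (m := INR (n1 + n2 + n3)).
set (T := (Re l / a) * m).
assert (HT : Re l * T = a * m) by (unfold T, a, Rabs; destruct (Rcase_abs (Re l)); field; lra).
assert (Hm : 0 <= m) by apply pos_INR.
assert (HT0 : 0 <= Re l * T) by (rewrite HT; apply Rmult_le_pos; lra).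
specialize (H1 m ltac:(apply le_INR; lia)); specialize (H2 m ltac:(apply le_INR; lia)).
specialize (H3 m ltac:(apply le_INR; lia)).
assert (B1 := lap_spec l _ M Cyt Byt Hl T HT0); assert (B2 := lap_spec l _ N Cvt Bvt Hl T HT0).
rewrite HT in B1, B2; fold a in B1, B2.
replace (M * exp (- (a * m)) / a) with (M / a * exp (- (a * m))) in B1 by (field; lra).
replace (N * exp (- (a * m)) / a) with (N / a * exp (- (a * m))) in B2 by (field; lra).
fold (Lp l y t) in B1; fold (Lp l v t) in B2.
assert (B3 : nrm (Cexp (- (l * RtoC T))%C *v y (t + T)) <= e).
{ rewrite nrm_sc, Cmod_Cexp.
  replace (Re (- (l * RtoC T))%C) with (- (Re l * T)) by (destruct l;
    unfold Re, RtoC, Cmult, Copp; simpl; ring).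
  rewrite HT; apply Rle_trans with (2 := H3); rewrite Rmult_comm.
  apply Rmult_le_compat_r; [left; apply exp_pos | apply Hy]. }
eexists; eexists; split; [exact (A_trunc l T y v t Cy Cv H) |].
set (u := ltr l T (fun s => y (t + s))) in *; set (w := ltr l T (fun s => v (t + s))) in *.
set (z := Cexp (- (l * RtoC T))%C *v y (t + T)) in *.
rewrite nrm_sub_sym in B1; rewrite nrm_sub_sym in B2.
split; [nra |].
replace (l *v u -v y t +v z -v w -v (l *v Lp l y t -v y t -v Lp l v t)) with
  (l *v (u -v Lp l y t) +v (z -v (w -v Lp l v t))) by vring.
apply Rle_trans with (1 := nrm_add _ _); rewrite nrm_sc.
assert (B4 := nrm_sub z (w -v Lp l v t)).
assert (Cmod l * nrm (u -v Lp l y t) <= Cmod l * e) by (apply Rmult_le_compat_l; lra).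
lra.
Qed.

(** With [Y = Lp l y] one has [(A + B) Y = l Y - y], hence [Y = S (y - (l - l0) Y)] for the
    resolvent [S] at [l0 = i x]. This bounds [Y] near [l0] and makes it Lipschitz in [l] with one
    constant for both sides of the axis, so the jump at distance [d] is [O(d)]. *)
Lemma jump_of_resolvent (y : BUC X) x : mildp A y (B y) ->
  ~ sigma_i (add_op (lift_op A) hB) x -> jump_null y x.
Proof.
intros Hm Hx; apply NNPP in Hx.
destruct Hx as [S [HS [_ HS2]]].
destruct (linear_norm S HS) as [K [HK HSK]].
set (l0 := (Ci * RtoC x)%C) in *.
assert (Hres : forall l (Hl : Re l <> 0), LpB l y Hl = S (minus y (scal ((l - l0)%C : C_AbsRing)
  (LpB l y Hl)))).
{ intros l Hl.
  assert (G : add_op (lift_op A) hB (LpB l y Hl) (bcomb l (LpB l y Hl) (bcomb (RtoC (-1)) y zero))).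
  { pose (z := bcomb l (LpB l y Hl) (bcomb (RtoC (-1)) y (bcomb (RtoC (-1))
    (B (LpB l y Hl)) zero))).
    exists z; split.
    - intros t.
      assert (E : z t = l *v Lp l y t -v y t -v Lp l (B y) t).
      { unfold z; rewrite !bcomb_eval, B_Lp; change (LpB l y Hl t) with (Lp l y t).
        change (bfun_fun (zero : BUC X) t) with (v0 : X); vring. }
      rewrite E; apply (A_Lp l y (B y) (bfun_norm y) (bfun_norm (B y)));
        auto using BUC_bdd, BUC_cont.
    - apply bfun_ext; intros t; change (bfun_fun (plus z (B (LpB l y Hl))) t) with (z t +v B (LpB
      l y Hl) t).
      unfold z; rewrite !bcomb_eval; change (bfun_fun (zero : BUC X) t) with (v0 : X); vring. }
  apply HS2 in G; rewrite <- G at 1; f_equal.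
  apply bfun_ext; intros t.
  rewrite !bminus_eval, !bcomb_eval.
  change (bfun_fun (zero : BUC X) t) with (v0 : X).
  change (scal l0 (LpB l y Hl) t) with (l0 *v LpB l y Hl t).
  change (scal (l - l0)%C (LpB l y Hl) t) with ((l - l0)%C *v LpB l y Hl t); vring. }
set (n := bfun_norm y); assert (Hn : 0 <= n) by apply bfun_norm_ge0.
assert (Hbd : forall l (Hl : Re l <> 0), Cmod (l - l0)%C * K <= / 2 -> bfun_norm (LpB l y Hl) <= 2
  * (K * n)).
{ intros l Hl Hc.
  set (Y := LpB l y Hl) in *.
  assert (E : bfun_norm Y <= K * bfun_norm (minus y (scal ((l - l0)%C : C_AbsRing) Y))).
  { assert (E0 := Hres l Hl); fold Y in E0; rewrite E0 at 1; apply HSK. }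
  assert (T : bfun_norm (minus y (scal ((l - l0)%C : C_AbsRing) Y)) <= n + Cmod (l - l0)%C *
    bfun_norm Y).
  { apply bfun_norm_le.
    - apply Rplus_le_le_0_compat; [exact Hn | apply Rmult_le_pos;
      [apply Cmod_ge_0 | apply bfun_norm_ge0]].
    - intros t; rewrite bminus_eval; apply Rle_trans with (1 := nrm_sub (y t) ((l - l0)%C *v Y t)).
      rewrite nrm_sc; apply Rplus_le_compat; [apply BUC_bdd |].
      apply Rmult_le_compat_l; [apply Cmod_ge_0 | apply BUC_bdd]. }
  assert (N := bfun_norm_ge0 Y).
  assert (K * bfun_norm (minus y (scal ((l - l0)%C : C_AbsRing) Y)) <= K * (n + Cmod (l - l0)%C *
    bfun_norm Y))
    by (apply Rmult_le_compat_l; lra).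
  assert (Cmod (l - l0)%C * K * bfun_norm Y <= / 2 * bfun_norm Y) by (apply Rmult_le_compat_r; lra).
  lra. }
assert (Hdiff : forall l m (Hl : Re l <> 0) (Hm : Re m <> 0), Cmod (l - l0)%C * K <= / 2 -> Cmod
  (m - l0)%C * K <= / 2 ->
   bfun_norm (minus (LpB l y Hl) (LpB m y Hm)) <= 4 * (K * K * n) * Cmod (l - m)%C).
{ intros l m Hl Hmm Hcl Hcm.
  assert (Bm := Hbd m Hmm Hcm).
  set (Y := LpB l y Hl) in *; set (Z := LpB m y Hmm) in *.
  assert (E : minus Y Z = S (bcomb (- (l - l0))%C (minus Y Z) (bcomb (- (l - m))%C Z zero))).
  { transitivity (S (minus (minus y (scal ((l - l0)%C : C_AbsRing) Y))
    (minus y (scal ((m - l0)%C : C_AbsRing) Z)))).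
    - assert (E1 := Hres l Hl); assert (E2 := Hres m Hmm); fold Y in E1; fold Z in E2.
      set (p := minus y (scal ((l - l0)%C : C_AbsRing) Y)) in *.
      set (q := minus y (scal ((m - l0)%C : C_AbsRing) Z)) in *.
      transitivity (S (plus p (scal (opp one : C_AbsRing) q))).
      + rewrite (linear_plus S HS), (linear_scal S HS), <- E1, <- E2; reflexivity.
      + reflexivity.
    - f_equal; apply bfun_ext; intros t; rewrite !bminus_eval, !bcomb_eval, !bminus_eval.
      change (scal ((l - l0)%C : C_AbsRing) Y t) with ((l - l0)%C *v Y t).
      change (scal ((m - l0)%C : C_AbsRing) Z t) with ((m - l0)%C *v Z t).
      change (bfun_fun (zero : BUC X) t) with (v0 : X); vring. }
  set (D := minus Y Z) in *.
  assert (N := bfun_norm_ge0 D); assert (NZ := bfun_norm_ge0 Z).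
  assert (T : bfun_norm (bcomb (- (l - l0))%C D (bcomb (- (l - m))%C Z zero)) <= Cmod (l - l0)%C *
    bfun_norm D + Cmod (l - m)%C * bfun_norm Z).
  { apply bfun_norm_le.
    - apply Rplus_le_le_0_compat; (apply Rmult_le_pos; [apply Cmod_ge_0 | lra]).
    - intros t; rewrite !bcomb_eval; change (bfun_fun (zero : BUC X) t) with (v0 : X).
      replace ((- (l - m))%C *v Z t +v v0) with ((- (l - m))%C *v Z t) by vring.
      apply Rle_trans with (1 := nrm_add ((- (l - l0))%C *v D t) ((- (l - m))%C *v Z t)).
      rewrite !nrm_sc, !Cmod_opp.
      apply Rplus_le_compat; (apply Rmult_le_compat_l; [apply Cmod_ge_0 | apply BUC_bdd]). }
  assert (E2 : bfun_norm D <= K * bfun_norm (bcomb (- (l - l0))%C D (bcomb (- (l - m))%C Z zero))).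
  { rewrite E at 1; apply HSK. }
  assert (K * bfun_norm (bcomb (- (l - l0))%C D (bcomb (- (l - m))%C Z zero)) <= K * (Cmod (l -
    l0)%C * bfun_norm D + Cmod (l - m)%C * bfun_norm Z))
    by (apply Rmult_le_compat_l; lra).
  assert (Cmod (l - l0)%C * K * bfun_norm D <= / 2 * bfun_norm D) by (apply Rmult_le_compat_r; lra).
  assert (Hlm := Cmod_ge_0 (l - m)%C).
  assert (K * Cmod (l - m)%C * bfun_norm Z <= K * Cmod (l - m)%C * (2 * (K * n))).
  { apply Rmult_le_compat_l; [apply Rmult_le_pos; lra | exact Bm]. }
  lra. }
assert (HK4 : 0 < / (4 * K)) by (apply Rinv_0_lt_compat; lra).
(* With [d] and [|r - x|] both below [1 / (4 K)], [K |l - l0| <= 1 / 2] and the estimates above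
   apply. *)
exists (/ (4 * K)); split; [exact HK4 |]; intros eps He.
assert (HP : 0 <= K * K * n) by (apply Rmult_le_pos; [nra | exact Hn]).
set (P := 8 * (K * K * n) + 1).
assert (HeP : 0 < eps / P) by (apply Rdiv_lt_0_compat; unfold P; lra).
exists (Rmin (/ (4 * K)) (eps / P)); split; [now apply Rmin_pos |].
intros d r [Hd1 Hd2] Hr.
assert (Hd3 := Rlt_le_trans _ _ _ Hd2 (Rmin_l _ _)); assert (Hd4 := Rlt_le_trans _ _ _ Hd2 (Rmin_r
  _ _)).
assert (Hl : Re (d, r) <> 0) by (simpl; lra); assert (Hm' : Re (- d, r) <> 0) by (simpl; lra).
assert (Hnear : forall s, Rabs s = d -> Cmod ((s, r) - l0)%C * K <= / 2).
{ intros s Hs.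
  assert (Cmod ((s, r) - l0)%C <= d + Rabs (r - x)).
  { replace ((s, r) - l0)%C with (Cplus (RtoC s) (Cmult Ci (RtoC (r - x)))).
    - apply Rle_trans with (1 := Cmod_triangle _ _); rewrite Cmod_mult, Cmod_Ci, !Cmod_R; lra.
    - unfold l0, Cminus, Cplus, Copp, Cmult, Ci, RtoC; simpl; f_equal; ring. }
  apply Rle_trans with (2 * / (4 * K) * K); [apply Rmult_le_compat_r; lra | right; field; lra]. }
assert (F := Hdiff (d, r) (- d, r) Hl Hm' (Hnear d (Rabs_pos_eq _ (Rlt_le _ _ Hd1)))
   (Hnear (- d) ltac:(rewrite Rabs_Ropp; apply Rabs_pos_eq; lra))).
assert (E0 : forall l (Hl : Re l <> 0), LpB l y Hl 0 = laplace y l).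
{ intros l Hl'; change (laplace (fun s => y (0 + s)) l = laplace y l); f_equal.
  apply functional_extensionality; intros; f_equal; ring. }
rewrite <- (E0 _ Hl), <- (E0 _ Hm'), <- bminus_eval.
apply Rle_trans with (1 := BUC_bdd _ 0), Rle_trans with (1 := F).
replace ((d, r) - (Ropp d, r))%C with (RtoC (2 * d)) by (unfold Cminus, Cplus, Copp, RtoC; simpl;
  f_equal; ring).
rewrite Cmod_R, Rabs_pos_eq by lra.
apply Rle_trans with (P * (eps / P)); [| right; field; unfold P; lra].
apply Rle_trans with (P * d); [unfold P; nra | apply Rmult_le_compat_l; [unfold P; lra | lra]].
Qed.

End GraphLaplace.

(** Of the local extension [h] only continuity on the axis is used: both sides are close to the
    value of [h] at a nearby axis point, and compactness of an interval makes this uniform. *)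
Lemma jump_of_sp (f : R -> X) x : ~ sp f x -> jump_null f x.
Proof.
intros Hx; apply NNPP in Hx; destruct Hx as [h [eps0 Hh]].
assert (Heps0 := cond_pos eps0).
assert (Hin : forall d y, Rabs d < eps0 -> Rabs (y - x) < eps0 ->
  ex_derive (K := C_AbsRing) h ((d, y) : C) /\ (d <> 0 -> h (d, y) = laplace f (d, y))).
{ intros d y Hd Hy; apply Hh; split; simpl.
  - change (Rabs (d - (0 * x - 1 * 0)) < eps0); now replace (d - (0 * x - 1 * 0)) with d by ring.
  - change (Rabs (y - (0 * 0 + 1 * x)) < eps0); now replace (y - (0 * 0 + 1 * x)) with (y - x) by
    ring. }
set (r := eps0 / 2); assert (Hr : 0 < r) by (unfold r; lra).
exists r; split; [exact Hr |]; intros eps He.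
assert (Hloc : forall y, exists d : posreal, Rabs (y - x) <= r -> forall s z,
  Rabs s < d -> Rabs (z - y) < d ->
   nrm (h (s, z) -v h (0, y)) <= eps / 2).
{ intros y; destruct (Rle_lt_dec (Rabs (y - x)) r) as [Hy | Hy]; [| exists eps0; lra].
  destruct (Hin 0 y) as [Hd _]; [rewrite Rabs_R0; lra | unfold r in Hy; lra |].
  apply (ex_derive_continuous (K := C_AbsRing) (V := X)) in Hd.
  destruct (@nrm_of_ball X) as [k [Hk Hb]].
  assert (Hek : 0 < eps / 2 / k) by (apply Rdiv_lt_0_compat; lra).
  destruct (Hd (ball (h (0, y)) (eps / 2 / k)) (locally_ball _ (mkposreal _ Hek))) as [d1 Hd1].
  exists (mkposreal (d1 / 2) (is_pos_div_2 d1)); intros _ s z Hs Hz; simpl in Hs, Hz.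
  assert (Hdp := cond_pos d1).
  assert (HB : ball (h (0, y)) (eps / 2 / k) (h (s, z))).
  { apply (Hd1 (s, z)).
    change (Cmod ((s, z) - (0, y))%C < d1).
    replace ((s, z) - (0, y))%C with (Cplus (RtoC s) (Cmult Ci (RtoC (z - y)))).
    - apply Rle_lt_trans with (1 := Cmod_triangle _ _); rewrite Cmod_mult, Cmod_Ci, !Cmod_R; lra.
    - unfold Cminus, Cplus, Copp, Cmult, Ci, RtoC; simpl; f_equal; ring. }
  apply Hb in HB; [| exact Hek]; replace (k * (eps / 2 / k)) with (eps / 2) in HB by (field; lra);
    lra. }
destruct (choice _ Hloc) as [dl Hdl].
apply NNPP; intros HN.
apply (compactness_list 1 (x - r, tt) (x + r, tt) (fun y => dl (fst y))).
intros [l Hl]; apply HN.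
assert (Hd : exists d0 : posreal, forall y, In y l -> d0 <= dl (fst y)).
{ clear Hl; induction l as [|y l [d1 D1]].
  - exists (mkposreal 1 Rlt_0_1); easy.
  - assert (Hp : 0 < Rmin d1 (dl (fst y))) by (apply Rmin_pos; apply cond_pos).
    exists (mkposreal _ Hp); simpl; intros z [<- | Hz]; [apply Rmin_r |].
    apply Rle_trans with (1 := Rmin_l _ _); auto. }
destruct Hd as [d0 D0]; assert (D0p := cond_pos d0).
exists (Rmin d0 eps0); split; [now apply Rmin_pos |].
intros d y [Hd1 Hd2] Hy.
assert (Hd3 := Rlt_le_trans _ _ _ Hd2 (Rmin_l _ _)); assert (Hd4 := Rlt_le_trans _ _ _ Hd2 (Rmin_r
  _ _)).
assert (Hy' := Hy); apply Rabs_def2 in Hy'.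
destruct (Hl (y, tt)) as [[z []] [Z1 [[Z2 _] [Z3 _]]]].
{ simpl; split; [lra | easy]. }
simpl in Z2, Z3; specialize (D0 _ Z1); simpl in D0.
assert (Hz : Rabs (z - x) <= r) by (apply Rabs_le; lra).
assert (A1 := Hdl z Hz d y ltac:(rewrite Rabs_pos_eq; lra) Z3).
assert (A2 := Hdl z Hz (- d) y ltac:(rewrite Rabs_Ropp, Rabs_pos_eq; lra) Z3).
destruct (Hin d y) as [_ E1]; [rewrite Rabs_pos_eq; lra | unfold r in Hy; lra |].
destruct (Hin (- d) y) as [_ E2]; [rewrite Rabs_Ropp, Rabs_pos_eq; lra | unfold r in Hy; lra |].
rewrite <- E1, <- E2 by lra.
assert (T := nrm_sub_tri (h (d, y)) (h (0, z)) (h (- d, y))).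
rewrite (nrm_sub_sym (h (0, z))) in T; lra.
Qed.

End BUC.

(** * Analytic continuation of the Carleman transform *)

Section Analytic.
Context {X : CompleteNormedModule C_AbsRing}.

Lemma mk_linear (F : BUC X -> BUC X) K : 0 < K ->
  (forall c (g h : BUC X) t, F (bcomb c g h) t = c *v F g t +v F h t) ->
  (forall (g : BUC X) e, 0 <= e -> bdd g e -> bdd (F g) (K * e)) -> is_linear F.
Proof.
intros HK Hc Hb.
assert (Hz : forall t, F zero t = v0).
{ intros t; apply nrm_eq0, Rle_antisym; [| apply nrm_ge0].
  assert (B0 : bdd (zero : BUC X) 0) by (intros s; change (nrm (v0 : X) <= 0); rewrite nrm_0; lra).
  apply Rle_trans with (1 := Hb zero 0 (Rle_refl 0) B0 t); lra. }
split.
- intros g h; apply bfun_ext; intros t.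
  transitivity (F (bcomb (RtoC 1) g h) t).
  + f_equal; f_equal; apply bfun_ext; intros s; change (g s +v h s = RtoC 1 *v g s +v h s); vring.
  + rewrite Hc; change (RtoC 1 *v F g t +v F h t = F g t +v F h t); vring.
- intros c g; apply bfun_ext; intros t.
  transitivity (F (bcomb c g zero) t).
  + f_equal; f_equal; apply bfun_ext; intros s; change (c *v g s = c *v g s +v v0); vring.
  + rewrite Hc, Hz; change (c *v F g t +v v0 = c *v F g t); vring.
- exists K; split; [exact HK |]; intros g.
  apply bfun_norm_le; [apply Rmult_le_pos; [lra | apply bfun_norm_ge0] |].
  intros t; exact (Hb g (bfun_norm g) (bfun_norm_ge0 g) (BUC_bdd g) t).
Qed.

Lemma BUC_complete (x : nat -> BUC X) (e : nat -> R) :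
  (forall n m, (n <= m)%nat -> forall t, nrm (x n t -v x m t) <= e n) ->
  (forall eps, 0 < eps -> exists n, forall m, (n <= m)%nat -> e m <= eps) ->
  exists l : BUC X, forall n t, nrm (x n t -v l t) <= e n.
Proof.
intros H He.
assert (Hp : forall t, exists y, forall n, nrm (x n t -v y) <= e n).
{ intros t; apply complete_limit; [intros; now apply H | exact He]. }
destruct (choice _ Hp) as [l Hl].
assert (Bl : bdd l (bfun_norm (x 0%nat) + e 0%nat)).
{ intros t; assert (A := nrm_sub_ge (l t) (x 0%nat t)); rewrite nrm_sub_sym in A.
  specialize (Hl t 0%nat); assert (B := BUC_bdd (x 0%nat) t); lra. }
assert (Ul : ucont l).
{ intros eps Hep; destruct (He (eps / 3)) as [n Hn]; [lra |]; specialize (Hn n (Nat.le_refl _)).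
  destruct (BUC_ucont (x n) (eps / 3)) as [d [Hd Hs]]; [lra |].
  exists d; split; [exact Hd |]; intros s t Hst; specialize (Hs s t Hst).
  assert (A1 := Hl s n); assert (A2 := Hl t n).
  assert (T1 := nrm_sub_tri (l s) (x n s) (l t)); assert (T2 := nrm_sub_tri (x n s) (x n t) (l t)).
  rewrite (nrm_sub_sym (l s) (x n s)) in T1; lra. }
exists (toBUC l _ Bl Ul); intros n t; exact (Hl t n).
Qed.

Section Neumann.
Variables (R0 : BUC X -> BUC X) (K : R).
Hypothesis HK : 0 < K.
Hypothesis R0_comb : forall c (g h : BUC X) t, R0 (bcomb c g h) t = c *v R0 g t +v R0 h t.
Hypothesis R0_bound : forall (g : BUC X) e, 0 <= e -> bdd g e -> bdd (R0 g) (K * e).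

(** [H = (1 + mu R0)^{-1} R0 g], the continuation of a resolvent [R0] by the distance [mu]; the map
    is a contraction when [Cmod mu * K <= / 2]. *)
Definition sol (mu : C) (g H : BUC X) := forall t, H t = R0 (bcomb (- mu)%C H g) t.

Lemma sol_bound mu g H : Cmod mu * K <= / 2 -> sol mu g H -> bdd H (2 * (K * bfun_norm g)).
Proof.
intros Hmu HS.
assert (N1 := bfun_norm_ge0 H); assert (N2 := bfun_norm_ge0 g); assert (Hc := Cmod_ge_0 mu).
assert (B : bdd H (K * (Cmod mu * bfun_norm H + bfun_norm g))).
{ intros t; rewrite HS; apply R0_bound.
  - assert (0 <= Cmod mu * bfun_norm H) by now apply Rmult_le_pos. lra.
  - intros s; rewrite bcomb_eval; apply Rle_trans with (1 := nrm_add _ _); rewrite nrm_sc, Cmod_opp.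
    apply Rplus_le_compat; [apply Rmult_le_compat_l; [exact Hc |] |]; apply BUC_bdd. }
assert (B2 := bfun_norm_le (bdd_ge0 _ _ B) B).
assert (Cmod mu * K * bfun_norm H <= / 2 * bfun_norm H) by (apply Rmult_le_compat_r; lra).
intros t; apply Rle_trans with (1 := BUC_bdd H t); lra.
Qed.

Lemma R0_dist (g h : BUC X) e : 0 <= e -> (forall t, nrm (g t -v h t) <= e) ->
  forall t, nrm (R0 g t -v R0 h t) <= K * e.
Proof.
intros He H t.
assert (E : R0 (bcomb (RtoC (-1)) h g) t = R0 g t -v R0 h t) by (rewrite R0_comb; vring).
rewrite <- E; apply R0_bound; [exact He |]; intros s; rewrite bcomb_eval.
replace (RtoC (-1) *v h s +v g s) with (g s -v h s) by vring; apply H.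
Qed.

Lemma sol_exists mu g : Cmod mu * K <= / 2 -> exists H, sol mu g H.
Proof.
intros Hmu; assert (Hc := Cmod_ge_0 mu).
pose (x := nat_rect (fun _ => BUC X) (zero : BUC X) (fun _ H => R0 (bcomb (- mu)%C H g))).
set (c := bfun_norm (x 1%nat)); assert (Hc0 : 0 <= c) by apply bfun_norm_ge0.
assert (Hstep : forall n t, nrm (x n t -v x (S n) t) <= c / 2 ^ n).
{ induction n as [|n IH]; intros t.
  - replace (c / 2 ^ 0) with c by (simpl; field).
    change (x 0%nat t) with (v0 : X); rewrite nrm_sub_sym.
    replace (x 1%nat t -v v0) with (x 1%nat t) by vring; apply BUC_bdd.
  - change (nrm (R0 (bcomb (- mu)%C (x n) g) t -v R0 (bcomb (- mu)%C (x (S n)) g) t) <= c / 2 ^ S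
    n).
    assert (P : 0 < 2 ^ n) by (apply pow_lt; lra).
    assert (Q : 0 <= c / 2 ^ n) by (apply Rmult_le_pos; [lra | left; now apply Rinv_0_lt_compat]).
    apply Rle_trans with (K * (Cmod mu * (c / 2 ^ n))).
    + apply R0_dist; [now apply Rmult_le_pos |]; intros s; rewrite !bcomb_eval.
      replace ((- mu)%C *v x n s +v g s -v ((- mu)%C *v x (S n) s +v g s)) with ((- mu)%C *v (x n
        s -v x (S n) s)) by vring.
      rewrite nrm_sc, Cmod_opp; apply Rmult_le_compat_l; [exact Hc | apply IH].
    + replace (c / 2 ^ S n) with (/ 2 * (c / 2 ^ n)) by (simpl; field; lra).
      replace (K * (Cmod mu * (c / 2 ^ n))) with (Cmod mu * K * (c / 2 ^ n)) by ring.
      now apply Rmult_le_compat_r. }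
destruct (BUC_complete x (fun n => 2 * (c / 2 ^ n))) as [H HH].
- intros n m Hnm t.
  assert (A : nrm (x n t -v x m t) <= 2 * (c / 2 ^ n) - 2 * (c / 2 ^ m)).
  { induction Hnm as [|m Hnm IH].
    - replace (x n t -v x n t) with (v0 : X) by vring; rewrite nrm_0; lra.
    - assert (T := nrm_sub_tri (x n t) (x m t) (x (S m) t)); specialize (Hstep m t).
      assert (P : 0 < 2 ^ m) by (apply pow_lt; lra).
      replace (2 * (c / 2 ^ S m)) with (c / 2 ^ m) by (simpl; field; lra); lra. }
  assert (0 <= c / 2 ^ m) by (apply Rmult_le_pos; [lra | left; apply Rinv_0_lt_compat, pow_lt;
    lra]); lra.
- intros eps He.
  destruct (pow_lt_1_zero (1 / 2)) with (y := eps / (2 * (c + 1))) as [n Hn].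
  + rewrite Rabs_pos_eq; lra.
  + apply Rdiv_lt_0_compat; lra.
  + exists n; intros m Hm; specialize (Hn m Hm).
    rewrite Rabs_pos_eq in Hn by (apply pow_le; lra).
    unfold Rdiv in Hn at 1; rewrite Rmult_1_l, pow_inv in Hn.
    assert (0 < / 2 ^ m) by (apply Rinv_0_lt_compat, pow_lt; lra).
    apply Rle_trans with (2 * (c + 1) * (eps / (2 * (c + 1)))); [| right; field; lra].
    unfold Rdiv at 1; apply Rle_trans with (2 * (c + 1) * / 2 ^ m); [nra |].
    apply Rmult_le_compat_l; lra.
- exists H; intros t.
  apply (eq_by_eps _ _ 2); intros eps He.
  destruct (pow_lt_1_zero (1 / 2)) with (y := eps / (2 * (c + 1))) as [n Hn].
  { rewrite Rabs_pos_eq; lra. }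
  { apply Rdiv_lt_0_compat; lra. }
  assert (Hsm : forall m, (n <= m)%nat -> 2 * (c / 2 ^ m) <= eps).
  { intros m Hm; specialize (Hn m Hm).
    rewrite Rabs_pos_eq in Hn by (apply pow_le; lra).
    unfold Rdiv in Hn at 1; rewrite Rmult_1_l, pow_inv in Hn.
    assert (0 < / 2 ^ m) by (apply Rinv_0_lt_compat, pow_lt; lra).
    apply Rle_trans with (2 * (c + 1) * (eps / (2 * (c + 1)))); [| right; field; lra].
    unfold Rdiv at 1; apply Rle_trans with (2 * (c + 1) * / 2 ^ m); [nra |].
    apply Rmult_le_compat_l; lra. }
  assert (A1 := HH (S n) t); assert (A2 := Hsm (S n) ltac:(lia));
    assert (A3 := Hsm n (Nat.le_refl _)).
  change (x (S n) t) with (R0 (bcomb (- mu)%C (x n) g) t) in A1.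
  assert (A4 : nrm (R0 (bcomb (- mu)%C (x n) g) t -v R0 (bcomb (- mu)%C H g) t) <= K * (Cmod mu *
    eps)).
  { apply R0_dist; [apply Rmult_le_pos; lra |]; intros s; rewrite !bcomb_eval.
    replace ((- mu)%C *v x n s +v g s -v ((- mu)%C *v H s +v g s)) with ((- mu)%C *v (x n s -v H
      s)) by vring.
    rewrite nrm_sc, Cmod_opp; apply Rmult_le_compat_l; [exact Hc |].
    apply Rle_trans with (1 := HH n s), A3. }
  assert (A5 : Cmod mu * K * eps <= / 2 * eps) by (apply Rmult_le_compat_r; lra).
  assert (T := nrm_sub_tri (H t) (R0 (bcomb (- mu)%C (x n) g) t) (R0 (bcomb (- mu)%C H g) t)).
  rewrite (nrm_sub_sym (H t) (R0 (bcomb (- mu)%C (x n) g) t)) in T; lra.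
Qed.

Lemma sol_unique mu g H H' : Cmod mu * K <= / 2 -> sol mu g H -> sol mu g H' -> forall t,
  H t = H' t.
Proof.
intros Hmu HS HS' t.
assert (HD : sol mu zero (bcomb (RtoC (-1)) H' H)).
{ intros s.
  replace (bcomb (- mu)%C (bcomb (RtoC (-1)) H' H) zero) with
    (bcomb (RtoC (-1)) (bcomb (- mu)%C H' g) (bcomb (- mu)%C H g)).
  - rewrite R0_comb, bcomb_eval, <- HS, <- HS'; reflexivity.
  - apply bfun_ext; intros r; rewrite !bcomb_eval; change (bfun_fun (zero : BUC X) r) with (v0
    : X); vring. }
assert (B := sol_bound mu zero _ Hmu HD t).
assert (N : bfun_norm (zero : BUC X) = 0).
{ apply Rle_antisym; [| apply bfun_norm_ge0]; apply bfun_norm_le; [lra |].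
  intros s; change (nrm (v0 : X) <= 0); rewrite nrm_0; lra. }
rewrite N, Rmult_0_r, Rmult_0_r, bcomb_eval in B.
apply nrm_sub0, Rle_antisym; [| apply nrm_ge0].
now replace (H t -v H' t) with (RtoC (-1) *v H' t +v H t) by vring.
Qed.

(** The resolvent identity: the derivative of the solution at [l] is minus the solution [H2] with
    right side [H l]. *)
Lemma neumann_analytic (w : BUC X) (l0 : C) : exists h : C -> X,
  (forall l, Cmod (l - l0)%C * K < / 2 -> ex_derive (K := C_AbsRing) h l) /\
  forall l v, Cmod (l - l0)%C * K < / 2 -> sol (l - l0)%C w v -> v 0 = h l.
Proof.
assert (Hex : forall l, exists H, Cmod (l - l0)%C * K <= / 2 -> sol (l - l0)%C w H).
{ intros l; destruct (classic (Cmod (l - l0)%C * K <= / 2)) as [A | A].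
  - destruct (sol_exists _ w A) as [H HH]; now exists H.
  - exists zero; tauto. }
destruct (choice _ Hex) as [H HH].
exists (fun l => H l 0); split.
- intros l Hl.
  destruct (sol_exists (l - l0)%C (H l) (Rlt_le _ _ Hl)) as [H2 HH2].
  exists ((- (1))%C *v H2 0); split.
  { apply (is_linear_scal_l (K := C_AbsRing) (V := X)). }
  intros l' Hl'.
  apply (is_filter_lim_locally_unique (V := AbsRing_NormedModule C_AbsRing)) in Hl'; subst l'.
  intros eps; assert (He := cond_pos eps).
  set (N2 := bfun_norm H2); assert (HN2 : 0 <= N2) by apply bfun_norm_ge0.
  set (r := / 2 - Cmod (l - l0)%C * K).
  set (d := Rmin (r / K) (eps / (2 * K * N2 + 1))).
  assert (HKN : 0 <= K * N2) by (apply Rmult_le_pos; lra).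
  assert (Hd : 0 < d).
  { apply Rmin_pos; apply Rdiv_lt_0_compat; unfold r; lra. }
  exists (mkposreal d Hd); intros m Hm.
  change (Cmod (m - l)%C < d) in Hm.
  change (nrm (H m 0 -v H l 0 -v (m - l)%C *v ((- (1))%C *v H2 0)) <= eps * Cmod (m - l)%C).
  assert (Hm1 := Rlt_le_trans _ _ _ Hm (Rmin_l _ _)); assert (Hm2 := Rlt_le_trans _ _ _ Hm (Rmin_r
    _ _)).
  assert (Hml : Cmod (m - l0)%C * K <= / 2).
  { replace (m - l0)%C with ((m - l) + (l - l0))%C by ring.
    apply Rle_trans with ((Cmod (m - l)%C + Cmod (l - l0)%C) * K).
    - apply Rmult_le_compat_r; [lra | apply Cmod_triangle].
    - assert (Cmod (m - l)%C * K <= r / K * K) by (apply Rmult_le_compat_r; lra).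
      replace (r / K * K) with r in H0 by (field; lra); unfold r in H0; lra. }
  (* The first-order remainder of [H] at [l]; it solves the same equation with the right side
     [(m - l)^2 H2], so [sol_bound] makes it quadratically small. *)
  pose (E := bcomb (m - l)%C H2 (bcomb (RtoC (-1)) (H l) (H m))).
  assert (HE : sol (m - l0)%C (bcomb ((m - l) * (m - l))%C H2 zero) E).
  { intros t.
    replace (bcomb (- (m - l0))%C E (bcomb ((m - l) * (m - l))%C H2 zero)) with
      (bcomb (m - l)%C (bcomb (- (l - l0))%C H2 (H l)) (bcomb (RtoC (-1))
        (bcomb (- (l - l0))%C (H l) w) (bcomb (- (m - l0))%C (H m) w))).
    - rewrite (R0_comb (m - l)%C), (R0_comb (RtoC (-1))); unfold E; rewrite !bcomb_eval.
      rewrite <- (HH2 t), <- (HH l (Rlt_le _ _ Hl) t), <- (HH m Hml t); reflexivity.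
    - apply bfun_ext; intros s; unfold E; rewrite !bcomb_eval;
      change (bfun_fun (zero : BUC X) s) with (v0 : X); vring. }
  assert (B := sol_bound _ _ _ Hml HE 0).
  assert (BN : bfun_norm (bcomb ((m - l) * (m - l))%C H2 zero) <= Cmod (m - l)%C * Cmod (m - l)%C
    * N2).
  { apply bfun_norm_le.
    - repeat apply Rmult_le_pos; auto using Cmod_ge_0.
    - intros t; rewrite bcomb_eval; change (bfun_fun (zero : BUC X) t) with (v0 : X).
      replace (((m - l) * (m - l))%C *v H2 t +v v0) with (((m - l) * (m - l))%C *v H2 t) by vring.
      change (nrm (((m - l) * (m - l))%C *v H2 t) <= Cmod (m - l)%C * Cmod (m - l)%C * N2).
      rewrite nrm_sc, Cmod_mult; apply Rmult_le_compat_l; [apply Rmult_le_pos;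
        apply Cmod_ge_0 | apply BUC_bdd]. }
  unfold E in B; rewrite !bcomb_eval in B.
  replace (H m 0 -v H l 0 -v (m - l)%C *v ((- (1))%C *v H2 0)) with ((m - l)%C *v H2 0 +v (RtoC
    (-1) *v H l 0 +v H m 0)) by vring.
  apply Rle_trans with (1 := B).
  set (c := Cmod (m - l)%C) in *; assert (Hc : 0 <= c) by apply Cmod_ge_0.
  apply Rle_trans with (2 * (K * (c * c * N2))).
  + apply Rmult_le_compat_l; [lra |]; apply Rmult_le_compat_l; lra.
  + replace (2 * (K * (c * c * N2))) with (2 * K * N2 * c * c) by ring.
    apply Rmult_le_compat_r; [exact Hc |].
    apply Rle_trans with ((2 * K * N2 + 1) * (eps / (2 * K * N2 + 1))); [| right; field; lra].
    apply Rmult_le_compat; lra.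
- intros l v Hl Hv.
  apply (sol_unique (l - l0)%C w v (H l)); [lra | exact Hv | apply HH; lra].
Qed.

End Neumann.

Lemma op_as_BUC L phi : Op L phi -> exists BL : BUC X -> BUC X, (forall (g : BUC X) t,
  BL g t = L g t) /\
  is_linear BL /\ autonomous BL /\ exists K, 0 < K /\
  (forall c (g h : BUC X) t, BL (bcomb c g h) t = c *v BL g t +v BL h t) /\
  (forall (g : BUC X) e, 0 <= e -> bdd g e -> bdd (BL g) (K * e)).
Proof.
intros HL; destruct (Op_bound L phi HL) as [K [HK [HK1 _]]].
pose (BL := fun g : BUC X => toBUC (L g) _ (fun t => HK1 g _ t (BUC_bdd g))
  (Op_ucont L phi g _ HL (BUC_bdd g) (BUC_ucont g))).
assert (Hc : forall c (g h : BUC X) t, BL (bcomb c g h) t = c *v BL g t +v BL h t).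
{ intros c g h t; exact (Op_lin L phi c g h _ _ t HL (BUC_bdd g) (BUC_bdd h)). }
assert (Hb : forall (g : BUC X) e, 0 <= e -> bdd g e -> bdd (BL g) (K * e)).
{ intros g e _ Hg t; exact (HK1 g e t Hg). }
exists BL; split; [reflexivity |]; split; [now apply mk_linear with K |]; split; [| now exists K].
intros t g; apply bfun_ext; intros s.
exact (Op_shift L phi g _ t s HL (BUC_bdd g)).
Qed.

(** [L] is itself an autonomous bounded operator, so [B_Lp] applies to it. *)
Lemma op_Lp L phi l (y : BUC X) : Op L phi -> Re l <> 0 -> (forall t, L y t = v0) -> forall t,
  L (Lp l y) t = v0.
Proof.
intros HL Hl Hy t.
destruct (op_as_BUC L phi HL) as [BL [E [Lin [Aut _]]]].
assert (A := B_Lp BL Lin Aut l y Hl t); rewrite E in A.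
change (L (Lp l y) t = Lp l (BL y) t) in A; rewrite A.
unfold Lp; replace (fun s => BL y (t + s)) with (fun _ : R => v0 : X)
  by (apply functional_extensionality; intros s; now rewrite E, Hy).
apply nrm_eq0, Rle_antisym; [| apply nrm_ge0].
apply Rle_trans with (0 / Rabs (Re l)); [apply lap_bound | unfold Rdiv; lra]; auto.
- intros; apply cont_at_const.
- intros s; rewrite nrm_0; lra.
Qed.

(* [wint l g t = e^l int_0^1 e^{- l s} g (t + s) ds], so that [v' = l v - g]
   gives [v (t + 1) = e^l v t - wint l g t]. *)
Definition wint (l : C) (g : R -> X) (t : R) : X := Cexp l *v integral (kern l (fun s => g (t +
  s))) 0 1.

Lemma wint_comb l c (g h : R -> X) t : (forall s, cont_at g s) -> (forall s, cont_at h s) ->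
  wint l (fun s => c *v g s +v h s) t = c *v wint l g t +v wint l h t.
Proof.
intros Cg Ch; unfold wint.
rewrite (integral_ext _ _ 0 1 (kern_comb l c (fun s => g (t + s)) (fun s => h (t + s)))).
rewrite integral_comb; [vring | |]; intros s; apply kern_cont; intros r; now apply cont_at_shift.
Qed.

Lemma wint_bound x (g : R -> X) e : (forall s, cont_at g s) -> bdd g e -> bdd (wint (Ci * RtoC
  x)%C g) e.
Proof.
intros Cg Hg t; unfold wint; rewrite nrm_sc, Cmod_Cexp.
assert (E : Re (Ci * RtoC x)%C = 0) by (unfold Re, Ci, RtoC, Cmult; simpl; ring).
rewrite E, exp_0, Rmult_1_l; apply Rle_trans with (e * Rabs (1 - 0)).
- apply integral_bound; [apply kern_cont; intros; now apply cont_at_shift |].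
  intros s _; rewrite nrm_kern, E, Rmult_0_l, Ropp_0, exp_0, Rmult_1_l; apply Hg.
- rewrite Rminus_0_r, Rabs_R1; lra.
Qed.

Lemma wint_ucont x (g : R -> X) : ucont g -> ucont (wint (Ci * RtoC x)%C g).
Proof.
intros Ug eps He; destruct (Ug eps He) as [d [Hd Hs]]; exists d; split; [exact Hd |].
intros s t Hst.
assert (Cg : forall s, cont_at g s) by (intros; now apply ucont_cont).
assert (E : wint (Ci * RtoC x)%C g s -v wint (Ci * RtoC x)%C g t =
  wint (Ci * RtoC x)%C (fun r => RtoC (-1) *v g (t + r) +v g (s + r)) 0).
{ rewrite wint_comb by (intros; apply cont_at_shift, Cg).
  assert (E0 : forall a, wint (Ci * RtoC x)%C (fun r => g (a + r)) 0 = wint (Ci * RtoC x)%C g a).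
  { intros a; unfold wint; f_equal; apply integral_ext; intros r; unfold kern; f_equal; f_equal;
    ring. }
  rewrite !E0; vring. }
rewrite E; apply wint_bound.
- intros r; apply cont_at_comb; apply cont_at_shift, Cg.
- intros r; replace (RtoC (-1) *v g (t + r) +v g (s + r)) with (g (s + r) -v g (t + r)) by vring.
  apply Hs; now replace (s + r - (t + r)) with (s - t) by ring.
Qed.

Lemma wint_step l (v g : R -> X) t : (forall s, has_deriv v s (l *v v s -v g s)) -> (forall s,
  cont_at g s) ->
  Cexp l *v v t -v v (t + 1) = wint l g t.
Proof.
intros HD Cg.
assert (Cv : forall s, cont_at v s) by (intros s; eapply has_deriv_cont, HD).
assert (C1 : forall s, cont_at (fun s => v (t + s)) s) by (intros; apply cont_at_shift, Cv).
assert (C2 : forall s, cont_at (fun s => g (t + s)) s) by (intros; apply cont_at_shift, Cg).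
assert (C0 : forall s, cont_at (fun _ : R => v0 : X) s) by (intros; apply cont_at_const).
assert (C3 : forall s, cont_at (fun s => l *v v (t + s) +v v0) s) by (intros;
  now apply cont_at_comb).
assert (D : forall s, has_deriv (fun s => v (t + s)) s ((- (1))%C *v g (t + s) +v (l *v v (t + s)
  +v v0))).
{ intros s; apply has_deriv_shift.
  replace ((- (1))%C *v g (t + s) +v (l *v v (t + s) +v v0)) with (l *v v (t + s) -v g (t + s)) by
    vring; apply HD. }
assert (P := by_parts l (fun s => v (t + s)) _ 1 D (fun s => cont_at_comb _ _ _ s (C2 s) (C3 s))).
rewrite (integral_ext _ _ 0 1 (kern_comb l _ (fun s => g (t + s))
  (fun s => l *v v (t + s) +v v0))) in P.
rewrite (integral_comb _ _ _ 0 1 (kern_cont l _ C2) (kern_cont l _ C3)) in P.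
rewrite (integral_ext _ _ 0 1 (kern_comb l _ (fun s => v (t + s)) (fun _ => v0))) in P.
rewrite (integral_comb _ _ _ 0 1 (kern_cont l _ C1) (kern_cont l _ C0)) in P.
rewrite (integral_ext (kern l (fun _ => v0)) (fun _ => v0)), integral_const in P by (intros;
  unfold kern; vring).
rewrite Rplus_0_r in P; unfold wint.
set (Ig := integral (kern l (fun s => g (t + s))) 0 1) in *.
set (Iv := integral (kern l (fun s => v (t + s))) 0 1) in *.
assert (E : Cexp l *v (Cexp (- (l * RtoC 1))%C *v v (t + 1)) = v (t + 1)).
{ replace (Cexp l *v (Cexp (- (l * RtoC 1))%C *v v (t + 1))) with ((Cexp l * Cexp (- (l * RtoC
  1)))%C *v v (t + 1)) by vring.
  rewrite <- Cexp_plus; replace (l + - (l * RtoC 1))%C with (RtoC 0) by ring.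
  replace (Cexp (RtoC 0)) with (RtoC 1) by (unfold Cexp, RtoC; simpl; rewrite exp_0, cos_0, sin_0;
    f_equal; ring).
  vring. }
assert (P2 : Ig = v t -v Cexp (- (l * RtoC 1))%C *v v (t + 1)).
{ transitivity (RtoC (-1) *v ((- (1))%C *v Ig +v (l *v Iv +v RtoC (1 - 0) *v v0)) +v l *v Iv);
  [vring |].
  rewrite P; vring. }
rewrite P2; transitivity (Cexp l *v v t -v Cexp l *v (Cexp (- (l * RtoC 1))%C *v v (t + 1)));
  [rewrite E; easy | vring].
Qed.

Lemma bump_one (x0 c : R) : c < 1 -> exists phi c1, C2per phi /\ c < c1 < 1 /\
  (forall y, cos (y - x0) <= c -> phi y = 0) /\ (forall y, c1 < cos (y - x0) -> phi y = 1).
Proof.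
intros Hc; set (c1 := (1 + c) / 2).
destruct (cos_near ((c1 - c) / 2)) as [c2 [C1 C2]]; [unfold c1; lra |].
destruct (urysohn (fun y => cos (y - x0) <= c) (fun y => c1 < cos (y - x0))) as [phi [H1 [H2 H3]]].
- intros x; destruct (Rlt_le_dec ((c1 + c) / 2) (cos (x - x0))) as [H | H]; [left | right];
    exists c2; (split; [exact C1 |]); intros y Hy; specialize (C2 x0 y x Hy);
    apply Rabs_def2 in C2; lra.
- exists phi, c1; split; [exact H1 |]; split; [unfold c1; lra |]; split; intros y Hy.
  + destruct (H2 y Hy) as [d [D1 D2]]; apply D2; rewrite Rminus_diag, cos_0; exact D1.
  + destruct (H3 y Hy) as [d [D1 D2]]; apply D2; rewrite Rminus_diag, cos_0; exact D1.
Qed.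

(** With [s = y - x0], [1 / (1 - e^{i s}) = 1 / 2 + (i / 2) sin s / (1 - cos s)]. Hence [q] is built
    from two real C^2 symbols after multiplication by [chi = 1 - phi], which removes the
    singularity. *)
Lemma local_inverse x0 c : c < 1 -> exists LP LQ phi q,
  Op (X := X) LP phi /\ Op (X := X) LQ q /\ (forall y, cos (y - x0) <= c -> phi y = RtoC 0) /\
  forall y, (q y * (cis x0 - cis y) + phi y = RtoC 1)%C.
Proof.
intros Hc; destruct (bump_one x0 c Hc) as [phi [c1 [P1 [Hc1 [P2 P3]]]]].
pose (Y := fun y => 1 + (-1) * cos (y - x0)).
assert (CY : C2per Y).
{ apply (C2per_plus (fun _ => 1)); [apply C2per_const |].
  apply (C2per_mult (fun _ => -1)); [apply C2per_const | apply C2per_cos]. }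
(* [d] equals [1 - cos (y - x0)] wherever [chi] may be nonzero and has no zero at all, so [chi / d]
   is C^2 on the whole circle. *)
pose (d := fun y => Y y + pos3 (1 - c1 + (-1) * Y y)).
assert (Cd : C2per d).
{ apply (C2per_plus Y); [exact CY |].
  apply (C2per_pos3 (fun y => 1 - c1 + (-1) * Y y)), (C2per_plus (fun _ => 1 - c1));
    [apply C2per_const |].
  apply (C2per_mult (fun _ => -1)); [apply C2per_const | exact CY]. }
assert (Hd : forall y, d y <> 0).
{ intros y; unfold d; assert (A := COS_bound (y - x0)); assert (B := pos3_ge0 (1 - c1 + (-1) * Y
  y)).
  assert (HY : 0 <= Y y) by (unfold Y; lra).
  destruct (Req_dec (Y y) 0) as [E | E]; [| lra].
  assert (0 < pos3 (1 - c1 + (-1) * Y y)) by (apply pos3_gt0; lra); lra. }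
pose (chi := fun y => 1 + (-1) * phi y).
assert (Cchi : C2per chi).
{ apply (C2per_plus (fun _ => 1)); [apply C2per_const |].
  apply (C2per_mult (fun _ => -1)); [apply C2per_const | exact P1]. }
pose (kap := fun y => chi y * (sin (y - x0) * / d y)).
assert (Ckap : C2per kap).
{ apply (C2per_mult chi); [exact Cchi |].
  apply (C2per_mult (fun y => sin (y - x0))); [apply C2per_sin | now apply C2per_inv]. }
destruct (C2per_Op X phi P1) as [LP HLP].
destruct (C2per_Op X chi Cchi) as [L1 HL1]; destruct (C2per_Op X kap Ckap) as [L2 HL2].
assert (Hz := Op_tp (X := X) []).
assert (HQ := Op_comb (cis (- x0) * RtoC (/ 2))%C _ _ _ _ HL1 (Op_comb (cis (- x0) * (Ci * RtoC (/
  2)))%C _ _ _ _ HL2 Hz)).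
eexists; eexists; eexists; eexists; split; [exact HLP | split; [exact HQ | split]].
- intros y Hy; now rewrite P2.
- intros y; simpl tp_eval.
  assert (E : (cis (- x0) * (cis x0 - cis y) = RtoC 1 - cis (y - x0))%C).
  { replace (cis (y - x0)) with (cis (- x0) * cis y)%C by (rewrite <- cis_plus; f_equal; ring).
    transitivity (cis (- x0) * cis x0 - cis (- x0) * cis y)%C; [ring |]; now rewrite cis_opp. }
  transitivity ((RtoC (/ 2) * RtoC (chi y) + Ci * RtoC (/ 2) * RtoC (kap y)) * (cis (- x0) * (cis
    x0 - cis y)) + RtoC (phi y))%C; [ring |].
  rewrite E.
  destruct (Rlt_le_dec c1 (cos (y - x0))) as [Hy | Hy].
  + assert (Ec : chi y = 0) by (unfold chi; rewrite P3 by exact Hy; ring).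
    unfold kap; rewrite Ec, P3, Rmult_0_l by exact Hy; ring.
  + assert (Ed : d y = 1 - cos (y - x0)).
    { unfold d; rewrite pos3_eq0; unfold Y; lra. }
    assert (Hne : 1 - cos (y - x0) <> 0) by lra.
    assert (Ep : phi y = 1 - chi y) by (unfold chi; ring).
    rewrite Ep; unfold kap; rewrite Ed; clear Ep.
    assert (S := sin2_cos2 (y - x0)); unfold Rsqr in S.
    set (co := cos (y - x0)) in *; set (si := sin (y - x0)) in *; set (k := chi y).
    set (kk := k * (si * / (1 - co))).
    assert (F1 : kk * (1 - co) = k * si) by (unfold kk; field; exact Hne).
    assert (F2 : kk * si = k * (1 + co)).
    { apply Rmult_eq_reg_r with (1 - co); [| exact Hne].
      replace (kk * si * (1 - co)) with (kk * (1 - co) * si) by ring; rewrite F1.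
      replace (k * si * si) with (k * (si * si)) by ring.
      replace (si * si) with (1 - co * co) by lra; ring. }
    unfold cis; fold co si.
    unfold Cplus, Cminus, Copp, Cmult, Ci, RtoC; simpl; f_equal; lra.
Qed.

(* With [phi] a bump equal to 1 near [x0], [phi(S) w = 0], so that [q(S)], for
   [q = (1 - phi) / (e^{i x0} - e^{i y})], inverts the
   equation [e^l v - v (. + 1) = wint l w] at [l = i x0]; this gives an operator
   [R0] with [v = R0 (w - (l - i x0) v)] for [v = Lp l w], solved by a Neumann
   series in [l]. *)
Lemma not_sp (w : BUC X) x0 : regular (fun h => forall t, h t = v0) w x0 -> ~ sp w x0.
Proof.
intros [c [Hc Hreg]] Hsp; apply Hsp; clear Hsp.
destruct (local_inverse x0 c Hc) as [LP [LQ [phi [q [HP [HQ [P1 P2]]]]]]].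
assert (HPw : forall t, LP w t = v0) by (apply (Hreg LP phi HP); exact P1).
set (l0 := (Ci * RtoC x0)%C).
assert (El0 : Cexp l0 = cis x0) by apply Cexp_Ci.
destruct (op_as_BUC LQ q HQ) as [BQ [EQ [_ [_ [K [HK [BQc BQb]]]]]]].
pose (G0 := fun g : BUC X => toBUC (wint l0 g) _ (wint_bound x0 g _ (BUC_cont g) (BUC_bdd g))
  (wint_ucont x0 g (BUC_ucont g))).
pose (R0 := fun g => BQ (G0 g)).
assert (R0c : forall c (g h : BUC X) t, R0 (bcomb c g h) t = c *v R0 g t +v R0 h t).
{ intros k g h t; unfold R0; rewrite <- BQc; f_equal; f_equal; apply bfun_ext; intros s.
  rewrite bcomb_eval; exact (wint_comb l0 k g h s (BUC_cont g) (BUC_cont h)). }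
assert (R0b : forall (g : BUC X) e, 0 <= e -> bdd g e -> bdd (R0 g) (K * e)).
{ intros g e He Hg; apply BQb; [exact He |]; exact (wint_bound x0 g e (BUC_cont g) Hg). }
destruct (neumann_analytic R0 K HK R0c R0b w l0) as [h [H1 H2]].
exists h.
assert (Hr : 0 < / (8 * K)) by (apply Rinv_0_lt_compat; lra).
exists (mkposreal _ Hr); intros l Hl.
assert (Hnear : Cmod (l - l0)%C * K < / 2).
{ destruct l as [a b]; destruct Hl as [L1 L2]; simpl in L1, L2.
  change (Rabs (a - (0 * x0 - 1 * 0)) < / (8 * K)) in L1; change (Rabs (b - (0 * 0 + 1 * x0)) < /
    (8 * K)) in L2.
  replace (a - (0 * x0 - 1 * 0)) with a in L1 by ring; replace (b - (0 * 0 + 1 * x0)) with (b -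
    x0) in L2 by ring.
  replace ((a, b) - l0)%C with (Cplus (RtoC a) (Cmult Ci (RtoC (b - x0)))).
  - apply Rle_lt_trans with ((Rabs a + Rabs (b - x0)) * K).
    + apply Rmult_le_compat_r; [lra |].
      apply Rle_trans with (1 := Cmod_triangle _ _); rewrite Cmod_mult, Cmod_Ci, !Cmod_R; lra.
    + apply Rlt_le_trans with (2 * / (8 * K) * K); [apply Rmult_lt_compat_r; lra |].
      replace (2 * / (8 * K) * K) with (/ 4) by (field; lra); lra.
  - unfold l0, Cminus, Cplus, Copp, Cmult, Ci, RtoC; simpl; f_equal; ring. }
split; [now apply H1 |]; intros Hre.
assert (Hv : sol R0 (l - l0)%C w (LpB l w Hre)).
{ intros t; set (V := LpB l w Hre).
  (* Moving [(l - l0) V] to the right side turns the equation of [V] at [l] into one at the fixed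
     point [l0]. *)
  set (g := bcomb (- (l - l0))%C V w).
  assert (HD : forall s, has_deriv V s (l0 *v V s -v g s)).
  { intros s; unfold g; rewrite bcomb_eval.
    replace (l0 *v V s -v ((- (l - l0))%C *v V s +v w s)) with (l *v V s -v w s) by vring.
    exact (Lp_deriv l w _ Hre (BUC_bdd w) (BUC_ucont w) s). }
  assert (HPV : forall t, LP V t = v0) by exact (op_Lp LP phi l w HP Hre HPw).
  (* [Tot] is [LQ (e^{i x0} - S) + LP - 1], with zero symbol by [P2]; since [LP V = 0], its
     vanishing at [V] reads [V = LQ (wint l0 g)]. *)
  pose (Sh := Op_comb (X := X) (cis x0) _ _ _ _ (Op_tp [(0%Z, RtoC 1)]) (Op_tp [(1%Z, (- (1))%C)])).
  pose (id := Op_tp (X := X) [(0%Z, (- (1))%C)]).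
  pose (Tot := Op_comb (RtoC 1) _ _ _ _ (Op_comp _ _ _ _ HQ Sh) (Op_comb (RtoC 1) _ _ _ _ HP id)).
  assert (N := op_null V _ (BUC_cont V) (BUC_bdd V) _ _ Tot); cbv beta in N.
  assert (N0 := fun H => N (fun x => or_introl (ex_intro _ 1 (conj Rlt_0_1 (fun y _ => H y)))) t).
  cbv beta in N0; specialize (N0 ltac:(intros y; simpl tp_eval; rewrite Rmult_0_l, Rmult_1_l, cis_0;
    transitivity (q y * (cis x0 - cis y) + phi y - RtoC 1)%C; [ring | rewrite P2; ring])).
  clear N; rewrite HPV in N0; cbn [tp_act] in N0.
  assert (EW : (fun t => cis x0 *v (RtoC 1 *v V (t + 0) +v v0) +v ((- (1))%C *v V (t + 1) +v v0))
    = wint l0 g).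
  { apply functional_extensionality; intros s.
    rewrite <- (wint_step l0 V g s HD (BUC_cont g)), El0, Rplus_0_r; vring. }
  rewrite EW, Rplus_0_r in N0.
  transitivity (LQ (wint l0 g) t); [| symmetry; exact (EQ (G0 g) t)].
  transitivity (V t +v (RtoC 1 *v LQ (wint l0 g) t +v (RtoC 1 *v v0 +v ((- (1))%C *v V t +v v0)))).
  - rewrite N0; vring.
  - vring. }
assert (E := H2 l _ Hnear Hv); rewrite <- E.
change (laplace (fun s => w (0 + s)) l = laplace w l); f_equal.
apply functional_extensionality; intros; f_equal; ring.
Qed.

End Analytic.

(** * Loomis' theorem *)

(** Here [rho z = z / q3 z] is the profile of the cutoff: the identity up to 1, bounded on the
    half-line, with first two derivatives [rho1] and [rho2]. *)
Definition q3 (z : R) := 1 + pos3 (z - 1).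
Definition iq (z : R) := / q3 z.
Definition iq' (z : R) := (- pos3' (z - 1)) * / (q3 z * q3 z).
Definition iq'' (z : R) := (- pos3'' (z - 1)) * / (q3 z * q3 z) +
  (- pos3' (z - 1)) * (pos3' (z - 1) * (- 2 * / (q3 z * q3 z * q3 z))).
Definition rho (z : R) := z * iq z.
Definition rho1 (z : R) := 1 * iq z + z * iq' z.
Definition rho2 (z : R) := iq' z + (1 * iq' z + z * iq'' z).

Lemma q3_ge1 z : 1 <= q3 z.
Proof. unfold q3; assert (H := pos3_ge0 (z - 1)); lra. Qed.

Lemma is_derive_shift1 (f : R -> R) z l : is_derive f (z - 1) l -> is_derive (fun z => f (z - 1))
  z l.
Proof.
intros H; apply is_derive_eq with (1 * l); [ring |].
apply (is_derive_Rcomp f (fun z => z - 1)); [exact H | auto_derive; auto].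
Qed.

Lemma q3_derive z : is_derive q3 z (pos3' (z - 1)).
Proof.
apply is_derive_eq with (0 + pos3' (z - 1)); [ring |].
apply (is_derive_Rplus (fun _ => 1) (fun z => pos3 (z - 1))).
- apply (is_derive_const (K := R_AbsRing) (V := R_NormedModule)).
- apply is_derive_shift1, pos3_derive.
Qed.

Lemma iq_derive z : is_derive iq z (iq' z).
Proof.
assert (Q := q3_ge1 z).
apply is_derive_eq with (pos3' (z - 1) * (- / (q3 z * q3 z))); [unfold iq'; ring |].
apply (is_derive_Rcomp (fun u => / u) q3); [| apply q3_derive].
auto_derive; [lra | field; lra].
Qed.

Lemma iq'_derive z : is_derive iq' z (iq'' z).
Proof.
assert (Q := q3_ge1 z).
apply (is_derive_Rmult (fun z => - pos3' (z - 1)) (fun z => / (q3 z * q3 z))).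
- apply (is_derive_opp (K := R_AbsRing) (V := R_NormedModule) (fun z => pos3' (z - 1))),
  is_derive_shift1, pos3'_derive.
- apply (is_derive_Rcomp (fun u => / (u * u)) q3); [| apply q3_derive].
  auto_derive; [nra | field; lra].
Qed.

Lemma rho_derive z : is_derive rho z (rho1 z).
Proof.
apply (is_derive_Rmult (fun z => z) iq); [apply (is_derive_id (K := R_AbsRing)) | apply iq_derive].
Qed.

Lemma rho1_derive z : is_derive rho1 z (rho2 z).
Proof.
apply (is_derive_Rplus (fun z => 1 * iq z) (fun z => z * iq' z)).
- apply is_derive_eq with (0 * iq z + 1 * iq' z); [ring |].
  apply (is_derive_Rmult (fun _ => 1) iq); [| apply iq_derive].
  apply (is_derive_const (K := R_AbsRing) (V := R_NormedModule)).
- apply (is_derive_Rmult (fun z => z) iq'); [apply (is_derive_id (K := R_AbsRing)) | apply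
  iq'_derive].
Qed.

Lemma rho2_continuous z : continuous rho2 z.
Proof.
assert (Q := q3_ge1 z).
assert (C1 : continuous iq' z) by (eapply is_derive_continuous, iq'_derive).
assert (Cq : continuous q3 z) by (eapply is_derive_continuous, q3_derive).
assert (Cs : continuous (fun z => z - 1) z).
{ apply (ex_derive_continuous (K := R_AbsRing) (V := R_NormedModule)); auto_derive; auto. }
assert (C2 : continuous (fun z => pos3'' (z - 1)) z) by (apply (continuous_Rcomp pos3'' (fun z =>
  z - 1)); [exact Cs | apply pos3''_continuous]).
assert (C3 : continuous (fun z => pos3' (z - 1)) z).
{ apply (continuous_Rcomp pos3' (fun z => z - 1)); [exact Cs | eapply is_derive_continuous,
  pos3'_derive]. }
assert (I2 : continuous (fun z => / (q3 z * q3 z)) z).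
{ apply (continuous_Rcomp (fun u => / (u * u)) q3); [exact Cq |].
  apply (ex_derive_continuous (K := R_AbsRing) (V := R_NormedModule)); auto_derive; nra. }
assert (I3 : continuous (fun z => - 2 * / (q3 z * q3 z * q3 z)) z).
{ apply (continuous_Rcomp (fun u => - 2 * / (u * u * u)) q3); [exact Cq |].
  apply (ex_derive_continuous (K := R_AbsRing) (V := R_NormedModule)); auto_derive.
  assert (0 < q3 z * q3 z) by nra; nra. }
assert (N1 : continuous (fun z => - pos3' (z - 1)) z) by now apply (continuous_opp (fun z => pos3'
  (z - 1))).
assert (N2 : continuous (fun z => - pos3'' (z - 1)) z) by now apply (continuous_opp (fun z =>
  pos3'' (z - 1))).
assert (Cid : continuous (fun z : R => z) z) by apply continuous_id.
assert (C0 : continuous (fun _ : R => 1) z) by apply continuous_const.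
assert (Ciq : continuous iq'' z).
{ apply (continuous_Rplus (fun z => (- pos3'' (z - 1)) * / (q3 z * q3 z))).
  - now apply (continuous_Rmult (fun z => - pos3'' (z - 1))).
  - apply (continuous_Rmult (fun z => - pos3' (z - 1))); [exact N1 |].
    now apply (continuous_Rmult (fun z => pos3' (z - 1))). }
apply (continuous_Rplus iq'); [exact C1 |].
apply (continuous_Rplus (fun z => 1 * iq' z)); [now apply (continuous_Rmult (fun _ => 1)) |].
now apply (continuous_Rmult (fun z => z)).
Qed.

Lemma rho_id z : z <= 1 -> rho z = z.
Proof. intros H; unfold rho, iq, q3; rewrite pos3_eq0 by lra; field. Qed.

(** The weight [z] is what [small_cutoff] needs: there [rho2 z] is multiplied by
    [sin^2 / d <= 2 z]. *)
Lemma rho_bounds z : 0 <= z -> Rabs (rho z) <= 2 /\ Rabs (rho1 z) <= 13 /\ z * Rabs (rho2 z) <= 336.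
Proof.
intros Hz; unfold rho, rho1, rho2, iq, iq', iq'', q3, pos3, pos3', pos3''.
destruct (Rle_lt_dec z 1) as [H1 | H1].
- rewrite !Rmax_left by lra.
  split; [| split].
  + match goal with |- Rabs ?e <= _ => replace e with z by field end; rewrite Rabs_pos_eq; lra.
  + match goal with |- Rabs ?e <= _ => replace e with 1 by field end; rewrite Rabs_R1; lra.
  + match goal with |- _ * Rabs ?e <= _ => replace e with 0 by field end; rewrite Rabs_R0; lra.
- rewrite Rmax_right by lra.
  set (m := z - 1); assert (Hm : 0 < m) by (unfold m; lra); assert (Ez : z = 1 + m) by (unfold m;
    ring).
  set (q := 1 + m * m * m).
  assert (Hm2 : 0 < m * m) by nra; assert (Hm3 : 0 < m * m * m) by nra.
  assert (Hq : 1 <= q) by (unfold q; lra).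
  (* [4 (1 + m^3) - (1 + m)^3 = 3 (m + 1) (m - 1)^2]. So [z^3 / q <= 4], from which the bounds
     [1 + 3 * 4 = 13] and [6 * 4 + 6 * 4 + 18 * 16 = 336] follow. *)
  assert (Hz3 : z * (z * z) <= 4 * q).
  { assert (0 <= (m + 1) * ((m - 1) * (m - 1))) by (apply Rmult_le_pos; [lra | apply Rle_0_sqr]).
    rewrite Ez; unfold q; lra. }
  set (i := / q); assert (Hi : 0 < i <= 1).
  { unfold i; split; [apply Rinv_0_lt_compat; lra |]; rewrite <- Rinv_1; apply Rinv_le_contravar;
    lra. }
  assert (Eqi : q * i = 1) by (unfold i; field; lra).
  replace (/ (q * q)) with (i * i) by (unfold i; field; lra).
  replace (/ (q * q * q)) with (i * i * i) by (unfold i; field; lra).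
  assert (Hzi : z * (z * z) * i <= 4).
  { apply Rle_trans with (4 * q * i); [apply Rmult_le_compat_r; lra | rewrite Rmult_assoc, Eqi;
    lra]. }
  assert (Hmz : m <= z) by lra.
  assert (Hzz : m * m <= z * z) by (apply Rmult_le_compat; lra).
  assert (B1 : 0 <= z * (m * m) * i <= 4).
  { split; [repeat apply Rmult_le_pos; lra |]; apply Rle_trans with (2 := Hzi).
    apply Rmult_le_compat_r; [lra |]; apply Rmult_le_compat_l; lra. }
  assert (B2 : 0 <= z * (z * m) * i <= 4).
  { split; [repeat apply Rmult_le_pos; lra |]; apply Rle_trans with (2 := Hzi).
    apply Rmult_le_compat_r; [lra |]; apply Rmult_le_compat_l; [lra |]; apply Rmult_le_compat_l;
      lra. }
  split; [| split].
  + rewrite Rabs_pos_eq by (apply Rmult_le_pos; lra).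
    assert (z <= 2 * q).
    { rewrite Ez; unfold q; destruct (Rle_lt_dec m 1); [lra |];
      assert (m * 1 <= m * (m * m)) by (apply Rmult_le_compat_l; nra); lra. }
    apply Rle_trans with (2 * q * i); [apply Rmult_le_compat_r; lra | rewrite Rmult_assoc, Eqi;
      lra].
  + replace (1 * i + z * (- (3 * (m * m)) * (i * i))) with (i - 3 * (z * (m * m) * i) * i) by ring.
    set (b := z * (m * m) * i) in *.
    assert (0 <= b * i <= 4 * 1) by (split; [apply Rmult_le_pos; lra | apply Rmult_le_compat; lra]).
    apply Rabs_le; lra.
  + rewrite <- (Rabs_pos_eq z) at 1 by lra; rewrite <- Rabs_mult.
    set (b := z * (m * m) * i) in *; set (d := z * (z * m) * i) in *.
    replace (z * (- (3 * (m * m)) * (i * i) + (1 * (- (3 * (m * m)) * (i * i)) +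
      z * (- (6 * m) * (i * i) + - (3 * (m * m)) * (3 * (m * m) * (-2 * (i * i * i))))))) with
      (- 6 * (b * i) - 6 * (d * i) + 18 * (b * b * i)) by (unfold b, d; ring).
    assert (0 <= b * i <= 4 * 1) by (split; [apply Rmult_le_pos; lra | apply Rmult_le_compat; lra]).
    assert (0 <= d * i <= 4 * 1) by (split; [apply Rmult_le_pos; lra | apply Rmult_le_compat; lra]).
    assert (0 <= b * b <= 16) by (split; nra).
    assert (0 <= b * b * i <= 16 * 1) by (split; [apply Rmult_le_pos; lra | apply Rmult_le_compat;
      lra]).
    apply Rabs_le; lra.
Qed.

Section DiscreteLoomis.
Context {X : CompleteNormedModule C_AbsRing}.

(* [1 - cos] has a double zero, hence can be cut off near it by a function of
   small Wiener norm: [f = d rho ((1 - cos) / d)] has [|f| <= 2 d] while [f'']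
   stays bounded. *)
Lemma small_cutoff x0 eps : 0 < eps -> exists (L : (R -> X) -> R -> X) f,
  Op L (fun y => RtoC (f y)) /\
  vanish_near 0 (fun y => f y - (1 - cos (y - x0))) x0 /\
  forall g M t, bdd g M -> nrm (L g t) <= eps * M.
Proof.
intros He.
(* The bound 700 on [f2] does not depend on [d]. So [m] is chosen first, to make the tail
   [4 * 700 / m] less than [eps / 2]; then [d] makes the head [(4 m + 1) * (2 d)] equal to
   [eps / 2]. *)
destruct (inv_INR_small (eps / 8000)) as [m [Hm1 Hm2]]; [lra |].
assert (Hm : 0 < INR m) by now apply lt_0_INR.
set (d := eps / (4 * (4 * INR m + 1))).
assert (Hd : 0 < d) by (apply Rdiv_lt_0_compat; lra).
pose (Y := fun y => 1 - cos (y - x0)).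
assert (HY : forall y, 0 <= Y y).
{ intros y; unfold Y; assert (H := COS_bound (y - x0)); lra. }
assert (DY : forall y, is_derive (fun y => Y y / d) y (sin (y - x0) / d)).
{ intros y; unfold Y; auto_derive; auto; unfold Rminus; field; lra. }
pose (f := fun y => d * rho (Y y / d)).
pose (f1 := fun y => sin (y - x0) * rho1 (Y y / d)).
pose (f2 := fun y => cos (y - x0) * rho1 (Y y / d) + sin (y - x0) * (sin (y - x0) / d * rho2 (Y y
  / d))).
assert (D1 : forall y, is_derive f y (f1 y)).
{ intros y; apply is_derive_eq with (0 * rho (Y y / d) + d * (sin (y - x0) / d * rho1 (Y y / d))).
  - unfold f1; field; lra.
  - apply (is_derive_Rmult (fun _ => d) (fun y => rho (Y y / d))).
    + apply (is_derive_const (K := R_AbsRing) (V := R_NormedModule)).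
    + apply (is_derive_Rcomp rho (fun y => Y y / d)); [apply rho_derive | apply DY]. }
assert (D2 : forall y, is_derive f1 y (f2 y)).
{ intros y; apply (is_derive_Rmult (fun y => sin (y - x0)) (fun y => rho1 (Y y / d))).
  - auto_derive; auto; unfold Rminus; ring.
  - apply (is_derive_Rcomp rho1 (fun y => Y y / d)); [apply rho1_derive | apply DY]. }
assert (Cs : forall y, continuous (fun y => sin (y - x0)) y).
{ intros y; apply (ex_derive_continuous (K := R_AbsRing) (V := R_NormedModule)); auto_derive;
  auto. }
assert (Cc : forall y, continuous (fun y => cos (y - x0)) y).
{ intros y; apply (ex_derive_continuous (K := R_AbsRing) (V := R_NormedModule)); auto_derive;
  auto. }
assert (CY : forall y, continuous (fun y => Y y / d) y) by (intros y;
  eapply is_derive_continuous, DY).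
assert (C2 : forall y, continuous f2 y).
{ intros y; apply (continuous_Rplus (fun y => cos (y - x0) * rho1 (Y y / d))).
  - apply (continuous_Rmult (fun y => cos (y - x0))); [apply Cc |].
    apply (continuous_Rcomp rho1 (fun y => Y y / d)); [apply CY | eapply is_derive_continuous,
      rho1_derive].
  - apply (continuous_Rmult (fun y => sin (y - x0))); [apply Cs |].
    apply (continuous_Rmult (fun y => sin (y - x0) / d)).
    + apply (continuous_Rmult (fun y => sin (y - x0)) (fun _ => / d));
      [apply Cs | apply continuous_const].
    + apply (continuous_Rcomp rho2 (fun y => Y y / d)); [apply CY | apply rho2_continuous]. }
assert (Hper : forall y, f (y + 2 * PI) = f y).
{ intros y; unfold f, Y; replace (y + 2 * PI - x0) with (y - x0 + 2 * INR 1 * PI) by (simpl;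
  ring); now rewrite cos_period. }
assert (HYd : forall y, 0 <= Y y / d) by (intros y; apply Rmult_le_pos; [apply HY | left;
  now apply Rinv_0_lt_compat]).
assert (Ba : forall y, Rabs (f y) <= 2 * d).
{ intros y; unfold f; destruct (rho_bounds _ (HYd y)) as [B _].
  rewrite Rabs_mult, Rabs_pos_eq by lra; nra. }
assert (Bb : forall y, Rabs (f2 y) <= 700).
{ intros y; unfold f2; destruct (rho_bounds _ (HYd y)) as [_ [B1 B2]].
  set (z := Y y / d) in *; set (si := sin (y - x0)); set (co := cos (y - x0)).
  assert (Hsi : si * si <= 2 * Y y).
  { unfold Y; fold co; assert (S := sin2_cos2 (y - x0)); unfold Rsqr in S; fold si co in S.
    assert (C := COS_bound (y - x0)); fold co in C; nra. }
  replace (si * (si / d * rho2 z)) with (si * si / d * rho2 z) by (field; lra).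
  apply Rle_trans with (1 := Rabs_triang _ _); rewrite !Rabs_mult.
  assert (Hco : Rabs co <= 1) by apply Rabs_cos_le.
  assert (P1 := Rabs_pos (rho1 z)); assert (P2 := Rabs_pos (rho2 z)); assert (P0 := Rabs_pos co).
  assert (T1 : Rabs co * Rabs (rho1 z) <= 1 * 13) by (apply Rmult_le_compat; lra).
  assert (T2 : Rabs (si * si / d) <= 2 * z).
  { assert (0 <= si * si) by nra; assert (0 < / d) by now apply Rinv_0_lt_compat.
    unfold Rdiv, z; rewrite Rabs_pos_eq by (apply Rmult_le_pos; lra).
    unfold Rdiv; rewrite <- Rmult_assoc; apply Rmult_le_compat_r; lra. }
  assert (T3 : Rabs (si * si / d) * Rabs (rho2 z) <= 2 * z * Rabs (rho2 z)) by (apply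
    Rmult_le_compat_r; lra).
  lra. }
destruct (Op_fourier f f1 f2 (2 * d) 700 D1 D2 C2 Hper Ba Bb X) as [L [HL HLb]].
exists L, f; split; [exact HL | split].
- exists (1 - d); split; [lra |]; intros y Hy; unfold f; rewrite rho_id.
  + unfold Y; field; lra.
  + apply Rmult_le_reg_r with d; [exact Hd |]; unfold Rdiv; rewrite Rmult_assoc, Rinv_l by lra;
    unfold Y; lra.
- intros g M t Hg; apply Rle_trans with (1 := HLb m g M t Hm1 Hg).
  apply Rmult_le_compat_r; [now apply bdd_ge0 in Hg |].
  replace ((4 * INR m + 1) * (2 * d)) with (eps / 2) by (unfold d; field; lra).
  unfold Rdiv at 2; lra.
Qed.

(** Almost periodicity along each coset of [Z], the notion that matches a calculus of integer
    shifts. *)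
Definition ZAP (h : R -> X) := forall s, apseq (fun n : Z => h (s + IZR n)).

Lemma ZAP_zero : ZAP (fun _ => v0).
Proof. intros s; apply apseq_const. Qed.

Lemma ZAP_add g h : ZAP g -> ZAP h -> ZAP (fun t => g t +v h t).
Proof.
intros Hg Hh s.
apply (apseq_ext (fun n => RtoC 1 *v g (s + IZR n) +v h (s + IZR n))); [intros; vring |].
apply (apseq_comb (RtoC 1) (fun n => g (s + IZR n)) (fun n => h (s + IZR n))); auto.
Qed.

Lemma real_classes (N : nat) : (0 < N)%nat -> exists (c : R -> nat) K,
  (forall r, Rabs r <= 1 -> (c r < K)%nat) /\
  forall r r', Rabs r <= 1 -> Rabs r' <= 1 -> c r = c r' -> Rabs (r - r') <= / INR N.
Proof.
intros HN; assert (Hn : 0 < INR N) by now apply lt_0_INR.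
assert (Hup : forall r, Rabs r <= 1 -> (0 <= up ((r + 1) * INR N) <= 2 * Z.of_nat N + 1)%Z).
{ intros r Hr; apply Rabs_le_between in Hr; destruct (archimed ((r + 1) * INR N)) as [U1 U2]; split.
  - apply le_IZR; assert (0 <= (r + 1) * INR N) by (apply Rmult_le_pos; lra); simpl; lra.
  - apply le_IZR; rewrite plus_IZR, mult_IZR, <- INR_IZR_INZ.
    assert ((r + 1) * INR N <= 2 * INR N) by (apply Rmult_le_compat_r; lra); lra. }
exists (fun r => Z.to_nat (up ((r + 1) * INR N))), (2 * N + 2)%nat; split.
- intros r Hr; specialize (Hup r Hr); lia.
- intros r r' Hr Hr' E.
  assert (H1 := Hup r Hr); assert (H2 := Hup r' Hr').
  assert (E' : up ((r + 1) * INR N) = up ((r' + 1) * INR N)) by lia.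
  destruct (archimed ((r + 1) * INR N)) as [U1 U2]; destruct (archimed ((r' + 1) * INR N))
    as [U3 U4].
  rewrite <- E' in U3, U4.
  assert (A : Rabs ((r - r') * INR N) <= 1) by (apply Rabs_le; lra).
  rewrite Rabs_mult, (Rabs_pos_eq (INR N)) in A by lra.
  apply Rmult_le_reg_r with (INR N); [exact Hn |]; rewrite Rinv_l; lra.
Qed.

(** A translation by [m] multiplies the character by [cis (a * m)], so colouring [m] by approximate
    cosine and sine of [a * m] refines the colouring of [x]. *)
Lemma apseq_character a (x : Z -> X) M : (forall n, nrm (x n) <= M) -> apseq x ->
  apseq (fun n => cis (a * IZR n) *v x n).
Proof.
intros HM Hx eps He.
assert (HM0 : 0 <= M) by (apply Rle_trans with (2 := HM 0%Z), nrm_ge0).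
destruct (inv_INR_small (eps / (4 * (M + 1)))) as [N [N1 N2]]; [apply Rdiv_lt_0_compat; lra |].
destruct (real_classes N N1) as [c [K [C1 C2]]].
destruct (Hx (eps / 2)) as [c0 [K0 [D1 D2]]]; [lra |].
pose (cc := fun m : Z => c (cos (a * IZR m))); pose (cs := fun m : Z => c (sin (a * IZR m))).
assert (Lc : forall m, (cc m < K)%nat) by (intros; apply C1, Rabs_cos_le).
assert (Ls : forall m, (cs m < K)%nat) by (intros; apply C1, Rabs_sin_le).
assert (L1 : forall m, (pair_class K cc cs m < K * K)%nat) by (intros; now apply pair_class_lt).
exists (pair_class (K * K) (pair_class K cc cs) c0), (K * K * K0)%nat; split.
{ intros m; now apply pair_class_lt. }
intros m m' Hm n.
apply pair_class_eq in Hm as [E1 E2]; auto; apply pair_class_eq in E1 as [E1 E3]; auto.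
assert (A1 := C2 _ _ (Rabs_cos_le _) (Rabs_cos_le _) E1).
assert (A2 := C2 _ _ (Rabs_sin_le _) (Rabs_sin_le _) E3).
assert (A3 := D2 m m' E2 n).
assert (A4 : Cmod (cis (a * IZR (n + m)) - cis (a * IZR (n + m')))%C <= 2 * / INR N).
{ rewrite !plus_IZR, !Rmult_plus_distr_l, !cis_plus.
  replace (cis (a * IZR n) * cis (a * IZR m) - cis (a * IZR n) * cis (a * IZR m'))%C with
    (cis (a * IZR n) * (cis (a * IZR m) - cis (a * IZR m')))%C by ring.
  rewrite Cmod_mult, Cmod_cis, Rmult_1_l.
  replace (cis (a * IZR m) - cis (a * IZR m'))%C with
    (Cplus (RtoC (cos (a * IZR m) - cos (a * IZR m'))) (Cmult Ci (RtoC (sin (a * IZR m) - sin (a *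
      IZR m'))))).
  - apply Rle_trans with (1 := Cmod_triangle _ _); rewrite Cmod_mult, Cmod_Ci, !Cmod_R; lra.
  - unfold cis, Cminus, Cplus, Copp, Cmult, Ci, RtoC; simpl; f_equal; ring. }
set (u := cis (a * IZR (n + m))) in *; set (u' := cis (a * IZR (n + m'))) in *.
replace (u *v x (n + m)%Z -v u' *v x (n + m')%Z) with (u *v (x (n + m)%Z -v x (n + m')%Z) +v (u -
  u')%C *v x (n + m')%Z) by vring.
apply Rle_trans with (1 := nrm_add _ _); rewrite !nrm_sc.
unfold u at 1; rewrite Cmod_cis, Rmult_1_l.
assert (A5 : Cmod (u - u')%C * nrm (x (n + m')%Z) <= 2 * / INR N * (M + 1)).
{ apply Rmult_le_compat; [apply Cmod_ge_0 | apply nrm_ge0 | exact A4 | specialize (HM (n + m')%Z);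
  lra]. }
assert (A6 : 2 * / INR N * (M + 1) <= 2 * (eps / (4 * (M + 1))) * (M + 1)).
{ apply Rmult_le_compat_r; lra. }
replace (2 * (eps / (4 * (M + 1))) * (M + 1)) with (eps / 2) in A6 by (field; lra); lra.
Qed.

(* The second difference of [e^{- i x0 n} v (s + n)] is almost periodic, and two
   applications of Kadets' theorem remove it. *)
Lemma twisted_kadets x0 (v : R -> X) M : ~ contains_copy c0 X -> bdd v M ->
  ZAP (tp_act [(1%Z, cis (- x0)); (0%Z, RtoC (-2)); ((-1)%Z, cis x0)] v) -> ZAP v.
Proof.
intros HX HM H s.
assert (HM0 := bdd_ge0 _ _ HM).
set (D := tp_act _ v) in H.
assert (DB : bdd D (4 * M)).
{ intros t; apply Rle_trans with (1 := tp_act_bound _ v M t HM); simpl;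
  rewrite !Cmod_cis, Cmod_R, Rabs_left by lra; lra. }
pose (y := fun n : Z => v (s + IZR n)).
pose (z := fun n : Z => cis (- x0 * IZR n) *v y n).
assert (zB : forall n, nrm (z n) <= M) by (intros n; unfold z;
  rewrite nrm_sc, Cmod_cis, Rmult_1_l; apply HM).
assert (Hz2 : apseq (diff 1 (diff 1 z))).
{ apply (apseq_ext (fun n => (fun k => cis (- x0 * IZR k) *v D (s + IZR k)) (n + 1)%Z)).
  - intros n; unfold diff, z, y, D; cbn [tp_act].
    replace (s + IZR (n + 1) + IZR 1) with (s + IZR (n + 1 + 1)) by (rewrite !plus_IZR; ring).
    replace (s + IZR (n + 1) + IZR 0) with (s + IZR (n + 1)) by (rewrite !plus_IZR; ring).
    replace (s + IZR (n + 1) + IZR (-1)) with (s + IZR n) by (rewrite !plus_IZR; ring).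
    replace (- x0 * IZR (n + 1 + 1)) with (- x0 * IZR (n + 1) + - x0) by (rewrite !plus_IZR; ring).
    replace (- x0 * IZR n) with (- x0 * IZR (n + 1) + x0) by (rewrite !plus_IZR; ring).
    rewrite !cis_plus; vring.
  - apply (apseq_shift (fun k => cis (- x0 * IZR k) *v D (s + IZR k)) 1).
    apply (apseq_character (- x0) (fun k => D (s + IZR k)) (4 * M)); [intros; apply DB | apply H]. }
assert (Hz1 : apseq (diff 1 z)).
{ apply (kadets _ (2 * M)); auto.
  intros n; unfold diff; apply Rle_trans with (1 := nrm_sub _ _).
  assert (A := zB (n + 1)%Z); assert (B := zB n); lra. }
assert (Hz : apseq z) by now apply (kadets z M).
apply (apseq_ext (fun n => cis (x0 * IZR n) *v z n)).
- intros n; unfold z, y.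
  replace (cis (x0 * IZR n) *v (cis (- x0 * IZR n) *v v (s + IZR n))) with ((cis (x0 * IZR n) *
    cis (- x0 * IZR n))%C *v v (s + IZR n)) by vring.
  rewrite <- cis_plus; replace (x0 * IZR n + - x0 * IZR n) with 0 by ring; rewrite cis_0; vring.
- now apply (apseq_character x0 z M).
Qed.

Variable w : R -> X.
Variable M : R.
Hypothesis Cw : forall t, cont_at w t.
Hypothesis Bw : bdd w M.
Hypothesis HX : ~ contains_copy c0 X.

Lemma null_zero L : Op L (fun _ => RtoC 0) -> forall t, L w t = v0.
Proof.
intros HL; apply (op_null w M Cw Bw L _ HL).
intros x; left; exists 1; split; [lra | reflexivity].
Qed.

(** For [psi] supported near [x0], [psi(S) w] becomes almost periodic under any symbol that vanishes
    near [x0]. The twisted second difference has symbol [- 2 (1 - cos (y - x0))]; adding [2 f] from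
    [small_cutoff] makes it vanish near [x0] at arbitrarily small cost. So that difference is a
    uniform limit of almost periodic functions, and [twisted_kadets] applies. *)
Lemma isolated_regular x0 c : c < 1 ->
  (forall y, c < cos (y - x0) -> cos (y - x0) < 1 -> regular ZAP w y) -> regular ZAP w x0.
Proof.
intros Hc H.
set (c1 := (1 + c) / 2).
exists c1; split; [unfold c1; lra |]; intros L psi HL Hpsi.
destruct (Op_bound L psi HL) as [K [HK [HKb _]]].
assert (Bv : bdd (L w) (K * M)) by (intros t; now apply HKb).
assert (Hcut : forall Lc chi, Op Lc chi -> vanish_near (RtoC 0) chi x0 -> ZAP (Lc (L w))).
{ intros Lc chi HLc [d [D1 D2]].
  apply (local_global ZAP w (fun g => Lc (L g)) (fun y => Cmult (chi y)
    (psi y)) ZAP_zero ZAP_add null_zero (Op_comp _ _ _ _ HLc HL)).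
  intros x; destruct (Rlt_le_dec c (cos (x - x0))) as [Hx | Hx].
  - destruct (Rlt_le_dec (cos (x - x0)) 1) as [Hx1 | Hx1]; [left; now apply H |].
    right; exists d; split; [exact D1 |]; intros y Hy.
    rewrite D2; [ring |].
    assert (E : cos (x - x0) = 1) by (assert (B := COS_bound (x - x0)); lra).
    assert (S := sin2_cos2 (x - x0)); rewrite E in S; unfold Rsqr in S.
    assert (E2 : sin (x - x0) = 0) by nra.
    replace (y - x0) with ((y - x) + (x - x0)) by ring; rewrite cos_plus, E, E2; lra.
  - right; destruct (cos_near (c1 - c)) as [e [E1 E2]]; [unfold c1; lra |].
    exists e; split; [exact E1 |]; intros y Hy.
    specialize (E2 x0 y x Hy); apply Rabs_def2 in E2.
    rewrite Hpsi by lra; ring. }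
apply (twisted_kadets x0 (L w) (K * M) HX Bv).
intros s; apply apseq_limit; intros eps He.
assert (HKM : 0 <= K * M) by now apply bdd_ge0 in Bv.
destruct (small_cutoff x0 (eps / (2 * (K * M + 1)))) as [Lf [f [HLf [Hvan Hsmall]]]].
{ apply Rdiv_lt_0_compat; lra. }
assert (HC := Op_comb (RtoC 2) _ _ _ _ HLf (Op_tp [(1%Z, cis (- x0)); (0%Z, RtoC (-2));
  ((-1)%Z, cis x0)])).
eexists (fun n => (_ : R -> X) (s + IZR n)); split.
- refine (Hcut _ _ HC _ s).
  destruct Hvan as [d [D1 D2]]; exists d; split; [exact D1 |]; intros y Hy.
  specialize (D2 y Hy); cbn [tp_eval].
  assert (Ef : f y = 1 - cos (y - x0)) by lra.
  rewrite Ef, Rmult_1_l, Rmult_0_l, cis_0.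
  replace (cis (- x0) * cis y)%C with (cis (y - x0)) by (rewrite <- cis_plus; f_equal; ring).
  replace (cis x0 * cis (-1 * y))%C with (cis (- (y - x0))) by (rewrite <- cis_plus; f_equal; ring).
  unfold cis; rewrite cos_neg, sin_neg; unfold Cplus, Cmult, RtoC; simpl; f_equal; ring.
- intros n; cbv beta.
  set (a := tp_act _ (L w) (s + IZR n)); set (b := Lf (L w) (s + IZR n)).
  replace (a -v (RtoC 2 *v b +v a)) with (RtoC (-2) *v b).
  2:{ change (RtoC (-2)) with (RtoC (- (2))); vring. }
  rewrite nrm_sc, Cmod_R, Rabs_left by lra.
  assert (B := Hsmall (L w) (K * M) (s + IZR n) Bv); fold b in B.
  assert (E : eps / (2 * (K * M + 1)) * (K * M) <= eps / (2 * (K * M + 1)) * (K * M + 1)).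
  { apply Rmult_le_compat_l; [left; apply Rdiv_lt_0_compat; lra | lra]. }
  replace (eps / (2 * (K * M + 1)) * (K * M + 1)) with (eps / 2) in E by (field; lra); lra.
Qed.

Lemma regular_open x : regular ZAP w x -> exists r, 0 < r /\ forall y,
  Rabs (y - x) < r -> regular ZAP w y.
Proof.
intros [c [Hc H]]; set (c1 := (1 + c) / 2).
exists (1 - c1); split; [unfold c1; lra |]; intros y Hy.
assert (A := cos_near1 x y).
destruct (cos_near (c1 - c)) as [e [E1 E2]]; [unfold c1; lra |].
exists e; split; [exact E1 |]; intros L psi HL Hpsi; apply (H L psi HL); intros z Hz.
apply Hpsi, Rnot_lt_le; intros Hlt; specialize (E2 x z y Hlt); apply Rabs_def2 in E2; lra.
Qed.

Lemma regular_periodic x (k : Z) : regular ZAP w (x + 2 * IZR k * PI) -> regular ZAP w x.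
Proof.
intros [c [Hc H]]; exists c; split; [exact Hc |]; intros L psi HL Hpsi; apply (H L psi HL).
intros y Hy; apply Hpsi.
assert (E := cis_Z2PI (y - x) (- k)); injection E as E _.
replace (y - (x + 2 * IZR k * PI)) with (y - x + 2 * IZR (- k) * PI) in Hy by (rewrite opp_IZR;
  ring).
now rewrite E in Hy.
Qed.

Lemma not_isolated x r : 0 < r -> ~ regular ZAP w x ->
  exists y, 0 < Rabs (y - x) < r /\ ~ regular ZAP w y.
Proof.
intros Hr Hx; apply NNPP; intros HN; apply Hx.
(* By [sq_le_cos], [cos s > 1 - r^2 / 18] forces [|s| < r] once [s] is reduced modulo [2 PI]. *)
apply (isolated_regular x (1 - r * r / 18)); [nra |].
intros y Hy Hy1.
destruct (reduce_2PI (y - x)) as [k Hk].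
assert (E := cis_Z2PI (y - x) k); injection E as E _.
set (s := y - x + 2 * IZR k * PI) in *.
assert (A := sq_le_cos s Hk); rewrite E in A.
apply (regular_periodic y k); replace (y + 2 * IZR k * PI) with (x + s) by (unfold s; ring).
apply NNPP; intros Hreg; apply HN; exists (x + s); split; [| exact Hreg].
replace (x + s - x) with s by ring; split.
- apply Rabs_pos_lt; intros E0; rewrite E0, cos_0 in E; lra.
- apply Rabs_def1; nra.
Qed.

Lemma cis_inj_near x y : 0 < Rabs (y - x) < 1 -> cis x <> cis y.
Proof.
intros [H1 H2] E.
assert (A : Rabs (y - x) <= PI) by (assert (P := PI2_3_2); unfold PI2 in P; lra).
apply sq_le_cos in A.
assert (Ec : cis (y - x) = RtoC 1).
{ replace (y - x) with (- x + y) by ring; rewrite cis_plus, <- E; apply cis_opp. }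
injection Ec as E1 _; rewrite E1 in A.
assert (E0 : y - x = 0) by nra; rewrite E0, Rabs_R0 in H1; lra.
Qed.

(* Baire category: a nonempty closed countable set has an isolated point. *)
Theorem loomis (e : nat -> C) :
  (forall x, (exists n, e n = cis x) \/ regular ZAP w x) -> forall x, regular ZAP w x.
Proof.
intros He x0; apply NNPP; intros Hx0.
(* From an irregular point and a radius, a smaller interval around an irregular point on which [cis]
   misses [e n]. The common point of the nested intervals is irregular by [regular_open], yet its
   image is none of the [e n]. *)
assert (Hstep : forall s : (R * R) * nat, exists t : R * R,
  0 < snd (fst s) -> ~ regular ZAP w (fst (fst s)) ->
  ~ regular ZAP w (fst t) /\ 0 < snd t <= snd (fst s) / 2 /\
  Rabs (fst t - fst (fst s)) <= snd (fst s) / 2 /\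
  forall y, Rabs (y - fst t) <= snd t -> cis y <> e (snd s)).
{ intros [[x r] n]; simpl.
  destruct (Rle_lt_dec r 0) as [Hr | Hr]; [exists (0, 0); lra |].
  destruct (classic (regular ZAP w x)) as [Hx | Hx]; [exists (0, 0); tauto |].
  destruct (not_isolated x (Rmin (r / 2) 1)) as [y [Hy1 Hy2]]; [apply Rmin_pos; lra | exact Hx |].
  assert (L1 := Rmin_l (r / 2) 1); assert (L2 := Rmin_r (r / 2) 1).
  assert (Hz : exists z, ~ regular ZAP w z /\ Rabs (z - x) <= r / 2 /\ cis z <> e n).
  { destruct (Ceq_dec (cis x) (e n)) as [E | E].
    - exists y; split; [exact Hy2 | split; [lra |]].
      rewrite <- E; intros E'; apply (cis_inj_near x y); [lra | now symmetry].
    - exists x; split; [exact Hx | split; [rewrite Rminus_diag, Rabs_R0; lra | exact E]]. }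
  destruct Hz as [z [Z1 [Z2 Z3]]].
  assert (Hm : 0 < Cmod (cis z - e n)%C).
  { apply Cmod_gt_0; intros E; apply Z3.
    replace (cis z) with ((cis z - e n) + e n)%C by ring; rewrite E; ring. }
  (* [cis] is 2-Lipschitz by [cis_lip], so on this interval it moves by at most half the distance to
     [e n]. *)
  exists (z, Rmin (r / 2) (Cmod (cis z - e n)%C / 4)); simpl; intros _ _.
  split; [exact Z1 | split; [split; [apply Rmin_pos; lra | apply Rmin_l] | split; [exact Z2 |]]].
  intros t Ht Et; assert (L3 := Rmin_r (r / 2) (Cmod (cis z - e n)%C / 4)).
  assert (A := cis_lip z t); rewrite Et, Rabs_minus_sym in A; lra. }
destruct (choice _ Hstep) as [F HF].
pose (st := nat_rect (fun _ => (R * R)%type) (x0, 1) (fun n s => F (s, n))).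
pose (x := fun n => fst (st n)); pose (r := fun n => snd (st n)).
assert (Hinv : forall n, ~ regular ZAP w (x n) /\ 0 < r n).
{ induction n as [|n [I1 I2]]; [split; [exact Hx0 | unfold r; simpl; lra] |].
  destruct (HF (st n, n) I2 I1) as [A1 [A2 _]]; split; [exact A1 | apply A2]. }
assert (Hnext : forall n, r (S n) <= r n / 2 /\ Rabs (x (S n) - x n) <= r n / 2 /\
   forall y, Rabs (y - x (S n)) <= r (S n) -> cis y <> e n).
{ intros n; destruct (Hinv n) as [I1 I2]; destruct (HF (st n, n) I2 I1) as [_ [A2 [A3 A4]]].
  split; [apply A2 | split; [exact A3 | exact A4]]. }
assert (Hdist : forall n m, (n <= m)%nat -> Rabs (x m - x n) <= r n - r m).
{ intros n m Hnm; induction Hnm as [|m Hnm IH]; [rewrite !Rminus_diag, Rabs_R0; lra |].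
  destruct (Hnext m) as [A1 [A2 _]].
  replace (x (S m) - x n) with ((x (S m) - x m) + (x m - x n)) by ring.
  apply Rle_trans with (1 := Rabs_triang _ _); lra. }
assert (Hr : forall n, r n <= / 2 ^ n).
{ induction n as [|n IH]; [unfold r; simpl; lra |].
  destruct (Hnext n) as [A1 _]; simpl; rewrite Rinv_mult; lra. }
assert (Hrs : forall eps, 0 < eps -> exists n, forall m, (n <= m)%nat -> r m < eps).
{ intros eps Hep; destruct (pow_lt_1_zero (/ 2)) with (y := eps)
  as [n Hn]; [rewrite Rabs_pos_eq; lra | exact Hep |].
  exists n; intros m Hm; specialize (Hn m Hm); rewrite pow_inv, Rabs_pos_eq in Hn.
  - specialize (Hr m); lra.
  - left; apply Rinv_0_lt_compat, pow_lt; lra. }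
destruct (Rcomplete.R_complete x) as [l Hl].
{ intros eps Hep; destruct (Hrs (eps / 2)) as [n Hn]; [lra |]; exists n; intros p q Hp Hq.
  unfold Rdist; assert (A := Hdist n p Hp); assert (B := Hdist n q Hq).
  assert (P1 := proj2 (Hinv p)); assert (P2 := proj2 (Hinv q)); specialize (Hn n (Nat.le_refl _)).
  replace (x p - x q) with ((x p - x n) - (x q - x n)) by ring.
  apply Rle_lt_trans with (1 := Rabs_triang _ _); rewrite Rabs_Ropp; lra. }
assert (Hlx : forall n, Rabs (l - x n) <= r n).
{ intros n; apply Rnot_lt_le; intros Hlt.
  destruct (Hl (Rabs (l - x n) - r n)) as [m Hm]; [lra |].
  specialize (Hm (n + m)%nat ltac:(lia)); unfold Rdist in Hm; rewrite Rabs_minus_sym in Hm.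
  assert (A := Hdist n (n + m)%nat ltac:(lia)); assert (P := proj2 (Hinv (n + m)%nat)).
  assert (T := Rabs_triang (l - x (n + m)%nat) (x (n + m)%nat - x n)).
  replace (l - x (n + m)%nat + (x (n + m)%nat - x n)) with (l - x n) in T by ring; lra. }
assert (Hnl : ~ regular ZAP w l).
{ intros Hreg; destruct (regular_open l Hreg) as [d [D1 D2]].
  destruct (Hrs d D1) as [n Hn]; apply (proj1 (Hinv n)), D2.
  rewrite Rabs_minus_sym; specialize (Hlx n); specialize (Hn n (Nat.le_refl _)); lra. }
destruct (He l) as [[n Hn] | Hreg]; [| now apply Hnl].
destruct (Hnext n) as [_ [_ A]]; apply (A l (Hlx (S n))); now symmetry.
Qed.

Lemma ZAP_of_regular : (forall x, regular ZAP w x) -> ZAP w.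
Proof.
intros H.
assert (HI := Op_tp (X := X) [(0%Z, RtoC 1)]).
assert (A : ZAP (tp_act [(0%Z, RtoC 1)] w)).
{ apply (local_global ZAP w _ _ ZAP_zero ZAP_add null_zero HI); intros x; left; apply H. }
intros s; apply (apseq_ext (fun n => tp_act [(0%Z, RtoC 1)] w (s + IZR n))); [| apply A].
intros n; cbn [tp_act]; rewrite Rplus_0_r; vring.
Qed.

Lemma grid (d : R) : 0 < d -> exists l : list R, forall s, 0 <= s <= 1 -> exists p,
  In p l /\ Rabs (s - p) < d.
Proof.
intros Hd; apply NNPP; intros HN.
apply (compactness_list 1 (0, tt) (1, tt) (fun _ => mkposreal d Hd)).
intros [l Hl]; apply HN; exists (map fst l); intros s Hs.
destruct (Hl (s, tt)) as [[p []] [P1 [_ P2]]]; [simpl; split; [lra | easy] |].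
exists p; split; [now apply (in_map fst) in P1 | simpl in P2; exact (proj1 P2)].
Qed.

(** By uniform continuity finitely many offsets [p] in [[0, 1]] represent all cosets up to
    [eps / 4], and their sequences have common integer almost periods. These are relatively dense:
    every integer has the colour of one of finitely many representatives. *)
Lemma almost_periodic_of_ZAP : ucont w -> ZAP w -> almost_periodic w.
Proof.
intros Uw Hz; split; [intros t; apply cont_at_continuous, Cw |].
intros eps He.
destruct (Uw (eps / 4)) as [d [Hd Hs]]; [lra |].
destruct (grid d Hd) as [l Hl].
destruct (apseq_common (map (fun p n => w (p + IZR n)) l) (eps / 4) ltac:(lra)) as [c [N [C1 C2]]].
{ intros y Hy; apply in_map_iff in Hy as [p [<- _]]; apply Hz. }
destruct (representatives c N C1) as [q Hq].
assert (HB : exists B : Z, (0 < B)%Z /\ forall a, In a q -> (Z.abs a <= B)%Z).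
{ clear; induction q as [|a q [B [B1 B2]]].
  - exists 1%Z; split; [lia | easy].
  - exists (Z.max B (Z.abs a)); split; [lia |]; intros b [<- | Hb]; [lia | specialize (B2 b Hb);
    lia]. }
destruct HB as [B [B1 B2]].
exists (IZR (2 * B + 1)); split; [apply IZR_lt; lia |].
intros a.
destruct (archimed a) as [U1 U2].
(* Subtracting a representative [b], with [|b| <= B], from [up a + B] yields a common almost period
   between [up a] and [up a + 2 B]. *)
destruct (Hq (up a + B)%Z) as [b [Q1 Q2]].
specialize (B2 b Q1).
set (tau := (up a + B - b)%Z).
exists (IZR tau); split.
{ assert (L1 : (up a <= tau <= up a + 2 * B)%Z) by (unfold tau; lia); destruct L1 as [L1 L2].
  apply IZR_le in L1, L2; rewrite plus_IZR in L2; rewrite plus_IZR; lra. }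
intros t.
destruct (archimed t) as [V1 V2].
set (n := (up t - 1)%Z); set (s := t - IZR n).
assert (Hs01 : 0 <= s <= 1) by (unfold s, n; rewrite minus_IZR; lra).
destruct (Hl s Hs01) as [p [P1 P2]].
assert (A := proj2 (C2 _ (in_map (fun p n => w (p + IZR n)) l p P1)) (up a + B)%Z b (eq_sym Q2)
  (n - b)%Z).
cbv beta in A.
replace (n - b + (up a + B))%Z with (n + tau)%Z in A by (unfold tau; lia).
replace (n - b + b)%Z with n in A by lia.
assert (A1 := Hs (s + IZR (n + tau)) (p + IZR (n + tau))); replace (s + IZR (n + tau) - (p + IZR
  (n + tau))) with (s - p) in A1 by ring.
assert (A2 := Hs (s + IZR n) (p + IZR n)); replace (s + IZR n - (p + IZR n)) with (s - p) in A2 by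
  ring.
specialize (A1 P2); specialize (A2 P2).
replace (s + IZR (n + tau)) with (t + IZR tau) in A1 by (unfold s; rewrite plus_IZR; ring).
replace (s + IZR n) with t in A2 by (unfold s; ring).
change (nrm (w (t + IZR tau) -v w t) < eps).
assert (T1 := nrm_sub_tri (w (t + IZR tau)) (w (p + IZR (n + tau))) (w t)).
assert (T2 := nrm_sub_tri (w (p + IZR (n + tau))) (w (p + IZR n)) (w t)).
rewrite (nrm_sub_sym (w (p + IZR n)) (w t)) in T2; lra.
Qed.

End DiscreteLoomis.

(** * Spectral splitting of mild solutions *)

Lemma closed_closure (T : UniformSpace) (E : T -> Prop) : closed (closure E).
Proof.
intros x Hx P HP; apply NNPP; intros HN; apply Hx.
apply (filter_imp (fun z => locally z P)); [| now apply locally_locally].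
intros z Hz Hc; apply HN, (Hc P Hz).
Qed.

Lemma closed_circle (D : C -> Prop) x : closed D -> ~ D (cis x) ->
  exists c, c < 1 /\ forall y, c < cos (y - x) -> ~ D (cis y).
Proof.
intros HD Hx.
assert (HL : locally (cis x) (fun z => ~ D z)) by (apply NNPP; intros HN;
  apply Hx, (HD (cis x) HN)).
destruct HL as [[e He] HL].
destruct (cos_near e He) as [c [Hc H]]; exists c; split; [exact Hc |]; intros y Hy.
(* Neighbourhoods in [C] are squares: [cos_near] with base point 0 controls the real part, with base
   point [PI / 2] the imaginary part. *)
apply HL; split.
- assert (A := H 0 y x Hy); rewrite !Rminus_0_r in A; exact A.
- assert (A := H (PI / 2) y x Hy).
  replace (y - PI / 2) with (- (PI / 2 - y)) in A by ring; replace (x - PI / 2) with (- (PI / 2 -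
    x)) in A by ring.
  rewrite !cos_neg, !cos_shift in A; exact A.
Qed.

Lemma vanish_near_line {T : Type} (z : T) phi x : vanish_near z phi x ->
  exists r, 0 < r /\ forall y, Rabs (y - x) < r -> phi y = z.
Proof.
intros [c [Hc H]]; exists (1 - c); split; [lra |]; intros y Hy.
apply H; assert (A := cos_near1 x y); lra.
Qed.

Section Assembly.
Context {X : CompleteNormedModule C_AbsRing}.

Lemma op_vanish (g : R -> X) M L phi : (forall t, cont_at g t) -> bdd g M -> Op L phi ->
  (forall x, vanish_near (RtoC 0) phi x \/ jump_null g x) -> forall t, L g t = v0.
Proof.
intros Cg Hg HL H; apply (op_null g M Cg Hg L phi HL).
intros x; destruct (H x) as [A | A]; [left; now apply vanish_near_line | now right].
Qed.

(** A 1-almost period brings any [t] into the compact interval [[0, l]]. *)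
Lemma almost_periodic_bdd (f : R -> X) : almost_periodic f -> exists M, bdd f M.
Proof.
intros [Hc Hf]; destruct (Hf 1 Rlt_0_1) as [l [Hl H]].
destruct (bounded_continuity f 0 l) as [M HM]; [intros; apply Hc |].
exists (M + 1); intros t; destruct (H (- t)) as [tau [Ht Hs]]; specialize (Hs t).
assert (A := HM (t + tau) ltac:(lra)).
change (nrm (f (t + tau) -v f t) < 1) in Hs; change (nrm (f (t + tau)) < M) in A.
rewrite nrm_sub_sym in Hs; assert (B := nrm_sub_ge (f t) (f (t + tau))); lra.
Qed.

Lemma mild_mildp (A : lin_op X) (B : BUC X -> BUC X) (f : R -> X) (u : BUC X) : (forall t,
  cont_at f t) ->
  mild_solution A B f u <-> mildp A u (fun t => B u t +v f t).
Proof.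
intros Cf; set (v := fun t => B u t +v f t).
assert (Cu : forall t, cont_at u t) by (intros; apply BUC_cont).
assert (Cv : forall t, cont_at v t).
{ intros t; assert (H := cont_at_comb (RtoC 1) (B u) f t (BUC_cont _ t) (Cf t)).
  intros e He; destruct (H e He) as [d [Hd Hs]]; exists d; split; [exact Hd |]; intros s Hst.
  specialize (Hs s Hst); cbv beta in Hs; unfold v.
  replace (B u s +v f s -v (B u t +v f t)) with (RtoC 1 *v B u s +v f s -v (RtoC 1 *v B u t +v f
    t)) by vring; exact Hs. }
split.
- intros H a b; destruct (H a) as [ya [A1 A2]]; destruct (H b) as [yb [B1 B2]].
  change (u a -v u 0 = ya +v integral v 0 a) in A2; change (u b -v u 0 = yb +v integral v 0 b) in
    B2.
  rewrite <- (integral_chasles v 0 a b Cv) in B2; rewrite <- (integral_chasles u 0 a b Cu) in B1.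
  assert (G := graph_comb A (RtoC (-1)) _ _ _ _ A1 B1).
  replace (RtoC (-1) *v integral u 0 a +v (integral u 0 a +v integral u a b)) with (integral u a
    b) in G by vring.
  replace (u b -v u a -v integral v a b) with (RtoC (-1) *v ya +v yb); [exact G |].
  replace ya with (u a -v u 0 -v integral v 0 a) by (rewrite A2; vring).
  replace yb with (u b -v u 0 -v (integral v 0 a +v integral v a b)) by (rewrite B2; vring).
  vring.
- intros H t; exists (u t -v u 0 -v integral v 0 t); split; [apply H |].
  change (u t -v u 0 = u t -v u 0 -v integral v 0 t +v integral v 0 t); vring.
Qed.

Lemma vanish_off_arc {T : Type} (z : T) phi x0 c0 c x : c0 < c -> (forall y,
  cos (y - x0) <= c -> phi y = z) ->
  cos (x - x0) <= c0 -> vanish_near z phi x.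
Proof.
intros Hc H Hx; destruct (cos_near (c - c0)) as [d [D1 D2]]; [lra |].
exists d; split; [exact D1 |]; intros y Hy; specialize (D2 x0 y x Hy); apply Rabs_def2 in D2;
  apply H; lra.
Qed.

Lemma exp_i_closure (E : R -> Prop) x : E x -> closure (exp_i E) (cis x).
Proof.
intros H P HP; exists (cis x); split; [| now apply locally_singleton].
exists x; split; [exact H | symmetry; apply Cexp_Ci].
Qed.

Variables (A : lin_op X) (B : BUC X -> BUC X) (f : R -> X) (Mf : R).
Hypothesis hA : closed_op A.
Hypothesis hB : is_linear B.
Hypothesis hBaut : autonomous B.
Hypothesis Cf : forall t, cont_at f t.
Hypothesis Bf : bdd f Mf.

(** [L] commutes with [A] through [mildp_op] and with [B] through [B_op], so it maps a solution for
    [f] to a solution for [L f]. *)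
Lemma mild_op L phi (BL : BUC X -> BUC X) (u : BUC X) : Op L phi -> (forall (g : BUC X) t,
  BL g t = L g t) ->
  mildp A u (fun t => B u t +v f t) -> mildp A (BL u) (fun t => B (BL u) t +v L f t).
Proof.
intros HL HBL Hu.
assert (Cv : forall t, cont_at (fun t => B u t +v f t) t).
{ intros t; replace (fun t => B u t +v f t) with (fun t => RtoC 1 *v B u t +v f t) by (apply
  functional_extensionality; intros; vring).
  apply cont_at_comb; [apply BUC_cont | apply Cf]. }
assert (Bv : bdd (fun t => B u t +v f t) (bfun_norm (B u) + Mf)).
{ intros t; apply Rle_trans with (1 := nrm_add _ _), Rplus_le_compat; [apply BUC_bdd | apply Bf]. }
assert (H := mildp_op A hA L phi u _ _ _ HL (BUC_bdd u) Bv (BUC_cont u) Cv Hu).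
replace (bfun_fun (BL u)) with (L u) by (apply functional_extensionality; intros; now rewrite HBL).
replace (fun t => B (BL u) t +v L f t) with (L (fun t => B u t +v f t)); [exact H |].
apply functional_extensionality; intros t.
rewrite (B_op B hB hBaut L phi u (BL u) HL (HBL u)).
replace (fun t => B u t +v f t) with (fun t => RtoC 1 *v B u t +v f t) by (apply
  functional_extensionality; intros; vring).
rewrite (Op_lin L phi (RtoC 1) (B u) f _ _ t HL (BUC_bdd _) Bf); vring.
Qed.

Let E1 := closure (exp_i (sigma_i (add_op (lift_op A) hB))).
Let E2 := closure (exp_i (sp f)).

Lemma jump_off_E1 (y : BUC X) x : mildp A y (B y) -> ~ E1 (cis x) -> jump_null y x.
Proof.
intros Hy Hx; apply (jump_of_resolvent B hB hBaut A hA y x Hy); intros H; apply Hx;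
  now apply exp_i_closure.
Qed.

Lemma jump_off_E2 x : ~ E2 (cis x) -> jump_null f x.
Proof.
intros Hx; apply jump_of_sp; intros H; apply Hx; now apply exp_i_closure.
Qed.

Hypothesis hclosed : closed (fun z : C => E1 z /\ ~ E2 z).

(* [w = phi(S)^2 u] with [phi = 1] near [E2] and [phi = 0] near [E1 \ E2]. Near
   a point [x] off [E2], [w] coincides spectrally with [phi(S)] applied to
   [y = chi(S) phi(S) u], [chi] a bump at [x]; [y] solves the homogeneous
   equation, so its spectrum lies in [E1], where [phi] vanishes. *)
Lemma spectral_splitting (u : BUC X) : mildp A u (fun t => B u t +v f t) ->
  exists w : BUC X, mildp A w (fun t => B w t +v f t) /\
    forall x, ~ E2 (cis x) -> regular (fun h => forall t, h t = v0) w x.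
Proof.
intros Hu.
assert (K2 : closed E2) by apply closed_closure.
destruct (urysohn (fun x => E1 (cis x) /\ ~ E2 (cis x)) (fun x => E2 (cis x)))
  as [phi [P0 [P1 P2]]].
{ intros x; destruct (classic (E2 (cis x))) as [H | H].
  - left; apply (closed_circle (fun z => E1 z /\ ~ E2 z) x hclosed); tauto.
  - right; now apply (closed_circle E2 x). }
destruct (C2per_Op X phi P0) as [L HL].
destruct (op_as_BUC L _ HL) as [BL [EL _]].
(* The symbol [phi - 1] vanishes near the points of [E2], and [f] has no jump elsewhere. *)
assert (Hf : L f = f).
{ apply functional_extensionality; intros t.
  assert (H := op_vanish f Mf _ _ Cf Bf (Op_comb (RtoC (-1)) _ _ _ _ HL (Op_tp [(0%Z, RtoC 1)]))).
  cbv beta in H; specialize (fun H1 => H H1 t); cbn [tp_act] in H; rewrite Rplus_0_r in H.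
  assert (H0 : RtoC (-1) *v L f t +v (RtoC 1 *v f t +v v0) = v0).
  { apply H; intros x; destruct (classic (E2 (cis x))) as [Hx | Hx]; [left | right;
    now apply jump_off_E2].
    destruct (P2 x Hx) as [c [C1 C2]]; exists c; split; [exact C1 |]; intros y Hy.
    cbn [tp_eval]; rewrite (C2 y Hy), Rmult_0_l, cis_0.
    unfold Cplus, Cmult, RtoC; simpl; f_equal; ring. }
  replace (f t) with ((RtoC (-1) *v L f t +v (RtoC 1 *v f t +v v0)) +v L f t) by vring.
  rewrite H0; vring. }
assert (M1 := mild_op L _ BL u HL EL Hu); rewrite Hf in M1.
assert (M2 := mild_op L _ BL (BL u) HL EL M1); rewrite Hf in M2.
exists (BL (BL u)); split; [exact M2 |].
intros x Hx.
destruct (closed_circle E2 x K2 Hx) as [c0 [C0 HE2]].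
destruct (bump_one x ((1 + c0) / 2)) as [chi [c1 [X0 [X1 [X2 X3]]]]]; [lra |].
destruct (C2per_Op X chi X0) as [Lc HLc].
destruct (op_as_BUC Lc _ HLc) as [Bc [Ec _]].
assert (Harc : forall z, E2 (cis z) -> cos (z - x) <= c0).
{ intros z Hz; apply Rnot_lt_le; intros Hlt; now apply (HE2 z Hlt). }
(* [chi] vanishes near [E2], so it annihilates the forcing; this is why [y] solves the homogeneous
   equation. *)
assert (Hcf : forall t, Lc f t = v0).
{ apply (op_vanish f Mf Lc _ Cf Bf HLc); intros z.
  destruct (classic (E2 (cis z))) as [Hz | Hz]; [left | right; now apply jump_off_E2].
  apply (vanish_off_arc (RtoC 0) _ x c0 ((1 + c0) / 2)); [lra | | now apply Harc].
  intros y Hy; now rewrite X2. }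
set (y := Bc (BL u)).
assert (My : mildp A y (B y)).
{ assert (M3 := mild_op Lc _ Bc (BL u) HLc Ec M1); fold y in M3.
  replace (bfun_fun (B y)) with (fun t => B y t +v Lc f t); [exact M3 |].
  apply functional_extensionality; intros t; rewrite Hcf; vring. }
exists c1; split; [lra |]; intros Lp psi HLp Hpsi t.
assert (Hy : Lp (L y) t = v0).
{ apply (op_vanish y (bfun_norm y) (fun g => Lp (L g)) _ (BUC_cont y) (BUC_bdd y)
  (Op_comp _ _ _ _ HLp HL)).
  intros z; destruct (classic (E1 (cis z))) as [Hz | Hz]; [left | right; now apply jump_off_E1].
  destruct (classic (E2 (cis z))) as [Hz2 | Hz2].
  - apply (vanish_off_arc (RtoC 0) _ x c0 c1); [lra | | now apply Harc].
    intros r Hr; rewrite Hpsi by exact Hr; ring.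
  - destruct (P1 z (conj Hz Hz2)) as [d [D1 D2]]; exists d; split; [exact D1 |]; intros r Hr.
    rewrite D2 by exact Hr; ring. }
(* [psi phi chi phi] and [psi phi phi] are the same symbol, since [chi = 1] wherever [psi] may be
   nonzero. So [psi(S) w] equals [psi(S) phi(S) y], which is 0 by [Hy]. *)
assert (HC := Op_comb (RtoC (-1)) _ _ _ _ (Op_comp _ _ _ _ HLp (Op_comp _ _ _ _ HL (Op_comp _ _ _
  _ HLc HL)))
   (Op_comp _ _ _ _ HLp (Op_comp _ _ _ _ HL HL))).
assert (HD := op_vanish u _ _ _ (BUC_cont u) (BUC_bdd u) HC); specialize (fun H => HD H t);
  cbv beta in HD.
assert (F1 : forall g : BUC X, bfun_fun (BL g) = L g) by (intros g;
  apply functional_extensionality, EL).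
assert (F2 : forall g : BUC X, bfun_fun (Bc g) = Lc g) by (intros g;
  apply functional_extensionality, Ec).
unfold y in Hy; rewrite F2, F1 in Hy; rewrite !F1.
rewrite Hy in HD.
replace (Lp (L (L u)) t) with (RtoC (-1) *v v0 +v Lp (L (L u)) t) by vring.
apply HD; intros z; left; exists 0; split; [lra |]; intros r _.
destruct (Rle_lt_dec (cos (r - x)) c1) as [Hr | Hr].
- rewrite Hpsi by exact Hr; ring.
- rewrite X3 by exact Hr; ring.
Qed.

End Assembly.

Theorem theorem21 (X : CompleteNormedModule C_AbsRing) (A : lin_op X)
    (B : BUC X -> BUC X) (f : R -> X)
    (hX : ~ contains_copy c0 X)
    (hA : closed_op A)
    (hB : is_linear B)
    (hBaut : autonomous B)
    (hf : almost_periodic f)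
    (hu : exists u : BUC X, mild_solution A B f u)
    (hclosed : closed (fun z : C =>
       closure (exp_i (sigma_i (add_op (lift_op A) hB))) z /\
       ~ closure (exp_i (sp f)) z))
    (hcount : countable (closure (exp_i (sp f)))) :
  exists w : BUC X,
    mild_solution A B f w /\ almost_periodic w /\
    forall z : C, exp_i (sp w) z -> closure (exp_i (sp f)) z.
Proof.
destruct (almost_periodic_bdd f hf) as [Mf Bf].
assert (Cf : forall t, cont_at f t) by (intros t; apply cont_at_continuous, hf).
destruct hu as [u Hu]; apply (mild_mildp A B f u Cf) in Hu.
destruct (spectral_splitting A B f Mf hA hB hBaut Cf Bf hclosed u Hu) as [w [Hw Hreg]].
exists w; split; [now apply mild_mildp | split].
- apply almost_periodic_of_ZAP; [apply BUC_cont | apply BUC_ucont |].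
  apply (ZAP_of_regular w (bfun_norm w) (BUC_cont w) (BUC_bdd w)).
  destruct hcount as [e He].
  apply (loomis w (bfun_norm w) (BUC_cont w) (BUC_bdd w) hX e).
  (* Off the countable set [w] is spectrally zero, in particular almost periodic there; [loomis]
     takes care of the remaining points. *)
  intros x; destruct (classic (closure (exp_i (sp f)) (cis x)))
    as [Hx | Hx]; [left; now apply He | right].
  destruct (Hreg x Hx) as [c [Hc H]]; exists c; split; [exact Hc |]; intros L psi HL Hpsi.
  replace (L w) with (fun _ : R => (v0 : X)); [apply ZAP_zero |].
  apply functional_extensionality; intros t; symmetry; now apply (H L psi).
- intros z [xi [Hxi ->]]; rewrite Cexp_Ci; apply NNPP; intros Hx.
  now apply (not_sp w xi (Hreg xi Hx)).
Qed.
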